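(* Let $0<s_0<1$ and let $f\in C^\infty(\mathbb{R})$ satisfy $f(s)=0$ for $s\le0$ and $f(s)=1$ for $s\ge s_0$. Let $u:=u_{in}+u_r+u_d$ on $\overline{Q}\times\mathbb{R}$, with $u_{in},u_r,u_d$ defined in the context. Then $u$ is a classical solution of $$(\partial_t^2-\Delta)u(y,t)=0,\ y\in Q;\qquad \frac{\partial}{\partial\mathbf n}u(y,t)=0,\ y\in\partial Q;\qquad t\in\mathbb{R},$$ with the initial condition $u(y,t)=u_{in}(y,t)$ for $y\in Q$, $t<0$; $u$ belongs to the space $$C^\infty\left((\overline{Q}\setminus\{0\})\times\overline{\mathbb{R}^+}\right)\cap C\left(\overline{Q}\times\overline{\mathbb{R}^+}\right)\cap\mathcal{E}_{1-2q,\,1-2q},$$ and $u$ is the unique solution in this space.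
   Context: Fix $\omega_0>0$, $\phi\in(0,\pi)$, $\Phi:=2\pi-\phi\in(\pi,2\pi)$, $q:=\pi/(2\Phi)$, and $\alpha$ with $\max\{\phi-\frac{\pi}{2},0\}<\alpha<\min\{\frac{\pi}{2},\phi\}$. The wedge is $W=\{(\rho\cos\theta,\rho\sin\theta):\rho\ge0,\ 0\le\theta\le\phi\}$, $Q=\mathbb{R}^2\setminus W$; $(\rho,\theta)$, $\phi\le\theta\le2\pi$, are polar coordinates in $\overline{Q}$. $\partial Q$ (for the boundary condition) is $Q_1\cup Q_2$ with $Q_1=\{(y_1,0):y_1>0\}$, $Q_2=\{(\rho\cos\phi,\rho\sin\phi):\rho>0\}$, and $\partial/\partial\mathbf n$ is the exterior normal derivative. $\overline{\mathbb{R}^+}=[0,\infty)$. Incident wave: $u_{in}(y,t):=e^{i\omega_0(\mathbf{n_0}\cdot y-t)}f(t-\mathbf{n_0}\cdot y)$, $\mathbf{n_0}=(\cos\alpha,\sin\alpha)$. Put $\theta_1:=2\phi-\alpha$, $\theta_2:=2\pi-\alpha$, $\mathbf{v_j}=(\cos\theta_j,\sin\theta_j)$. Reflected wave: with $u_{r,j}(y,t):=e^{i\omega_0(\mathbf{v_j}\cdot y-t)}f(t-\mathbf{v_j}\cdot y)$, $j=1,2$, $u_r:=u_{r,1}$ for $\phi\le\theta\le\theta_1$, $u_r:=0$ for $\theta_1<\theta<\theta_2$, $u_r:=u_{r,2}$ for $\theta_2\le\theta\le2\pi$. Diffracted wave: for $\rho>0$, $\theta\in[\phi,2\pi]\setminus\{\theta_1,\theta_2\}$,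 $t\in\mathbb{R}$, $$u_d(\rho,\theta,t):=\frac{i\,e^{-i\omega_0t}}{4\Phi}\int_{-\infty}^{+\infty}e^{i\omega_0\rho\cosh\beta}Z_N(\beta+i\theta)f(t-\rho\cosh\beta)\,d\beta,$$ where $Z_N(\beta):=H_N(\beta-\frac{5i\pi}{2})-H_N(\beta-\frac{i\pi}{2})$ and $$H_N(\beta):=\coth\left[q\left(\beta+\tfrac{i\pi}{2}-i\alpha\right)\right]+\coth\left[q\left(\beta-\tfrac{3i\pi}{2}+i\alpha\right)\right].$$ On the rays $\theta=\theta_1,\theta_2$ and at $y=0$ the sum $u$ is understood as extended by continuity. For $\varepsilon,N\ge0$, $\mathcal{E}_{\varepsilon,N}$ is the space of functions $u\in C(\overline{Q}\times\overline{\mathbb{R}^+})$ with $\nabla_y u\in C((\overline{Q}\setminus\{0\})\times\overline{\mathbb{R}^+})$ and finite norm $$\|u\|_{\varepsilon,N}:=\sup_{t\ge0}\left[\sup_{y\in\overline{Q}}|u(y,t)|+\sup_{y\in\overline{Q}\setminus\{0\}}(1+t)^{-N}\{y\}^{\varepsilon}|\nabla_yu(y,t)|\right],\qquad \{y\}:=\frac{|y|}{1+|y|}.$$ *)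

(* Defs.v *)
From Stdlib Require Import Reals List ClassicalEpsilon.
From Coquelicot Require Import Coquelicot.
Import ListNotations.
Open Scope R_scope.

Definition Cexp (z : C) : C :=
  (exp (Re z) * cos (Im z), exp (Re z) * sin (Im z)).

Definition Ccoth (z : C) : C :=
  ((Cexp z + Cexp (- z)) / (Cexp z - Cexp (- z)))%C.

Definition plane : Type := (R * R)%type.
Definition spacetime : Type := (plane * R)%type.

Definition dot (a b : plane) : R := fst a * fst b + snd a * snd b.
Definition abs (y : plane) : R := sqrt (dot y y).
Definition dir (theta : R) : plane := (cos theta, sin theta).
Definition polar (rho theta : R) : plane := (rho * cos theta, rho * sin theta).

(* The polar angle in the determination (0, 2 PI]; its value at 0 is never
   used. *)
Definition angle (y : plane) : R :=
  if Rlt_dec 0 (snd y) then acos (fst y / abs y)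
  else 2 * PI - acos (fst y / abs y).

Definition W (phi : R) (y : plane) : Prop :=
  exists rho theta, 0 <= rho /\ 0 <= theta <= phi /\ y = polar rho theta.

Definition Q (phi : R) (y : plane) : Prop := ~ W phi y.

Definition Qbar (phi : R) (y : plane) : Prop :=
  forall P : plane -> Prop, locally y P -> exists z, P z /\ Q phi z.

Definition Qbar_punctured (phi : R) (y : plane) : Prop :=
  Qbar phi y /\ y <> (0, 0).

Definition Q1 (y : plane) : Prop := exists y1, 0 < y1 /\ y = (y1, 0).
Definition Q2 (phi : R) (y : plane) : Prop :=
  exists rho, 0 < rho /\ y = polar rho phi.

(* Unit normals on Q1 and Q2 pointing out of Q, that is, into the wedge W. *)
Definition normal1 : plane := (0, 1).
Definition normal2 (phi : R) : plane := (sin phi, - cos phi).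

Definition cyl (A : plane -> Prop) (I : R -> Prop) (p : spacetime) : Prop :=
  A (fst p) /\ I (snd p).
Definition all_times (t : R) : Prop := True.
Definition pos_times (t : R) : Prop := 0 < t.
Definition nonneg_times (t : R) : Prop := 0 <= t.

Definition smooth (f : R -> C) : Prop :=
  forall (n : nat) (s : R),
    ex_derive_n (fun x => Re (f x)) n s /\ ex_derive_n (fun x => Im (f x)) n s.

Inductive coord : Set := dy1 | dy2 | dt.

Definition shift (d : coord) (p : spacetime) (h : R) : spacetime :=
  match d, p with
  | dy1, ((y1, y2), t) => ((y1 + h, y2), t)
  | dy2, ((y1, y2), t) => ((y1, y2 + h), t)
  | dt, ((y1, y2), t) => ((y1, y2), t + h)
  end.

Definition ex_partial (d : coord) (u : spacetime -> C) (p : spacetime) : Prop :=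
  ex_derive (fun h => Re (u (shift d p h))) 0 /\
  ex_derive (fun h => Im (u (shift d p h))) 0.

Definition partial (d : coord) (u : spacetime -> C) (p : spacetime) : C :=
  (Derive (fun h => Re (u (shift d p h))) 0,
   Derive (fun h => Im (u (shift d p h))) 0).

Definition partials (w : list coord) (u : spacetime -> C) : spacetime -> C :=
  fold_right partial u w.

Definition extends_continuously (D E : spacetime -> Prop)
    (g : spacetime -> C) : Prop :=
  exists h : spacetime -> C,
    continuous_on E h /\ forall p, D p -> h p = g p.

(* [C_n n D E u]: for D open and E between D and its closure, u is of class
   C^n up to E, i.e. u is continuous on E and its partial derivatives of order
   at most n exist in D and have continuous extensions to E.  With E = D this
   is the usual class C^n(D). *)
Definition C_n (n : nat) (D E : spacetime -> Prop) (u : spacetime -> C) : Prop :=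
  continuous_on E u /\
  (forall (w : list coord) (d : coord), (length w < n)%nat ->
     forall p, D p -> ex_partial d (partials w u) p) /\
  (forall w : list coord, (length w <= n)%nat ->
     extends_continuously D E (partials w u)).

Definition C_infty (D E : spacetime -> Prop) (u : spacetime -> C) : Prop :=
  forall n, C_n n D E u.

Definition dalembertian (u : spacetime -> C) (p : spacetime) : C :=
  (partial dt (partial dt u) p
   - (partial dy1 (partial dy1 u) p + partial dy2 (partial dy2 u) p))%C.

(* One-sided: y is a boundary point and y - h n lies in the domain for small
   h > 0. *)
Definition is_normal_derivative (u : spacetime -> C) (n y : plane) (t : R)
    (l : C) : Prop :=
  filterlim
    (fun h : R =>
       ((u (y, t) - u (((fst y - h * fst n)%R, (snd y - h * snd n)%R), t)) / RtoC h)%C)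
    (at_right 0) (locally l).

Definition wave_solution (phi : R) (u : spacetime -> C) : Prop :=
  C_n 2 (cyl (Q phi) all_times) (cyl (Q phi) all_times) u /\
  (forall y t, Q phi y -> dalembertian u (y, t) = 0%C) /\
  (forall y t, Q1 y -> is_normal_derivative u normal1 y t 0%C) /\
  (forall y t, Q2 phi y -> is_normal_derivative u (normal2 phi) y t 0%C).

(* (g1, g2) is the y-gradient of u, extended by continuity from
   Q x [0, oo) to (Qbar \ {0}) x [0, oo). *)
Definition is_gradient (phi : R) (u g1 g2 : spacetime -> C) : Prop :=
  continuous_on (cyl (Qbar_punctured phi) nonneg_times) g1 /\
  continuous_on (cyl (Qbar_punctured phi) nonneg_times) g2 /\
  forall p, cyl (Q phi) nonneg_times p ->
    ex_partial dy1 u p /\ ex_partial dy2 u p /\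
    g1 p = partial dy1 u p /\ g2 p = partial dy2 u p.

Definition bracket (y : plane) : R := abs y / (1 + abs y).

Definition E_norm (eps N phi : R) (u g1 g2 : spacetime -> C) : Rbar :=
  Rbar_lub (fun s : Rbar => exists t : R, 0 <= t /\
    s = Rbar_plus
          (Lub_Rbar (fun x => exists y, Qbar phi y /\ x = Cmod (u (y, t))))
          (Lub_Rbar (fun x => exists y, Qbar_punctured phi y /\
             x = Rpower (1 + t) (- N) * Rpower (bracket y) eps
                 * sqrt (Cmod (g1 (y, t)) ^ 2 + Cmod (g2 (y, t)) ^ 2)))).

Definition E_space (eps N phi : R) (u : spacetime -> C) : Prop :=
  continuous_on (cyl (Qbar phi) nonneg_times) u /\
  exists g1 g2 : spacetime -> C,
    is_gradient phi u g1 g2 /\ is_finite (E_norm eps N phi u g1 g2).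

Definition Phi (phi : R) : R := 2 * PI - phi.
Definition q (phi : R) : R := PI / (2 * Phi phi).
Definition theta1 (phi alpha : R) : R := 2 * phi - alpha.
Definition theta2 (alpha : R) : R := 2 * PI - alpha.

Definition plane_wave (omega0 : R) (f : R -> C) (n : plane)
    (p : spacetime) : C :=
  let (y, t) := p in
  (Cexp (Ci * RtoC (omega0 * (dot n y - t))) * f (t - dot n y)%R)%C.

Definition u_in (omega0 alpha : R) (f : R -> C) : spacetime -> C :=
  plane_wave omega0 f (dir alpha).

Definition u_r (omega0 phi alpha : R) (f : R -> C) (p : spacetime) : C :=
  let theta := angle (fst p) in
  if Rle_dec theta (theta1 phi alpha)
  then plane_wave omega0 f (dir (theta1 phi alpha)) p
  else if Rle_dec (theta2 alpha) theta
  then plane_wave omega0 f (dir (theta2 alpha)) p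
  else 0%C.

Definition H_N (phi alpha : R) (beta : C) : C :=
  (Ccoth (RtoC (q phi) * (beta + Ci * RtoC (PI / 2) - Ci * RtoC alpha))
   + Ccoth (RtoC (q phi) * (beta - Ci * RtoC (3 * PI / 2) + Ci * RtoC alpha)))%C.

Definition Z_N (phi alpha : R) (beta : C) : C :=
  (H_N phi alpha (beta - Ci * RtoC (5 * PI / 2))
   - H_N phi alpha (beta - Ci * RtoC (PI / 2)))%C.

Definition u_d (omega0 phi alpha : R) (f : R -> C) (p : spacetime) : C :=
  let rho := abs (fst p) in
  let theta := angle (fst p) in
  let t := snd p in
  (Ci * Cexp (- (Ci * RtoC (omega0 * t))) / RtoC (4 * Phi phi)
   * RInt_gen (V := C_R_CompleteNormedModule)
       (fun beta : R =>
          Cexp (Ci * RtoC (omega0 * rho * cosh beta))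
          * Z_N phi alpha (RtoC beta + Ci * RtoC theta)
          * f (t - rho * cosh beta)%R)
       (Rbar_locally m_infty) (Rbar_locally p_infty))%C.

Definition regular (phi alpha : R) (y : plane) : Prop :=
  Qbar_punctured phi y /\ angle y <> theta1 phi alpha /\ angle y <> theta2 alpha.

Definition wave_sum (omega0 phi alpha : R) (f : R -> C) (p : spacetime) : C :=
  (u_in omega0 alpha f p + u_r omega0 phi alpha f p
   + u_d omega0 phi alpha f p)%C.

(* On the two critical rays and at the vertex, the value is the limit of
   [wave_sum] along regular points. *)
Definition total_wave (omega0 phi alpha : R) (f : R -> C) (p : spacetime) : C :=
  if excluded_middle_informative (regular phi alpha (fst p))
  then wave_sum omega0 phi alpha f p
  else iota (T := C_R_CompleteNormedModule)
         (fun l : C =>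
            filterlim (wave_sum omega0 phi alpha f)
              (within (cyl (regular phi alpha) all_times) (locally p))
              (locally l)).

Definition solution (omega0 phi alpha : R) (f : R -> C)
    (u : spacetime -> C) : Prop :=
  wave_solution phi u /\
  (forall y t, Q phi y -> t < 0 -> u (y, t) = u_in omega0 alpha f (y, t)).

Definition solution_space (phi : R) (u : spacetime -> C) : Prop :=
  C_infty (cyl (Q phi) pos_times)
    (cyl (Qbar_punctured phi) nonneg_times) u /\
  continuous_on (cyl (Qbar phi) nonneg_times) u /\
  E_space (1 - 2 * q phi) (1 - 2 * q phi) phi u.

(* Main.v *)
(** Existence.  Put F(s) = exp(-i omega0 s) f(s) and split into real and
    imaginary parts.  Then u is a signed sum of four "edge waves", one for each
    image of the source in the wedge, and of a plane wave: with z = b + i x, where x is the polar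
    angle measured from the cut-off ray of the image,
      T_(n,g) F = 1_(x < 0) cos g F(t - rho cos x)
                  - (q / PI) int_(b > 0) Im (coth (q z) cosh (n z + i g)) F(t - rho cosh b) db.
    At x = 0 the jump of the plane wave is compensated by the Poisson-type
    kernel Im coth (q z), so T is continuous across the ray; integration by
    parts in b gives the key identity
      d_psi T_(n,g) F = - (T_(n+1,g+k) F' + T_(n-1,g-k) F') / 2,
    where k is the angle from the direction psi to the cut-off ray, for the
    derivative in any fixed direction psi.  Hence the linear span of the T is
    closed under all partial derivatives, which yields smoothness across the
    critical rays and the wave equation.  On the sides of the wedge the image
    kernels cancel in pairs (Neumann), at the vertex the angular integrals of
    the kernels have explicit arctangent values, and the gradient is bounded
    because the ones in coth cancel in the sum over the images, leaving
    (coth - 1) sinh b = O(exp ((1 - 2 q) b)).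

    Uniqueness.  For the difference w of two solutions, in polar coordinates,
    let p and r be the time integrals from 0 of the rho- and theta-derivatives
    of w, and
      E(t) = 1/2 int int exp(-rho) (rho w^2 + rho p^2 + r^2 / rho) drho dtheta.
    Using w_t = Laplacian of the time integral of w, one gets E' <= E + boundary
    terms; these contain only w and p, r, all controlled by the norm and the
    Neumann condition, and vanish as the truncated domain exhausts the sector.
    Gronwall then gives w = 0. *)
Require Import Defs.
From Stdlib Require Import Reals Lra Lia List Classical ClassicalEpsilon FunctionalExtensionality.
From Coquelicot Require Import Coquelicot.
Import ListNotations.
Open Scope R_scope.

(** * Continuity and parametric integrals *)

(** Multiplying [f] by exp(-i omega0 s) leaves one profile F travelling along characteristics: the
    frequency disappears from the geometry. The obstacle to regularity is the pole of coth at z = 0.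
    On a critical ray a jump of the plane wave and a singular integral meet, and only their sum
    behaves well; so derivatives are computed off the ray, where the formulas are classical, and
    extended over it by continuity. The plane is cut along the ray at angle al, inside the wedge:
    all of Qbar without the vertex is then interior to the domain of the edge waves, and smoothness
    up to the sides is the same as smoothness inside.

    From PI < Phi < 2 PI one gets 1/4 < q < 1/2. The lower bound makes the exponent 1 - 2 q of the
    gradient less than 1/2, so that the flux through a small arc around the vertex tends to 0. The
    weight exp(-rho) makes the energy of a merely bounded solution converge; its derivative produces
    an error that Gronwall absorbs. *)

Section Continuity.
Context {E : UniformSpace}.
Implicit Types (f g : E -> R) (p : E).

Lemma cont_plus f g p : continuous f p -> continuous g p -> continuous (fun x => f x + g x) p.
Proof. intros; now apply (continuous_plus f g). Qed.

Lemma cont_opp f p : continuous f p -> continuous (fun x => - f x) p.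
Proof. intros; now apply (continuous_opp f). Qed.

Lemma cont_minus f g p : continuous f p -> continuous g p -> continuous (fun x => f x - g x) p.
Proof. intros; now apply (continuous_minus f g). Qed.

Lemma cont_mult f g p : continuous f p -> continuous g p -> continuous (fun x => f x * g x) p.
Proof. intros; now apply (continuous_mult f g). Qed.

Lemma cont_comp (h : R -> R) f p :
  continuous f p -> continuous h (f p) -> continuous (fun x => h (f x)) p.
Proof. intros; now apply (continuous_comp f h). Qed.

Lemma cont_inv f p : continuous f p -> f p <> 0 -> continuous (fun x => / f x) p.
Proof.
intros Hf H0. apply (cont_comp Rinv); [exact Hf|].
apply (ex_derive_continuous (V := R_NormedModule)). auto_derive. exact H0.
Qed.

Lemma cont_div f g p : continuous f p -> continuous g p -> g p <> 0 ->
  continuous (fun x => f x / g x) p.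
Proof. intros; apply cont_mult; auto. now apply cont_inv. Qed.

Lemma cont_const (c : R) p : continuous (fun _ : E => c) p.
Proof. apply continuous_const. Qed.
End Continuity.

Lemma cont_pair {E U V : UniformSpace} (f : E -> U) (g : E -> V) p :
  continuous f p -> continuous g p -> continuous (fun x => (f x, g x)) p.
Proof.
intros Hf Hg P [e He]. unfold filtermap.
apply (filter_imp (fun x => ball (f p) e (f x) /\ ball (g p) e (g x))).
- intros x Hx. now apply He.
- apply filter_and; [apply Hf|apply Hg]; now exists e.
Qed.

Lemma continuous_sin_R x : continuous sin x.
Proof. apply (ex_derive_continuous (V := R_NormedModule)); auto_derive; auto. Qed.
Lemma continuous_cos_R x : continuous cos x.
Proof. apply (ex_derive_continuous (V := R_NormedModule)); auto_derive; auto. Qed.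
Lemma continuous_exp_R x : continuous exp x.
Proof. apply (ex_derive_continuous (V := R_NormedModule)); auto_derive; auto. Qed.
Lemma is_derive_sinh x : is_derive sinh x (cosh x).
Proof. unfold sinh, cosh; auto_derive; auto; lra. Qed.
Lemma is_derive_cosh x : is_derive cosh x (sinh x).
Proof. unfold sinh, cosh; auto_derive; auto; lra. Qed.
Lemma continuous_sinh x : continuous sinh x.
Proof. apply (ex_derive_continuous (V := R_NormedModule)); eexists; apply is_derive_sinh. Qed.
Lemma continuous_cosh x : continuous cosh x.
Proof. apply (ex_derive_continuous (V := R_NormedModule)); eexists; apply is_derive_cosh. Qed.

Lemma continuity_pt_cont (f : R -> R) x : continuous f x -> continuity_pt f x.
Proof. intros; now apply continuity_pt_filterlim. Qed.

Ltac eqR := match goal with |- @eq _ ?a ?b => change (@eq R a b) end.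

Ltac cont1 :=
  match goal with
  | |- continuous (fun z => fst (fst z)) _ => apply (continuous_comp fst fst)
  | |- continuous (fun z => snd (fst z)) _ => apply (continuous_comp fst snd)
  | |- continuous (fun z => fst z) _ => apply continuous_fst
  | |- continuous (fun z => snd z) _ => apply continuous_snd
  | |- continuous (Rmult ?k) ?p => change (continuous (fun z => k * z) p)
  | |- continuous (Rplus ?k) ?p => change (continuous (fun z => k + z) p)
  | |- continuous (Rminus ?k) ?p => change (continuous (fun z => k - z) p)
  | |- continuous sinh _ => apply continuous_sinh
  | |- continuous cosh _ => apply continuous_cosh
  | |- continuous sin _ => apply continuous_sin_R
  | |- continuous cos _ => apply continuous_cos_R
  | |- continuous exp _ => apply continuous_exp_R
  | |- continuous fst _ => apply continuous_fst
  | |- continuous snd _ => apply continuous_snd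
  | |- continuous (fun z => z) _ => apply continuous_id
  | |- continuous (fun _ => ?c) _ => apply cont_const
  | |- continuous (fun z => _ + _) _ => apply cont_plus
  | |- continuous (fun z => _ - _) _ => apply cont_minus
  | |- continuous (fun z => - _) _ => apply cont_opp
  | |- continuous (fun z => _ * _) _ => apply cont_mult
  | |- continuous (fun z => _ / _) _ => apply cont_div
  | |- continuous (fun z => / _) _ => apply cont_inv
  | |- continuous (fun z => sin _) _ => apply (cont_comp sin); [|apply continuous_sin_R]
  | |- continuous (fun z => cos _) _ => apply (cont_comp cos); [|apply continuous_cos_R]
  | |- continuous (fun z => exp _) _ => apply (cont_comp exp); [|apply continuous_exp_R]
  | |- continuous (fun z => sinh _) _ => apply (cont_comp sinh); [|apply continuous_sinh]
  | |- continuous (fun z => cosh _) _ => apply (cont_comp cosh); [|apply continuous_cosh]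
  end.
Ltac cont := repeat (assumption || cont1).

(** Compactness of [[c, d]] makes the neighbourhoods uniform in [b]. The parameter space is an
    arbitrary uniform space, so that the lemma serves for points of space-time as well as for single
    radii, angles and times. *)
Lemma tube {E : UniformSpace} (p0 : E) (P : E -> R -> Prop) (c d : R) :
  (forall b, c <= b <= d -> locally (p0, b) (fun z : E * R => P (fst z) (snd z))) ->
  locally p0 (fun p => forall b, c <= b <= d -> P p b).
Proof.
intros H.
assert (D : forall b, exists e : posreal, c <= b <= d ->
  forall p b', ball p0 e p -> Rabs (b' - b) < e -> P p b').
{ intros b. destruct (classic (c <= b <= d)) as [Hb|Hb].
  - destruct (H b Hb) as [e He]. exists e. intros _ p b' Hp Hb'.
    apply (He (p, b')). split; [exact Hp|exact Hb'].
  - exists (mkposreal 1 Rlt_0_1). intros; contradiction. }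
destruct (ClassicalEpsilon.constructive_indefinite_description
  (fun dl : R -> posreal => forall b, c <= b <= d ->
    forall p b', ball p0 (dl b) p -> Rabs (b' - b) < dl b -> P p b')) as [dl Hdl].
{ exists (fun b => proj1_sig (ClassicalEpsilon.constructive_indefinite_description _ (D b))).
  intros b. exact (proj2_sig (ClassicalEpsilon.constructive_indefinite_description _ (D b))). }
(* The gauge [dl] has to be total, hence the dummy radius 1 outside [[c, d]]. The covering point
   comes under a double negation, whence [NNPP]. *)
destruct (compactness_value_1d c d dl) as [e He].
exists e. intros p Hp b Hb.
apply NNPP. intros HP. apply (He b Hb). intros [t [Ht [Hbt Het]]].
apply HP. apply (Hdl t Ht); [|exact Hbt].
now apply ball_le with e.
Qed.

Lemma continuous_locally_lt {E : UniformSpace} (f : E -> R) (p : E) (e : R) :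
  continuous f p -> 0 < e -> locally p (fun x => Rabs (f x - f p) < e).
Proof.
intros Hf He. apply (Hf (fun y => Rabs (y - f p) < e)).
exists (mkposreal e He). intros y Hy. exact Hy.
Qed.

Lemma continuous_of_lt {E : UniformSpace} (f : E -> R) (p : E) :
  (forall e, 0 < e -> locally p (fun x => Rabs (f x - f p) < e)) -> continuous f p.
Proof.
intros H P [e HP]. specialize (H e (cond_pos e)).
unfold filtermap. revert H. apply filter_imp. intros x Hx. now apply HP.
Qed.

Lemma locally_continuous_gt {E : UniformSpace} (f : E -> R) (p : E) (c : R) :
  continuous f p -> c < f p -> locally p (fun x => c < f x).
Proof.
intros Hf Hc. assert (H := continuous_locally_lt f p (f p - c) Hf ltac:(lra)).
revert H. apply filter_imp. intros x Hx. apply Rabs_def2 in Hx. lra.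
Qed.

Lemma locally_continuous_lt {E : UniformSpace} (f : E -> R) (p : E) (c : R) :
  continuous f p -> f p < c -> locally p (fun x => f x < c).
Proof.
intros Hf Hc. assert (H := continuous_locally_lt f p (c - f p) Hf ltac:(lra)).
revert H. apply filter_imp. intros x Hx. apply Rabs_def2 in Hx. lra.
Qed.

Lemma locally_continuous_neq {E : UniformSpace} (f : E -> R) (p : E) (c : R) :
  continuous f p -> f p <> c -> locally p (fun x => f x <> c).
Proof.
intros Hf Hc. destruct (Rlt_or_le c (f p)) as [H|H].
- generalize (locally_continuous_gt f p c Hf H). apply filter_imp; intros; lra.
- generalize (locally_continuous_lt f p c Hf ltac:(lra)). apply filter_imp; intros; lra.
Qed.

Lemma abs_RInt_le_open (f : R -> R) (a b M : R) : a <= b -> ex_RInt f a b ->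
  (forall t, a < t < b -> Rabs (f t) <= M) -> Rabs (RInt f a b) <= (b - a) * M.
Proof.
intros Hab Hf HM. apply Rabs_le.
assert (E1 : ((b - a) * M) = RInt (fun _ => M) a b).
{ rewrite RInt_const. reflexivity. }
assert (E2 : (- ((b - a) * M)) = RInt (fun _ => - M) a b).
{ rewrite RInt_const. unfold scal; simpl; unfold mult; simpl; ring. }
split.
- rewrite E2. apply RInt_le; auto. apply ex_RInt_const.
  intros x Hx. specialize (HM x Hx). apply Rabs_le_between in HM. lra.
- rewrite E1. apply RInt_le; auto. apply ex_RInt_const.
  intros x Hx. specialize (HM x Hx). apply Rabs_le_between in HM. lra.
Qed.

Lemma ex_RInt_sub (f : R -> R) (a b c d : R) :
  a <= c <= d -> d <= b -> ex_RInt f a b -> ex_RInt f c d.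
Proof.
intros H1 H2 H. apply (ex_RInt_Chasles_2 (V := R_CompleteNormedModule)) with a; [lra|].
apply (ex_RInt_Chasles_1 (V := R_CompleteNormedModule)) with b; [lra|exact H].
Qed.

(* The bound replaces continuity at the left endpoint, where the kernels of the
   diffracted wave are singular when [p0] lies on a critical ray. *)
Lemma continuous_RInt_bounded {E : UniformSpace} (g : E -> R -> R) (p0 : E) (a b M : R) :
  a < b ->
  (forall s, a < s <= b -> continuous (fun z : E * R => g (fst z) (snd z)) (p0, s)) ->
  locally p0 (fun p => forall s, a < s < b -> Rabs (g p s) <= M) ->
  locally p0 (fun p => ex_RInt (g p) a b) ->
  continuous (fun p => RInt (g p) a b) p0.
Proof.
intros Hb Hc HM Hex. apply continuous_of_lt. intros e He.
assert (M0 : 0 <= M).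
{ apply locally_singleton in HM. apply Rle_trans with (2 := HM ((a + b)/2) ltac:(lra)). apply Rabs_pos. }
(* The piece [[a, c]] next to the singular end is so short that the bound [M] alone keeps its share
   below e / 4; on [[c, b]] the integrands differ by less than [k], which costs another e / 4. *)
set (c0 := Rmin ((b - a) / 2) (e / (8 * (M + 1)))). set (c := a + c0).
assert (Hc1 : 0 < e / (8 * (M + 1))) by (apply Rdiv_lt_0_compat; lra).
assert (Hc0 : 0 < c0) by (apply Rmin_glb_lt; lra).
assert (Hcb0 : c0 <= (b - a) / 2) by apply Rmin_l.
assert (Hac : a < c) by (unfold c; lra). assert (Hcb : c < b) by (unfold c; lra).
assert (HcM : 2 * M * c0 <= e / 4).
{ assert (c0 <= e / (8 * (M + 1))) by apply Rmin_r.
  apply Rle_trans with (2 * M * (e / (8 * (M + 1)))); [apply Rmult_le_compat_l; lra|].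
  apply Rle_trans with (2 * (M + 1) * (e / (8 * (M + 1)))); [nra|].
  right. field. lra. }
set (k := e / (4 * (b - a))). assert (Hk : 0 < k) by (apply Rdiv_lt_0_compat; lra).
assert (T : locally p0 (fun p => forall s, c <= s <= b -> Rabs (g p s - g p0 s) < k)).
{ apply (tube p0 (fun p s => Rabs (g p s - g p0 s) < k)). intros s Hs.
  assert (C1 := Hc s ltac:(lra)).
  assert (C2 : continuous (fun z : E * R => g (fst z) (snd z) - g p0 (snd z)) (p0, s)).
  { apply cont_minus; [exact C1|].
    apply (continuous_comp (fun z : E * R => (p0, snd z)) (fun z : E * R => g (fst z) (snd z)));
      [|exact C1].
    apply cont_pair; [apply continuous_const|apply continuous_snd]. }
  generalize (continuous_locally_lt _ _ k C2 Hk). apply filter_imp.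
  intros z Hz. simpl in Hz. replace (g p0 s - g p0 s) with 0 in Hz by ring. now rewrite Rminus_0_r in Hz. }
assert (Hex0 := locally_singleton _ _ Hex). assert (HM0 := locally_singleton _ _ HM).
simpl in Hex0, HM0.
generalize (filter_and _ _ HM (filter_and _ _ Hex T)). apply filter_imp.
intros p [HMp [Hexp Tp]].
assert (D : ex_RInt (fun s => g p s - g p0 s) a b) by (apply (ex_RInt_minus (g p) (g p0)); auto).
assert (EQ : RInt (g p) a b - RInt (g p0) a b = RInt (fun s => g p s - g p0 s) a b).
{ symmetry. apply (RInt_minus (g p) (g p0)); auto. }
rewrite EQ.
assert (D1 : ex_RInt (fun s => g p s - g p0 s) a c) by (apply (ex_RInt_sub _ a b); auto; lra).
assert (D2 : ex_RInt (fun s => g p s - g p0 s) c b) by (apply (ex_RInt_sub _ a b); auto; lra).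
rewrite <- (RInt_Chasles _ a c b D1 D2). unfold plus; simpl.
apply Rle_lt_trans with (1 := Rabs_triang _ _).
assert (B1 : Rabs (RInt (fun s => g p s - g p0 s) a c) <= (c - a) * (2 * M)).
{ apply abs_RInt_le_open; auto; try lra. intros s Hs.
  apply Rle_trans with (1 := Rabs_triang _ _). rewrite Rabs_Ropp.
  specialize (HMp s ltac:(lra)); specialize (HM0 s ltac:(lra)). lra. }
assert (B2 : Rabs (RInt (fun s => g p s - g p0 s) c b) <= (b - c) * k).
{ apply abs_RInt_le_open; auto; try lra. intros s Hs. left; apply Tp; lra. }
assert ((b - c) * k <= e / 4).
{ apply Rle_trans with ((b - a) * k); [nra|]. right. unfold k. field. lra. }
replace (c - a) with c0 in B1 by (unfold c; ring).
lra.
Qed.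

(** The bound asked for by [continuous_RInt_bounded] is the maximum at [p0] over the compact
    interval plus 1, which persists near [p0] by [tube]. *)
Lemma continuous_RInt_param {E : UniformSpace} (g : E -> R -> R) (p0 : E) (a b : R) :
  a < b ->
  (forall s, a <= s <= b -> continuous (fun z : E * R => g (fst z) (snd z)) (p0, s)) ->
  locally p0 (fun p => ex_RInt (g p) a b) ->
  continuous (fun p => RInt (g p) a b) p0.
Proof.
intros Hb Hc Hex.
assert (C0 : forall s, a <= s <= b -> continuous (g p0) s).
{ intros s Hs. apply (continuous_comp (fun s : R => (p0, s)) (fun z : E * R => g (fst z) (snd z)));
   [|now apply Hc].
  apply cont_pair; [apply continuous_const|apply continuous_id]. }
assert (BM : exists M, forall s, a <= s <= b -> Rabs (g p0 s) <= M).
{ destruct (continuity_ab_maj (fun s => Rabs (g p0 s)) a b ltac:(lra)) as [m Hm].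
  - intros s Hs. apply continuity_pt_filterlim. apply (cont_comp Rabs). now apply C0.
    apply continuous_Rabs.
  - exists (Rabs (g p0 m)). exact (proj1 Hm). }
destruct BM as [M HM].
apply (continuous_RInt_bounded g p0 a b (M + 1)); auto.
- intros s Hs; apply Hc; lra.
- assert (T : locally p0 (fun p => forall s, a <= s <= b -> Rabs (g p s) <= M + 1)).
  { apply (tube p0 (fun p s => Rabs (g p s) <= M + 1)). intros s Hs.
    generalize (continuous_locally_lt _ _ 1 (Hc s Hs) Rlt_0_1). apply filter_imp.
    intros z Hz. simpl in Hz. specialize (HM s Hs).
    apply Rle_trans with (Rabs (g (fst z) (snd z) - g p0 s) + Rabs (g p0 s));
      [|rewrite (Rplus_comm M); apply Rplus_le_compat; [left; exact Hz|exact HM]].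
    generalize (Rabs_triang (g (fst z) (snd z) - g p0 s) (g p0 s)).
    now replace (g (fst z) (snd z) - g p0 s + g p0 s) with (g (fst z) (snd z)) by ring. }
  generalize T. apply filter_imp. intros p Hp s Hs; apply Hp; lra.
Qed.

Lemma is_derive_0_of_eps (v : R -> R) (l : R) :
  (forall e, 0 < e -> exists d, 0 < d /\ forall h, Rabs h < d ->
     Rabs (v h - v 0 - h * l) <= e * Rabs h) -> is_derive v 0 l.
Proof.
intros MV. split; [apply is_linear_scal_l|].
intros x Hx. assert (x = 0) as ->.
{ symmetry. now apply (is_filter_lim_locally_unique (V := R_NormedModule)). }
intros e. destruct (MV e (cond_pos e)) as [d [Hd0 Hd1]].
exists (mkposreal d Hd0). intros h Hh.
unfold ball in Hh; simpl in Hh; unfold AbsRing_ball, abs, minus, plus, opp in Hh; simpl in Hh.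
unfold norm, minus, plus, opp, scal; simpl; unfold abs, mult, minus, plus, opp; simpl.
rewrite Ropp_0, Rplus_0_r in *. apply Hd1. exact Hh.
Qed.

(* [v_e = w] off the line [m = 0] extends to the line by continuity.  [v s h]
   stands for the value at distance [s] across and [h] along the direction e
   when e is parallel to the line. *)
Lemma is_derive_parallel (v w : R -> R -> R) (e0 : R) :
  0 < e0 ->
  continuous (fun z : R * R => w (fst z) (snd z)) (0, 0) ->
  (forall h, Rabs h < e0 -> continuous (fun s => v s h) 0) ->
  (forall s h, Rabs s < e0 -> Rabs h < e0 -> s <> 0 -> is_derive (v s) h (w s h)) ->
  is_derive (v 0) 0 (w 0 0).
Proof.
intros He0 Hw Hv Hd.
assert (MV : forall e, 0 < e -> exists d, 0 < d /\ forall h, Rabs h < d ->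
  Rabs (v 0 h - v 0 0 - h * w 0 0) <= e * Rabs h).
{ intros e He. destruct (continuous_locally_lt _ _ e Hw He) as [d Hd1].
  exists (Rmin d e0). split; [apply Rmin_glb_lt; [apply cond_pos|lra]|].
  intros h Hh.
  assert (Hhd : Rabs h < d) by (apply Rlt_le_trans with (1 := Hh); apply Rmin_l).
  assert (Hhe : Rabs h < e0) by (apply Rlt_le_trans with (1 := Hh); apply Rmin_r).
  assert (S : forall s, Rabs s < Rmin d e0 -> s <> 0 -> Rabs (v s h - v s 0 - h * w 0 0) <= e * Rabs h).
  { intros s Hs Hs0.
    assert (Hsd : Rabs s < d) by (apply Rlt_le_trans with (1 := Hs); apply Rmin_l).
    assert (Hse : Rabs s < e0) by (apply Rlt_le_trans with (1 := Hs); apply Rmin_r).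
    assert (IN : forall x, Rmin 0 h <= x <= Rmax 0 h -> Rabs x <= Rabs h).
    { intros x. unfold Rmin, Rmax. destruct (Rle_dec 0 h); intros Hx.
      - rewrite (Rabs_pos_eq x), (Rabs_pos_eq h); lra.
      - rewrite (Rabs_left1 x), (Rabs_left1 h); lra. }
    destruct (MVT_gen (v s) 0 h (w s)) as [c [Hc Hce]].
    - intros x Hx. apply Hd; auto. apply Rle_lt_trans with (2 := Hhe). apply IN; lra.
    - intros x Hx. apply continuity_pt_filterlim. apply (ex_derive_continuous (v s)).
      eexists. apply Hd; auto. apply Rle_lt_trans with (2 := Hhe). apply IN; lra.
    - rewrite Hce. replace (w s c * (h - 0) - h * w 0 0) with ((w s c - w 0 0) * h) by ring.
      rewrite Rabs_mult. apply Rmult_le_compat_r; [apply Rabs_pos|].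
      left. apply (Hd1 (s, c)). split; simpl.
      + unfold ball; simpl; unfold AbsRing_ball, abs, minus, plus, opp; simpl. now rewrite Ropp_0, Rplus_0_r.
      + unfold ball; simpl; unfold AbsRing_ball, abs, minus, plus, opp; simpl. rewrite Ropp_0, Rplus_0_r.
        apply Rle_lt_trans with (2 := Hhd). now apply IN. }
  (* [S] excludes [s = 0]; a strict violation at [s = 0] would persist for small [s <> 0] by
     continuity in [s]. *)
  apply Rnot_lt_le. intros Hlt.
  assert (CV : continuous (fun s => Rabs (v s h - v s 0 - h * w 0 0)) 0).
  { apply (cont_comp Rabs); [|apply continuous_Rabs]. cont. now apply Hv. apply Hv. rewrite Rabs_R0; lra. }
  destruct (locally_continuous_gt _ _ _ CV Hlt) as [d2 Hd2].
  set (s := Rmin d2 (Rmin d e0) / 2).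
  assert (0 < Rmin d2 (Rmin d e0)).
  { apply Rmin_glb_lt; [apply cond_pos|apply Rmin_glb_lt; [apply cond_pos|lra]]. }
  assert (s < d2) by (unfold s; generalize (Rmin_l d2 (Rmin d e0)); lra).
  assert (s < Rmin d e0) by (unfold s; generalize (Rmin_r d2 (Rmin d e0)); lra).
  assert (0 < s) by (unfold s; lra).
  apply (Rlt_irrefl (e * Rabs h)). apply Rlt_le_trans with (Rabs (v s h - v s 0 - h * w 0 0)).
  + apply Hd2. unfold ball; simpl; unfold AbsRing_ball, abs, minus, plus, opp; simpl.
    rewrite Ropp_0, Rplus_0_r. rewrite Rabs_pos_eq; lra.
  + apply S; [rewrite Rabs_pos_eq; lra|lra]. }
now apply is_derive_0_of_eps.
Qed.

(** For a direction that meets the line only at [h = 0]: the mean value theorem between 0 and [h]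
    uses no derivative at its end points. *)
Lemma is_derive_transversal (v w : R -> R) (e0 : R) :
  0 < e0 -> continuous w 0 -> (forall h, Rabs h < e0 -> continuous v h) ->
  (forall h, Rabs h < e0 -> h <> 0 -> is_derive v h (w h)) ->
  is_derive v 0 (w 0).
Proof.
intros He0 Hw Hv Hd.
apply is_derive_0_of_eps. intros e He.
destruct (continuous_locally_lt _ _ e Hw He) as [d Hd1].
exists (Rmin d e0). split; [apply Rmin_glb_lt; [apply cond_pos|lra]|]. intros h Hh.
assert (Hhd : Rabs h < d) by (apply Rlt_le_trans with (1 := Hh); apply Rmin_l).
assert (Hhe : Rabs h < e0) by (apply Rlt_le_trans with (1 := Hh); apply Rmin_r).
assert (IN : forall x, Rmin 0 h <= x <= Rmax 0 h -> Rabs x <= Rabs h).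
{ intros x. unfold Rmin, Rmax. destruct (Rle_dec 0 h); intros Hx'.
  - rewrite (Rabs_pos_eq x), (Rabs_pos_eq h); lra.
  - rewrite (Rabs_left1 x), (Rabs_left1 h); lra. }
destruct (MVT_gen v 0 h w) as [c [Hc Hce]].
- intros x Hx. apply Hd.
  + apply Rle_lt_trans with (2 := Hhe). apply IN; lra.
  + unfold Rmin, Rmax in Hx; destruct (Rle_dec 0 h); lra.
- intros x Hx. apply continuity_pt_filterlim. apply Hv.
  apply Rle_lt_trans with (2 := Hhe). now apply IN.
- replace (v h - v 0 - h * w 0) with ((w c - w 0) * h) by lra.
  rewrite Rabs_mult. apply Rmult_le_compat_r; [apply Rabs_pos|].
  left. apply Hd1. unfold ball; simpl; unfold AbsRing_ball, abs, minus, plus, opp; simpl.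
  rewrite Ropp_0, Rplus_0_r. apply Rle_lt_trans with (2 := Hhd). now apply IN.
Qed.

Lemma is_RInt_mult_r (f : R -> R) (a b l c : R) :
  is_RInt f a b l -> is_RInt (fun s => f s * c) a b (l * c).
Proof.
intros H. rewrite (Rmult_comm l c).
apply (is_RInt_ext (V := R_NormedModule) (fun s => c * f s)).
- intros; apply Rmult_comm.
- now apply (is_RInt_scal (V := R_NormedModule)).
Qed.

(** * Hyperbolic functions *)

Lemma cosh_plus a b : cosh (a + b) = cosh a * cosh b + sinh a * sinh b.
Proof. unfold cosh, sinh. rewrite Ropp_plus_distr, !exp_plus. field. Qed.
Lemma sinh_plus a b : sinh (a + b) = sinh a * cosh b + cosh a * sinh b.
Proof. unfold cosh, sinh. rewrite Ropp_plus_distr, !exp_plus. field. Qed.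
Lemma cosh_opp a : cosh (- a) = cosh a.
Proof. unfold cosh. rewrite Ropp_involutive. field. Qed.
Lemma sinh_opp a : sinh (- a) = - sinh a.
Proof. unfold sinh. rewrite Ropp_involutive. field. Qed.
Lemma cosh2_sinh2 a : cosh a * cosh a = 1 + sinh a * sinh a.
Proof.
assert (H := cosh_plus a (- a)). rewrite Rplus_opp_r, cosh_opp, sinh_opp, cosh_0 in H. lra.
Qed.
Lemma cosh_ge_1 a : 1 <= cosh a.
Proof.
assert (H := cosh2_sinh2 a). assert (0 < cosh a).
{ unfold cosh. generalize (exp_pos a) (exp_pos (-a)). lra. }
nra.
Qed.
Lemma sinh_ge a : 0 <= a -> a <= sinh a.
Proof.
intros Ha. destruct (MVT_gen sinh 0 a cosh) as [c [Hc He]].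
- intros; apply is_derive_sinh.
- intros; apply continuity_pt_cont; apply continuous_sinh.
- rewrite sinh_0 in He. generalize (cosh_ge_1 c). nra.
Qed.
Lemma cosh_ge a : 0 <= a -> a <= cosh a.
Proof.
intros Ha. generalize (sinh_ge a Ha). unfold sinh, cosh. generalize (exp_pos (-a)). lra.
Qed.
Lemma cosh_incr a b : Rabs a <= Rabs b -> cosh a <= cosh b.
Proof.
intros H.
assert (Habs : forall u, cosh u = cosh (Rabs u)).
{ intros u. unfold Rabs. destruct (Rcase_abs u); [now rewrite cosh_opp|easy]. }
rewrite (Habs a), (Habs b).
destruct (MVT_gen cosh (Rabs a) (Rabs b) sinh) as [c [Hc He]].
- intros; apply is_derive_cosh.
- intros; apply continuity_pt_cont; apply continuous_cosh.
- rewrite Rmin_left, Rmax_right in Hc by lra.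
  generalize (Rabs_pos a); intros. generalize (sinh_ge c ltac:(lra)). nra.
Qed.
(** The factor [b] compensates the pole of [coth_re] at [b = 0] in [continuous_edge_wave]. *)
Lemma abs_sinh_le k b B : 0 <= b <= B -> Rabs (sinh (k * b)) <= Rabs k * b * cosh (k * B).
Proof.
intros Hb. destruct (MVT_gen (fun b => sinh (k * b)) 0 b (fun b => k * cosh (k * b))) as [c [Hc He]].
- intros. evar_last. apply (is_derive_comp sinh (fun b => k * b)). apply is_derive_sinh.
  auto_derive; auto. unfold scal; simpl; unfold mult; simpl; ring.
- intros. apply continuity_pt_cont. cont.
- rewrite Rmin_left, Rmax_right in Hc by lra.
  rewrite Rmult_0_r, sinh_0, !Rminus_0_r in He. rewrite He, !Rabs_mult.
  rewrite (Rabs_pos_eq b) by lra.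
  rewrite (Rabs_pos_eq (cosh _)) by (generalize (cosh_ge_1 (k * c)); lra).
  assert (cosh (k * c) <= cosh (k * B)).
  { apply cosh_incr. rewrite !Rabs_mult. apply Rmult_le_compat_l; [apply Rabs_pos|].
    rewrite !Rabs_pos_eq; lra. }
  generalize (Rabs_pos k) (cosh_ge_1 (k * c)). intros.
  assert (0 <= Rabs k * b) by (apply Rmult_le_pos; lra).
  replace (Rabs k * cosh (k * c) * b) with (Rabs k * b * cosh (k * c)) by ring.
  now apply Rmult_le_compat_l.
Qed.

(** * Kernels and edge waves *)

(* Real and imaginary parts of coth (q (b + i x)), of cosh (n (b + i x) + i g)
   and of their product. *)
Definition coth_den (q b x : R) : R := cosh (2 * q * b) - cos (2 * q * x).
Definition coth_re (q b x : R) : R := sinh (2 * q * b) / coth_den q b x.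
Definition coth_im (q b x : R) : R := - sin (2 * q * x) / coth_den q b x.
Definition mul_re (n g b x : R) : R := cosh (n * b) * cos (n * x + g).
Definition mul_im (n g b x : R) : R := sinh (n * b) * sin (n * x + g).
Definition ker_re (q n g b x : R) : R :=
  coth_re q b x * mul_re n g b x - coth_im q b x * mul_im n g b x.
Definition ker_im (q n g b x : R) : R :=
  coth_re q b x * mul_im n g b x + coth_im q b x * mul_re n g b x.
Definition coth_re' (q b x : R) : R :=
  2 * q * (1 - cosh (2 * q * b) * cos (2 * q * x)) / (coth_den q b x) ^ 2.
Definition coth_im' (q b x : R) : R :=
  2 * q * sin (2 * q * x) * sinh (2 * q * b) / (coth_den q b x) ^ 2.
Definition ker_re' (q n g b x : R) : R :=
  coth_re' q b x * mul_re n g b x + coth_re q b x * (n * sinh (n * b) * cos (n * x + g))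
  - coth_im' q b x * mul_im n g b x - coth_im q b x * (n * cosh (n * b) * sin (n * x + g)).

(** The denominator is 2 |sinh (q z)|^2 with z = b + i x. For |q x| < PI it vanishes only at z = 0,
    the single pole of the kernel. *)
Lemma coth_den_eq q b x :
  coth_den q b x = 2 * (sinh (q * b) * sinh (q * b)) + 2 * (sin (q * x) * sin (q * x)).
Proof.
unfold coth_den. replace (2 * q * b) with (q * b + q * b) by ring.
replace (2 * q * x) with (2 * (q * x)) by ring.
rewrite cosh_plus, cosh2_sinh2, cos_2a_sin. ring.
Qed.

Lemma sinh_pos a : 0 < a -> 0 < sinh a.
Proof. intros H. generalize (sinh_ge a). lra. Qed.

Lemma sin_neq_0_pi u : - PI < u < PI -> u <> 0 -> sin u <> 0.
Proof.
intros Hu H0. destruct (Rlt_or_le 0 u).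
- generalize (sin_gt_0 u ltac:(lra) ltac:(lra)); lra.
- generalize (sin_gt_0 (-u) ltac:(lra) ltac:(lra)); rewrite sin_neg; lra.
Qed.

Lemma sq_pos u : u <> 0 -> 0 < u * u.
Proof. intros; now apply Rsqr_pos_lt. Qed.

Lemma coth_den_pos_b q b x : 0 < q -> 0 < b -> 0 < coth_den q b x.
Proof.
intros Hq Hb. rewrite coth_den_eq.
assert (0 < q * b) by now apply Rmult_lt_0_compat.
generalize (sinh_pos _ H) (Rle_0_sqr (sin (q * x))). unfold Rsqr. nra.
Qed.

Lemma coth_den_pos_x q b x : 0 < q -> - PI < q * x < PI -> x <> 0 -> 0 < coth_den q b x.
Proof.
intros Hq Hx H0. rewrite coth_den_eq.
assert (q * x <> 0) by (apply Rmult_integral_contrapositive_currified; lra).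
generalize (sq_pos _ (sin_neq_0_pi _ Hx H)) (Rle_0_sqr (sinh (q * b))). unfold Rsqr. lra.
Qed.

Section Derivatives.
Variables (q n g b x : R).
Hypothesis D : coth_den q b x <> 0.

Lemma is_derive_cosh_lin k u : is_derive (fun u => cosh (k * u)) u (k * sinh (k * u)).
Proof.
evar_last. apply (is_derive_comp cosh (fun b => k * b)). apply is_derive_cosh.
auto_derive; auto. unfold scal; simpl; unfold mult; simpl; ring.
Qed.
Lemma is_derive_sinh_lin k u : is_derive (fun u => sinh (k * u)) u (k * cosh (k * u)).
Proof.
evar_last. apply (is_derive_comp sinh (fun b => k * b)). apply is_derive_sinh.
auto_derive; auto. unfold scal; simpl; unfold mult; simpl; ring.
Qed.

Lemma is_derive_den_b : is_derive (fun b => coth_den q b x) b (2 * q * sinh (2 * q * b)).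
Proof.
unfold coth_den. evar_last. apply @is_derive_minus. apply is_derive_cosh_lin.
apply @is_derive_const. unfold minus, plus, opp, zero; simpl; ring.
Qed.
Lemma is_derive_den_x : is_derive (fun x => coth_den q b x) x (2 * q * sin (2 * q * x)).
Proof. unfold coth_den. auto_derive; auto. ring. Qed.

Lemma is_derive_coth_re_b : is_derive (fun b => coth_re q b x) b (coth_re' q b x).
Proof.
unfold coth_re. evar_last.
apply is_derive_div; [apply is_derive_sinh_lin|apply is_derive_den_b|exact D].
unfold coth_re', Rdiv. f_equal. unfold coth_den.
transitivity (2 * q * (cosh (2 * q * b) * cosh (2 * q * b)
  - cosh (2 * q * b) * cos (2 * q * x) - sinh (2 * q * b) * sinh (2 * q * b))); [ring|].
rewrite cosh2_sinh2; ring.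
Qed.
Lemma is_derive_coth_im_b : is_derive (fun b => coth_im q b x) b (coth_im' q b x).
Proof.
unfold coth_im. evar_last.
apply is_derive_div; [apply @is_derive_const|apply is_derive_den_b|exact D].
unfold coth_im', zero; simpl. field; auto.
Qed.
Lemma is_derive_coth_re_x : is_derive (fun x => coth_re q b x) x (- coth_im' q b x).
Proof.
unfold coth_re. evar_last.
apply is_derive_div; [apply @is_derive_const|apply is_derive_den_x|exact D].
unfold coth_im', zero; simpl. field; auto.
Qed.
Lemma is_derive_coth_im_x : is_derive (fun x => coth_im q b x) x (coth_re' q b x).
Proof.
unfold coth_im. evar_last.
apply (is_derive_div _ _ _ (- (2 * q * cos (2 * q * x)))); [|apply is_derive_den_x|exact D].
auto_derive; auto; ring.
unfold coth_re', Rdiv. f_equal. unfold coth_den.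
transitivity (2 * q * (Rsqr (sin (2 * q * x)) + Rsqr (cos (2 * q * x))
  - cosh (2 * q * b) * cos (2 * q * x))); [unfold Rsqr; ring|].
rewrite sin2_cos2; ring.
Qed.
Lemma is_derive_mul_re_b : is_derive (fun b => mul_re n g b x) b (n * sinh (n * b) * cos (n * x + g)).
Proof.
unfold mul_re. apply (is_derive_scal_l (fun b => cosh (n * b)) b (n * sinh (n * b)) (cos (n * x + g))).
apply is_derive_cosh_lin.
Qed.
Lemma is_derive_mul_im_b : is_derive (fun b => mul_im n g b x) b (n * cosh (n * b) * sin (n * x + g)).
Proof.
unfold mul_im. apply (is_derive_scal_l (fun b => sinh (n * b)) b (n * cosh (n * b)) (sin (n * x + g))).
apply is_derive_sinh_lin.
Qed.
Lemma is_derive_mul_re_x : is_derive (fun x => mul_re n g b x) x (- (n * cosh (n * b) * sin (n * x + g))).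
Proof. unfold mul_re. auto_derive; auto. ring. Qed.
Lemma is_derive_mul_im_x : is_derive (fun x => mul_im n g b x) x (n * sinh (n * b) * cos (n * x + g)).
Proof. unfold mul_im. auto_derive; auto. ring. Qed.

Lemma is_derive_ker_re_b : is_derive (fun b => ker_re q n g b x) b (ker_re' q n g b x).
Proof.
unfold ker_re. evar_last. apply @is_derive_minus; apply Derive.is_derive_mult.
apply is_derive_coth_re_b. apply is_derive_mul_re_b. apply is_derive_coth_im_b. apply is_derive_mul_im_b.
unfold ker_re', minus, plus, opp; simpl; ring.
Qed.
(** Cauchy-Riemann for the holomorphic function coth (q z) cosh (n z + i g): the derivative of the
    imaginary part in [x] is that of the real part in [b]. This exchange is what makes integration
    by parts in [b] possible. *)
Lemma is_derive_ker_im_x : is_derive (fun x => ker_im q n g b x) x (ker_re' q n g b x).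
Proof.
unfold ker_im. evar_last. apply @is_derive_plus; apply Derive.is_derive_mult.
apply is_derive_coth_re_x. apply is_derive_mul_im_x. apply is_derive_coth_im_x. apply is_derive_mul_re_x.
unfold ker_re', minus, plus, opp; simpl; ring.
Qed.
End Derivatives.

Section KernelContinuity.
Context {E : UniformSpace}.
Variables (q n g : R) (b x : E -> R) (p : E).
Hypothesis Hb : continuous b p.
Hypothesis Hx : continuous x p.
Hypothesis D : coth_den q (b p) (x p) <> 0.

Lemma cont_coth_re : continuous (fun p => coth_re q (b p) (x p)) p.
Proof. unfold coth_re, coth_den. cont. Qed.
Lemma cont_coth_im : continuous (fun p => coth_im q (b p) (x p)) p.
Proof. unfold coth_im, coth_den. cont. Qed.
Lemma cont_mul_re : continuous (fun p => mul_re n g (b p) (x p)) p.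
Proof. unfold mul_re. cont. Qed.
Lemma cont_mul_im : continuous (fun p => mul_im n g (b p) (x p)) p.
Proof. unfold mul_im. cont. Qed.
Lemma cont_ker_re : continuous (fun p => ker_re q n g (b p) (x p)) p.
Proof. unfold ker_re. generalize cont_coth_re cont_coth_im cont_mul_re cont_mul_im; intros; cont. Qed.
Lemma cont_ker_im : continuous (fun p => ker_im q n g (b p) (x p)) p.
Proof. unfold ker_im. generalize cont_coth_re cont_coth_im cont_mul_re cont_mul_im; intros; cont. Qed.
Lemma cont_ker_re' : continuous (fun p => ker_re' q n g (b p) (x p)) p.
Proof.
assert (D2 : coth_den q (b p) (x p) ^ 2 <> 0) by now apply pow_nonzero.
assert (C : continuous (fun p => coth_den q (b p) (x p) ^ 2) p).
{ unfold coth_den; simpl. cont. }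
unfold ker_re', coth_re', coth_im'.
generalize cont_coth_re cont_coth_im cont_mul_re cont_mul_im; intros. cont; assumption.
Qed.
End KernelContinuity.

(* The real form of
   cosh (n z + i g) cosh (z + i k)
     = (cosh ((n + 1) z + i (g + k)) + cosh ((n - 1) z + i (g - k))) / 2. *)
Lemma ker_im_product q n g k b x :
  sinh b * sin (x + k) * ker_re q n g b x + cosh b * cos (x + k) * ker_im q n g b x
  = / 2 * (ker_im q (n + 1) (g + k) b x + ker_im q (n - 1) (g - k) b x).
Proof.
unfold ker_im, ker_re, mul_re, mul_im.
replace ((n + 1) * b) with (n * b + b) by ring.
replace ((n - 1) * b) with (n * b + - b) by ring.
replace ((n + 1) * x + (g + k)) with ((n * x + g) + (x + k)) by ring.
replace ((n - 1) * x + (g - k)) with ((n * x + g) - (x + k)) by ring.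
generalize (n * x + g) (x + k) (n * b). intros u v w.
rewrite !cosh_plus, !sinh_plus, !sinh_opp, !cosh_opp, cos_plus, sin_plus, cos_minus, sin_minus.
field.
Qed.

(** The bound does not depend on [x], so it survives the passage of [x] through the critical value
    0. *)
Lemma coth_re_le q b x : 0 < q -> 0 < b -> Rabs (coth_re q b x) <= cosh (q * b) / sinh (q * b).
Proof.
intros Hq Hb. assert (Hs := sinh_pos (q * b) ltac:(now apply Rmult_lt_0_compat)).
assert (HD := coth_den_pos_b q b x Hq Hb). assert (HC := cosh_ge_1 (q * b)).
unfold coth_re. replace (2 * q * b) with (q * b + q * b) by ring. rewrite sinh_plus.
rewrite Rabs_pos_eq.
- apply Rmult_le_reg_r with (coth_den q b x); auto.
  unfold Rdiv at 1. rewrite Rmult_assoc, Rinv_l, Rmult_1_r by lra.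
  rewrite coth_den_eq. generalize (Rle_0_sqr (sin (q * x))). unfold Rsqr. intros H.
  replace (cosh (q * b) / sinh (q * b) * (2 * (sinh (q * b) * sinh (q * b)) + 2 * (sin (q * x) * sin (q * x))))
   with (2 * cosh (q * b) * sinh (q * b) + cosh (q * b) / sinh (q * b) * 2 * (sin (q * x) * sin (q * x)))
   by (field; lra).
  assert (0 <= cosh (q * b) / sinh (q * b) * 2 * (sin (q * x) * sin (q * x))).
  { apply Rmult_le_pos; auto. apply Rmult_le_pos; [|lra]. apply Rdiv_le_0_compat; lra. }
  lra.
- apply Rdiv_le_0_compat; auto. nra.
Qed.

(** By |cos| <= 1 and 2 |sinh (q b) sin (q x)| <= sinh^2 (q b) + sin^2 (q x); again uniform in [x],
    with a simple pole at [b = 0]. *)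
Lemma coth_im_le q b x : 0 < q -> 0 < b -> Rabs (coth_im q b x) <= / (2 * sinh (q * b)).
Proof.
intros Hq Hb. assert (Hs := sinh_pos (q * b) ltac:(now apply Rmult_lt_0_compat)).
assert (HD := coth_den_pos_b q b x Hq Hb).
unfold coth_im. replace (2 * q * x) with (2 * (q * x)) by ring. rewrite sin_2a.
unfold Rdiv; rewrite Rabs_mult, Rabs_Ropp, Rabs_inv, (Rabs_pos_eq (coth_den _ _ _)) by lra.
apply Rmult_le_reg_r with (coth_den q b x); auto.
rewrite Rmult_assoc, Rinv_l, Rmult_1_r by lra.
apply Rmult_le_reg_l with (2 * sinh (q * b)); [lra|].
rewrite <- Rmult_assoc, Rinv_r, Rmult_1_l by lra.
rewrite coth_den_eq, !Rabs_mult, (Rabs_pos_eq 2) by lra.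
assert (Rabs (cos (q * x)) <= 1) by (apply Rabs_le; apply COS_bound).
replace (sin (q * x) * sin (q * x)) with (Rabs (sin (q * x)) * Rabs (sin (q * x)))
  by (rewrite <- Rabs_mult; apply Rabs_pos_eq; apply Rle_0_sqr).
set (s := sinh (q * b)) in *. set (u := Rabs (sin (q * x))).
set (c := Rabs (cos (q * x))) in *.
assert (0 <= u) by apply Rabs_pos. assert (0 <= c) by apply Rabs_pos.
assert (0 <= (s - u) * (s - u)) by apply Rle_0_sqr.
assert (u * c <= u) by nra. assert (s * (u * c) <= s * u) by (apply Rmult_le_compat_l; lra).
lra.
Qed.

Definition causal (F : R -> R) : Prop := forall s, s <= 0 -> F s = 0.

(** The continuous extension of sinh (k b) / b. Quotients of two such functions express the kernel
    on the critical ray, which is of the form 0 / 0 at [b = 0]. *)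
Definition sinhc (k b : R) : R := if Req_EM_T b 0 then k else sinh (k * b) / b.

Lemma continuous_sinhc k b : continuous (sinhc k) b.
Proof.
destruct (Req_dec b 0) as [->|Hb].
- apply continuous_of_lt. intros e He.
  destruct (is_derive_sinh_lin k 0) as [_ H].
  specialize (H 0 (fun P HP => HP) (pos_div_2 (mkposreal e He))).
  revert H. apply filter_imp. intros h Hh. change R in (type of h).
  unfold norm, minus, plus, opp, scal in Hh; simpl in Hh. unfold abs, mult, minus, plus, opp in Hh; simpl in Hh.
  unfold sinhc. destruct (Req_EM_T 0 0) as [_|]; [|lra].
  destruct (Req_EM_T h 0) as [->|Hh0].
  { rewrite Rminus_diag, Rabs_R0; lra. }
  rewrite Rmult_0_r, sinh_0, cosh_0 in Hh.
  replace (sinh (k * h) / h - k) with ((sinh (k * h) - h * k) / h) by (field; auto).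
  unfold Rdiv; rewrite Rabs_mult, Rabs_inv.
  assert (0 < Rabs h) by now apply Rabs_pos_lt.
  apply Rmult_lt_reg_r with (Rabs h); auto.
  rewrite Rmult_assoc, Rinv_l, Rmult_1_r by lra.
  replace (sinh (k * h) + - 0 + - ((h + - 0) * (k * 1))) with (sinh (k * h) - h * k) in Hh by ring.
  replace (h + - 0) with h in Hh by ring.
  apply Rle_lt_trans with (1 := Hh). nra.
- apply continuous_ext_loc with (fun b => sinh (k * b) / b).
  + generalize (locally_continuous_neq (fun b => b) b 0 (continuous_id b) Hb).
    apply filter_imp. intros y Hy. unfold sinhc. now destruct (Req_EM_T y 0).
  + cont.
Qed.

Lemma sinhc_pos k b : 0 < k -> 0 <= b -> 0 < sinhc k b.
Proof.
intros Hk Hb. unfold sinhc. destruct (Req_EM_T b 0); auto.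
apply Rdiv_lt_0_compat; [|lra]. apply sinh_pos. apply Rmult_lt_0_compat; lra.
Qed.

(** * The angular integral and the diffracted integral *)

Section Diffraction.
Variable q : R.
Hypothesis Hq : 0 < q.

(** On the ray [coth_im] vanishes, and the zero of sinh (n b) at [b = 0] cancels the pole of coth (q
    b). *)
Lemma ker_im_critical n g b : 0 < b ->
  ker_im q n g b 0 = cosh (q * b) * (sinhc n b / sinhc q b) * sin g.
Proof.
intros Hb. unfold ker_im, coth_re, coth_im, mul_im, mul_re, sinhc.
rewrite coth_den_eq, !Rmult_0_r, sin_0.
replace (2 * q * b) with (q * b + q * b) by ring. rewrite sinh_plus, Rplus_0_l.
destruct (Req_EM_T b 0); [lra|].
assert (Hs := sinh_pos (q * b) ltac:(now apply Rmult_lt_0_compat)). field. split; lra.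
Qed.

Lemma ex_RInt_ker n g x (F : R -> R) b : - PI < q * x < PI -> 0 <= b ->
  (forall s, continuous F s) -> ex_RInt (fun s => ker_im q n g s x * F s) 0 b.
Proof.
intros Hx Hb HF. destruct (Req_dec x 0) as [->|Hx0].
(* At [s = 0] the kernel on the ray is a quotient by zero; the integral only sees the open interval,
   on which the kernel agrees with a continuous function. *)
- apply ex_RInt_ext with (fun s => cosh (q * s) * (sinhc n s / sinhc q s) * sin g * F s).
  { intros s. rewrite Rmin_left by lra. intros Hs. rewrite ker_im_critical; auto; lra. }
  apply (ex_RInt_continuous (V := R_CompleteNormedModule)). intros s.
  rewrite Rmin_left, Rmax_right by lra. intros Hs.
  apply cont_mult; [|apply HF]. cont.
  + apply continuous_sinhc.
  + apply continuous_sinhc.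
  + generalize (sinhc_pos q s Hq ltac:(lra)); lra.
- apply (ex_RInt_continuous (V := R_CompleteNormedModule)). intros s _.
  apply cont_mult; [|apply HF].
  apply (cont_ker_im q n g (fun s => s) (fun _ => x)); cont.
  generalize (coth_den_pos_x q s x Hq Hx Hx0); lra.
Qed.

(* J is the angular integral of -q coth_im over [0,b]: see [RInt_coth_im]. *)
Definition angular (b x : R) : R :=
  if Req_EM_T x 0 then 0 else atan (sinh (q * b) * cos (q * x) / (cosh (q * b) * sin (q * x))).

Lemma is_derive_angular b x : - PI < q * x < PI -> x <> 0 ->
  is_derive (fun b => angular b x) b (- q * coth_im q b x).
Proof.
intros Hx Hx0. unfold angular. destruct (Req_EM_T x 0); [contradiction|].
assert (Hs : sin (q * x) <> 0).
{ apply sin_neq_0_pi; auto. apply Rmult_integral_contrapositive_currified; lra. }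
assert (HC := cosh_ge_1 (q * b)).
assert (HD := coth_den_pos_x q b x Hq Hx Hx0).
evar_last.
{ apply (is_derive_comp atan (fun b => sinh (q * b) * cos (q * x) / (cosh (q * b) * sin (q * x)))).
  - apply is_derive_Reals. apply derivable_pt_lim_atan.
  - apply is_derive_div.
    + apply (is_derive_scal_l (fun b => sinh (q * b)) b (q * cosh (q * b)) (cos (q * x))).
      apply is_derive_sinh_lin.
    + apply (is_derive_scal_l (fun b => cosh (q * b)) b (q * sinh (q * b)) (sin (q * x))).
      apply is_derive_cosh_lin.
    + apply Rmult_integral_contrapositive_currified; lra. }
unfold scal; simpl; unfold mult; simpl. unfold coth_im. rewrite coth_den_eq in *.
replace (2 * q * x) with (2 * (q * x)) by ring. rewrite sin_2a.
set (S := sinh (q * b)) in *. set (Ch := cosh (q * b)) in *.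
set (s := sin (q * x)) in *. set (c := cos (q * x)) in *.
assert (E1 : Ch * Ch = 1 + S * S) by apply cosh2_sinh2.
assert (E2 : c * c = 1 - s * s).
{ generalize (sin2_cos2 (q * x)). unfold Rsqr. fold s c. lra. }
(* This turns the denominator 1 + u^2 of the derivative of the arctangent into half of [coth_den],
   up to the square of cosh (q b) sin (q x). *)
assert (E3 : 1 + (S * c / (Ch * s))² = (S * S + s * s) / (Ch * Ch * (s * s))).
{ unfold Rsqr. apply Rmult_eq_reg_r with (Ch * Ch * (s * s)).
  2: { generalize (sq_pos s Hs). nra. }
  transitivity (Ch * Ch * (s * s) + S * S * (c * c)); [field; split; lra|].
  rewrite E1, E2. field. split; [exact Hs|]. generalize (Rle_0_sqr S). unfold Rsqr. lra. }
replace (1 + S * c / (Ch * s) * (S * c / (Ch * s) * 1)) with (1 + (S * c / (Ch * s))²)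
  by (unfold Rsqr; ring).
rewrite E3. replace (q * Ch * c * (Ch * s) - S * c * (q * S * s)) with (q * c * s * (Ch * Ch - S * S)) by ring.
replace (q * c * s * (Ch * Ch - S * S)) with (q * c * s) by (rewrite E1; ring).
field. repeat split; lra.
Qed.

Lemma RInt_coth_im b x : - PI < q * x < PI -> 0 <= b ->
  is_RInt (fun s => coth_im q s x) 0 b (- / q * angular b x).
Proof.
intros Hx Hb. destruct (Req_dec x 0) as [->|Hx0].
- apply (is_RInt_ext (V := R_NormedModule) (fun _ => 0)).
  { intros s _. change (0 = coth_im q s 0). unfold coth_im. rewrite Rmult_0_r, sin_0. unfold Rdiv; ring. }
  evar_last. apply @is_RInt_const. unfold angular, scal; simpl; unfold mult; simpl.
  destruct (Req_EM_T 0 0); [ring|lra].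
- evar_last.
  + apply (is_RInt_derive (fun s => - / q * angular s x) (fun s => coth_im q s x)).
    * intros s _. evar_last. apply is_derive_scal. now apply is_derive_angular. simpl; field; lra.
    * intros s _. apply (cont_coth_im q (fun s => s) (fun _ => x)); cont.
      generalize (coth_den_pos_x q s x Hq Hx Hx0); lra.
  + unfold minus, plus, opp; simpl. replace (angular 0 x) with 0; [ring|].
    unfold angular. destruct (Req_EM_T x 0); auto. rewrite Rmult_0_r, sinh_0.
    unfold Rdiv. rewrite !Rmult_0_l, atan_0. ring.
Qed.

(** The value 1/2 at 0, the mean of the one-sided limits, is what makes [edge_wave] continuous on
    the critical ray itself. *)
Definition step (x : R) : R :=
  if Rlt_dec x 0 then 1 else if Req_EM_T x 0 then / 2 else 0.

(** By arctan u + arctan (1 / u) = PI / 2 for u > 0: the jump of [angular] at [x = 0], from - PI / 2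
    to PI / 2, cancels that of [step], and the right side is visibly continuous in [x]. *)
Lemma step_angular b x : 0 < b -> - PI < 2 * q * x < PI ->
  step x + angular b x / PI
  = / 2 - atan (cosh (q * b) * sin (q * x) / (sinh (q * b) * cos (q * x))) / PI.
Proof.
intros Hb Hx. assert (HP := PI_RGT_0).
assert (Hs := sinh_pos (q * b) ltac:(now apply Rmult_lt_0_compat)). assert (HC := cosh_ge_1 (q * b)).
assert (Hc : 0 < cos (q * x)) by (apply cos_gt_0; lra).
assert (INV : forall x, 0 < x -> - PI < 2 * q * x < PI -> 0 < cos (q * x) ->
  angular b x = PI / 2 - atan (cosh (q * b) * sin (q * x) / (sinh (q * b) * cos (q * x)))).
{ clear x Hx Hc. intros x H0 Hx Hc. unfold angular. destruct (Req_EM_T x 0); [lra|].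
  assert (0 < q * x) by now apply Rmult_lt_0_compat.
  assert (0 < sin (q * x)) by (apply sin_gt_0; lra).
  rewrite <- atan_inv.
  - f_equal. field. repeat split; lra.
  - apply Rdiv_lt_0_compat; apply Rmult_lt_0_compat; lra. }
unfold step. destruct (Rlt_dec x 0).
- assert (A := INV (- x) ltac:(lra)). replace (q * - x) with (- (q * x)) in A by ring.
  rewrite sin_neg, cos_neg in A. specialize (A ltac:(lra) Hc).
  replace (angular b x) with (- angular b (- x)).
  + rewrite A. replace (cosh (q * b) * - sin (q * x) / (sinh (q * b) * cos (q * x))) with
     (- (cosh (q * b) * sin (q * x) / (sinh (q * b) * cos (q * x)))) by (field; lra).
    rewrite atan_opp. field; lra.
  + unfold angular. destruct (Req_EM_T x 0); [lra|]. destruct (Req_EM_T (- x) 0); [lra|].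
    replace (q * - x) with (- (q * x)) by ring. rewrite sin_neg, cos_neg, <- atan_opp. f_equal.
    assert (0 < q * - x) by (apply Rmult_lt_0_compat; lra).
    assert (0 < sin (- (q * x))) by (apply sin_gt_0; lra). rewrite sin_neg in H0.
    field. split; lra.
- destruct (Req_EM_T x 0) as [->|].
  + unfold angular. destruct (Req_EM_T 0 0); [|lra].
    rewrite Rmult_0_r, sin_0, Rmult_0_r. unfold Rdiv. rewrite !Rmult_0_l, atan_0. ring.
  + rewrite (INV x); try lra. field; lra.
Qed.

Lemma angular_bound b x : Rabs (angular b x) <= PI / 2.
Proof.
generalize PI_RGT_0; intros. unfold angular. destruct (Req_EM_T x 0).
- rewrite Rabs_R0; lra.
- apply Rabs_le. generalize (atan_bound (sinh (q * b) * cos (q * x) / (cosh (q * b) * sin (q * x)))). lra.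
Qed.

(** The improper integral over b > 0, cut off at a point past which the integrand vanishes for
    causal [F], because cosh b >= b. The absolute value keeps the upper limit non-negative at all
    times. *)
Definition diffracted (n g : R) (F : R -> R) (rho x t : R) : R :=
  RInt (fun b => ker_im q n g b x * F (t - rho * cosh b)) 0 (Rabs t / rho).

(* For n = g = 0 this is the diffracted wave of one image source at angle 0
   together with the plane wave it cuts off. *)
Definition edge_wave (n g : R) (F : R -> R) (rho x t : R) : R :=
  step x * cos g * F (t - rho * cos x) - q / PI * diffracted n g F rho x t.

Lemma causal_beyond F rho t b : causal F -> 0 < rho -> Rabs t / rho <= b -> F (t - rho * cosh b) = 0.
Proof.
intros HF Hr Hb. apply HF.
assert (0 <= b). { apply Rle_trans with (2 := Hb). apply Rdiv_le_0_compat; auto. apply Rabs_pos. }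
assert (Rabs t <= rho * b).
{ apply Rmult_le_reg_r with (/ rho). now apply Rinv_0_lt_compat.
  replace (rho * b * / rho) with b by (field; lra). exact Hb. }
generalize (cosh_ge b H) (Rle_abs t). nra.
Qed.

Section Causal.
Variables (F : R -> R).
Hypothesis CF : causal F.
Hypothesis F0 : forall s, continuous F s.

Lemma ex_RInt_diffracted n g rho x t b : - PI < q * x < PI -> 0 <= b ->
  ex_RInt (fun b => ker_im q n g b x * F (t - rho * cosh b)) 0 b.
Proof.
intros Hx Hb. apply (ex_RInt_ker n g x (fun b => F (t - rho * cosh b))); auto.
intros s. apply (cont_comp F); [cont|apply F0].
Qed.

Lemma diffracted_eq n g rho x t b : - PI < q * x < PI -> 0 < rho -> Rabs t / rho <= b ->
  diffracted n g F rho x t = RInt (fun b => ker_im q n g b x * F (t - rho * cosh b)) 0 b.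
Proof.
intros Hx Hr Hb. unfold diffracted.
assert (H0 : 0 <= Rabs t / rho) by (apply Rdiv_le_0_compat; auto; apply Rabs_pos).
rewrite <- (RInt_Chasles (V := R_CompleteNormedModule) _ 0 (Rabs t / rho) b).
- replace (RInt (fun b => ker_im q n g b x * F (t - rho * cosh b)) (Rabs t / rho) b) with 0.
  + symmetry. apply Rplus_0_r.
  + symmetry. rewrite (RInt_ext _ (fun _ => 0)).
    * rewrite RInt_const. apply Rmult_0_r.
    * intros s Hs. rewrite Rmin_left, Rmax_right in Hs by lra.
      rewrite (causal_beyond F); auto; lra.
- now apply ex_RInt_diffracted.
- apply (ex_RInt_sub _ 0 b); try lra. apply ex_RInt_diffracted; auto; lra.
Qed.

(** The cut-off of [diffracted] moves with the point. Any larger limit gives the same integral, so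
    one fixed limit works in a whole neighbourhood, and the results on parametric integrals with
    constant bounds apply. *)
Lemma locally_diffracted_eq {E : UniformSpace} n g (r x t : E -> R) p :
  continuous r p -> continuous x p -> continuous t p -> 0 < r p -> - PI < q * x p < PI ->
  exists b, 0 < b /\ forall b', b <= b' -> locally p (fun p =>
    diffracted n g F (r p) (x p) (t p)
    = RInt (fun b => ker_im q n g b (x p) * F (t p - r p * cosh b)) 0 b').
Proof.
intros Hr Hx Ht Hr0 Hx0. exists (Rabs (t p) / r p + 1).
assert (H0 : 0 <= Rabs (t p) / r p) by (apply Rdiv_le_0_compat; auto; apply Rabs_pos).
split; [lra|]. intros b' Hb'.
assert (C1 : continuous (fun p => Rabs (t p) / r p) p).
{ cont; [|lra]. apply (cont_comp Rabs); auto. apply continuous_Rabs. }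
assert (C2 : continuous (fun p => q * x p) p) by cont.
assert (C3 : Rabs (t p) / r p < b') by lra.
generalize (filter_and _ _ (locally_continuous_lt _ _ b' C1 C3)
  (filter_and _ _ (locally_continuous_gt _ _ 0 Hr Hr0)
  (filter_and _ _ (locally_continuous_gt _ _ (-PI) C2 (proj1 Hx0))
                  (locally_continuous_lt _ _ PI C2 (proj2 Hx0))))).
apply filter_imp. intros y [H1 [H2 [H3 H4]]]. apply diffracted_eq; auto; lra.
Qed.

Lemma cont_ker_wave {E : UniformSpace} n g (r x t : E -> R) p s :
  continuous r p -> continuous x p -> continuous t p -> coth_den q s (x p) <> 0 ->
  continuous (fun z : E * R => ker_im q n g (snd z) (x (fst z)) * F (t (fst z) - r (fst z) * cosh (snd z))) (p, s).
Proof.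
intros Hr Hx Ht HD.
assert (L : forall h : E -> R, continuous h p -> continuous (fun z : E * R => h (fst z)) (p, s)).
{ intros h Hh. apply (continuous_comp fst h); auto. apply continuous_fst. }
apply cont_mult.
- apply (cont_ker_im q n g (fun z : E * R => snd z) (fun z : E * R => x (fst z))); [cont|now apply L|exact HD].
- apply (cont_comp F); [|apply F0]. apply cont_minus; [now apply L|]. apply cont_mult; [now apply L|]. cont.
Qed.

Lemma continuous_diffracted_off {E : UniformSpace} n g (r x t : E -> R) p :
  continuous r p -> continuous x p -> continuous t p -> 0 < r p -> - PI < q * x p < PI -> x p <> 0 ->
  continuous (fun p => diffracted n g F (r p) (x p) (t p)) p.
Proof.
intros Hr Hx Ht Hr0 Hx0 Hxp.
destruct (locally_diffracted_eq n g r x t p Hr Hx Ht Hr0 Hx0) as [b [Hb HL]].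
apply continuous_ext_loc with (fun p => RInt (fun b => ker_im q n g b (x p) * F (t p - r p * cosh b)) 0 b).
{ generalize (HL b (Rle_refl b)). apply filter_imp; intros; congruence. }
apply continuous_RInt_param; auto.
- intros s Hs. apply (cont_ker_wave n g r x t); auto.
  generalize (coth_den_pos_x q s (x p) Hq Hx0 Hxp); lra.
- assert (C2 : continuous (fun p => q * x p) p) by cont.
  generalize (filter_and _ _ (locally_continuous_gt _ _ (-PI) C2 (proj1 Hx0))
                  (locally_continuous_lt _ _ PI C2 (proj2 Hx0))).
  apply filter_imp. intros y Hy. apply ex_RInt_diffracted; auto; lra.
Qed.

Lemma continuous_step x : x <> 0 -> continuous step x.
Proof.
intros Hx. destruct (Rlt_or_le x 0).
- apply continuous_ext_loc with (fun _ => 1); [|apply cont_const].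
  generalize (locally_continuous_lt (fun x => x) x 0 (continuous_id x) H).
  apply filter_imp. intros y Hy. unfold step. destruct (Rlt_dec y 0); lra.
- apply continuous_ext_loc with (fun _ => 0); [|apply cont_const].
  generalize (locally_continuous_gt (fun x => x) x 0 (continuous_id x) ltac:(lra)).
  apply filter_imp. intros y Hy. unfold step. destruct (Rlt_dec y 0); [lra|].
  destruct (Req_EM_T y 0); lra.
Qed.
End Causal.
End Diffraction.

Lemma ball_R_sym (a e y : R) : ball a e y <-> Rabs (y - a) < e.
Proof. split; intros H; exact H. Qed.

(** * Continuity of edge waves across the critical ray *)

Section EdgeWave.
Variable q : R.
Hypothesis Hq : 0 < q.
Variables (F F' : R -> R).
Hypothesis CF : causal F.
Hypothesis CF' : causal F'.
Hypothesis DF : forall s, is_derive F s (F' s).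
Hypothesis F'0 : forall s, continuous F' s.

Lemma continuous_of_derive s : continuous F s.
Proof. apply (ex_derive_continuous (V := R_NormedModule)). eexists; apply DF. Qed.

(** Subtracting the value at [b = 0] leaves a factor [b] to compensate the simple pole of [coth_im],
    with one constant for a whole neighbourhood of [p]. *)
Lemma local_lipschitz {E : UniformSpace} n (r t : E -> R) p B :
  continuous r p -> continuous t p -> 0 < B ->
  exists L, 0 <= L /\ locally p (fun p => forall b, 0 <= b <= B ->
    Rabs (cosh (n * b) * F (t p - r p * cosh b) - F (t p - r p)) <= L * b).
Proof.
intros Hr Ht HB. assert (F0 := continuous_of_derive).
set (d := fun p b => n * sinh (n * b) * F (t p - r p * cosh b)
                     - cosh (n * b) * (F' (t p - r p * cosh b) * (r p * sinh b))).
assert (LF : forall h : E -> R, continuous h p -> forall s, continuous (fun z : E * R => h (fst z)) (p, s)).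
{ intros h Hh s. apply (continuous_comp fst h); auto. apply continuous_fst. }
assert (Cd : forall s, continuous (fun z : E * R => d (fst z) (snd z)) (p, s)).
{ intros s. assert (A := LF _ Hr s). assert (A' := LF _ Ht s).
  assert (Ct : continuous (fun z : E * R => t (fst z) - r (fst z) * cosh (snd z)) (p, s)).
  { cont. }
  assert (CF1 := cont_comp F _ _ Ct (F0 _)). assert (CF2 := cont_comp F' _ _ Ct (F'0 _)).
  simpl in CF1, CF2. unfold d. cont. }
assert (BM : exists M, forall s, 0 <= s <= B -> Rabs (d p s) <= M).
{ destruct (continuity_ab_maj (fun s => Rabs (d p s)) 0 B ltac:(lra)) as [m Hm].
  - intros s Hs. apply continuity_pt_cont. apply (cont_comp Rabs); [|apply continuous_Rabs].
    apply (continuous_comp (fun s : R => (p, s)) (fun z : E * R => d (fst z) (snd z))); [|apply Cd].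
    apply cont_pair; [apply continuous_const|apply continuous_id].
  - exists (Rabs (d p m)). exact (proj1 Hm). }
destruct BM as [M HM].
assert (HM0 : 0 <= M) by (apply Rle_trans with (2 := HM 0 ltac:(lra)); apply Rabs_pos).
exists (M + 1). split; [lra|].
assert (T : locally p (fun p => forall s, 0 <= s <= B -> Rabs (d p s) <= M + 1)).
{ apply (tube p (fun p s => Rabs (d p s) <= M + 1)). intros s Hs.
  generalize (continuous_locally_lt _ _ 1 (Cd s) Rlt_0_1). apply filter_imp.
  intros z Hz. simpl in Hz. specialize (HM s Hs).
  generalize (Rabs_triang (d (fst z) (snd z) - d p s) (d p s)).
  replace (d (fst z) (snd z) - d p s + d p s) with (d (fst z) (snd z)) by ring.
  intros. apply Rle_trans with (1 := H). rewrite (Rplus_comm M).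
  apply Rplus_le_compat; [left; exact Hz|exact HM]. }
generalize T. apply filter_imp. intros y Hy b Hb.
assert (Dv : forall s, is_derive (fun b => cosh (n * b) * F (t y - r y * cosh b)) s (d y s)).
{ intros s. evar_last. apply Derive.is_derive_mult. apply is_derive_cosh_lin.
  apply (is_derive_comp F (fun b => t y - r y * cosh b)). apply DF.
  apply @is_derive_minus. apply @is_derive_const.
  apply is_derive_scal. apply is_derive_cosh.
  unfold d, scal, minus, plus, opp, zero; simpl; unfold mult; simpl. ring. }
destruct (MVT_gen (fun b => cosh (n * b) * F (t y - r y * cosh b)) 0 b (d y)) as [c [Hc He]].
- intros; apply Dv.
- intros; apply continuity_pt_cont; apply (ex_derive_continuous (V := R_NormedModule)); eexists; apply Dv.
- rewrite Rmult_0_r, cosh_0, Rmult_1_l, Rmult_1_r in He. rewrite He, Rminus_0_r, Rabs_mult.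
  rewrite (Rabs_pos_eq b) by lra. apply Rmult_le_compat_r; [lra|]. apply Hy.
  rewrite Rmin_left, Rmax_right in Hc by lra. lra.
Qed.

(** Here [h] may be discontinuous; it will be [angular], which jumps on the ray, next to a
    coefficient [f] that vanishes there. *)
Lemma continuous_0_mult {E : UniformSpace} (f h : E -> R) p M :
  continuous f p -> f p = 0 -> (forall y, Rabs (h y) <= M) -> continuous (fun y => f y * h y) p.
Proof.
intros Hf Hf0 HM. apply continuous_of_lt. intros e He. rewrite Hf0, Rmult_0_l.
assert (0 <= M) by (apply Rle_trans with (2 := HM p); apply Rabs_pos).
assert (0 < e / (M + 1)) by (apply Rdiv_lt_0_compat; lra).
generalize (continuous_locally_lt _ _ _ Hf H0). apply filter_imp. intros y Hy.
rewrite Hf0, Rminus_0_r in Hy. rewrite Rminus_0_r, Rabs_mult.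
apply Rle_lt_trans with (Rabs (f y) * (M + 1)).
- apply Rmult_le_compat_l; [apply Rabs_pos|]. generalize (HM y); lra.
- apply Rlt_le_trans with (e / (M + 1) * (M + 1)).
  + apply Rmult_lt_compat_r; lra.
  + right; field; lra.
Qed.

(** Off the ray all ingredients are continuous. On the ray the singular part of the integrand, with
    [F] frozen at its value for [b = 0], is split off and integrated exactly through [angular]; the
    remainder [G] is bounded uniformly near [p], so that [continuous_RInt_bounded] applies. *)
Lemma continuous_edge_wave {E : UniformSpace} n g (r x t : E -> R) p :
  continuous r p -> continuous x p -> continuous t p -> 0 < r p -> - PI < q * x p < PI ->
  continuous (fun p => edge_wave q n g F (r p) (x p) (t p)) p.
Proof.
intros Hr Hx Ht Hr0 Hx0. assert (F0 := continuous_of_derive). unfold edge_wave.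
assert (CP : continuous (fun p => F (t p - r p * cos (x p))) p).
{ apply (cont_comp F); [cont|apply F0]. }
destruct (Req_dec (x p) 0) as [Hxp|Hxp].
2:{ generalize (continuous_diffracted_off q Hq F CF F0 n g r x t p Hr Hx Ht Hr0 Hx0 Hxp); intros CD.
    cont. apply (cont_comp step); auto. now apply continuous_step. }
destruct (locally_diffracted_eq q Hq F CF F0 n g r x t p Hr Hx Ht Hr0 Hx0) as [b [Hb HL]].
specialize (HL b (Rle_refl b)).
set (G := fun p s => ker_im q n g s (x p) * F (t p - r p * cosh s)
                     - coth_im q s (x p) * cos (n * x p + g) * F (t p - r p)).
assert (HPI := PI_RGT_0).
assert (DOM : locally p (fun y => - PI < 2 * q * x y < PI)).
{ assert (C2 : continuous (fun p => 2 * q * x p) p) by cont.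
  assert (D1 : - PI < 2 * q * x p) by (rewrite Hxp; lra).
  assert (D2 : 2 * q * x p < PI) by (rewrite Hxp; lra).
  generalize (filter_and _ _ (locally_continuous_gt _ _ (-PI) C2 D1)
                  (locally_continuous_lt _ _ PI C2 D2)).
  apply filter_imp. auto. }
assert (EXG : forall y, - PI < 2 * q * x y < PI -> ex_RInt (G y) 0 b).
{ intros y Hy. apply (ex_RInt_minus (V := R_NormedModule)
    (fun s => ker_im q n g s (x y) * F (t y - r y * cosh s))
    (fun s => coth_im q s (x y) * cos (n * x y + g) * F (t y - r y))).
  - apply ex_RInt_diffracted; auto; lra.
  - eexists. apply (is_RInt_mult_r (fun s => coth_im q s (x y) * cos (n * x y + g)) 0 b
      (- / q * angular q b (x y) * cos (n * x y + g)) (F (t y - r y))).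
    apply (is_RInt_mult_r (fun s => coth_im q s (x y)) 0 b (- / q * angular q b (x y)) (cos (n * x y + g))).
    apply RInt_coth_im; auto; lra. }
assert (CG : continuous (fun y => RInt (G y) 0 b) p).
{ destruct (local_lipschitz n r t p b Hr Ht Hb) as [L [HL0 HLip]].
  assert (BF : exists M, 0 <= M /\ locally p (fun y => forall s, 0 <= s <= b -> Rabs (F (t y - r y * cosh s)) <= M)).
  { destruct (local_lipschitz 0 r t p b Hr Ht Hb) as [L' [HL0' HLip']].
    exists (L' * b + (Rabs (F (t p - r p)) + 1)). split.
    { generalize (Rabs_pos (F (t p - r p))). assert (0 <= L' * b) by (apply Rmult_le_pos; lra). lra. }
    assert (C1 : continuous (fun y => F (t y - r y)) p) by (apply (cont_comp F); [cont|apply F0]).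
    generalize (filter_and _ _ HLip' (continuous_locally_lt _ _ 1 C1 Rlt_0_1)). apply filter_imp.
    intros y [H1 H2] s Hs. specialize (H1 s Hs). rewrite Rmult_0_l, cosh_0, Rmult_1_l in H1.
    assert (L' * s <= L' * b) by (apply Rmult_le_compat_l; lra).
    generalize (Rabs_triang (F (t y - r y * cosh s) - F (t y - r y)) (F (t y - r y))).
    generalize (Rabs_triang (F (t y - r y) - F (t p - r p)) (F (t p - r p))).
    replace (F (t y - r y * cosh s) - F (t y - r y) + F (t y - r y)) with (F (t y - r y * cosh s)) by ring.
    replace (F (t y - r y) - F (t p - r p) + F (t p - r p)) with (F (t y - r y)) by ring.
    lra. }
  destruct BF as [M [HM0 HM]].
  (* The first summand bounds coth_re sinh (n s), the second the Lipschitz difference multiplied by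
     [coth_im]. In both a factor [s] cancels the pole 1 / s. *)
  apply (continuous_RInt_bounded G p 0 b (cosh (q * b) * Rabs n * cosh (n * b) / q * M + / (2 * q) * L)).
  - exact Hb.
  - intros s Hs. assert (HD := coth_den_pos_b q s (x p) Hq (proj1 Hs)).
    assert (LF : forall h : E -> R, continuous h p -> continuous (fun z : E * R => h (fst z)) (p, s)).
    { intros h Hh. apply (continuous_comp fst h); auto. apply continuous_fst. }
    apply cont_minus; [|apply cont_mult; [apply cont_mult|]].
    + apply cont_ker_wave; auto. lra.
    + apply (cont_coth_im q (fun z : E * R => snd z) (fun z : E * R => x (fst z))); [cont|now apply LF|simpl; lra].
    + assert (A := LF _ Hx). cont.
    + apply (LF (fun p => F (t p - r p))). apply (cont_comp F); [cont|apply F0].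
  - generalize (filter_and _ _ HLip HM). apply filter_imp. intros y [H1 H2] s Hs.
    assert (A1 := coth_re_le q s (x y) Hq (proj1 Hs)).
    assert (A2 := coth_im_le q s (x y) Hq (proj1 Hs)).
    specialize (H1 s ltac:(lra)). specialize (H2 s ltac:(lra)).
    assert (Hqs : 0 < q * s) by now apply Rmult_lt_0_compat.
    assert (A3 := sinh_ge (q * s) ltac:(lra)).
    replace (G y s) with
     (coth_re q s (x y) * sinh (n * s) * sin (n * x y + g) * F (t y - r y * cosh s)
      + coth_im q s (x y) * (cosh (n * s) * F (t y - r y * cosh s) - F (t y - r y)) * cos (n * x y + g))
     by (unfold G, ker_im, mul_re, mul_im; ring).
    apply Rle_trans with (1 := Rabs_triang _ _).
    assert (S1 : Rabs (sin (n * x y + g)) <= 1) by (apply Rabs_le; apply SIN_bound).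
    assert (S2 : Rabs (cos (n * x y + g)) <= 1) by (apply Rabs_le; apply COS_bound).
    apply Rplus_le_compat.
    + rewrite !Rabs_mult.
      apply Rmult_le_compat; auto; try apply Rabs_pos.
      { repeat apply Rmult_le_pos; apply Rabs_pos. }
      rewrite <- (Rmult_1_r (_ / q)). apply Rmult_le_compat; auto; try apply Rabs_pos.
      { apply Rmult_le_pos; apply Rabs_pos. }
      apply Rle_trans with (cosh (q * b) / (q * s) * (Rabs n * s * cosh (n * b))).
      * apply Rmult_le_compat; try apply Rabs_pos.
        -- apply Rle_trans with (1 := A1). unfold Rdiv. apply Rmult_le_compat.
           ++ generalize (cosh_ge_1 (q * s)); lra.
           ++ left; apply Rinv_0_lt_compat; lra.
           ++ apply cosh_incr. rewrite !Rabs_mult, (Rabs_pos_eq q), (Rabs_pos_eq s), (Rabs_pos_eq b) by lra.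
              apply Rmult_le_compat_l; lra.
           ++ apply Rinv_le_contravar; lra.
        -- apply abs_sinh_le; lra.
      * right. field. lra.
    + rewrite !Rabs_mult.
      rewrite <- (Rmult_1_r (_ * L)). apply Rmult_le_compat; auto; try apply Rabs_pos.
      { apply Rmult_le_pos; apply Rabs_pos. }
      apply Rle_trans with (/ (2 * (q * s)) * (L * s)).
      * apply Rmult_le_compat; auto; try apply Rabs_pos.
        apply Rle_trans with (1 := A2). apply Rinv_le_contravar; lra.
      * right. field. lra.
  - generalize DOM. apply filter_imp. intros; now apply EXG. }
(* Three continuous terms: the jump of [step] is absorbed by [angular]; the rest of [angular]
   carries a coefficient that vanishes on the ray; the last is the regularised integral. *)
apply continuous_ext_loc with (fun y =>
  cos g * F (t y - r y * cos (x y)) *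
    (/ 2 - atan (cosh (q * b) * sin (q * x y) / (sinh (q * b) * cos (q * x y))) / PI)
  + (cos (n * x y + g) * F (t y - r y) - cos g * F (t y - r y * cos (x y))) * (angular q b (x y) / PI)
  - q / PI * RInt (G y) 0 b).
{ generalize (filter_and _ _ DOM HL). apply filter_imp. intros y [Hy HE]. rewrite HE.
  rewrite <- (step_angular q Hq b (x y) Hb Hy).
  assert (IG : RInt (G y) 0 b = RInt (fun s => ker_im q n g s (x y) * F (t y - r y * cosh s)) 0 b
     - (- / q * angular q b (x y)) * cos (n * x y + g) * F (t y - r y)).
  { apply is_RInt_unique. apply (is_RInt_minus (V := R_NormedModule)
    (fun s => ker_im q n g s (x y) * F (t y - r y * cosh s))
    (fun s => coth_im q s (x y) * cos (n * x y + g) * F (t y - r y))).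
  - apply (RInt_correct (V := R_CompleteNormedModule)). apply ex_RInt_diffracted; auto; lra.
  - apply (is_RInt_mult_r (fun s => coth_im q s (x y) * cos (n * x y + g)) 0 b
      (- / q * angular q b (x y) * cos (n * x y + g)) (F (t y - r y))).
    apply (is_RInt_mult_r (fun s => coth_im q s (x y)) 0 b (- / q * angular q b (x y)) (cos (n * x y + g))).
    apply RInt_coth_im; auto; lra. }
  rewrite IG. eqR. field. split; lra. }
assert (C1 : continuous (fun y => F (t y - r y)) p) by (apply (cont_comp F); [cont|apply F0]).
assert (HS := sinh_pos (q * b) ltac:(now apply Rmult_lt_0_compat)).
apply cont_minus; [apply cont_plus|].
- apply cont_mult; [cont|]. apply cont_minus; [cont|].
  apply cont_div; [|cont|lra]. apply (cont_comp atan).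
  + cont. rewrite Hxp, Rmult_0_r, cos_0. lra.
  + apply (ex_derive_continuous (V := R_NormedModule)). eexists. apply is_derive_Reals. apply derivable_pt_lim_atan.
- apply continuous_0_mult with (M := / 2).
  + cont.
  + rewrite Hxp, Rmult_0_r, Rplus_0_l, cos_0, Rmult_1_r. ring.
  + intros y. unfold Rdiv. rewrite Rabs_mult, (Rabs_pos_eq (/ PI)) by (left; apply Rinv_0_lt_compat; lra).
    apply Rmult_le_reg_r with PI; auto. rewrite Rmult_assoc, Rinv_l by lra.
    generalize (angular_bound q b (x y)). lra.
- cont.
Qed.

End EdgeWave.

(** * Derivatives of edge waves off the critical ray *)

Section OffRay.
Variable q : R.
Hypothesis Hq : 0 < q.
Variables (F F' : R -> R).
Hypothesis CF : causal F.
Hypothesis CF' : causal F'.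
Hypothesis DF : forall s, is_derive F s (F' s).
Hypothesis F'0 : forall s, continuous F' s.

Variables (n g : R) (r x t r' x' t' : R -> R) (h0 : R).
Hypothesis Dr : locally h0 (fun h => is_derive r h (r' h)).
Hypothesis Dx : locally h0 (fun h => is_derive x h (x' h)).
Hypothesis Dt : locally h0 (fun h => is_derive t h (t' h)).
Hypothesis Cr' : continuous r' h0.
Hypothesis Cx' : continuous x' h0.
Hypothesis Ct' : continuous t' h0.
Hypothesis Hr0 : 0 < r h0.
Hypothesis Hx0 : - PI < q * x h0 < PI.
Hypothesis Hxp : x h0 <> 0.

(* Since [d ker_im / d x = d ker_re / d b], the x-derivative is integrated by
   parts in b; the boundary terms vanish because ker_re vanishes at b = 0. *)
Lemma is_derive_diffracted : exists b, 0 < b /\ forall b', b <= b' ->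
  is_derive (fun h => diffracted q n g F (r h) (x h) (t h)) h0
    (RInt (fun s => (r h0 * x' h0 * (sinh s * ker_re q n g s (x h0))
                    + (t' h0 - r' h0 * cosh s) * ker_im q n g s (x h0))
                    * F' (t h0 - r h0 * cosh s)) 0 b').
Proof.
assert (F0 := continuous_of_derive F F' DF).
assert (Cr : continuous r h0).
{ apply (ex_derive_continuous (V := R_NormedModule)). eexists. exact (locally_singleton _ _ Dr). }
assert (Cx : continuous x h0).
{ apply (ex_derive_continuous (V := R_NormedModule)). eexists. exact (locally_singleton _ _ Dx). }
assert (Ct : continuous t h0).
{ apply (ex_derive_continuous (V := R_NormedModule)). eexists. exact (locally_singleton _ _ Dt). }
destruct (locally_diffracted_eq q Hq F CF F0 n g r x t h0 Cr Cx Ct Hr0 Hx0) as [b [Hb HL]].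
exists (Rmax b (Rabs (t h0) / r h0)). split; [apply Rlt_le_trans with b; auto; apply Rmax_l|].
intros b' Hb'.
assert (Hbb : b <= b') by (apply Rle_trans with (2 := Hb'); apply Rmax_l).
assert (Hbt : Rabs (t h0) / r h0 <= b') by (apply Rle_trans with (2 := Hb'); apply Rmax_r).
assert (HD : forall s, coth_den q s (x h0) <> 0).
{ intros s. generalize (coth_den_pos_x q s (x h0) Hq Hx0 Hxp); lra. }
set (gg := fun h s => ker_im q n g s (x h) * F (t h - r h * cosh s)).
set (dg := fun h s => ker_re' q n g s (x h) * x' h * F (t h - r h * cosh s)
   + ker_im q n g s (x h) * ((t' h - r' h * cosh s) * F' (t h - r h * cosh s))).
assert (Cqx : continuous (fun h => q * x h) h0) by cont.
assert (GOOD : locally h0 (fun h => (is_derive r h (r' h) /\ is_derive x h (x' h) /\ is_derive t h (t' h))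
   /\ (- PI < q * x h < PI /\ x h <> 0))).
{ apply filter_and; [apply filter_and; [exact Dr|apply filter_and; [exact Dx|exact Dt]]|].
  apply filter_and; [apply filter_and|].
  - now apply (locally_continuous_gt (fun h => q * x h)).
  - now apply (locally_continuous_lt (fun h => q * x h)).
  - now apply locally_continuous_neq. }
assert (DG : forall h, (is_derive r h (r' h) /\ is_derive x h (x' h) /\ is_derive t h (t' h))
   /\ (- PI < q * x h < PI /\ x h <> 0) -> forall s, is_derive (fun h => gg h s) h (dg h s)).
{ intros h [[H1 [H2 H3]] [H4 H5]] s. unfold gg. evar_last.
  apply Derive.is_derive_mult.
  - apply (is_derive_comp (fun x => ker_im q n g s x) x).
    + apply is_derive_ker_im_x. generalize (coth_den_pos_x q s (x h) Hq H4 H5); lra.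
    + exact H2.
  - apply (is_derive_comp F (fun h => t h - r h * cosh s)). apply DF.
    apply @is_derive_minus. exact H3. exact (is_derive_scal_l r h (r' h) (cosh s) H1).
  - unfold dg, minus, plus, opp, scal; simpl; unfold mult; simpl. ring. }
assert (CD : forall s, continuous (fun z : R * R => dg (fst z) (snd z)) (h0, s)).
{ intros s.
  assert (LF : forall h : R -> R, continuous h h0 -> continuous (fun z : R * R => h (fst z)) (h0, s)).
  { intros h Hh. apply (continuous_comp fst h); auto. apply continuous_fst. }
  assert (A1 := LF _ Cr). assert (A2 := LF _ Cx). assert (A3 := LF _ Ct).
  assert (A4 := LF _ Cr'). assert (A5 := LF _ Cx'). assert (A6 := LF _ Ct').
  assert (At : continuous (fun z : R * R => t (fst z) - r (fst z) * cosh (snd z)) (h0, s)) by cont.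
  assert (B1 := cont_comp F _ _ At (F0 _)). assert (B2 := cont_comp F' _ _ At (F'0 _)).
  assert (B3 := cont_ker_im q n g (fun z : R * R => snd z) (fun z : R * R => x (fst z)) (h0, s)
    (continuous_snd h0 s) A2 (HD s)).
  assert (B4 := cont_ker_re' q n g (fun z : R * R => snd z) (fun z : R * R => x (fst z)) (h0, s)
    (continuous_snd h0 s) A2 (HD s)).
  simpl in B1, B2, B3, B4. unfold dg. cont. }
assert (P0 := locally_singleton _ _ GOOD).
assert (MAIN : is_derive (fun h => RInt (gg h) 0 b') h0 (RInt (dg h0) 0 b')).
{ evar_last.
  - apply (is_derive_RInt_param gg 0 b' h0).
    + generalize GOOD. apply filter_imp. intros h Hh s _. eexists. now apply DG.
    + intros s _. apply continuity_2d_pt_filterlim.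
      assert (EQ : forall h s, (is_derive r h (r' h) /\ is_derive x h (x' h) /\ is_derive t h (t' h))
        /\ (- PI < q * x h < PI /\ x h <> 0) -> dg h s = Derive (fun z => gg z s) h).
      { intros h s' Hh. symmetry. apply is_derive_unique. now apply DG. }
      rewrite <- (EQ h0 s P0).
      apply (filterlim_ext_loc (fun z : R * R => dg (fst z) (snd z))); [|apply CD].
      assert (GOOD2 : locally ((h0, s) : R * R) (fun z : R * R =>
         (is_derive r (fst z) (r' (fst z)) /\ is_derive x (fst z) (x' (fst z)) /\ is_derive t (fst z) (t' (fst z)))
         /\ (- PI < q * x (fst z) < PI /\ x (fst z) <> 0))).
      { exact (continuous_fst h0 s _ GOOD). }
      generalize GOOD2. apply filter_imp. intros z Hz. now apply EQ.
    + generalize GOOD. apply filter_imp. intros h Hh. apply ex_RInt_diffracted; auto; lra.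
  - apply RInt_ext. intros s _. apply is_derive_unique. now apply DG. }
apply (is_derive_ext_loc (fun h => RInt (gg h) 0 b')).
{ generalize (HL b' Hbb). apply filter_imp. intros h Hh. symmetry. exact Hh. }
evar_last. apply MAIN.
(* [dg h0] equals [dbd] plus the target integrand, and [dbd] is the derivative of [bd]. As [dbd]
   integrates to 0, the derivative of the kernel is traded for a derivative of [F]. *)
set (bd := fun s => x' h0 * (ker_re q n g s (x h0) * F (t h0 - r h0 * cosh s))).
set (dbd := fun s => x' h0 * (ker_re' q n g s (x h0) * F (t h0 - r h0 * cosh s)
   + ker_re q n g s (x h0) * (- (r h0 * sinh s) * F' (t h0 - r h0 * cosh s)))).
assert (I1 : is_RInt dbd 0 b' 0).
{ evar_last.
  - apply (is_RInt_derive bd dbd).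
    + intros s _. unfold bd, dbd. apply is_derive_scal. evar_last. apply Derive.is_derive_mult.
      * apply is_derive_ker_re_b. apply HD.
      * apply (is_derive_comp F (fun s => t h0 - r h0 * cosh s)). apply DF.
        apply @is_derive_minus. apply @is_derive_const. apply is_derive_scal. apply is_derive_cosh.
      * unfold minus, plus, opp, scal, zero; simpl; unfold mult; simpl. ring.
    + intros s _.
      assert (A : continuous (fun s => t h0 - r h0 * cosh s) s) by cont.
      assert (B1 := cont_comp F _ _ A (F0 _)). assert (B2 := cont_comp F' _ _ A (F'0 _)).
      assert (B3 := cont_ker_re q n g (fun s => s) (fun _ => x h0) s (continuous_id _) (cont_const _ _) (HD s)).
      assert (B4 := cont_ker_re' q n g (fun s => s) (fun _ => x h0) s (continuous_id _) (cont_const _ _) (HD s)).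
      simpl in *. unfold dbd. cont.
  - unfold bd, minus, plus, opp; simpl. rewrite (causal_beyond F (r h0) (t h0) b'); auto.
    replace (ker_re q n g 0 (x h0)) with 0. ring.
    unfold ker_re, coth_re, mul_im. rewrite !Rmult_0_r, sinh_0. unfold Rdiv. ring. }
assert (CT : forall s, continuous (fun s => (r h0 * x' h0 * (sinh s * ker_re q n g s (x h0))
                    + (t' h0 - r' h0 * cosh s) * ker_im q n g s (x h0))
                    * F' (t h0 - r h0 * cosh s)) s).
{ intros s. assert (A : continuous (fun s => t h0 - r h0 * cosh s) s) by cont.
  assert (B2 := cont_comp F' _ _ A (F'0 _)).
  assert (B3 := cont_ker_re q n g (fun s => s) (fun _ => x h0) s (continuous_id _) (cont_const _ _) (HD s)).
  assert (B4 := cont_ker_im q n g (fun s => s) (fun _ => x h0) s (continuous_id _) (cont_const _ _) (HD s)).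
  simpl in *. cont. }
set (tg := fun s => (r h0 * x' h0 * (sinh s * ker_re q n g s (x h0))
                    + (t' h0 - r' h0 * cosh s) * ker_im q n g s (x h0))
                    * F' (t h0 - r h0 * cosh s)) in *.
assert (I2 : is_RInt tg 0 b' (RInt tg 0 b')).
{ apply (RInt_correct (V := R_CompleteNormedModule)).
  apply (ex_RInt_continuous (V := R_CompleteNormedModule)). intros; apply CT. }
rewrite <- (Rplus_0_l (RInt tg 0 b')).
apply is_RInt_unique.
apply (is_RInt_ext (V := R_NormedModule) (fun s => dbd s + tg s)).
{ intros s _. unfold dbd, tg, dg. eqR. ring. }
exact (is_RInt_plus (V := R_NormedModule) _ _ _ _ _ _ I1 I2).
Qed.

End OffRay.

Section OffRayEdge.
Variable q : R.
Hypothesis Hq : 0 < q.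
Variables (F F' : R -> R).
Hypothesis CF : causal F.
Hypothesis CF' : causal F'.
Hypothesis DF : forall s, is_derive F s (F' s).
Hypothesis F'0 : forall s, continuous F' s.

Lemma locally_step_const (x : R -> R) h0 : continuous x h0 -> x h0 <> 0 ->
  locally h0 (fun h => step (x h) = step (x h0)).
Proof.
intros Cx Hx. destruct (Rlt_or_le (x h0) 0).
- generalize (locally_continuous_lt x h0 0 Cx H). apply filter_imp. intros y Hy.
  unfold step. destruct (Rlt_dec (x y) 0), (Rlt_dec (x h0) 0); lra.
- generalize (locally_continuous_gt x h0 0 Cx ltac:(lra)). apply filter_imp. intros y Hy.
  unfold step. destruct (Rlt_dec (x y) 0), (Rlt_dec (x h0) 0); try lra.
  destruct (Req_EM_T (x y) 0), (Req_EM_T (x h0) 0); lra.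
Qed.

(* [k] is the angle between the ray [x = 0] and the direction of motion. *)
Lemma is_derive_edge_wave_off n g k (r x : R -> R) t h0 :
  locally h0 (fun h => is_derive r h (cos (x h + k))) ->
  locally h0 (fun h => is_derive x h (- sin (x h + k) / r h)) ->
  0 < r h0 -> - PI < q * x h0 < PI -> x h0 <> 0 ->
  is_derive (fun h => edge_wave q n g F (r h) (x h) t) h0
    (- / 2 * (edge_wave q (n + 1) (g + k) F' (r h0) (x h0) t
              + edge_wave q (n - 1) (g - k) F' (r h0) (x h0) t)).
Proof.
intros Dr Dx Hr0 Hx0 Hxp.
assert (Cr : continuous r h0).
{ apply (ex_derive_continuous (V := R_NormedModule)). eexists. exact (locally_singleton _ _ Dr). }
assert (Cx : continuous x h0).
{ apply (ex_derive_continuous (V := R_NormedModule)). eexists. exact (locally_singleton _ _ Dx). }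
assert (C1 : continuous (fun h => cos (x h + k)) h0) by cont.
assert (C2 : continuous (fun h => - sin (x h + k) / r h) h0) by (cont; lra).
destruct (is_derive_diffracted q Hq F F' CF DF F'0 n g r x (fun _ => t)
  _ _ (fun _ => 0) h0 Dr Dx (filter_forall _ (fun h => is_derive_const t h)) C1 C2 (cont_const _ _) Hr0 Hx0 Hxp)
  as [b [Hb HD]].
set (b' := Rmax b (Rabs t / r h0)).
specialize (HD b' (Rmax_l _ _)).
assert (Hb' : Rabs t / r h0 <= b') by apply Rmax_r.
assert (Hb0 : 0 <= b') by (apply Rle_trans with b; [lra|apply Rmax_l]).
unfold edge_wave.
apply (is_derive_ext_loc (fun h => step (x h0) * cos g * F (t - r h * cos (x h)) - q / PI * diffracted q n g F (r h) (x h) t)).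
{ generalize (locally_step_const x h0 Cx Hxp). apply filter_imp. intros h Hh. now rewrite Hh. }
evar_last.
- apply @is_derive_minus.
  + apply is_derive_scal. apply (is_derive_comp F (fun h => t - r h * cos (x h))). apply DF.
    apply @is_derive_minus. apply @is_derive_const. apply Derive.is_derive_mult.
    exact (locally_singleton _ _ Dr).
    apply (is_derive_comp cos x). apply is_derive_cos. exact (locally_singleton _ _ Dx).
  + apply is_derive_scal. exact HD.
- rewrite (diffracted_eq q Hq F' CF' F'0 (n + 1) (g + k) (r h0) (x h0) t b'); auto.
  rewrite (diffracted_eq q Hq F' CF' F'0 (n - 1) (g - k) (r h0) (x h0) t b'); auto.
  set (I1 := RInt (fun b => ker_im q (n + 1) (g + k) b (x h0) * F' (t - r h0 * cosh b)) 0 b').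
  set (I2 := RInt (fun b => ker_im q (n - 1) (g - k) b (x h0) * F' (t - r h0 * cosh b)) 0 b').
  match goal with |- context [RInt ?f 0 b'] => replace (RInt f 0 b') with (- / 2 * (I1 + I2)) end.
  + rewrite (cos_plus g k), (cos_minus g k).
    unfold minus, plus, opp, scal, zero; simpl; unfold mult; simpl.
    replace (x h0 + k) with (x h0 + k) by ring.
    (* The plane-wave part is cos g cos k = (cos (g + k) + cos (g - k)) / 2. Expanding cos k as cos
       (w - x) turns it into a polynomial identity. *)
    set (w := x h0 + k). replace k with (w - x h0) by (unfold w; ring).
    rewrite cos_minus, sin_minus. field. split; [exact PI_neq0|lra].
  + symmetry. apply is_RInt_unique.
    apply (is_RInt_ext (V := R_NormedModule) (fun b => - / 2 *
     (ker_im q (n + 1) (g + k) b (x h0) * F' (t - r h0 * cosh b)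
      + ker_im q (n - 1) (g - k) b (x h0) * F' (t - r h0 * cosh b)))).
    * intros s _. eqR.
      transitivity (- (/ 2 * (ker_im q (n + 1) (g + k) s (x h0) + ker_im q (n - 1) (g - k) s (x h0)))
         * F' (t - r h0 * cosh s)); [ring|].
      rewrite <- ker_im_product. field. lra.
    * apply (is_RInt_scal (V := R_NormedModule)). apply (is_RInt_plus (V := R_NormedModule));
      apply (RInt_correct (V := R_CompleteNormedModule)); apply ex_RInt_diffracted; auto.
Qed.

Lemma is_derive_edge_wave_time_off n g r x t :
  0 < r -> - PI < q * x < PI -> x <> 0 ->
  is_derive (fun t => edge_wave q n g F r x t) t (edge_wave q n g F' r x t).
Proof.
intros Hr0 Hx0 Hxp.
destruct (is_derive_diffracted q Hq F F' CF DF F'0 n g (fun _ => r) (fun _ => x) (fun t => t)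
  (fun _ => 0) (fun _ => 0) (fun _ => 1) t
  (filter_forall _ (fun h => is_derive_const r h)) (filter_forall _ (fun h => is_derive_const x h))
  (filter_forall _ (fun h => is_derive_id h)) (cont_const _ _) (cont_const _ _) (cont_const _ _) Hr0 Hx0 Hxp)
  as [b [Hb HD]].
set (b' := Rmax b (Rabs t / r)).
specialize (HD b' (Rmax_l _ _)).
assert (Hb' : Rabs t / r <= b') by apply Rmax_r.
unfold edge_wave. evar_last.
- apply @is_derive_minus.
  + apply is_derive_scal. apply (is_derive_comp F (fun t => t - r * cos x)). apply DF.
    apply @is_derive_minus. apply @is_derive_id. apply @is_derive_const.
  + apply is_derive_scal. exact HD.
- rewrite (diffracted_eq q Hq F' CF' F'0 n g r x t b'); auto.
  match goal with |- context [RInt ?f 0 b'] => replace (RInt f 0 b') with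
   (RInt (fun b => ker_im q n g b x * F' (t - r * cosh b)) 0 b') end.
  + unfold minus, plus, opp, scal, zero, one; simpl; unfold mult; simpl. ring.
  + apply RInt_ext. intros s _. eqR. ring.
Qed.
End OffRayEdge.

Lemma abs_nonneg (y : plane) : 0 <= Defs.abs y.
Proof. apply sqrt_pos. Qed.

Lemma abs_sqr (y : plane) : Defs.abs y * Defs.abs y = fst y * fst y + snd y * snd y.
Proof. unfold Defs.abs, dot. apply sqrt_sqrt. nra. Qed.

Lemma cos2_eq a : cos a * cos a = 1 - sin a * sin a.
Proof. generalize (sin2_cos2 a). unfold Rsqr. lra. Qed.

Lemma abs_polar r th : 0 <= r -> Defs.abs (polar r th) = r.
Proof.
intros Hr. unfold Defs.abs, dot, polar; simpl.
replace (r * cos th * (r * cos th) + r * sin th * (r * sin th)) with (r * r * (sin th * sin th + cos th * cos th)) by ring.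
rewrite cos2_eq. replace (r * r * (sin th * sin th + (1 - sin th * sin th))) with (r * r) by ring.
now apply sqrt_square.
Qed.

(** * Waves on the slit plane *)

(* The plane cut along the ray at angle [al]. *)
Definition slit (al : R) (y : plane) : Prop := 0 < Defs.abs y - dot (dir al) y.

(* The polar angle in the determination (al, al + 2 PI). *)
Definition cut_angle (al : R) (y : plane) : R :=
  PI + al + 2 * atan ((fst y * sin al - snd y * cos al) / (Defs.abs y - dot (dir al) y)).

Definition line (y : plane) (psi h : R) : plane := (fst y + h * cos psi, snd y + h * sin psi).

Section Slit.
Variable al : R.

Lemma slit_abs_pos y : slit al y -> 0 < Defs.abs y.
Proof.
intros H. unfold slit in H. destruct (Rle_lt_or_eq_dec 0 _ (abs_nonneg y)); auto.
assert (S := abs_sqr y). rewrite <- e in S, H.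
assert (fst y = 0) by nra. assert (snd y = 0) by nra.
unfold dot, dir in H. rewrite H0, H1 in H. simpl in H. lra.
Qed.

Lemma rotated_sqr y :
  dot (dir al) y * dot (dir al) y
  + (fst y * sin al - snd y * cos al) * (fst y * sin al - snd y * cos al) = Defs.abs y * Defs.abs y.
Proof.
rewrite abs_sqr. unfold dot, dir; simpl.
replace (fst y * fst y + snd y * snd y) with ((fst y * fst y + snd y * snd y) * (sin al * sin al + cos al * cos al)).
ring. rewrite cos2_eq. ring.
Qed.

Lemma cut_angle_bounds y : al < cut_angle al y < al + 2 * PI.
Proof.
unfold cut_angle.
generalize (atan_bound ((fst y * sin al - snd y * cos al) / (Defs.abs y - dot (dir al) y))). lra.
Qed.

Lemma half_angle u : cos (2 * atan u) = (1 - u * u) / (1 + u * u) /\ sin (2 * atan u) = 2 * u / (1 + u * u).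
Proof.
assert (H : 0 < 1 + u * u) by nra.
assert (S : sqrt (1 + u²) * sqrt (1 + u²) = 1 + u * u) by (apply sqrt_sqrt; unfold Rsqr; lra).
assert (S0 : sqrt (1 + u²) <> 0) by (intros E; rewrite E in S; lra).
rewrite cos_2a, sin_2a, cos_atan, sin_atan. set (w := sqrt (1 + u²)) in *. rewrite <- S.
split.
- replace (1 - u * u) with (1 - u * u) by ring. field. exact S0.
- field. exact S0.
Qed.

(** Let psi be the polar angle minus al + PI. The components of y along and across the slit are a =
    - r cos psi and b = r sin psi, so b / (r - a) = tan (psi / 2). Hence the arctangent is smooth on
    the whole slit plane, and the rational parametrisation of [half_angle] recovers cosine and
    sine. *)
Lemma cut_angle_cos_sin y : slit al y ->
  Defs.abs y * cos (cut_angle al y) = fst y /\ Defs.abs y * sin (cut_angle al y) = snd y.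
Proof.
intros H. assert (Hr := slit_abs_pos y H). assert (Rot := rotated_sqr y). unfold slit in H.
unfold cut_angle. replace (PI + al + 2 * atan ((fst y * sin al - snd y * cos al) / (Defs.abs y - dot (dir al) y)))
 with ((al + 2 * atan ((fst y * sin al - snd y * cos al) / (Defs.abs y - dot (dir al) y))) + PI) by ring.
rewrite neg_cos, neg_sin, cos_plus, sin_plus.
destruct (half_angle ((fst y * sin al - snd y * cos al) / (Defs.abs y - dot (dir al) y))) as [-> ->].
set (a := dot (dir al) y) in *. set (b := fst y * sin al - snd y * cos al) in *. set (r := Defs.abs y) in *.
assert (Hd : 1 + b / (r - a) * (b / (r - a)) = 2 * r / (r - a)).
{ apply Rmult_eq_reg_r with ((r - a) * (r - a)); [|nra].
  transitivity ((r - a) * (r - a) + b * b); [field; lra|].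
  replace (b * b) with (r * r - a * a) by lra. field; lra. }
assert (Hn : 1 - b / (r - a) * (b / (r - a)) = - 2 * a / (r - a)).
{ apply Rmult_eq_reg_r with ((r - a) * (r - a)); [|nra].
  transitivity ((r - a) * (r - a) - b * b); [field; lra|].
  replace (b * b) with (r * r - a * a) by lra. field; lra. }
rewrite Hd, Hn.
assert (E1 : a * cos al + b * sin al = fst y).
{ unfold a, b, dot, dir; simpl. replace (fst y) with (fst y * (sin al * sin al + cos al * cos al)) at 3 by (rewrite cos2_eq; ring). ring. }
assert (E2 : a * sin al - b * cos al = snd y).
{ unfold a, b, dot, dir; simpl. replace (snd y) with (snd y * (sin al * sin al + cos al * cos al)) at 3 by (rewrite cos2_eq; ring). ring. }
rewrite <- E1 at 1. rewrite <- E2. split; field; lra.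
Qed.

Lemma slit_polar y : slit al y -> y = polar (Defs.abs y) (cut_angle al y).
Proof.
intros H. destruct (cut_angle_cos_sin y H) as [H1 H2]. unfold polar. rewrite H1, H2. now destruct y.
Qed.

Lemma is_derive_abs_line y psi h : slit al (line y psi h) ->
  is_derive (fun h => Defs.abs (line y psi h)) h (cos (cut_angle al (line y psi h) - psi)).
Proof.
intros H. assert (Hr := slit_abs_pos _ H). destruct (cut_angle_cos_sin _ H) as [H1 H2].
assert (Hd : is_derive (fun h => dot (line y psi h) (line y psi h)) h
  (2 * (fst (line y psi h) * cos psi + snd (line y psi h) * sin psi))).
{ unfold dot, line; simpl. auto_derive; auto. ring. }
unfold Defs.abs. evar_last.
- apply (is_derive_comp sqrt (fun h => dot (line y psi h) (line y psi h))).
  + apply is_derive_Reals. apply derivable_pt_lim_sqrt.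
    unfold Defs.abs in Hr. apply Rnot_le_lt. intros E. rewrite sqrt_neg_0 in Hr; lra.
  + exact Hd.
- unfold scal; simpl; unfold mult; simpl. rewrite cos_minus.
  change (sqrt (dot (line y psi h) (line y psi h))) with (Defs.abs (line y psi h)).
  change (fst y + h * cos psi) with (fst (line y psi h)). change (snd y + h * sin psi) with (snd (line y psi h)).
  rewrite <- H1 at 1. rewrite <- H2 at 1. field. lra.
Qed.

Lemma is_derive_cut_angle_line y psi h : slit al (line y psi h) ->
  is_derive (fun h => cut_angle al (line y psi h)) h
    (- sin (cut_angle al (line y psi h) - psi) / Defs.abs (line y psi h)).
Proof.
intros H. assert (Hr := slit_abs_pos _ H). destruct (cut_angle_cos_sin _ H) as [H1 H2].
assert (Rot := rotated_sqr (line y psi h)).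
assert (Dr := is_derive_abs_line y psi h H). unfold slit in H.
set (r := Defs.abs (line y psi h)) in *. set (th := cut_angle al (line y psi h)) in *.
assert (Db : is_derive (fun h => fst (line y psi h) * sin al - snd (line y psi h) * cos al) h
  (cos psi * sin al - sin psi * cos al)).
{ unfold line; simpl. auto_derive; auto. ring. }
assert (Da : is_derive (fun h => dot (dir al) (line y psi h)) h (cos al * cos psi + sin al * sin psi)).
{ unfold dot, dir, line; simpl. auto_derive; auto. ring. }
unfold cut_angle at 1. evar_last.
- apply @is_derive_plus. apply @is_derive_const. apply is_derive_scal.
  apply (is_derive_comp atan (fun h => (fst (line y psi h) * sin al - snd (line y psi h) * cos al)
     / (Defs.abs (line y psi h) - dot (dir al) (line y psi h)))).
  apply is_derive_Reals. apply derivable_pt_lim_atan.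
  apply is_derive_div. exact Db. apply @is_derive_minus. exact Dr. exact Da.
  apply Rgt_not_eq. exact H.
- unfold plus, minus, opp, scal, zero; simpl; unfold mult; simpl.
  change (fst y + h * cos psi) with (fst (line y psi h)). change (snd y + h * sin psi) with (snd (line y psi h)).
  fold r.
  set (a := dot (dir al) (line y psi h)) in *.
  set (b := fst (line y psi h) * sin al - snd (line y psi h) * cos al) in *.
  assert (Hu : 1 + b / (r - a) * (b / (r - a) * 1) = 2 * r / (r - a)).
  { apply Rmult_eq_reg_r with ((r - a) * (r - a)); [|nra].
    transitivity ((r - a) * (r - a) + b * b); [field; lra|].
    replace (b * b) with (r * r - a * a) by lra. field; lra. }
  rewrite Hu. fold th.
  assert (A : a = r * cos (th - al)).
  { unfold a, dot, dir; simpl. change (fst y + h * cos psi) with (fst (line y psi h)).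
    change (snd y + h * sin psi) with (snd (line y psi h)). rewrite <- H1, <- H2, cos_minus. ring. }
  assert (B : b = - (r * sin (th - al))).
  { unfold b. rewrite <- H1, <- H2, sin_minus. ring. }
  replace (cos psi * sin al - sin psi * cos al) with (sin (al - psi)) by (rewrite sin_minus; ring).
  replace (cos al * cos psi + sin al * sin psi) with (cos (al - psi)) by (rewrite cos_minus; ring).
  replace (th - psi) with ((th - al) + (al - psi)) by ring. rewrite cos_plus, sin_plus.
  generalize dependent (th - al); intros u. intros. rewrite A, B in *.
  assert (C := cos2_eq u).
  assert (1 - cos u <> 0) by (intros E; replace (cos u) with 1 in H by lra; lra).
  generalize dependent (al - psi); intros w.
  apply Rmult_eq_reg_r with (r * (1 - cos u)); [|apply Rmult_integral_contrapositive_currified; lra].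
  transitivity (sin w * (1 - cos u) + sin u * (cos u * cos w - sin u * sin w - cos w)).
  { change (plus (cos u * cos w - sin u * sin w) (- cos w)) with (cos u * cos w - sin u * sin w + - cos w).
    field. split; lra. }
  transitivity (- (sin u * cos w + cos u * sin w) * (1 - cos u)); [|field; lra].
  replace (sin u * (cos u * cos w - sin u * sin w - cos w)) with (sin u * (cos u * cos w - cos w) - (sin u * sin u) * sin w) by ring.
  replace (sin u * sin u) with (1 - cos u * cos u) by lra. ring.
Qed.

Lemma continuous_plane_abs (y : plane) : continuous Defs.abs y.
Proof.
unfold Defs.abs, dot. apply (cont_comp sqrt).
- destruct y; cont.
- apply continuous_sqrt.
Qed.

Lemma continuous_dot e (y : plane) : continuous (dot e) y.
Proof. unfold dot. destruct y; cont. Qed.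

Lemma locally_slit y : slit al y -> locally y (slit al).
Proof.
intros H. apply (locally_continuous_gt (fun y => Defs.abs y - dot (dir al) y)); auto.
apply cont_minus. apply continuous_plane_abs. apply continuous_dot.
Qed.

Lemma continuous_cut_angle y : slit al y -> continuous (cut_angle al) y.
Proof.
intros H. unfold cut_angle. apply cont_plus; [apply cont_const|]. apply cont_mult; [apply cont_const|].
apply (cont_comp atan).
- apply cont_div; [destruct y; cont| |unfold slit in H; lra].
  apply cont_minus. apply continuous_plane_abs. apply continuous_dot.
- apply (ex_derive_continuous (V := R_NormedModule)). eexists. apply is_derive_Reals. apply derivable_pt_lim_atan.
Qed.

Lemma continuous_line y psi h : continuous (line y psi) h.
Proof. unfold line. apply cont_pair; cont. Qed.

Lemma locally_slit_line y psi h : slit al (line y psi h) -> locally h (fun h => slit al (line y psi h)).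
Proof. intros H. apply (continuous_line y psi h). now apply locally_slit. Qed.
End Slit.

Lemma line_0 y psi : line y psi 0 = y.
Proof. unfold line. destruct y; simpl. f_equal; ring. Qed.

(** * Waves of one image source and their derivatives on the slit plane *)

Section Image.
Variables (q al a : R).
Hypothesis Hq : 0 < q.
Hypothesis Hdom : forall th, al < th < al + 2 * PI -> - PI < q * (th - a) < PI.

Definition image_wave (n g : R) (F : R -> R) (p : spacetime) : R :=
  edge_wave q n g F (Defs.abs (fst p)) (cut_angle al (fst p) - a) (snd p).

Variables (F F' F'' : R -> R).
Hypothesis CF : causal F.
Hypothesis CF' : causal F'.
Hypothesis DF : forall s, is_derive F s (F' s).
Hypothesis DF' : forall s, is_derive F' s (F'' s).
Hypothesis F''0 : forall s, continuous F'' s.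

Lemma F'_continuous s : continuous F' s.
Proof. exact (continuous_of_derive F' F'' DF' s). Qed.

Lemma continuous_image_wave_comp {E : UniformSpace} n g (y : E -> plane) (t : E -> R) p :
  continuous y p -> continuous t p -> slit al (y p) ->
  continuous (fun p => image_wave n g F (y p, t p)) p.
Proof.
intros Hy Ht Hs. unfold image_wave; simpl.
apply (continuous_edge_wave q Hq F F' CF DF F'_continuous n g
  (fun p => Defs.abs (y p)) (fun p => cut_angle al (y p) - a) t); auto.
- apply (continuous_comp y Defs.abs); auto. apply continuous_plane_abs.
- apply cont_minus; [|apply cont_const]. apply (continuous_comp y (cut_angle al)); auto. now apply continuous_cut_angle.
- now apply (slit_abs_pos al).
- apply Hdom. apply cut_angle_bounds.
Qed.

Lemma is_derive_image_wave_off n g psi y t h : slit al (line y psi h) -> cut_angle al (line y psi h) <> a ->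
  is_derive (fun h => image_wave n g F (line y psi h, t)) h
   (- / 2 * (image_wave (n + 1) (g + (a - psi)) F' (line y psi h, t)
           + image_wave (n - 1) (g - (a - psi)) F' (line y psi h, t))).
Proof.
intros Hs Ha. unfold image_wave; simpl.
apply (is_derive_edge_wave_off q Hq F F' CF CF' DF F'_continuous n g (a - psi)
  (fun h => Defs.abs (line y psi h)) (fun h => cut_angle al (line y psi h) - a)).
- generalize (locally_slit_line al y psi h Hs). apply filter_imp. intros z Hz.
  replace (cut_angle al (line y psi z) - a + (a - psi)) with (cut_angle al (line y psi z) - psi) by ring.
  now apply is_derive_abs_line.
- generalize (locally_slit_line al y psi h Hs). apply filter_imp. intros z Hz.
  replace (cut_angle al (line y psi z) - a + (a - psi)) with (cut_angle al (line y psi z) - psi) by ring.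
  evar_last. apply @is_derive_minus. now apply is_derive_cut_angle_line. apply @is_derive_const.
  unfold minus, plus, opp, zero; simpl; ring.
- now apply (slit_abs_pos al).
- apply Hdom. apply cut_angle_bounds.
- lra.
Qed.

Definition cross (u v : plane) : R := fst u * snd v - snd u * fst v.

Lemma cross_ray y : slit al y -> cut_angle al y = a -> cross (dir a) y = 0.
Proof.
intros H E. destruct (cut_angle_cos_sin al y H) as [H1 H2]. rewrite E in H1, H2.
unfold cross, dir; simpl. rewrite <- H1, <- H2. ring.
Qed.

(** Both sides are continuous on the slit plane and the formula holds off the ray. On the ray it
    extends from nearby parallel lines if psi is the direction of the ray, and from the punctured
    line otherwise. *)
Lemma is_derive_image_wave n g psi y t : slit al y ->
  is_derive (fun h => image_wave n g F (line y psi h, t)) 0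
   (- / 2 * (image_wave (n + 1) (g + (a - psi)) F' (y, t)
           + image_wave (n - 1) (g - (a - psi)) F' (y, t))).
Proof.
intros Hs.
set (W := fun y => - / 2 * (image_wave (n + 1) (g + (a - psi)) F' (y, t)
           + image_wave (n - 1) (g - (a - psi)) F' (y, t))).
change (is_derive (fun h => image_wave n g F (line y psi h, t)) 0 (W y)).
assert (CW : forall (E : UniformSpace) (Y : E -> plane) p, continuous Y p -> slit al (Y p) -> continuous (fun p => W (Y p)) p).
{ intros E Y p HY HS. unfold W.
  assert (C : forall n g, continuous (fun p => image_wave n g F' (Y p, t)) p).
  { intros n' g'. unfold image_wave; simpl.
    apply (continuous_edge_wave q Hq F' F'' CF' DF' F''0 n' g'
      (fun p => Defs.abs (Y p)) (fun p => cut_angle al (Y p) - a) (fun _ => t)); [| |apply cont_const| |].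
    - apply (continuous_comp Y Defs.abs); auto. apply continuous_plane_abs.
    - apply cont_minus; [|apply cont_const]. apply (continuous_comp Y (cut_angle al)); auto. now apply continuous_cut_angle.
    - now apply (slit_abs_pos al).
    - apply Hdom. apply cut_angle_bounds. }
  apply cont_mult; [apply cont_const|]. apply cont_plus; apply C. }
assert (OFF : forall y h, slit al (line y psi h) -> cut_angle al (line y psi h) <> a ->
   is_derive (fun h => image_wave n g F (line y psi h, t)) h (W (line y psi h))).
{ intros y' h H1 H2. now apply is_derive_image_wave_off. }
destruct (Req_dec (cut_angle al y) a) as [Ha|Ha].
2:{ evar_last; [apply OFF; rewrite line_0; auto|now rewrite line_0]. }
destruct (Req_dec (sin (psi - a)) 0) as [Hp|Hp].
(* Motion along the ray: [s] displaces the line perpendicularly. *)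
- set (Y := fun s h => line (line y (a + PI / 2) s) psi h).
  assert (CY : continuous (fun z : R * R => Y (fst z) (snd z)) (0, 0)).
  { unfold Y, line; simpl. apply cont_pair; cont. }
  assert (Y00 : Y 0 0 = y) by (unfold Y; now rewrite !line_0).
  assert (LS : locally ((0, 0) : R * R) (fun z : R * R => slit al (Y (fst z) (snd z)))).
  { apply CY. simpl. rewrite Y00. now apply locally_slit. }
  destruct LS as [e He].
  assert (He' : forall s h, Rabs s < e -> Rabs h < e -> slit al (Y s h)).
  { intros s h H1 H2. apply (He (s, h)). split; simpl; apply ball_R_sym; now rewrite Rminus_0_r. }
  generalize (is_derive_parallel (fun s h => image_wave n g F (Y s h, t)) (fun s h => W (Y s h)) e (cond_pos e)).
  simpl. rewrite Y00. intros HH.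
  apply (is_derive_ext (fun h => image_wave n g F (Y 0 h, t))).
  { intros h. unfold Y. now rewrite line_0. }
  apply HH.
  + apply (CW _ (fun z : R * R => Y (fst z) (snd z))); auto. simpl. now rewrite Y00.
  + intros h Hh. apply (continuous_image_wave_comp n g (fun s => Y s h) (fun _ => t)); [|apply cont_const|].
    * unfold Y, line; simpl. apply cont_pair; cont.
    * apply He'; auto. rewrite Rabs_R0. apply cond_pos.
  + intros s h H1 H2 H3. apply OFF; [now apply He'|].
    intros E. assert (X := cross_ray _ (He' s h H1 H2) E).
    assert (X0 := cross_ray _ Hs Ha).
    apply H3. rewrite sin_minus in Hp.
    unfold cross, Y, line, dir in X; simpl in X. unfold cross, dir in X0; simpl in X0.
    rewrite (Rplus_comm a), sin_plus, cos_plus, sin_PI2, cos_PI2 in X.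
    assert (C := cos2_eq a).
    (* The cross product of [dir a] with a point displaced by [s] is [s], so the displaced line
       misses the ray unless [s = 0]. *)
    assert (s * (cos a * cos a + sin a * sin a) = 0).
    { transitivity (cos a * (snd y + s * (1 * cos a + 0 * sin a) + h * sin psi) - sin a * (fst y + s * (0 * cos a - 1 * sin a) + h * cos psi)
      - (cos a * snd y - sin a * fst y) - h * (sin psi * cos a - cos psi * sin a)); [ring|].
      rewrite X, X0, Hp. ring. }
    rewrite C in H. lra.
- destruct (locally_slit_line al y psi 0) as [e He]. now rewrite line_0.
  assert (He' : forall h, Rabs h < e -> slit al (line y psi h)).
  { intros h H1. apply He. apply ball_R_sym; now rewrite Rminus_0_r. }
  generalize (is_derive_transversal (fun h => image_wave n g F (line y psi h, t)) (fun h => W (line y psi h)) e (cond_pos e)).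
  simpl. rewrite line_0. intros HH. apply HH.
  + apply (CW _ (fun h => line y psi h)). apply continuous_line. now rewrite line_0.
  + intros h Hh. apply (continuous_image_wave_comp n g (line y psi) (fun _ => t)); [|apply cont_const|].
    * apply continuous_line.
    * now apply He'.
  + intros h H1 H3. apply OFF; [now apply He'|].
    intros E. assert (X := cross_ray _ (He' h H1) E).
    assert (X0 := cross_ray _ Hs Ha).
    apply Hp. apply Rmult_eq_reg_l with h; auto. rewrite sin_minus.
    unfold cross, line, dir in X; simpl in X. unfold cross, dir in X0; simpl in X0. lra.
Qed.

Lemma is_derive_image_wave_time n g y t : slit al y ->
  is_derive (fun h => image_wave n g F (y, t + h)) 0 (image_wave n g F' (y, t)).
Proof.
intros Hs. assert (Hr := slit_abs_pos al y Hs).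
assert (OFF : forall x h, - PI < q * x < PI -> x <> 0 ->
  is_derive (fun h => edge_wave q n g F (Defs.abs y) x (t + h)) h (edge_wave q n g F' (Defs.abs y) x (t + h))).
{ intros x h Hx Hx0. evar_last.
  - apply (is_derive_comp (fun t => edge_wave q n g F (Defs.abs y) x t) (fun h => t + h)).
    + apply (is_derive_edge_wave_time_off q Hq F F' CF CF' DF F'_continuous); auto.
    + apply @is_derive_plus. apply @is_derive_const. apply @is_derive_id.
  - unfold scal, plus, zero, one; simpl; unfold mult; simpl. ring. }
unfold image_wave; simpl. set (x0 := cut_angle al y - a).
assert (Hx0 : - PI < q * x0 < PI) by (apply Hdom; apply cut_angle_bounds).
destruct (Req_dec x0 0) as [Ex|Ex].
2:{ evar_last; [now apply OFF|now rewrite Rplus_0_r]. }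
assert (HPI := PI_RGT_0).
rewrite Ex. replace (edge_wave q n g F' (Defs.abs y) 0 t) with (edge_wave q n g F' (Defs.abs y) 0 (t + 0))
  by now rewrite Rplus_0_r.
(* Motion in time stays on the critical ray; the transversal variable is the angle itself. *)
apply (is_derive_parallel (fun s h => edge_wave q n g F (Defs.abs y) s (t + h))
  (fun s h => edge_wave q n g F' (Defs.abs y) s (t + h)) (PI / q)).
- now apply Rdiv_lt_0_compat.
- apply (continuous_edge_wave q Hq F' F'' CF' DF' F''0 n g (fun _ => Defs.abs y)
    (fun z : R * R => fst z) (fun z : R * R => t + snd z)); auto; try cont. simpl; lra.
- intros h _. apply (continuous_edge_wave q Hq F F' CF DF F'_continuous n g (fun _ => Defs.abs y)
    (fun z => z) (fun _ => t + h)); auto; try cont. lra.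
- intros s h H1 _ H3. apply OFF; auto.
  apply Rabs_def2 in H1. destruct H1 as [H1 H2].
  split.
  + apply Rmult_lt_compat_l with (r := q) in H2; auto.
    replace (q * - (PI / q)) with (- PI) in H2 by (field; lra). exact H2.
  + apply Rmult_lt_compat_l with (r := q) in H1; auto.
    replace (q * (PI / q)) with PI in H1 by (field; lra). exact H1.
Qed.
End Image.

(** * Smooth and causal profiles *)

Definition smooth_real (F : R -> R) : Prop := forall n s, ex_derive_n F n s.

Lemma smooth_real_is_derive F s : smooth_real F -> is_derive F s (Derive F s).
Proof. intros H. apply Derive_correct. exact (H 1%nat s). Qed.

Lemma smooth_real_continuous F s : smooth_real F -> continuous F s.
Proof. intros H. apply (ex_derive_continuous (V := R_NormedModule)). exact (H 1%nat s). Qed.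

Lemma Derive_n_Derive F n : Derive_n (Derive F) n = Derive_n F (S n).
Proof.
apply functional_extensionality; intros s.
change (Derive F) with (Derive_n F 1). rewrite Derive_n_comp. f_equal. lia.
Qed.

Lemma smooth_real_Derive F : smooth_real F -> smooth_real (Derive F).
Proof.
intros H n s. destruct n; simpl; auto.
rewrite Derive_n_Derive. exact (H (S (S n)) s).
Qed.

Lemma ex_derive_n_of_Derive F n s :
  (forall z, ex_derive F z) -> ex_derive_n (Derive F) n s -> ex_derive_n F (S n) s.
Proof.
intros H1 H2. destruct n as [|n].
- apply H1.
- simpl in H2. rewrite Derive_n_Derive in H2. exact H2.
Qed.

Lemma smooth_real_plus F G : smooth_real F -> smooth_real G -> smooth_real (fun s => F s + G s).
Proof. intros HF HG n s. apply ex_derive_n_plus; apply filter_forall; intros; auto. Qed.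

Lemma smooth_real_scal c F : smooth_real F -> smooth_real (fun s => c * F s).
Proof. intros HF n s. apply ex_derive_n_scal_l. apply HF. Qed.

Lemma smooth_real_mult F G : smooth_real F -> smooth_real G -> smooth_real (fun s => F s * G s).
Proof.
(* Both factors are generalised, since the induction passes to the products with [Derive F] and
   [Derive G]; all orders up to [n] are carried along because [ex_derive_n_plus] asks for them. *)
assert (P : forall n F G, smooth_real F -> smooth_real G -> forall k, (k <= n)%nat ->
  forall s, ex_derive_n (fun s => F s * G s) k s).
{ clear F G. induction n as [|n IH]; intros F G HF HG k Hk s.
  - replace k with 0%nat by lia. exact I.
  - destruct k as [|k]; [exact I|].
    assert (D : forall s, is_derive (fun s => F s * G s) s (Derive F s * G s + F s * Derive G s)).
    { intros z. apply Derive.is_derive_mult; now apply smooth_real_is_derive. }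
    apply ex_derive_n_of_Derive; [intros z; eexists; apply D|].
    apply (ex_derive_n_ext (fun s => Derive F s * G s + F s * Derive G s)).
    { intros z. symmetry. apply is_derive_unique, D. }
    apply ex_derive_n_plus; apply filter_forall; intros z j Hj; apply IH; auto; try lia;
      now apply smooth_real_Derive. }
intros HF HG n s. now apply (P n F G HF HG n).
Qed.

Lemma smooth_real_cos k : smooth_real (fun s => cos (k * s)) /\ smooth_real (fun s => sin (k * s)).
Proof.
assert (P : forall n s, ex_derive_n (fun s => cos (k * s)) n s /\ ex_derive_n (fun s => sin (k * s)) n s).
{ induction n as [|n IH]; intros s; [split; exact I|]. split.
  - apply ex_derive_n_of_Derive; [intros z; auto_derive; auto|].
    apply (ex_derive_n_ext (fun s => (- k) * sin (k * s))); [|apply ex_derive_n_scal_l, IH].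
    intros z. symmetry. apply is_derive_unique. auto_derive; auto; ring.
  - apply ex_derive_n_of_Derive; [intros z; auto_derive; auto|].
    apply (ex_derive_n_ext (fun s => k * cos (k * s))); [|apply ex_derive_n_scal_l, IH].
    intros z. symmetry. apply is_derive_unique. auto_derive; auto; ring. }
split; intros n s; apply P.
Qed.

(** At [s = 0] continuity of the derivative extends its vanishing from negative [s]. *)
Lemma causal_Derive F : causal F -> smooth_real F -> causal (Derive F).
Proof.
intros CF SF.
assert (N : forall s, s < 0 -> Derive F s = 0).
{ intros s Hs. rewrite (Derive_ext_loc F (fun _ => 0)); [apply Derive_const|].
  generalize (locally_continuous_lt (fun z => z) s 0 (continuous_id s) Hs).
  apply filter_imp. intros y Hy. apply CF. lra. }
intros s Hs. destruct (Rle_lt_or_eq_dec _ _ Hs) as [H| ->]; auto.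
apply NNPP. intros H0.
assert (C := smooth_real_continuous _ 0 (smooth_real_Derive F SF)).
destruct (locally_continuous_neq _ _ _ C H0) as [e He].
apply (He (- e / 2)); [apply ball_R_sym|apply N].
- rewrite Rminus_0_r. destruct e as [e e0]; simpl. rewrite Rabs_left; lra.
- destruct e as [e e0]; simpl. lra.
Qed.

(** * A class of waves closed under differentiation *)

Section WaveClass.
Variables (q al : R).
Hypothesis Hq : 0 < q.

(** On the slit plane the angle x measured from the ray of the source stays in the strip |q x| < PI,
    where the kernel is singular only for x = 0. *)
Definition admissible (a : R) : Prop :=
  forall th, al < th < al + 2 * PI -> - PI < q * (th - a) < PI.

Definition plane_real (b : R) (F : R -> R) (p : spacetime) : R := F (snd p - dot (dir b) (fst p)).

(* A class of functions on the slit plane that is closed under all partial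
   derivatives; it contains the total wave. *)
Inductive wave_class : (spacetime -> R) -> Prop :=
| wave_class_image a n g F : admissible a -> causal F -> smooth_real F ->
    wave_class (image_wave q al a n g F)
| wave_class_plane b F : smooth_real F -> wave_class (plane_real b F)
| wave_class_lin c1 u1 c2 u2 : wave_class u1 -> wave_class u2 ->
    wave_class (fun p => c1 * u1 p + c2 * u2 p).

Definition slit_time (p : spacetime) : Prop := slit al (fst p).

Lemma wave_class_continuous u : wave_class u -> forall p, slit_time p -> continuous u p.
Proof.
intros H. induction H as [a n g F Ha CF SF|b F SF|c1 u1 c2 u2 _ IH1 _ IH2]; intros p Hp.
- apply (continuous_ext (fun p : spacetime => image_wave q al a n g F (fst p, snd p))).
  { intros [y t]; reflexivity. }
  assert (SF' := smooth_real_Derive F SF).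
  apply (continuous_image_wave_comp q al a Hq Ha F (Derive F) (Derive (Derive F)) CF
    (fun s => smooth_real_is_derive F s SF) (fun s => smooth_real_is_derive _ s SF')
    n g fst snd); [| |exact Hp]; destruct p; cont.
- unfold plane_real. destruct p as [y t].
  apply (cont_comp F (fun p : spacetime => snd p - dot (dir b) (fst p))); [|exact (smooth_real_continuous F _ SF)].
  apply (cont_minus (fun p : spacetime => snd p) (fun p : spacetime => dot (dir b) (fst p))); [cont|].
  apply (continuous_comp (fun p : spacetime => fst p) (dot (dir b))); [cont|]. apply continuous_dot.
- apply (cont_plus (fun p : spacetime => c1 * u1 p) (fun p : spacetime => c2 * u2 p)).
  + apply (cont_mult (fun _ : spacetime => c1) u1); [apply cont_const|auto].
  + apply (cont_mult (fun _ : spacetime => c2) u2); [apply cont_const|auto].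
Qed.

Lemma shift_dy1 y t h : shift dy1 (y, t) h = (line y 0 h, t).
Proof. unfold line. rewrite cos_0, sin_0, Rmult_1_r, Rmult_0_r, Rplus_0_r. now destruct y. Qed.
Lemma shift_dy2 y t h : shift dy2 (y, t) h = (line y (PI / 2) h, t).
Proof. unfold line. rewrite cos_PI2, sin_PI2, Rmult_1_r, Rmult_0_r, Rplus_0_r. now destruct y. Qed.
Lemma shift_dt y t h : shift dt (y, t) h = (y, t + h).
Proof. now destruct y. Qed.

Lemma plane_real_line b F psi y t : smooth_real F ->
  is_derive (fun h => plane_real b F (line y psi h, t)) 0
    (- cos (b - psi) * plane_real b (Derive F) (y, t)).
Proof.
intros SF. unfold plane_real; simpl.
replace (dot (dir b) y) with (dot (dir b) (line y psi 0)) by now rewrite line_0.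
evar_last.
- apply (is_derive_comp F (fun h => t - dot (dir b) (line y psi h))).
  + now apply smooth_real_is_derive.
  + unfold dot, dir, line; simpl. auto_derive; auto.
- unfold scal; simpl; unfold mult; simpl. rewrite cos_minus. ring.
Qed.

Lemma image_wave_line a n g F psi y t : admissible a -> causal F -> smooth_real F -> slit al y ->
  is_derive (fun h => image_wave q al a n g F (line y psi h, t)) 0
   (- / 2 * (image_wave q al a (n + 1) (g + (a - psi)) (Derive F) (y, t)
           + image_wave q al a (n - 1) (g - (a - psi)) (Derive F) (y, t))).
Proof.
intros Ha CF SF Hs. assert (SF' := smooth_real_Derive F SF). assert (SF'' := smooth_real_Derive _ SF').
exact (is_derive_image_wave q al a Hq Ha F (Derive F) (Derive (Derive F)) CF (causal_Derive F CF SF)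
  (fun s => smooth_real_is_derive F s SF) (fun s => smooth_real_is_derive _ s SF')
  (fun s => smooth_real_continuous _ s SF'') n g psi y t Hs).
Qed.

Lemma wave_class_line u psi : wave_class u -> exists v, wave_class v /\
  forall y t, slit al y -> is_derive (fun h => u (line y psi h, t)) 0 (v (y, t)).
Proof.
intros H. induction H as [a n g F Ha CF SF|b F SF|c1 u1 c2 u2 _ [v1 [C1 IH1]] _ [v2 [C2 IH2]]].
- exists (fun p => - / 2 * image_wave q al a (n + 1) (g + (a - psi)) (Derive F) p
           + - / 2 * image_wave q al a (n - 1) (g - (a - psi)) (Derive F) p). split.
  + apply wave_class_lin; apply wave_class_image; auto using smooth_real_Derive, causal_Derive.
  + intros y t Hs. evar_last. now apply image_wave_line. simpl; ring.
(* [wave_class_lin] is binary; the second term is padding. *)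
- exists (fun p => - cos (b - psi) * plane_real b (Derive F) p + 0 * plane_real b (Derive F) p). split.
  + apply wave_class_lin; apply wave_class_plane; auto using smooth_real_Derive.
  + intros y t Hs. evar_last. now apply plane_real_line. simpl; ring.
- exists (fun p => c1 * v1 p + c2 * v2 p). split.
  + now apply wave_class_lin.
  + intros y t Hs. apply @is_derive_plus; apply is_derive_scal; auto.
Qed.

Lemma wave_class_time u : wave_class u -> exists v, wave_class v /\
  forall y t, slit al y -> is_derive (fun h => u (y, t + h)) 0 (v (y, t)).
Proof.
intros H. induction H as [a n g F Ha CF SF|b F SF|c1 u1 c2 u2 _ [v1 [C1 IH1]] _ [v2 [C2 IH2]]].
- exists (image_wave q al a n g (Derive F)). split.
  + apply wave_class_image; auto using smooth_real_Derive, causal_Derive.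
  + intros y t Hs. assert (SF' := smooth_real_Derive F SF). assert (SF'' := smooth_real_Derive _ SF').
    exact (is_derive_image_wave_time q al a Hq Ha F (Derive F) (Derive (Derive F)) CF (causal_Derive F CF SF)
      (fun s => smooth_real_is_derive F s SF) (fun s => smooth_real_is_derive _ s SF')
      (fun s => smooth_real_continuous _ s SF'') n g y t Hs).
- exists (plane_real b (Derive F)). split.
  + apply wave_class_plane; auto using smooth_real_Derive.
  + intros y t Hs. unfold plane_real; simpl. evar_last.
    * apply (is_derive_comp F (fun h => t + h - dot (dir b) y)).
      now apply smooth_real_is_derive. auto_derive; auto.
    * unfold scal; simpl; unfold mult; simpl. rewrite Rplus_0_r. ring.
- exists (fun p => c1 * v1 p + c2 * v2 p). split.
  + now apply wave_class_lin.
  + intros y t Hs. apply @is_derive_plus; apply is_derive_scal; auto.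
Qed.

Lemma wave_class_partial u d : wave_class u -> exists v, wave_class v /\
  forall p, slit_time p -> is_derive (fun h => u (shift d p h)) 0 (v p).
Proof.
intros H. destruct d.
- destruct (wave_class_line u 0 H) as [v [Cv Hv]]. exists v. split; auto. intros [y t] Hs.
  apply (is_derive_ext (fun h => u (line y 0 h, t))); [|now apply Hv].
  intros h; now rewrite shift_dy1.
- destruct (wave_class_line u (PI / 2) H) as [v [Cv Hv]]. exists v. split; auto. intros [y t] Hs.
  apply (is_derive_ext (fun h => u (line y (PI / 2) h, t))); [|now apply Hv].
  intros h; now rewrite shift_dy2.
- destruct (wave_class_time u H) as [v [Cv Hv]]. exists v. split; auto. intros [y t] Hs.
  apply (is_derive_ext (fun h => u (y, t + h))); [|now apply Hv].
  intros h; now rewrite shift_dt.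
Qed.

Lemma shift_0 d p : shift d p 0 = p.
Proof. destruct d, p as [[y1 y2] t]; simpl; now rewrite Rplus_0_r. Qed.

Lemma continuous_shift d p h : continuous (shift d p) h.
Proof. destruct d, p as [[y1 y2] t]; simpl; repeat apply cont_pair; cont. Qed.

Lemma locally_shift d p (O : spacetime -> Prop) : locally p O -> locally 0 (fun h => O (shift d p h)).
Proof. intros H. apply (continuous_shift d p 0). now rewrite shift_0. Qed.

Section Represented.
Variables (O : spacetime -> Prop) (U : spacetime -> C) (u1 u2 : spacetime -> R).
Hypothesis openO : forall p, O p -> locally p O.
Hypothesis O_slit : forall p, O p -> slit_time p.
Hypothesis C1 : wave_class u1.
Hypothesis C2 : wave_class u2.
Hypothesis HU : forall p, O p -> U p = (u1 p, u2 p).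

(** A partial derivative depends only on values nearby, so on the open set [O] the representation of
    [U] can be differentiated repeatedly, and the class supplies each next representative. *)
Lemma partials_represented w : exists v1 v2, wave_class v1 /\ wave_class v2 /\
  forall p, O p -> partials w U p = (v1 p, v2 p).
Proof.
induction w as [|d w [v1 [v2 [Cv1 [Cv2 IH]]]]].
- exists u1, u2. auto.
- destruct (wave_class_partial v1 d Cv1) as [w1 [Cw1 Hw1]].
  destruct (wave_class_partial v2 d Cv2) as [w2 [Cw2 Hw2]].
  exists w1, w2. split; [|split]; auto. intros p Hp. simpl. unfold partial.
  assert (L := locally_shift d p O (openO p Hp)).
  f_equal.
  + rewrite (Derive_ext_loc _ (fun h => v1 (shift d p h))).
    * apply is_derive_unique. auto.
    * generalize L. apply filter_imp. intros h Hh. fold (partials w U). now rewrite IH.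
  + rewrite (Derive_ext_loc _ (fun h => v2 (shift d p h))).
    * apply is_derive_unique. auto.
    * generalize L. apply filter_imp. intros h Hh. fold (partials w U). now rewrite IH.
Qed.

Lemma ex_partial_represented w d p : O p -> ex_partial d (partials w U) p.
Proof.
intros Hp. destruct (partials_represented w) as [v1 [v2 [Cv1 [Cv2 IH]]]].
destruct (wave_class_partial v1 d Cv1) as [w1 [Cw1 Hw1]].
destruct (wave_class_partial v2 d Cv2) as [w2 [Cw2 Hw2]].
assert (L := locally_shift d p O (openO p Hp)).
split.
- apply (ex_derive_ext_loc (fun h => v1 (shift d p h))).
  + generalize L. apply filter_imp. intros h Hh. now rewrite IH.
  + eexists. auto.
- apply (ex_derive_ext_loc (fun h => v2 (shift d p h))).
  + generalize L. apply filter_imp. intros h Hh. now rewrite IH.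
  + eexists. auto.
Qed.

(** The continuous extension of a derivative of [U] up to [E] is its representative in the class,
    which lives on the whole slit plane. *)
Lemma C_n_represented n (D E : spacetime -> Prop) :
  (forall p, D p -> O p) -> (forall p, E p -> slit_time p) -> (forall p, E p -> U p = (u1 p, u2 p)) ->
  C_n n D E U.
Proof.
intros HD HE HUE.
assert (K : forall v1 v2, wave_class v1 -> wave_class v2 -> continuous_on E (fun p => (v1 p, v2 p) : C)).
{ intros v1 v2 Cv1 Cv2 p Hp. apply (filterlim_filter_le_1 (F := locally p)); [apply filter_le_within; apply locally_filter|].
  apply (cont_pair v1 v2); apply wave_class_continuous; auto. }
split; [|split].
- intros p Hp. rewrite (HUE p Hp).
  apply (filterlim_ext_loc (fun p : spacetime => (u1 p, u2 p))).
  + unfold within. apply filter_forall. intros z Hz. now rewrite HUE.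
  + exact (K u1 u2 C1 C2 p Hp).
- intros w d _ p Hp. apply ex_partial_represented. auto.
- intros w _. destruct (partials_represented w) as [v1 [v2 [Cv1 [Cv2 IH]]]].
  exists (fun p => (v1 p, v2 p)). split; [now apply K|]. intros p Hp. symmetry. apply IH. auto.
Qed.
End Represented.
End WaveClass.

(** * Polar coordinates in the wedge *)

Lemma cos_eq_1_small d : - (2 * PI) < d < 2 * PI -> cos d = 1 -> d = 0.
Proof.
intros Hd H. replace d with (2 * (d / 2)) in H by field. rewrite cos_2a_sin in H.
assert (sin (d / 2) = 0) by nra.
destruct (Req_dec (d / 2) 0); [lra|]. exfalso. apply (sin_neq_0_pi (d / 2)); lra.
Qed.

Lemma polar_angle_unique r th th' : 0 < r -> polar r th = polar r th' ->
  - (2 * PI) < th - th' < 2 * PI -> th = th'.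
Proof.
intros Hr H Hd. unfold polar in H. injection H as H1 H2.
apply Rmult_eq_reg_l in H1; [|lra]. apply Rmult_eq_reg_l in H2; [|lra].
enough (th - th' = 0) by lra. apply cos_eq_1_small; auto.
rewrite cos_minus, H1, H2. generalize (sin2_cos2 th'). unfold Rsqr. lra.
Qed.

Lemma abs_pos_neq (y : plane) : y <> (0, 0) -> 0 < Defs.abs y.
Proof.
intros H. destruct (Rle_lt_or_eq_dec 0 _ (abs_nonneg y)); auto.
exfalso. apply H. assert (S := abs_sqr y). rewrite <- e in S. destruct y; simpl in *. f_equal; nra.
Qed.

Lemma polar_neq_0 r th : 0 < r -> polar r th <> (0, 0).
Proof.
intros Hr E. assert (A := abs_polar r th (Rlt_le _ _ Hr)). rewrite E in A.
unfold Defs.abs, dot in A; simpl in A. rewrite Rmult_0_l, Rplus_0_r, sqrt_0 in A. lra.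
Qed.

Lemma angle_spec y : y <> (0, 0) -> y = polar (Defs.abs y) (angle y) /\ 0 < angle y <= 2 * PI.
Proof.
intros H. assert (Hr := abs_pos_neq y H). assert (S := abs_sqr y). assert (HPI := PI_RGT_0).
set (r := Defs.abs y) in *.
assert (B : -1 <= fst y / r <= 1).
{ assert (fst y * fst y <= r * r) by nra. split.
  - apply Rmult_le_reg_r with r; auto. unfold Rdiv. rewrite Rmult_assoc, Rinv_l by lra. nra.
  - apply Rmult_le_reg_r with r; auto. unfold Rdiv. rewrite Rmult_assoc, Rinv_l by lra. nra. }
assert (SN : r * sin (acos (fst y / r)) = Rabs (snd y)).
{ rewrite sin_acos by auto. rewrite <- (sqrt_square r) at 1 by lra.
  rewrite <- sqrt_mult_alt by nra.
  replace (r * r * (1 - (fst y / r)²)) with (snd y * snd y).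
  - apply sqrt_Rsqr_abs.
  - unfold Rsqr. replace (snd y * snd y) with (r * r - fst y * fst y) by lra. field; lra. }
assert (CS : r * cos (acos (fst y / r)) = fst y) by (rewrite cos_acos by auto; field; lra).
assert (AB := acos_bound (fst y / r)).
unfold angle. fold r. destruct (Rlt_dec 0 (snd y)) as [Hy|Hy].
- split.
  + unfold polar. rewrite SN, CS, Rabs_pos_eq by lra. now destruct y.
  + split; [|lra]. destruct (Rle_lt_or_eq_dec 0 _ (proj1 AB)) as [|E]; auto.
    rewrite <- E, sin_0, Rmult_0_r, Rabs_pos_eq in SN; lra.
- split.
  + unfold polar. rewrite cos_minus, sin_minus, cos_2PI, sin_2PI.
    replace (r * (1 * cos (acos (fst y / r)) + 0 * sin (acos (fst y / r)))) with (r * cos (acos (fst y / r))) by ring.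
    replace (r * (0 * cos (acos (fst y / r)) - 1 * sin (acos (fst y / r)))) with (- (r * sin (acos (fst y / r)))) by ring.
    rewrite SN, CS, Rabs_left1 by lra. rewrite Ropp_involutive. now destruct y.
  + lra.
Qed.

Lemma angle_polar r th : 0 < r -> 0 < th <= 2 * PI -> angle (polar r th) = th.
Proof.
intros Hr Hth. destruct (angle_spec (polar r th) (polar_neq_0 r th Hr)) as [H1 H2].
rewrite abs_polar in H1 by lra. symmetry. apply (polar_angle_unique r); auto. lra.
Qed.

Lemma cut_angle_polar al r th : 0 < r -> al < th < al + 2 * PI ->
  slit al (polar r th) /\ cut_angle al (polar r th) = th.
Proof.
intros Hr Hth.
assert (S : slit al (polar r th)).
{ unfold slit. rewrite abs_polar by lra. unfold dot, dir, polar; simpl.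
  replace (cos al * (r * cos th) + sin al * (r * sin th)) with (r * cos (th - al)) by (rewrite cos_minus; ring).
  assert (cos (th - al) < 1); [|nra].
  destruct (Rle_lt_or_eq_dec _ _ (proj2 (COS_bound (th - al)))) as [|E]; auto.
  apply cos_eq_1_small in E; lra. }
split; auto.
assert (P := slit_polar al _ S). rewrite abs_polar in P by lra.
symmetry. apply (polar_angle_unique r); auto. generalize (cut_angle_bounds al (polar r th)). lra.
Qed.

Lemma continuous_polar r th : continuous (polar r) th.
Proof. unfold polar. apply cont_pair; cont. Qed.

Section Wedge.
Variables (phi al : R).
Hypothesis Hphi : 0 < phi < PI.

Definition half_plane (y : plane) : R := fst y * sin phi - snd y * cos phi.

Lemma half_plane_polar r th : half_plane (polar r th) = r * sin (phi - th).
Proof. unfold half_plane, polar; simpl. rewrite sin_minus. ring. Qed.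

(** As phi < PI, the wedge is the intersection of two half-planes; openness of [Q] and the
    description of its closure then reduce to strict and weak inequalities. *)
Lemma W_iff y : W phi y <-> 0 <= snd y /\ 0 <= half_plane y.
Proof.
split.
- intros [r [th [Hr [Hth ->]]]]. rewrite half_plane_polar. simpl. split.
  + apply Rmult_le_pos; auto. apply sin_ge_0; lra.
  + apply Rmult_le_pos; auto. apply sin_ge_0; lra.
- intros [H1 H2]. destruct (classic (y = (0, 0))) as [->|Hy].
  + exists 0, 0. unfold polar. repeat split; try lra. f_equal; ring.
  + destruct (angle_spec y Hy) as [E [A1 A2]]. assert (Hr := abs_pos_neq y Hy).
    set (r := Defs.abs y) in *. set (th := angle y) in *. rewrite E in H1, H2.
    rewrite half_plane_polar in H2. unfold polar in H1; simpl in H1.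
    assert (S1 : 0 <= sin th) by (apply Rmult_le_reg_l with r; lra).
    assert (S2 : 0 <= sin (phi - th)) by (apply Rmult_le_reg_l with r; lra).
    destruct (Req_dec th (2 * PI)) as [E2|E2].
    * exists r, 0. repeat split; try lra. rewrite E, E2. unfold polar.
      now rewrite cos_0, sin_0, cos_2PI, sin_2PI.
    * assert (th <= PI).
      { apply Rnot_lt_le. intros L. generalize (sin_lt_0 th). lra. }
      exists r, th. repeat split; try lra; auto.
      apply Rnot_lt_le. intros L. generalize (sin_lt_0_var (phi - th)). lra.
Qed.

Lemma Q_iff y : Q phi y <-> snd y < 0 \/ half_plane y < 0.
Proof.
unfold Q. rewrite W_iff. split.
- intros H. apply NNPP. intros H'. apply H. lra.
- lra.
Qed.

Lemma continuous_half_plane y : continuous half_plane y.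
Proof. unfold half_plane. destruct y; cont. Qed.

Lemma Q_open y : Q phi y -> locally y (Q phi).
Proof.
intros H. apply Q_iff in H. destruct H as [H|H].
- generalize (locally_continuous_lt (fun y : plane => snd y) y 0 ltac:(destruct y; cont) H).
  apply filter_imp. intros z Hz. apply Q_iff. auto.
- generalize (locally_continuous_lt half_plane y 0 (continuous_half_plane y) H).
  apply filter_imp. intros z Hz. apply Q_iff. auto.
Qed.

Lemma Q_neq_0 y : Q phi y -> y <> (0, 0).
Proof. intros H ->. apply Q_iff in H. unfold half_plane in H; simpl in H. lra. Qed.

Lemma Q_Qbar y : Q phi y -> Qbar phi y.
Proof. intros H P HP. exists y. split; auto. exact (locally_singleton _ _ HP). Qed.

Lemma Q_polar r th : 0 < r -> phi < th < 2 * PI -> Q phi (polar r th).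
Proof.
intros Hr Hth. apply Q_iff. rewrite half_plane_polar. unfold polar; simpl.
destruct (Rlt_or_le th (PI + phi)).
- right. assert (sin (phi - th) < 0) by (apply sin_lt_0_var; lra). nra.
- left. assert (sin th < 0) by (apply sin_lt_0; lra). nra.
Qed.

Lemma Qbar_ineq y : Qbar phi y -> snd y <= 0 \/ half_plane y <= 0.
Proof.
intros H. apply NNPP. intros N.
assert (L : locally y (fun z : plane => 0 < snd z /\ 0 < half_plane z)).
{ apply filter_and.
  - apply (locally_continuous_gt (fun y : plane => snd y)); [destruct y; cont|lra].
  - apply (locally_continuous_gt half_plane); [apply continuous_half_plane|lra]. }
destruct (H _ L) as [z [Hz1 Hz2]]. apply Q_iff in Hz2. lra.
Qed.

Lemma Qbar_angle y : Qbar_punctured phi y -> phi <= angle y <= 2 * PI.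
Proof.
intros [H H0]. destruct (angle_spec y H0) as [E [A1 A2]]. split; auto.
assert (Hr := abs_pos_neq y H0). apply Qbar_ineq in H.
set (r := Defs.abs y) in *. set (th := angle y) in *. rewrite E, half_plane_polar in H.
unfold polar in H; simpl in H.
apply Rnot_lt_le. intros L. destruct H as [H|H].
- assert (0 < sin th) by (apply sin_gt_0; lra). nra.
- assert (0 < sin (phi - th)) by (apply sin_gt_0; lra). nra.
Qed.

Lemma Q_angle y : Q phi y -> phi < angle y < 2 * PI.
Proof.
intros H. assert (H0 := Q_neq_0 y H). destruct (angle_spec y H0) as [E A].
destruct (Qbar_angle y (conj (Q_Qbar y H) H0)) as [B1 B2].
assert (Hr := abs_pos_neq y H0). apply Q_iff in H.
set (r := Defs.abs y) in *. set (th := angle y) in *. rewrite E, half_plane_polar in H.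
unfold polar in H; simpl in H.
split; apply Rnot_le_lt; intros L.
- replace th with phi in H by lra. rewrite Rminus_diag, sin_0 in H.
  assert (0 < sin phi) by (apply sin_gt_0; lra). nra.
- replace th with (2 * PI) in H by lra. rewrite sin_2PI, sin_minus, sin_2PI, cos_2PI in H.
  assert (0 < sin phi) by (apply sin_gt_0; lra). nra.
Qed.

(** There are three distinct candidates, at the quarter points of the available interval; the two
    forbidden angles cannot exclude all of them. *)
Lemma angle_near th e (c d : R) : phi <= th <= 2 * PI -> 0 < e ->
  exists th', phi < th' < 2 * PI /\ Rabs (th' - th) < e /\ th' <> c /\ th' <> d.
Proof.
intros Hth He.
set (lo := Rmax phi (th - e)). set (hi := Rmin (2 * PI) (th + e)).
assert (A1 : phi <= lo) by apply Rmax_l. assert (A2 : th - e <= lo) by apply Rmax_r.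
assert (A3 : hi <= 2 * PI) by apply Rmin_l. assert (A4 : hi <= th + e) by apply Rmin_r.
assert (A5 : lo < hi) by (unfold lo, hi; apply Rmax_lub_lt; apply Rmin_glb_lt; lra).
assert (P : forall k, 0 < k < 1 -> phi < lo + k * (hi - lo) < 2 * PI /\ Rabs (lo + k * (hi - lo) - th) < e).
{ intros k Hk. split; [nra|]. apply Rabs_def1; nra. }
set (p1 := lo + / 4 * (hi - lo)). set (p2 := lo + / 2 * (hi - lo)). set (p3 := lo + 3 / 4 * (hi - lo)).
assert (p1 < p2) by (unfold p1, p2; lra). assert (p2 < p3) by (unfold p3, p2; lra).
destruct (P (/ 4)) as [B1 C1]; [lra|]. destruct (P (/ 2)) as [B2 C2]; [lra|].
destruct (P (3 / 4)) as [B3 C3]; [lra|].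
fold p1 in B1, C1. fold p2 in B2, C2. fold p3 in B3, C3.
destruct (Req_dec p1 c), (Req_dec p1 d), (Req_dec p2 c), (Req_dec p2 d), (Req_dec p3 c), (Req_dec p3 d);
  try lra; first [exists p1; now auto|exists p2; now auto|exists p3; now auto].
Qed.

Lemma Qbar_polar r th : 0 < r -> phi <= th <= 2 * PI -> Qbar_punctured phi (polar r th).
Proof.
intros Hr Hth. split; [|now apply polar_neq_0]. intros P HP.
destruct (continuous_polar r th P HP) as [e He].
destruct (angle_near th e 0 0 Hth (cond_pos e)) as [th' [H1 [H2 _]]].
exists (polar r th'). split; [|now apply Q_polar]. apply He. now apply ball_R_sym.
Qed.

Lemma Q1_polar y : Q1 y -> exists r, 0 < r /\ y = polar r (2 * PI).
Proof.
intros [y1 [H ->]]. exists y1. split; auto. unfold polar. rewrite cos_2PI, sin_2PI. f_equal; ring.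
Qed.

Section Slit.
Hypothesis Hal : 0 < al < phi.

(** The slit lies inside the wedge, so on the closed sector the two determinations of the polar
    angle coincide, although [angle] jumps across the side at 2 PI and [cut_angle] does not. *)
Lemma Qbar_slit y : Qbar_punctured phi y ->
  slit al y /\ cut_angle al y = angle y /\ phi <= angle y <= 2 * PI /\ 0 < Defs.abs y.
Proof.
intros H. assert (A := Qbar_angle y H). destruct H as [H H0].
assert (Hr := abs_pos_neq y H0). destruct (angle_spec y H0) as [E _].
destruct (cut_angle_polar al (Defs.abs y) (angle y) Hr ltac:(lra)) as [S C].
rewrite <- E in S, C. auto.
Qed.
End Slit.
End Wedge.

(** * The complex hyperbolic cotangent and integrals over symmetric intervals *)

Lemma Ccoth_eq q b x : coth_den q b x <> 0 ->
  Ccoth (RtoC q * (RtoC b + Ci * RtoC x))%C = (coth_re q b x, coth_im q b x).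
Proof.
intros HD. rewrite coth_den_eq in HD.
unfold coth_re, coth_im. rewrite coth_den_eq.
replace (2 * q * b) with (q * b + q * b) by ring. replace (2 * q * x) with (2 * (q * x)) by ring.
rewrite sinh_plus, sin_2a.
replace (RtoC q * (RtoC b + Ci * RtoC x))%C with ((q * b, q * x) : C)
  by (unfold RtoC, Ci, Cmult, Cplus; simpl; f_equal; ring).
unfold Ccoth, Cexp, Cdiv, Cinv, Cplus, Cminus, Copp, Cmult; simpl.
rewrite cos_neg, sin_neg.
assert (E1 : exp (q * b) = cosh (q * b) + sinh (q * b)) by (unfold cosh, sinh; field).
assert (E2 : exp (- (q * b)) = cosh (q * b) - sinh (q * b)) by (unfold cosh, sinh; field).
rewrite E1, E2.
assert (C1 := cosh2_sinh2 (q * b)). assert (C2 := cos2_eq (q * x)).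
set (S := sinh (q * b)) in *. set (Ch := cosh (q * b)) in *.
set (s := sin (q * x)) in *. set (c := cos (q * x)) in *.
assert (ND : ((Ch + S) * c + - ((Ch - S) * c)) * (((Ch + S) * c + - ((Ch - S) * c)) * 1)
  + ((Ch + S) * s + - ((Ch - S) * - s)) * (((Ch + S) * s + - ((Ch - S) * - s)) * 1)
  = 2 * (2 * (S * S) + 2 * (s * s))).
{ transitivity (4 * (S * S) * (c * c) + 4 * (Ch * Ch) * (s * s)); [ring|]. rewrite C1, C2. ring. }
rewrite ND. set (D := 2 * (S * S) + 2 * (s * s)) in *.
f_equal.
- transitivity (4 * S * Ch * (c * c + s * s) / (2 * D)); [field; auto|].
  rewrite C2. field; auto.
- transitivity (4 * s * c * (S * S - Ch * Ch) / (2 * D)); [field; auto|].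
  rewrite C1. field; auto.
Qed.

Lemma is_RInt_even (g : R -> R) b : 0 <= b -> (forall s, continuous g s) -> (forall s, g (- s) = g s) ->
  is_RInt g (- b) b (2 * RInt g 0 b).
Proof.
intros Hb Cg Eg.
assert (I : is_RInt g 0 b (RInt g 0 b)).
{ apply (RInt_correct (V := R_CompleteNormedModule)).
  apply (ex_RInt_continuous (V := R_CompleteNormedModule)). intros; apply Cg. }
replace (2 * RInt g 0 b) with (plus (RInt g 0 b) (RInt g 0 b)) by (unfold plus; simpl; ring).
apply (is_RInt_Chasles (V := R_NormedModule)) with 0; auto.
apply (is_RInt_swap (V := R_NormedModule)) in I.
apply (is_RInt_ext (V := R_NormedModule) (fun s => - (1) * (- (g (- s))))).
{ intros s _. rewrite Eg. eqR. ring. }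
evar_last.
- apply (is_RInt_scal (V := R_NormedModule)).
  apply (is_RInt_comp_opp (V := R_NormedModule) g). rewrite Ropp_involutive, Ropp_0. exact I.
- unfold scal, opp; simpl; unfold mult, opp; simpl. ring.
Qed.

Lemma is_RInt_odd (g : R -> R) b : (forall s, continuous g s) -> (forall s, g (- s) = - g s) ->
  is_RInt g (- b) b 0.
Proof.
intros Cg Og.
assert (I : is_RInt g (- b) b (RInt g (- b) b)).
{ apply (RInt_correct (V := R_CompleteNormedModule)).
  apply (ex_RInt_continuous (V := R_CompleteNormedModule)). intros; apply Cg. }
assert (I2 : is_RInt g (- b) b (opp (RInt g (- b) b))).
{ apply (is_RInt_ext (V := R_NormedModule) (fun s => - (g (- s)))).
  { intros s _. rewrite Og. eqR. ring. }
  apply (is_RInt_comp_opp (V := R_NormedModule) g). rewrite Ropp_involutive.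
  now apply (is_RInt_swap (V := R_NormedModule)). }
assert (E := is_RInt_unique _ _ _ _ I2).
replace 0 with (RInt g (- b) b); auto. unfold opp in E; simpl in E. lra.
Qed.

Lemma is_RInt_gen_compact (g : R -> C) (b : R) (l : C) : 0 <= b ->
  is_RInt (V := C_R_NormedModule) g (- b) b l -> (forall s, b <= Rabs s -> g s = 0%C) ->
  is_RInt_gen (V := C_R_NormedModule) g (Rbar_locally m_infty) (Rbar_locally p_infty) l.
Proof.
intros Hb Hl Hz P HP.
apply (Filter_prod _ _ _ (fun s => s < - b) (fun s => b < s)).
- now exists (- b).
- now exists b.
- intros x y Hx Hy. exists l. split; [|exact (locally_singleton _ _ HP)]. simpl.
  assert (Z : forall c d, c <= d -> (d <= - b \/ b <= c) -> is_RInt (V := C_R_NormedModule) g c d zero).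
  { intros c d Hcd H. apply (is_RInt_ext (V := C_R_NormedModule) (fun _ => zero)).
    - intros s. rewrite Rmin_left, Rmax_right by auto. intros Hs. symmetry. apply Hz.
      destruct H; [rewrite Rabs_left1|rewrite Rabs_pos_eq]; lra.
    - evar_last. apply @is_RInt_const. apply (scal_zero_r (V := C_R_NormedModule)). }
  rewrite <- (plus_zero_r (G := C_R_NormedModule) l). rewrite <- (plus_zero_l (G := C_R_NormedModule) l).
  apply (is_RInt_Chasles (V := C_R_NormedModule)) with b.
  + apply (is_RInt_Chasles (V := C_R_NormedModule)) with (- b); auto. apply Z; lra.
  + apply Z; lra.
Qed.

(** * The diffracted wave as a sum of edge waves *)

Definition modulated_re (om : R) (f : R -> C) (s : R) : R :=
  cos (om * s) * Re (f s) + sin (om * s) * Im (f s).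
Definition modulated_im (om : R) (f : R -> C) (s : R) : R :=
  cos (om * s) * Im (f s) + - (1) * (sin (om * s) * Re (f s)).

Section Modulated.
Variables (om : R) (f : R -> C).

Lemma smooth_modulated : smooth f -> smooth_real (modulated_re om f) /\ smooth_real (modulated_im om f).
Proof.
intros Hf. destruct (smooth_real_cos om) as [Hc Hs].
assert (H1 : smooth_real (fun s => Re (f s))) by (intros n s; apply Hf).
assert (H2 : smooth_real (fun s => Im (f s))) by (intros n s; apply Hf).
split.
- apply (smooth_real_plus (fun s => cos (om * s) * Re (f s)) (fun s => sin (om * s) * Im (f s))).
  + now apply (smooth_real_mult (fun s => cos (om * s)) (fun s => Re (f s))).
  + now apply (smooth_real_mult (fun s => sin (om * s)) (fun s => Im (f s))).
- apply (smooth_real_plus (fun s => cos (om * s) * Im (f s)) (fun s => - (1) * (sin (om * s) * Re (f s)))).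
  + now apply (smooth_real_mult (fun s => cos (om * s)) (fun s => Im (f s))).
  + apply (smooth_real_scal (- (1)) (fun s => sin (om * s) * Re (f s))).
    now apply (smooth_real_mult (fun s => sin (om * s)) (fun s => Re (f s))).
Qed.

Lemma causal_modulated : (forall s, s <= 0 -> f s = RtoC 0) ->
  causal (modulated_re om f) /\ causal (modulated_im om f).
Proof.
intros H. split; intros s Hs; unfold modulated_re, modulated_im; rewrite H; auto; simpl; ring.
Qed.

Lemma plane_wave_eq b p :
  plane_wave om f (dir b) p = (plane_real b (modulated_re om f) p, plane_real b (modulated_im om f) p).
Proof.
destruct p as [y t]. unfold plane_wave, plane_real, modulated_re, modulated_im. simpl fst; simpl snd.
set (d := dot (dir b) y). destruct (f (t - d)) as [u v].
unfold Cexp, Ci, RtoC, Cmult; simpl.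
replace (om * (t - d)) with (- (om * (d - t))) by ring. rewrite cos_neg, sin_neg.
replace (0 * (om * (d - t)) - 1 * 0) with 0 by ring.
replace (0 * 0 + 1 * (om * (d - t))) with (om * (d - t)) by ring. rewrite exp_0.
f_equal; ring.
Qed.
End Modulated.

Section Sources.
Variables (phi al : R).
Hypothesis Hphi : 0 < phi < PI.
Hypothesis Hal : 0 < al < phi /\ al < PI / 2.

Lemma Phi_pos : PI < Phi phi < 2 * PI.
Proof. unfold Phi. lra. Qed.
Lemma q_pos : 0 < q phi.
Proof. unfold q. apply Rdiv_lt_0_compat; generalize Phi_pos PI_RGT_0; lra. Qed.
Lemma q_Phi : q phi * (2 * Phi phi) = PI.
Proof. unfold q. field. generalize Phi_pos PI_RGT_0; lra. Qed.

Lemma admissible_of_bound a : al - a >= - (2 * Phi phi) -> al + 2 * PI - a <= 2 * Phi phi ->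
  admissible (q phi) al a.
Proof.
intros H1 H2 th Hth. rewrite <- q_Phi. generalize q_pos; intros. split; [|nra].
replace (- (q phi * (2 * Phi phi))) with (q phi * (- (2 * Phi phi))) by ring.
apply Rmult_lt_compat_l; lra.
Qed.

(** As Phi > PI, the window of length 2 PI seen from each source stays within distance 2 Phi of it,
    where coth (q .) has no further pole. *)
Lemma admissible_sources :
  admissible (q phi) al (2 * PI + al) /\ admissible (q phi) al (theta1 phi al)
  /\ admissible (q phi) al (theta2 al) /\ admissible (q phi) al al.
Proof.
generalize PI_RGT_0; intros. unfold theta1, theta2.
repeat split; apply admissible_of_bound; unfold Phi; lra.
Qed.

Lemma coth_re_periodic b x : coth_re (q phi) b (x - 2 * Phi phi) = coth_re (q phi) b x.
Proof.
unfold coth_re, coth_den. replace (2 * q phi * (x - 2 * Phi phi)) with (2 * q phi * x - 2 * PI)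
 by (rewrite <- q_Phi; ring). rewrite cos_minus, cos_2PI, sin_2PI. f_equal. ring.
Qed.
Lemma coth_im_periodic b x : coth_im (q phi) b (x - 2 * Phi phi) = coth_im (q phi) b x.
Proof.
unfold coth_im, coth_den. replace (2 * q phi * (x - 2 * Phi phi)) with (2 * q phi * x - 2 * PI)
 by (rewrite <- q_Phi; ring). rewrite cos_minus, sin_minus, cos_2PI, sin_2PI. f_equal; [|f_equal]; ring.
Qed.

(** The sum over the poles of [Z_N], one for each of its four hyperbolic cotangents. The signs are
    those of the two [H_N]; with two of each, anything common to the four terms cancels. *)
Definition sum4 (h : R -> R) (th : R) : R :=
  h (th - (2 * PI + al)) + h (th - theta1 phi al) - h (th - theta2 al) - h (th - al).

(** The second hyperbolic cotangent of [Z_N] has its pole at theta1 + 2 Phi; since q (2 Phi) = PI is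
    the period of coth along the imaginary axis, it is moved to theta1, inside the slit plane. *)
Lemma Z_N_eq b th : al < th < al + 2 * PI -> th <> theta1 phi al -> th <> theta2 al ->
  Z_N phi al (RtoC b + Ci * RtoC th)%C
  = (sum4 (fun x => coth_re (q phi) b x) th, sum4 (fun x => coth_im (q phi) b x) th).
Proof.
intros Hth H1 H2. unfold Z_N, H_N.
destruct admissible_sources as [A1 [A2 [A3 A4]]]. assert (Hq := q_pos). assert (HPI := PI_RGT_0).
assert (D : forall a, admissible (q phi) al a -> th - a <> 0 -> coth_den (q phi) b (th - a) <> 0).
{ intros a Ha H. generalize (coth_den_pos_x (q phi) b (th - a) Hq (Ha th Hth) H). lra. }
assert (D2 : coth_den (q phi) b (th - theta1 phi al - 2 * Phi phi) <> 0).
{ replace (coth_den (q phi) b (th - theta1 phi al - 2 * Phi phi)) with (coth_den (q phi) b (th - theta1 phi al)).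
  - apply D; auto; lra.
  - unfold coth_den. replace (2 * q phi * (th - theta1 phi al - 2 * Phi phi)) with (2 * q phi * (th - theta1 phi al) - 2 * PI)
      by (rewrite <- q_Phi; ring). rewrite cos_minus, cos_2PI, sin_2PI. ring. }
assert (E : forall c x, (RtoC b + Ci * RtoC th - Ci * RtoC c + Ci * RtoC x)%C = (RtoC b + Ci * RtoC (th - c + x))%C).
{ intros. unfold RtoC, Ci, Cplus, Cminus, Copp, Cmult; simpl. f_equal; ring. }
replace (RtoC b + Ci * RtoC th - Ci * RtoC (5 * PI / 2) + Ci * RtoC (PI / 2) - Ci * RtoC al)%C
  with (RtoC b + Ci * RtoC (th - (2 * PI + al)))%C
  by (unfold RtoC, Ci, Cplus, Cminus, Copp, Cmult; simpl; apply injective_projections; simpl; field).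
replace (RtoC b + Ci * RtoC th - Ci * RtoC (5 * PI / 2) - Ci * RtoC (3 * PI / 2) + Ci * RtoC al)%C
  with (RtoC b + Ci * RtoC (th - theta1 phi al - 2 * Phi phi))%C
  by (unfold RtoC, Ci, Cplus, Cminus, Copp, Cmult, theta1, Phi; simpl; apply injective_projections; simpl; field).
replace (RtoC b + Ci * RtoC th - Ci * RtoC (PI / 2) + Ci * RtoC (PI / 2) - Ci * RtoC al)%C
  with (RtoC b + Ci * RtoC (th - al))%C
  by (unfold RtoC, Ci, Cplus, Cminus, Copp, Cmult; simpl; apply injective_projections; simpl; field).
replace (RtoC b + Ci * RtoC th - Ci * RtoC (PI / 2) - Ci * RtoC (3 * PI / 2) + Ci * RtoC al)%C
  with (RtoC b + Ci * RtoC (th - theta2 al))%C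
  by (unfold RtoC, Ci, Cplus, Cminus, Copp, Cmult, theta2; simpl; apply injective_projections; simpl; field).
rewrite !Ccoth_eq; auto; try (apply D; auto; lra).
rewrite coth_re_periodic, coth_im_periodic.
unfold sum4, Cplus, Cminus, Copp. apply injective_projections; simpl; ring.
Qed.
End Sources.

Section Diffracted.
Variables (om phi al : R) (f : R -> C).
Hypothesis Hphi : 0 < phi < PI.
Hypothesis Hal : 0 < al < phi /\ al < PI / 2.
Hypothesis Hf : smooth f.
Hypothesis Hf0 : forall s, s <= 0 -> f s = RtoC 0.

Lemma ker_im_00 qq b x : ker_im qq 0 0 b x = coth_im qq b x.
Proof. unfold ker_im, mul_re, mul_im. rewrite !Rmult_0_l, Rplus_0_l, sinh_0, cosh_0, cos_0. ring. Qed.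

Lemma sum4_diffracted F rho th t b : causal F -> (forall s, continuous F s) -> 0 < rho -> 0 <= b -> Rabs t / rho <= b ->
  al < th < al + 2 * PI ->
  RInt (fun s => sum4 phi al (fun x => coth_im (q phi) s x) th * F (t - rho * cosh s)) 0 b
  = sum4 phi al (fun x => diffracted (q phi) 0 0 F rho x t) th.
Proof.
intros CF F0 Hr Hb0 Hb Hth. destruct (admissible_sources phi al Hphi Hal) as [A1 [A2 [A3 A4]]].
assert (Hq := q_pos phi Hphi).
assert (E : forall a, admissible (q phi) al a ->
   is_RInt (fun s => coth_im (q phi) s (th - a) * F (t - rho * cosh s)) 0 b (diffracted (q phi) 0 0 F rho (th - a) t)).
{ intros a Ha. rewrite (diffracted_eq (q phi) Hq F CF F0 0 0 rho (th - a) t b); auto.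
  apply (is_RInt_ext (V := R_NormedModule) (fun s => ker_im (q phi) 0 0 s (th - a) * F (t - rho * cosh s))).
  { intros s _. now rewrite ker_im_00. }
  apply (RInt_correct (V := R_CompleteNormedModule)). apply ex_RInt_diffracted; auto. }
apply is_RInt_unique. unfold sum4.
apply (is_RInt_ext (V := R_NormedModule) (fun s =>
   coth_im (q phi) s (th - (2 * PI + al)) * F (t - rho * cosh s)
 + coth_im (q phi) s (th - theta1 phi al) * F (t - rho * cosh s)
 - coth_im (q phi) s (th - theta2 al) * F (t - rho * cosh s)
 - coth_im (q phi) s (th - al) * F (t - rho * cosh s))).
{ intros s _. eqR. ring. }
apply (is_RInt_minus (V := R_NormedModule)); auto.
apply (is_RInt_minus (V := R_NormedModule)); auto.
apply (is_RInt_plus (V := R_NormedModule)); auto.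
Qed.

(** In the integration variable Re Z_N is odd and Im Z_N is even, while cosh is even; only twice the
    half-line integral of Im Z_N survives, and i times 2 i over 4 Phi gives the factor - q / PI. *)
Lemma u_d_eq y t : regular phi al y ->
  u_d om phi al f (y, t) =
  (- (q phi / PI) * sum4 phi al (fun x => diffracted (q phi) 0 0 (modulated_re om f) (Defs.abs y) x t) (angle y),
   - (q phi / PI) * sum4 phi al (fun x => diffracted (q phi) 0 0 (modulated_im om f) (Defs.abs y) x t) (angle y)).
Proof.
intros [HQ [N1 N2]]. destruct (Qbar_slit phi al Hphi (proj1 Hal) y HQ) as [_ [_ [Hth Hr]]].
assert (Hth' : al < angle y < al + 2 * PI) by lra.
assert (Hq := q_pos phi Hphi). assert (HPI := PI_RGT_0).
destruct (smooth_modulated om f Hf) as [S1 S2]. destruct (causal_modulated om f Hf0) as [K1 K2].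
destruct (admissible_sources phi al Hphi Hal) as [A1 [A2 [A3 A4]]].
unfold u_d. simpl fst; simpl snd. set (rho := Defs.abs y) in *. set (th := angle y) in *.
set (b := Rabs t / rho). assert (Hb : 0 <= b) by (apply Rdiv_le_0_compat; auto; apply Rabs_pos).
set (Fr := modulated_re om f) in *. set (Fi := modulated_im om f) in *.
set (Zr := fun s => sum4 phi al (fun x => coth_re (q phi) s x) th).
set (Zi := fun s => sum4 phi al (fun x => coth_im (q phi) s x) th).
set (c := cos (om * t)). set (sn := sin (om * t)).
assert (DEN : forall s a, admissible (q phi) al a -> th - a <> 0 -> coth_den (q phi) s (th - a) <> 0).
{ intros s a Ha H. generalize (coth_den_pos_x (q phi) s (th - a) Hq (Ha th Hth') H). lra. }
assert (CR : forall s a, admissible (q phi) al a -> th - a <> 0 ->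
   continuous (fun s => coth_re (q phi) s (th - a)) s /\ continuous (fun s => coth_im (q phi) s (th - a)) s).
{ intros s a Ha H. split.
  - apply (cont_coth_re (q phi) (fun s => s) (fun _ => th - a)); [cont|cont|now apply DEN].
  - apply (cont_coth_im (q phi) (fun s => s) (fun _ => th - a)); [cont|cont|now apply DEN]. }
assert (CZ : forall s, continuous Zr s /\ continuous Zi s).
{ intros s. destruct (CR s _ A1 ltac:(lra)) as [B1 C1]. destruct (CR s _ A2 ltac:(lra)) as [B2 C2].
  destruct (CR s _ A3 ltac:(lra)) as [B3 C3]. destruct (CR s _ A4 ltac:(lra)) as [B4 C4].
  split; unfold Zr, Zi, sum4; cont. }
assert (CF : forall F, smooth_real F -> forall s, continuous (fun s => F (t - rho * cosh s)) s).
{ intros F SF s. apply (cont_comp F); [cont|]. exact (smooth_real_continuous F _ SF). }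
assert (ODD : forall s, Zr (- s) = - Zr s).
{ intros s. assert (O : forall x, coth_re (q phi) (- s) x = - coth_re (q phi) s x).
  { intros x. unfold coth_re, coth_den. replace (2 * q phi * - s) with (- (2 * q phi * s)) by ring.
    rewrite sinh_opp, cosh_opp. unfold Rdiv. ring. }
  unfold Zr, sum4. rewrite !O. ring. }
assert (EVEN : forall s, Zi (- s) = Zi s).
{ intros s. assert (O : forall x, coth_im (q phi) (- s) x = coth_im (q phi) s x).
  { intros x. unfold coth_im, coth_den. replace (2 * q phi * - s) with (- (2 * q phi * s)) by ring.
    rewrite cosh_opp. reflexivity. }
  unfold Zi, sum4. now rewrite !O. }
assert (IE : forall F, smooth_real F -> causal F -> is_RInt (fun s => Zi s * F (t - rho * cosh s)) (- b) b
   (2 * sum4 phi al (fun x => diffracted (q phi) 0 0 F rho x t) th)).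
{ intros F SF KF. assert (F0 : forall s, continuous F s) by (intros s; now apply smooth_real_continuous).
  rewrite <- (sum4_diffracted F rho th t b KF F0 Hr Hb (Rle_refl b) Hth').
  apply (is_RInt_even (fun s => Zi s * F (t - rho * cosh s))); auto.
  - intros s. exact (cont_mult Zi (fun s => F (t - rho * cosh s)) s (proj2 (CZ s)) (CF F SF s)).
  - intros s. now rewrite EVEN, cosh_opp. }
assert (IO : forall F, smooth_real F -> is_RInt (fun s => Zr s * F (t - rho * cosh s)) (- b) b 0).
{ intros F SF. apply (is_RInt_odd (fun s => Zr s * F (t - rho * cosh s))).
  - intros s. exact (cont_mult Zr (fun s => F (t - rho * cosh s)) s (proj1 (CZ s)) (CF F SF s)).
  - intros s. rewrite ODD, cosh_opp. ring. }
set (Jr := sum4 phi al (fun x => diffracted (q phi) 0 0 Fr rho x t) th) in *.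
set (Ji := sum4 phi al (fun x => diffracted (q phi) 0 0 Fi rho x t) th) in *.
set (L := (c * (0 - 2 * Ji) - sn * (0 + 2 * Jr), c * (0 + 2 * Jr) + sn * (0 - 2 * Ji)) : C).
(* The integrand is exp(i om t) times (Zr + i Zi) (Fr + i Fi), where the profiles are taken at t -
   rho cosh s; the prefactor exp(-i om t) of [u_d] removes the phase. *)
assert (GE : forall s, (Cexp (Ci * RtoC (om * rho * cosh s)) * Z_N phi al (RtoC s + Ci * RtoC th) * f (t - rho * cosh s)%R)%C
  = (c * (Zr s * Fr (t - rho * cosh s) - Zi s * Fi (t - rho * cosh s))
     - sn * (Zr s * Fi (t - rho * cosh s) + Zi s * Fr (t - rho * cosh s)),
     c * (Zr s * Fi (t - rho * cosh s) + Zi s * Fr (t - rho * cosh s))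
     + sn * (Zr s * Fr (t - rho * cosh s) - Zi s * Fi (t - rho * cosh s)))).
{ intros s. rewrite (Z_N_eq phi al Hphi Hal s th Hth' N1 N2). fold (Zr s) (Zi s).
  unfold Fr, Fi, modulated_re, modulated_im, c, sn.
  replace (om * t) with (om * (t - rho * cosh s) + om * rho * cosh s) by ring.
  rewrite cos_plus, sin_plus.
  set (w := om * (t - rho * cosh s)). set (v := om * rho * cosh s). destruct (f (t - rho * cosh s)) as [u1 u2].
  unfold Cexp, Ci, RtoC, Cmult; simpl.
  replace (0 * v - 1 * 0) with 0 by ring. replace (0 * 0 + 1 * v) with v by ring. rewrite exp_0.
  assert (C := cos2_eq w).
  set (cw := cos w) in *. set (sw := sin w) in *. set (cv := cos v). set (sv := sin v).
  set (zr := Zr s). set (zi := Zi s).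
  assert (C' : cw * cw + sw * sw = 1) by lra.
  f_equal.
  - transitivity ((cw * cw + sw * sw) * (cv * zr * u1 - cv * zi * u2 - sv * zr * u2 - sv * zi * u1)).
    rewrite C'. ring. ring.
  - transitivity ((cw * cw + sw * sw) * (cv * zr * u2 + cv * zi * u1 + sv * zr * u1 - sv * zi * u2)).
    rewrite C'. ring. ring. }
assert (IL : is_RInt_gen (V := C_R_NormedModule) (fun s => (Cexp (Ci * RtoC (om * rho * cosh s)) * Z_N phi al (RtoC s + Ci * RtoC th) * f (t - rho * cosh s)%R)%C)
  (Rbar_locally m_infty) (Rbar_locally p_infty) L).
{ apply (is_RInt_gen_compact _ b); auto.
  - apply (is_RInt_ext (V := C_R_NormedModule) (fun s =>
    (c * (Zr s * Fr (t - rho * cosh s) - Zi s * Fi (t - rho * cosh s))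
     - sn * (Zr s * Fi (t - rho * cosh s) + Zi s * Fr (t - rho * cosh s)),
     c * (Zr s * Fi (t - rho * cosh s) + Zi s * Fr (t - rho * cosh s))
     + sn * (Zr s * Fr (t - rho * cosh s) - Zi s * Fi (t - rho * cosh s))))).
    { intros s _. now rewrite GE. }
    assert (X1 := is_RInt_minus (V := R_NormedModule) _ _ _ _ _ _ (IO Fr S1) (IE Fi S2 K2)).
    assert (X2 := is_RInt_plus (V := R_NormedModule) _ _ _ _ _ _ (IO Fi S2) (IE Fr S1 K1)).
    apply (is_RInt_fct_extend_pair (U := R_NormedModule) (V := R_NormedModule)).
    + apply (is_RInt_minus (V := R_NormedModule)); now apply (is_RInt_scal (V := R_NormedModule)).
    + apply (is_RInt_plus (V := R_NormedModule)); now apply (is_RInt_scal (V := R_NormedModule)).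
  - intros s Hs. rewrite Hf0; [apply Cmult_0_r|].
    assert (Rabs t <= rho * Rabs s).
    { apply Rmult_le_reg_r with (/ rho). now apply Rinv_0_lt_compat.
      replace (rho * Rabs s * / rho) with (Rabs s) by (field; lra). exact Hs. }
    assert (Rabs s <= cosh s).
    { replace (cosh s) with (cosh (Rabs s)). apply cosh_ge. apply Rabs_pos.
      unfold Rabs. destruct (Rcase_abs s); [now rewrite cosh_opp|easy]. }
    generalize (Rle_abs t). nra. }
rewrite (is_RInt_gen_unique (V := C_R_CompleteNormedModule) _ _ IL).
assert (HP := Phi_pos phi Hphi).
replace (q phi / PI) with (/ (2 * Phi phi)) by (unfold q; field; lra).
unfold L, Cexp, Ci, RtoC, Cdiv, Cinv, Copp, Cmult; simpl.
replace (- (0 * (om * t) - 1 * 0)) with 0 by ring.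
replace (- (0 * 0 + 1 * (om * t))) with (- (om * t)) by ring.
rewrite exp_0, cos_neg, sin_neg. fold c sn.
assert (C := cos2_eq (om * t)). fold c sn in C. assert (C' : c * c + sn * sn = 1) by lra.
f_equal.
- transitivity ((c * c + sn * sn) * (- / (2 * Phi phi) * Jr)); [field; lra|]. rewrite C'. ring.
- transitivity ((c * c + sn * sn) * (- / (2 * Phi phi) * Ji)); [field; lra|]. rewrite C'. ring.
Qed.
End Diffracted.

(** * Representation of the total wave *)

Section Representation.
Variables (phi al : R).
Hypothesis Hphi : 0 < phi < PI.
Hypothesis Hal : 0 < al < phi /\ al < PI / 2.

(* The incident wave is the part of the first term cut off at angle 2 PI + al,
   the second reflected wave is the difference of the two terms at theta2. *)
Definition total_real (F : R -> R) (p : spacetime) : R :=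
  image_wave (q phi) al (2 * PI + al) 0 0 F p
  + image_wave (q phi) al (theta1 phi al) 0 0 F p
  - image_wave (q phi) al (theta2 al) 0 0 F p
  - image_wave (q phi) al al 0 0 F p
  + plane_real (theta2 al) F p.

Lemma total_real_class F : causal F -> smooth_real F -> wave_class (q phi) al (total_real F).
Proof.
intros CF SF. destruct (admissible_sources phi al Hphi Hal) as [A1 [A2 [A3 A4]]].
set (A := image_wave (q phi) al (2 * PI + al) 0 0 F). set (B := image_wave (q phi) al (theta1 phi al) 0 0 F).
set (C := image_wave (q phi) al (theta2 al) 0 0 F). set (D := image_wave (q phi) al al 0 0 F).
set (P := plane_real (theta2 al) F).
replace (total_real F) with (fun p => 1 * (1 * (1 * A p + 1 * B p) + (-1) * (1 * C p + 1 * D p)) + 1 * P p).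
- apply (wave_class_lin (q phi) al 1 (fun p => 1 * (1 * A p + 1 * B p) + (-1) * (1 * C p + 1 * D p)) 1 P);
    [|now apply wave_class_plane].
  apply (wave_class_lin (q phi) al 1 (fun p => 1 * A p + 1 * B p) (-1) (fun p => 1 * C p + 1 * D p)).
  + apply (wave_class_lin (q phi) al 1 A 1 B); now apply wave_class_image.
  + apply (wave_class_lin (q phi) al 1 C 1 D); now apply wave_class_image.
- apply functional_extensionality; intros p. unfold total_real. fold A B C D P. ring.
Qed.

Section Source.
Variables (om : R) (f : R -> C).
Hypothesis Hf : smooth f.
Hypothesis Hf0 : forall s, s <= 0 -> f s = RtoC 0.

Lemma dot_dir_polar b y : dot (dir b) (polar (Defs.abs y) (angle y)) = Defs.abs y * cos (angle y - b).
Proof. unfold dot, dir, polar; simpl. rewrite cos_minus. ring. Qed.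

Definition cut_reflection (F : R -> R) (y : plane) (t : R) : R :=
  if Rle_dec (angle y) (theta1 phi al) then plane_real (theta1 phi al) F (y, t)
  else if Rle_dec (theta2 al) (angle y) then plane_real (theta2 al) F (y, t) else 0.

(** Throughout the sector the plane wave of the source at 2 PI + al is present and that of the
    source at al is absent; the source at theta1 contributes exactly the first reflected wave. *)
Lemma total_real_regular F y t : regular phi al y ->
  total_real F (y, t) = plane_real al F (y, t) + cut_reflection F y t
    - q phi / PI * sum4 phi al (fun x => diffracted (q phi) 0 0 F (Defs.abs y) x t) (angle y).
Proof.
intros [HQ [N1 N2]]. destruct (Qbar_slit phi al Hphi (proj1 Hal) y HQ) as [_ [E [Hth Hr]]].
destruct (angle_spec y (proj2 HQ)) as [P _]. assert (HPI := PI_RGT_0).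
assert (PR : forall b, F (t - Defs.abs y * cos (angle y - b)) = plane_real b F (y, t)).
{ intros b. unfold plane_real; simpl. now rewrite <- dot_dir_polar, <- P. }
unfold total_real, image_wave, edge_wave, sum4; simpl fst; simpl snd.
rewrite E, !PR, cos_0.
replace (plane_real (2 * PI + al) F (y, t)) with (plane_real al F (y, t)).
2:{ rewrite <- !PR. f_equal. replace (angle y - (2 * PI + al)) with ((angle y - al) - 2 * PI) by ring.
    rewrite (cos_minus _ (2 * PI)), cos_2PI, sin_2PI. ring. }
replace (step (angle y - (2 * PI + al))) with 1.
2:{ unfold step. destruct (Rlt_dec (angle y - (2 * PI + al)) 0); lra. }
replace (step (angle y - al)) with 0.
2:{ unfold step. destruct (Rlt_dec (angle y - al) 0); [lra|]. destruct (Req_EM_T (angle y - al) 0); lra. }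
unfold cut_reflection.
assert (theta1 phi al < theta2 al) by (unfold theta1, theta2; lra).
unfold step. destruct (Rle_dec (angle y) (theta1 phi al)).
- destruct (Rlt_dec (angle y - theta1 phi al) 0); [|lra].
  destruct (Rlt_dec (angle y - theta2 al) 0); [|lra]. ring.
- destruct (Rlt_dec (angle y - theta1 phi al) 0); [lra|].
  destruct (Req_EM_T (angle y - theta1 phi al) 0); [lra|].
  destruct (Rle_dec (theta2 al) (angle y)).
  + destruct (Rlt_dec (angle y - theta2 al) 0); [lra|].
    destruct (Req_EM_T (angle y - theta2 al) 0); [lra|]. ring.
  + destruct (Rlt_dec (angle y - theta2 al) 0); [|lra]. ring.
Qed.

Lemma wave_sum_eq y t : regular phi al y ->
  wave_sum om phi al f (y, t) = (total_real (modulated_re om f) (y, t), total_real (modulated_im om f) (y, t)).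
Proof.
intros H. rewrite !total_real_regular by auto.
unfold wave_sum, u_in. rewrite plane_wave_eq, (u_d_eq om phi al f Hphi Hal Hf Hf0 y t H).
replace (u_r om phi al f (y, t)) with (cut_reflection (modulated_re om f) y t, cut_reflection (modulated_im om f) y t).
2:{ unfold u_r, cut_reflection. simpl fst. rewrite !plane_wave_eq.
    destruct (Rle_dec (angle y) (theta1 phi al)); auto.
    destruct (Rle_dec (theta2 al) (angle y)); auto. }
apply injective_projections; simpl; ring.
Qed.

(** Points of [Q] accumulate at every point of the closure, and a small rotation leaves the two
    critical rays. So the filter in [total_wave] is proper and its limit unique. *)
Lemma regular_near y : Qbar phi y -> forall P, locally y P -> exists z, P z /\ regular phi al z.
Proof.
intros HQ P HP. assert (exists z, P z /\ Qbar_punctured phi z /\ locally z P) as [z [Hz [HzQ LP]]].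
{ apply locally_locally in HP. destruct (HQ _ HP) as [z [Hz Qz]]. exists z.
  split; [exact (locally_singleton _ _ Hz)|]. split; auto.
  split. now apply Q_Qbar. now apply (Q_neq_0 phi). }
destruct (Qbar_slit phi al Hphi (proj1 Hal) z HzQ) as [_ [_ [Hth Hr]]].
destruct (angle_spec z (proj2 HzQ)) as [E _].
rewrite E in LP. destruct (continuous_polar (Defs.abs z) (angle z) P LP) as [e He].
destruct (angle_near phi Hphi (angle z) e (theta1 phi al) (theta2 al) Hth (cond_pos e)) as [th' [H1 [H2 [H3 H4]]]].
exists (polar (Defs.abs z) th'). split; [apply He; now apply ball_R_sym|].
split; [|rewrite angle_polar by lra; auto].
apply Qbar_polar; auto; lra.
Qed.

Lemma proper_regular (p : spacetime) : Qbar phi (fst p) ->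
  ProperFilter' (within (cyl (regular phi al) all_times) (locally p)).
Proof.
intros HQ. constructor; [|apply within_filter; exact (filter_filter (ProperFilter := locally_filter (T := prod_UniformSpace (prod_UniformSpace R_UniformSpace R_UniformSpace) R_UniformSpace) p))].
unfold within. intros [e He].
destruct (regular_near (fst p) HQ (ball (fst p) e)) as [z [Hz Rz]]; [now exists e|].
apply (He (z, snd p)).
- split; [exact Hz|apply ball_center].
- split; [exact Rz|exact I].
Qed.

Lemma total_wave_limit (p : spacetime) (l : C) : Qbar phi (fst p) -> ~ regular phi al (fst p) ->
  filterlim (wave_sum om phi al f) (within (cyl (regular phi al) all_times) (locally p)) (locally l) ->
  total_wave om phi al f p = l.
Proof.
intros HQ HN HL. unfold total_wave.
destruct (excluded_middle_informative (regular phi al (fst p))); [contradiction|].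
apply (iota_filterlim_locally (V := C_R_CompleteNormedModule) (FF := proper_regular p HQ)). exact HL.
Qed.

(** On a critical ray the value is the limit of [wave_sum]; it equals [total_real] because edge
    waves are continuous across their rays. *)
Lemma total_wave_eq (p : spacetime) : Qbar_punctured phi (fst p) ->
  total_wave om phi al f p = (total_real (modulated_re om f) p, total_real (modulated_im om f) p).
Proof.
intros HQ. destruct (classic (regular phi al (fst p))) as [H|H].
- unfold total_wave. destruct (excluded_middle_informative (regular phi al (fst p))); [|contradiction].
  destruct p as [y t]. now apply wave_sum_eq.
- apply total_wave_limit; auto. apply HQ.
  assert (FW := filter_filter' (ProperFilter' := proper_regular p (proj1 HQ))).
  apply (filterlim_ext_loc (fun p : spacetime => (total_real (modulated_re om f) p, total_real (modulated_im om f) p))).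
  + unfold within. apply filter_forall. intros [y t] [Hy _]. symmetry. now apply wave_sum_eq.
  + apply (filterlim_filter_le_1 (F := locally p)); [apply filter_le_within; apply locally_filter|].
    destruct (smooth_modulated om f Hf) as [S1 S2]. destruct (causal_modulated om f Hf0) as [K1 K2].
    destruct (Qbar_slit phi al Hphi (proj1 Hal) (fst p) HQ) as [Sl _].
    apply (cont_pair (total_real (modulated_re om f)) (total_real (modulated_im om f)));
      apply (wave_class_continuous (q phi) al (q_pos phi Hphi)); auto; now apply total_real_class.
Qed.
End Source.
End Representation.

(** Uniform in [c], which will be the unbounded cot (q x): for k >= 1/2 one has |c| / (1 + k^2 c^2)
    <= |c| / (1 + c^2 / 4) <= 1. *)
Lemma atan_scal_diff c k k' : / 2 <= k -> k <= k' -> k' <= 1 ->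
  Rabs (atan (k' * c) - atan (k * c)) <= k' - k.
Proof.
intros H1 H2 H3.
destruct (MVT_gen (fun k => atan (k * c)) k k' (fun k => c / (1 + (k * c) * (k * c)))) as [z [Hz E]].
- intros x _. evar_last.
  + apply (is_derive_comp atan (fun k => k * c)). apply is_derive_Reals. apply derivable_pt_lim_atan.
    auto_derive; auto.
  + unfold scal; simpl; unfold mult; simpl. field.
    repeat split; generalize (Rle_0_sqr (x * c)); unfold Rsqr; intros; nra.
- intros x _. apply continuity_pt_cont. apply (cont_comp atan). cont.
  apply (ex_derive_continuous (V := R_NormedModule)). eexists. apply is_derive_Reals. apply derivable_pt_lim_atan.
- rewrite Rmin_left, Rmax_right in Hz by lra. rewrite E, Rabs_mult, (Rabs_pos_eq (k' - k)) by lra.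
  rewrite <- (Rmult_1_l (k' - k)) at 2. apply Rmult_le_compat_r; [lra|].
  assert (P : 0 < 1 + (z * c) * (z * c)) by (generalize (Rle_0_sqr (z * c)); unfold Rsqr; lra).
  unfold Rdiv. rewrite Rabs_mult, Rabs_inv, (Rabs_pos_eq (1 + _)) by lra.
  apply Rmult_le_reg_r with (1 + (z * c) * (z * c)); auto.
  rewrite Rmult_assoc, Rinv_l by lra.
  assert (0 <= Rabs c) by apply Rabs_pos.
  assert (Rabs c * Rabs c = c * c) by (rewrite <- Rabs_mult; apply Rabs_pos_eq; apply Rle_0_sqr).
  replace (z * c * (z * c)) with (z * z * (c * c)) by ring. rewrite <- H0.
  assert (/ 4 <= z * z) by nra. assert (0 <= (Rabs c - 2) * (Rabs c - 2)) by apply Rle_0_sqr. nra.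
Qed.

(** * Estimates near the vertex *)

Section EdgeEstimates.
Variable q : R.
Hypothesis Hq : 0 < q.

(** For fixed [x] the kernel keeps one sign, so the integral of its absolute value is known in
    closed form. *)
Lemma coth_im_sign x : - PI < q * x < PI ->
  exists sg, (sg = 1 \/ sg = -1) /\ forall s, 0 < s -> Rabs (coth_im q s x) = sg * coth_im q s x.
Proof.
intros Hx. destruct (Rle_lt_dec 0 (sin (2 * q * x))) as [H|H].
- exists (-1). split; auto. intros s Hs. assert (D := coth_den_pos_b q s x Hq Hs).
  rewrite Rabs_left1; [ring|]. unfold coth_im, Rdiv.
  assert (0 < / coth_den q s x) by now apply Rinv_0_lt_compat. nra.
- exists 1. split; auto. intros s Hs. assert (D := coth_den_pos_b q s x Hq Hs).
  rewrite Rabs_pos_eq; [ring|]. unfold coth_im. apply Rdiv_le_0_compat; lra.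
Qed.

(** The mass of the kernel on [[a, b]] is the increment of [angular] divided by q. It is bounded
    uniformly in [x], although the kernel itself is unbounded near the ray. *)
Lemma RInt_coth_im_bound x a b (h : R -> R) M : - PI < q * x < PI -> 0 <= a <= b ->
  ex_RInt (fun s => coth_im q s x * h s) a b -> (forall s, a < s < b -> Rabs (h s) <= M) ->
  Rabs (RInt (fun s => coth_im q s x * h s) a b) <= M * (/ q * Rabs (angular q b x - angular q a x)).
Proof.
intros Hx Hab Hex HM. destruct (coth_im_sign x Hx) as [sg [Hsg Hs]].
assert (I0 : is_RInt (fun s => coth_im q s x) a b (- / q * angular q b x - - / q * angular q a x)).
{ assert (Ia := RInt_coth_im q Hq a x Hx (proj1 Hab)).
  assert (Ib := RInt_coth_im q Hq b x Hx ltac:(lra)).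
  apply (is_RInt_swap (V := R_NormedModule)) in Ia.
  assert (Ic := is_RInt_Chasles (V := R_NormedModule) _ _ _ _ _ _ Ia Ib).
  evar_last. exact Ic. unfold plus, opp; simpl. ring. }
set (J := - / q * angular q b x - - / q * angular q a x) in *.
assert (IA : is_RInt (fun s => Rabs (coth_im q s x)) a b (sg * J)).
{ apply (is_RInt_ext (V := R_NormedModule) (fun s => sg * coth_im q s x)).
  { intros s. rewrite Rmin_left by lra. intros Hs'. symmetry. apply Hs. lra. }
  now apply (is_RInt_scal (V := R_NormedModule)). }
assert (IB : forall k, is_RInt (fun s => k * Rabs (coth_im q s x)) a b (k * (sg * J))).
{ intros k. now apply (is_RInt_scal (V := R_NormedModule)). }
assert (JJ : sg * J <= / q * Rabs (angular q b x - angular q a x)).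
{ replace J with (- / q * (angular q b x - angular q a x)) by (unfold J; ring).
  assert (0 < / q) by now apply Rinv_0_lt_compat.
  generalize (Rle_abs (angular q b x - angular q a x)) (Rle_abs (- (angular q b x - angular q a x))).
  rewrite Rabs_Ropp. set (dd := angular q b x - angular q a x). intros B1 B2.
  destruct Hsg as [-> | ->]; nra. }
destruct (Rle_lt_or_eq_dec _ _ (proj2 Hab)) as [L|E].
2:{ assert (RInt (fun s => coth_im q s x * h s) a b = 0) as ->
      by (rewrite E; apply (RInt_point (V := R_CompleteNormedModule))).
    rewrite E, Rminus_diag, Rabs_R0, !Rmult_0_r. lra. }
assert (M0 : 0 <= M) by (apply Rle_trans with (2 := HM ((a + b) / 2) ltac:(lra)); apply Rabs_pos).
apply Rle_trans with (M * (sg * J)); [|now apply Rmult_le_compat_l].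
assert (B : forall s, a < s < b -> Rabs (coth_im q s x * h s) <= M * Rabs (coth_im q s x)).
{ intros s Hs'. rewrite Rabs_mult, Rmult_comm. apply Rmult_le_compat_r; [apply Rabs_pos|auto]. }
apply Rabs_le. split.
- replace (- (M * (sg * J))) with (- M * (sg * J)) by ring.
  rewrite <- (is_RInt_unique _ _ _ _ (IB (- M))). apply RInt_le; auto; try lra.
  + eexists; apply IB.
  + intros s Hs'. specialize (B s Hs'). apply Rabs_le_between in B. lra.
- rewrite <- (is_RInt_unique _ _ _ _ (IB M)). apply RInt_le; auto; try lra.
  + eexists; apply IB.
  + intros s Hs'. specialize (B s Hs'). apply Rabs_le_between in B. lra.
Qed.

Lemma RInt_coth_im_bound_0 x b (h : R -> R) M : - PI < q * x < PI -> 0 <= b -> 0 <= M ->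
  ex_RInt (fun s => coth_im q s x * h s) 0 b -> (forall s, 0 < s < b -> Rabs (h s) <= M) ->
  Rabs (RInt (fun s => coth_im q s x * h s) 0 b) <= M * (/ q * (PI / 2)).
Proof.
intros Hx Hb HM0 Hex HM. apply Rle_trans with (1 := RInt_coth_im_bound x 0 b h M Hx ltac:(lra) Hex HM).
apply Rmult_le_compat_l; auto. apply Rmult_le_compat_l; [left; now apply Rinv_0_lt_compat|].
replace (angular q 0 x) with 0; [rewrite Rminus_0_r; apply angular_bound|].
unfold angular. destruct (Req_EM_T x 0); auto. rewrite Rmult_0_r, sinh_0. unfold Rdiv. rewrite !Rmult_0_l, atan_0. reflexivity.
Qed.

Definition tanh_q (b : R) : R := sinh (q * b) / cosh (q * b).

Lemma angular_tanh b x : x <> 0 -> angular q b x = atan (tanh_q b * (cos (q * x) / sin (q * x))).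
Proof.
intros H. unfold angular. destruct (Req_EM_T x 0); [contradiction|]. f_equal. unfold tanh_q.
unfold Rdiv. rewrite Rinv_mult. ring.
Qed.

Lemma tanh_q_incr a b : 0 <= a <= b -> tanh_q a <= tanh_q b.
Proof.
intros H. unfold tanh_q. assert (Ca := cosh_ge_1 (q * a)). assert (Cb := cosh_ge_1 (q * b)).
assert (0 <= sinh (q * b - q * a)).
{ assert (0 <= q * b - q * a) by nra. generalize (sinh_ge _ H0). lra. }
unfold Rminus in H0. rewrite sinh_plus, sinh_opp, cosh_opp in H0.
apply Rmult_le_reg_r with (cosh (q * a) * cosh (q * b)); [nra|].
replace (sinh (q * a) / cosh (q * a) * (cosh (q * a) * cosh (q * b))) with (sinh (q * a) * cosh (q * b)) by (field; lra).
replace (sinh (q * b) / cosh (q * b) * (cosh (q * a) * cosh (q * b))) with (sinh (q * b) * cosh (q * a)) by (field; lra).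
lra.
Qed.

Lemma tanh_q_bounds e : 0 < e -> exists B, 0 < B /\ forall b, B <= b -> / 2 <= tanh_q b /\ 1 - e <= tanh_q b <= 1.
Proof.
(* From 1 - tanh u = exp(-u) / cosh u <= 1 / u: the summand 2 gives the bound 1/2, the summand 1 / e
   the bound 1 - e. *)
intros He. exists ((2 + / e) / q).
assert (0 < / e) by now apply Rinv_0_lt_compat.
split; [apply Rdiv_lt_0_compat; lra|]. intros b Hb.
assert (Hu : 2 + / e <= q * b).
{ apply Rmult_le_compat_l with (r := q) in Hb; [|lra].
  replace (q * ((2 + / e) / q)) with (2 + / e) in Hb by (field; lra). exact Hb. }
assert (G := cosh_ge (q * b) ltac:(lra)).
assert (E : 1 - tanh_q b = exp (- (q * b)) / cosh (q * b)).
{ unfold tanh_q. replace (exp (- (q * b))) with (cosh (q * b) - sinh (q * b)) by (unfold cosh, sinh; field).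
  field. generalize (cosh_ge_1 (q * b)); lra. }
assert (X : 0 < exp (- (q * b)) <= 1).
{ split; [apply exp_pos|]. rewrite <- exp_0. apply Rlt_le, exp_increasing. lra. }
assert (Y : 0 <= 1 - tanh_q b <= / (q * b)).
{ rewrite E. split; [apply Rdiv_le_0_compat; lra|].
  apply Rmult_le_reg_r with (cosh (q * b)); [lra|]. unfold Rdiv. rewrite Rmult_assoc, Rinv_l by lra.
  assert (0 < / (q * b)) by (apply Rinv_0_lt_compat; lra).
  assert (/ (q * b) * (q * b) <= / (q * b) * cosh (q * b)) by (apply Rmult_le_compat_l; lra).
  rewrite Rinv_l in H1 by lra. lra. }
assert (/ (q * b) <= / 2) by (apply Rinv_le_contravar; lra).
assert (/ (q * b) <= e).
{ rewrite <- (Rinv_inv e). apply Rinv_le_contravar; lra. }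
lra.
Qed.

(** The limit of [step_angular] as b tends to infinity, where tanh (q b) becomes 1. The result is
    affine in [x], so that the direction drops out of the signed sum over the four sources. *)
Lemma step_atan_cot x : - PI < q * x < PI -> x <> 0 ->
  step x + atan (cos (q * x) / sin (q * x)) / PI = / 2 - q * x / PI.
Proof.
assert (HPI := PI_RGT_0).
assert (P : forall u, 0 < u < PI -> atan (cos u / sin u) = PI / 2 - u).
{ intros u Hu. rewrite <- (atan_tan (PI / 2 - u)) by lra. f_equal. unfold tan.
  rewrite sin_minus, cos_minus, sin_PI2, cos_PI2. f_equal; [|f_equal]; ring. }
intros Hx H0. unfold step. destruct (Rlt_dec x 0).
- replace (cos (q * x) / sin (q * x)) with (- (cos (- (q * x)) / sin (- (q * x)))).
  + rewrite atan_opp, P; [field; lra|]. nra.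
  + rewrite cos_neg, sin_neg. field.
    apply sin_neq_0_pi; auto. apply Rmult_integral_contrapositive_currified; lra.
- destruct (Req_EM_T x 0); [contradiction|]. rewrite P; [field; lra|]. split; [|lra].
  apply Rmult_lt_0_compat; lra.
Qed.

Section Wave.
Variables (F : R -> R) (C : R).
Hypothesis CF : causal F.
Hypothesis F0 : forall s, continuous F s.
Hypothesis HC : forall s, Rabs (F s) <= C.

Lemma step_bound x : 0 <= step x <= 1.
Proof. unfold step. destruct (Rlt_dec x 0); [lra|]. destruct (Req_EM_T x 0); lra. Qed.

Lemma diffracted_00 rho x t b : - PI < q * x < PI -> 0 < rho -> Rabs t / rho <= b ->
  diffracted q 0 0 F rho x t = RInt (fun s => coth_im q s x * F (t - rho * cosh s)) 0 b
  /\ ex_RInt (fun s => coth_im q s x * F (t - rho * cosh s)) 0 b.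
Proof.
intros Hx Hr Hb.
assert (0 <= Rabs t / rho) by (apply Rdiv_le_0_compat; auto; apply Rabs_pos).
rewrite (diffracted_eq q Hq F CF F0 0 0 rho x t b) by auto.
assert (E := ex_RInt_diffracted q Hq F F0 0 0 rho x t b Hx ltac:(lra)).
split.
- apply RInt_ext. intros s _. now rewrite ker_im_00.
- revert E. apply ex_RInt_ext. intros s _. now rewrite ker_im_00.
Qed.

Lemma edge_wave_bound rho x t : - PI < q * x < PI -> 0 < rho ->
  Rabs (edge_wave q 0 0 F rho x t) <= 2 * C.
Proof.
intros Hx Hr. assert (HPI := PI_RGT_0).
destruct (diffracted_00 rho x t _ Hx Hr (Rle_refl _)) as [E Ex].
assert (C0 : 0 <= C) by (apply Rle_trans with (2 := HC 0); apply Rabs_pos).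
assert (Hb : 0 <= Rabs t / rho) by (apply Rdiv_le_0_compat; auto; apply Rabs_pos).
unfold edge_wave. rewrite cos_0, Rmult_1_r.
assert (B : Rabs (diffracted q 0 0 F rho x t) <= C * (/ q * (PI / 2))).
{ rewrite E. apply (RInt_coth_im_bound_0 x _ (fun s => F (t - rho * cosh s))); auto. }
unfold Rminus at 1. apply Rle_trans with (1 := Rabs_triang _ _). rewrite Rabs_Ropp.
replace (2 * C) with (1 * C + C) by ring. apply Rplus_le_compat.
- rewrite Rabs_mult. apply Rmult_le_compat; try apply Rabs_pos; auto.
  rewrite Rabs_pos_eq; apply step_bound.
- rewrite Rabs_mult. rewrite (Rabs_pos_eq (q / PI)) by (apply Rdiv_le_0_compat; lra).
  apply Rle_trans with (q / PI * (C * (/ q * (PI / 2)))).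
  + apply Rmult_le_compat_l; auto. apply Rdiv_le_0_compat; lra.
  + assert (q / PI * (C * (/ q * (PI / 2))) = C / 2) by (field; lra). lra.
Qed.

(** For small rho, F (t - rho cosh b) is close to [F t0] on [[0, B]], while the mass of the kernel
    beyond [B] is at most k / q, uniformly in [x] by [atan_scal_diff]. The limit of a single edge
    wave still depends on the direction. *)
Lemma edge_wave_vertex t0 e : 0 < e -> exists d, 0 < d /\ forall rho x t,
  0 < rho < d -> - PI < q * x < PI -> Rabs (t - t0) < d ->
  Rabs (edge_wave q 0 0 F rho x t - (/ 2 - q * x / PI) * F t0) < e.
Proof.
intros He. assert (HPI := PI_RGT_0). assert (PG2 := PI2_1).
assert (C0 : 0 <= C) by (apply Rle_trans with (2 := HC 0); apply Rabs_pos).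
set (k := e / (8 * (C + 1))).
assert (Hk : 0 < k) by (apply Rdiv_lt_0_compat; lra).
assert (HkC : k * C <= e / 8).
{ apply Rle_trans with (k * (C + 1)); [nra|]. right. unfold k. field. lra. }
destruct (tanh_q_bounds k Hk) as [B [HB HT]].
destruct (continuous_locally_lt F t0 (e / 8) (F0 t0) ltac:(lra)) as [d0 Hd0].
assert (CB := cosh_ge_1 (q * B)). assert (CB' := cosh_ge_1 B).
(* So that |t - t0| + rho cosh B < d0. *)
set (d := d0 / (2 + cosh B)).
assert (Hd : 0 < d) by (apply Rdiv_lt_0_compat; [apply cond_pos|lra]).
exists d. split; auto. intros rho x t Hr Hx Ht.
assert (NEAR : forall c, Rabs c <= cosh B -> Rabs (F (t - rho * c) - F t0) <= e / 8).
{ intros c Hc. left. apply Hd0. apply ball_R_sym.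
  replace (t - rho * c - t0) with ((t - t0) + - (rho * c)) by ring.
  apply Rle_lt_trans with (1 := Rabs_triang _ _). rewrite Rabs_Ropp, Rabs_mult, (Rabs_pos_eq rho) by lra.
  apply Rle_lt_trans with (Rabs (t - t0) + d * cosh B).
  - apply Rplus_le_compat_l. apply Rmult_le_compat; try lra. apply Rabs_pos.
  - apply Rlt_le_trans with (d * (1 + cosh B)); [lra|].
    apply Rle_trans with (d * (2 + cosh B)); [nra|]. right. unfold d. field. lra. }
set (b := Rmax B (Rabs t / rho)).
assert (HBb : B <= b) by apply Rmax_l.
destruct (diffracted_00 rho x t b Hx (proj1 Hr) (Rmax_r _ _)) as [E Ex].
unfold edge_wave. rewrite cos_0, Rmult_1_r, E.
assert (EXC : ex_RInt (fun s => coth_im q s x) 0 b) by (eexists; apply RInt_coth_im; auto; lra).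
set (h := fun s => F (t - rho * cosh s) - F t0).
assert (EXh : ex_RInt (fun s => coth_im q s x * h s) 0 b).
{ apply (ex_RInt_ext (fun s => coth_im q s x * F (t - rho * cosh s) - coth_im q s x * F t0)).
  { intros s _. unfold h. eqR. ring. }
  apply (ex_RInt_minus (V := R_NormedModule)); auto.
  eexists. apply (is_RInt_mult_r (fun s => coth_im q s x) 0 b (- / q * angular q b x)). apply RInt_coth_im; auto; lra. }
assert (SP : RInt (fun s => coth_im q s x * F (t - rho * cosh s)) 0 b
  = RInt (fun s => coth_im q s x * h s) 0 b + (- / q * angular q b x) * F t0).
{ apply is_RInt_unique.
  apply (is_RInt_ext (V := R_NormedModule) (fun s => coth_im q s x * h s + coth_im q s x * F t0)).
  { intros s _. unfold h. eqR. ring. }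
  apply (is_RInt_plus (V := R_NormedModule)).
  - now apply (RInt_correct (V := R_CompleteNormedModule)).
  - apply is_RInt_mult_r. apply RInt_coth_im; auto; lra. }
rewrite SP.
assert (EX1 : ex_RInt (fun s => coth_im q s x * h s) 0 B) by (apply (ex_RInt_sub _ 0 b); auto; lra).
assert (EX2 : ex_RInt (fun s => coth_im q s x * h s) B b) by (apply (ex_RInt_sub _ 0 b); auto; lra).
assert (B1 : Rabs (RInt (fun s => coth_im q s x * h s) 0 B) <= e / 8 * (/ q * (PI / 2))).
{ apply RInt_coth_im_bound_0; auto; try lra. intros s Hs. apply NEAR.
  rewrite Rabs_pos_eq by (generalize (cosh_ge_1 s); lra). apply cosh_incr. rewrite !Rabs_pos_eq; lra. }
assert (TB := HT B (Rle_refl B)). assert (Tb := HT b HBb).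
assert (AD : Rabs (angular q b x - angular q B x) <= k).
{ destruct (Req_dec x 0) as [->|H0].
  - unfold angular. destruct (Req_EM_T 0 0); [|lra]. rewrite Rminus_0_r, Rabs_R0. lra.
  - rewrite !angular_tanh by auto. apply Rle_trans with (tanh_q b - tanh_q B); [|lra].
    apply atan_scal_diff; try lra. apply tanh_q_incr; lra. }
assert (B2 : Rabs (RInt (fun s => coth_im q s x * h s) B b) <= 2 * C * (/ q * k)).
{ apply Rle_trans with (2 * C * (/ q * Rabs (angular q b x - angular q B x))).
  - apply RInt_coth_im_bound; auto; try lra. intros s _. unfold h.
    unfold Rminus at 1. apply Rle_trans with (1 := Rabs_triang _ _). rewrite Rabs_Ropp.
    generalize (HC (t - rho * cosh s)) (HC t0). lra.
  - apply Rmult_le_compat_l; [lra|]. apply Rmult_le_compat_l; auto. left; now apply Rinv_0_lt_compat. }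
assert (B3 : Rabs (step x + angular q b x / PI - (/ 2 - q * x / PI)) <= k / PI).
{ destruct (Req_dec x 0) as [->|H0].
  - unfold angular, step. destruct (Req_EM_T 0 0); [|lra]. destruct (Rlt_dec 0 0); [lra|].
    replace (/ 2 + 0 / PI - (/ 2 - q * 0 / PI)) with 0 by (field; lra). rewrite Rabs_R0.
    apply Rdiv_le_0_compat; lra.
  - rewrite <- step_atan_cot, angular_tanh by auto.
    replace (step x + atan (tanh_q b * (cos (q * x) / sin (q * x))) / PI - (step x + atan (cos (q * x) / sin (q * x)) / PI))
      with (- ((atan (1 * (cos (q * x) / sin (q * x))) - atan (tanh_q b * (cos (q * x) / sin (q * x)))) / PI))
      by (rewrite Rmult_1_l; field; lra).
    rewrite Rabs_Ropp. unfold Rdiv. rewrite Rabs_mult, (Rabs_pos_eq (/ PI)) by (left; now apply Rinv_0_lt_compat).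
    apply Rmult_le_compat_r; [left; now apply Rinv_0_lt_compat|].
    apply Rle_trans with (1 - tanh_q b); [|lra]. apply atan_scal_diff; lra. }
rewrite <- (RInt_Chasles (V := R_CompleteNormedModule) _ 0 B b EX1 EX2). unfold plus; simpl.
set (I1 := RInt (fun s => coth_im q s x * h s) 0 B) in *. set (I2 := RInt (fun s => coth_im q s x * h s) B b) in *.
replace (step x * F (t - rho * cos x) - q / PI * (I1 + I2 + - / q * angular q b x * F t0) - (/ 2 - q * x / PI) * F t0)
 with (step x * (F (t - rho * cos x) - F t0) + - (q / PI * I1) + - (q / PI * I2)
   + (step x + angular q b x / PI - (/ 2 - q * x / PI)) * F t0) by (field; lra).
assert (Hc1 : Rabs (step x * (F (t - rho * cos x) - F t0)) <= e / 8).
{ rewrite Rabs_mult. rewrite <- (Rmult_1_l (e / 8)). apply Rmult_le_compat; try apply Rabs_pos.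
  - rewrite Rabs_pos_eq; apply step_bound.
  - apply NEAR. apply Rle_trans with 1; [|lra]. apply Rabs_le. apply COS_bound. }
assert (QP : 0 < q / PI) by (apply Rdiv_lt_0_compat; lra).
assert (Hc2 : Rabs (- (q / PI * I1)) <= e / 8).
{ rewrite Rabs_Ropp, Rabs_mult, (Rabs_pos_eq (q / PI)) by lra.
  apply Rle_trans with (q / PI * (e / 8 * (/ q * (PI / 2)))); [apply Rmult_le_compat_l; lra|].
  replace (q / PI * (e / 8 * (/ q * (PI / 2)))) with (e / 16) by (field; lra). lra. }
assert (HiP : / PI <= 1).
{ rewrite <- Rinv_1. apply Rinv_le_contravar; lra. }
assert (0 < / PI) by now apply Rinv_0_lt_compat.
assert (Hc3 : Rabs (- (q / PI * I2)) <= e / 4).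
{ rewrite Rabs_Ropp, Rabs_mult, (Rabs_pos_eq (q / PI)) by lra.
  apply Rle_trans with (q / PI * (2 * C * (/ q * k))); [apply Rmult_le_compat_l; lra|].
  replace (q / PI * (2 * C * (/ q * k))) with (2 * (k * C) * / PI) by (field; lra).
  assert (0 <= k * C) by (apply Rmult_le_pos; lra). nra. }
assert (Hc4 : Rabs ((step x + angular q b x / PI - (/ 2 - q * x / PI)) * F t0) <= e / 8).
{ rewrite Rabs_mult. apply Rle_trans with (k / PI * C).
  - apply Rmult_le_compat; try apply Rabs_pos; auto.
  - assert (0 <= k * C) by (apply Rmult_le_pos; lra). unfold Rdiv. nra. }
set (X1 := step x * (F (t - rho * cos x) - F t0)) in *. set (X2 := - (q / PI * I1)) in *.
set (X3 := - (q / PI * I2)) in *. set (X4 := (step x + angular q b x / PI - (/ 2 - q * x / PI)) * F t0) in *.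
generalize (Rabs_triang (X1 + X2 + X3) X4) (Rabs_triang (X1 + X2) X3) (Rabs_triang X1 X2). lra.
Qed.
End Wave.
End EdgeEstimates.

(** * Decay of the kernels and bound of the gradient *)

Section KernelDecay.
Variable q : R.
Hypothesis Hq : / 4 < q < / 2.

(** With w = exp(-s / 2) and E = exp(-2 q s), q > 1/4 gives E <= w, hence (1 - w) / (1 - E) <= 1.
    This removes the singularity at s = 0 from both decay estimates. *)
Lemma exp_half_bounds s : 0 < s -> 0 < exp (- s / 2) < 1 /\ 0 < exp (- (2 * q * s)) <= exp (- s / 2).
Proof.
intros Hs. split; split; try apply exp_pos.
- rewrite <- exp_0. apply exp_increasing. lra.
- destruct (Req_dec (- (2 * q * s)) (- s / 2)) as [->|]; [lra|].
  left. apply exp_increasing. nra.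
Qed.

(** Since coth (q z) - 1 = 2 e / (1 - e) with e = exp(-2 q z) of modulus [E], the first factor is at
    most 2 E / (1 - E). The constant 4 comes from 1 - w^4 <= 4 (1 - w). *)
Lemma coth_re_decay s x : 0 < s -> Rabs (coth_re q s x - 1) * sinh s <= 4 * exp ((1 - 2 * q) * s).
Proof.
intros Hs. destruct (exp_half_bounds s Hs) as [Hw HE].
assert (HD := coth_den_pos_b q s x ltac:(lra) Hs).
set (w := exp (- s / 2)) in *. set (E := exp (- (2 * q * s))) in *.
assert (EI : exp (2 * q * s) = / E) by (unfold E; rewrite <- exp_Ropp; f_equal; ring).
assert (Hc : -1 <= cos (2 * q * x) <= 1) by apply COS_bound.
assert (C1 : coth_re q s x - 1 = 2 * E * (cos (2 * q * x) - E) / (E * E + 1 - 2 * E * cos (2 * q * x))).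
{ assert (Den : coth_den q s x = (E * E + 1 - 2 * E * cos (2 * q * x)) / (2 * E)).
  { unfold coth_den, cosh. fold E. rewrite EI. field. lra. }
  unfold coth_re, sinh. fold E. rewrite EI, Den. rewrite Den in HD.
  assert (0 < E * E + 1 - 2 * E * cos (2 * q * x)).
  { replace (E * E + 1 - 2 * E * cos (2 * q * x)) with ((E * E + 1 - 2 * E * cos (2 * q * x)) / (2 * E) * (2 * E)) by (field; lra).
    apply Rmult_lt_0_compat; lra. }
  field. split; lra. }
set (c := cos (2 * q * x)) in *.
assert (P : 0 < E * E + 1 - 2 * E * c) by nra.
assert (B : Rabs (coth_re q s x - 1) <= 2 * E / (1 - E)).
{ rewrite C1. unfold Rdiv. rewrite !Rabs_mult, Rabs_inv, (Rabs_pos_eq (E * E + 1 - 2 * E * c)), (Rabs_pos_eq 2), (Rabs_pos_eq E) by lra.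
  rewrite (Rmult_assoc (2 * E)). apply Rmult_le_compat_l; [lra|].
  apply Rmult_le_reg_r with (E * E + 1 - 2 * E * c); auto. rewrite Rmult_assoc, Rinv_l, Rmult_1_r by lra.
  apply Rmult_le_reg_l with (1 - E); [lra|].
  replace ((1 - E) * (/ (1 - E) * (E * E + 1 - 2 * E * c))) with (E * E + 1 - 2 * E * c) by (field; lra).
  unfold Rabs. destruct (Rcase_abs (c - E)); nra. }
assert (S : sinh s = exp s * (1 - w * w * (w * w)) / 2).
{ unfold sinh. assert (w * w = exp (- s)) as -> by (unfold w; rewrite <- exp_plus; f_equal; field).
  rewrite <- exp_plus. replace (exp s * (1 - exp (- s + - s)) / 2) with ((exp s - exp s * exp (- s + - s)) / 2) by field.
  rewrite <- exp_plus. do 2 f_equal. f_equal. f_equal. ring. }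
assert (EE : E * exp s = exp ((1 - 2 * q) * s)) by (unfold E; rewrite <- exp_plus; f_equal; ring).
apply Rle_trans with (2 * E / (1 - E) * sinh s).
{ apply Rmult_le_compat_r; auto. generalize (sinh_pos s Hs); lra. }
rewrite S, <- EE. assert (0 < exp s) by apply exp_pos.
replace (2 * E / (1 - E) * (exp s * (1 - w * w * (w * w)) / 2)) with (E * exp s * ((1 - w * w * (w * w)) / (1 - E))) by (field; lra).
rewrite (Rmult_comm 4). apply Rmult_le_compat_l; [apply Rmult_le_pos; lra|].
apply Rmult_le_reg_r with (1 - E); [lra|]. unfold Rdiv. rewrite Rmult_assoc, Rinv_l, Rmult_1_r by lra.
apply Rle_trans with (4 * (1 - w)); [|lra].
replace (1 - w * w * (w * w)) with ((1 - w) * (1 + w + w * w + w * w * w)) by ring.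
rewrite (Rmult_comm 4). apply Rmult_le_compat_l; [lra|]. assert (w * w <= 1) by nra. assert (w * w * w <= 1) by nra. lra.
Qed.

(** Uniformly in [x] the kernel is bounded by 2 E / (1 - E)^2, with a double pole at s = 0; the
    double zero of cosh s - 1 absorbs it. *)
Lemma coth_im_decay s x : 0 < s -> Rabs (coth_im q s x) * (cosh s - 1) <= 4 * exp ((1 - 2 * q) * s).
Proof.
intros Hs. destruct (exp_half_bounds s Hs) as [Hw HE].
assert (HD := coth_den_pos_b q s x ltac:(lra) Hs).
set (w := exp (- s / 2)) in *. set (E := exp (- (2 * q * s))) in *.
assert (EI : exp (2 * q * s) = / E) by (unfold E; rewrite <- exp_Ropp; f_equal; ring).
assert (C1 : (1 - E) * (1 - E) / (2 * E) <= coth_den q s x).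
{ unfold coth_den, cosh. fold E. rewrite EI. generalize (COS_bound (2 * q * x)).
  replace ((1 - E) * (1 - E) / (2 * E)) with ((/ E + E) / 2 - 1) by (field; lra). lra. }
assert (P : 0 < (1 - E) * (1 - E) / (2 * E)).
{ apply Rdiv_lt_0_compat; [|lra]. apply Rmult_lt_0_compat; lra. }
assert (B : Rabs (coth_im q s x) <= 2 * E / ((1 - E) * (1 - E))).
{ unfold coth_im, Rdiv at 1. rewrite Rabs_mult, Rabs_inv, Rabs_Ropp, (Rabs_pos_eq (coth_den _ _ _)) by lra.
  replace (2 * E / ((1 - E) * (1 - E))) with (1 * / ((1 - E) * (1 - E) / (2 * E))) by (field; lra).
  apply Rmult_le_compat; [apply Rabs_pos|left; now apply Rinv_0_lt_compat|apply Rabs_le; apply SIN_bound|].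
  now apply Rinv_le_contravar. }
assert (S : cosh s - 1 = exp s * ((1 - w * w) * (1 - w * w)) / 2).
{ unfold cosh. assert (w * w = exp (- s)) as -> by (unfold w; rewrite <- exp_plus; f_equal; field).
  assert (X : exp s * exp (- s) = 1) by (rewrite <- exp_plus, Rplus_opp_r; apply exp_0).
  replace (exp s * ((1 - exp (- s)) * (1 - exp (- s))) / 2) with ((exp s - 2 * (exp s * exp (- s)) + (exp s * exp (- s)) * exp (- s)) / 2) by field.
  rewrite X. field. }
assert (EE : E * exp s = exp ((1 - 2 * q) * s)) by (unfold E; rewrite <- exp_plus; f_equal; ring).
apply Rle_trans with (2 * E / ((1 - E) * (1 - E)) * (cosh s - 1)).
{ apply Rmult_le_compat_r; auto. generalize (cosh_ge_1 s); lra. }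
rewrite S, <- EE. assert (0 < exp s) by apply exp_pos.
replace (2 * E / ((1 - E) * (1 - E)) * (exp s * ((1 - w * w) * (1 - w * w)) / 2))
  with (E * exp s * (((1 - w * w) / (1 - E)) * ((1 - w * w) / (1 - E)))) by (field; lra).
rewrite (Rmult_comm 4). apply Rmult_le_compat_l; [apply Rmult_le_pos; lra|].
assert (G : 0 <= (1 - w * w) / (1 - E) <= 2).
{ split.
  - apply Rdiv_le_0_compat; nra.
  - apply Rmult_le_reg_r with (1 - E); [lra|]. unfold Rdiv. rewrite Rmult_assoc, Rinv_l, Rmult_1_r by lra. nra. }
nra.
Qed.

Variables (F : R -> R) (C : R).
Hypothesis CF : causal F.
Hypothesis F0 : forall s, continuous F s.
Hypothesis HC : forall s, Rabs (F s) <= C.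

(* [ker_im] with 1 subtracted from the hyperbolic cotangent; the ones cancel in
   the sum over the four sources. *)
Definition ker_red (eta s x : R) : R :=
  (coth_re q s x - 1) * sinh s * sin eta + coth_im q s x * cosh s * cos eta.

Lemma ker_red_eq g s x : ker_red (x + g) s x = ker_im q 1 g s x - sinh s * sin (x + g).
Proof. unfold ker_red, ker_im, mul_re, mul_im. rewrite !Rmult_1_l. ring. Qed.

(** With cosh replaced by 1 the kernel has bounded mass. The remainder is at most 8 C exp ((1 - 2 q)
    s), and it vanishes as soon as rho cosh s >= t, which holds beyond ln (2 t / rho). Its integral
    yields the power of t / rho that the norm weighs against. *)
Lemma RInt_ker_red eta rho x t b : - PI < q * x < PI -> 0 < rho < t -> ln (2 * t / rho) <= b ->
  ex_RInt (fun s => ker_red eta s x * F (t - rho * cosh s)) 0 b /\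
  Rabs (RInt (fun s => ker_red eta s x * F (t - rho * cosh s)) 0 b)
  <= C * (/ q * (PI / 2)) + 8 * C / (1 - 2 * q) * Rpower (2 * t / rho) (1 - 2 * q).
Proof.
intros Hx Hr Hb. set (bs := ln (2 * t / rho)) in *.
assert (R2 : 2 < 2 * t / rho).
{ apply Rmult_lt_reg_r with rho; [lra|]. unfold Rdiv. rewrite Rmult_assoc, Rinv_l by lra. lra. }
assert (Hbs : 0 < bs) by (rewrite <- ln_1; apply ln_increasing; lra).
assert (C0 : 0 <= C) by (apply Rle_trans with (2 := HC 0); apply Rabs_pos).
assert (FC : forall s, continuous (fun s => F (t - rho * cosh s)) s).
{ intros s. apply (cont_comp F); [cont|apply F0]. }
assert (Eker : forall n g, ex_RInt (fun s => ker_im q n g s x * F (t - rho * cosh s)) 0 b).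
{ intros n g. apply (ex_RInt_ker q ltac:(lra) n g x (fun s => F (t - rho * cosh s))); auto; lra. }
assert (Eim : ex_RInt (fun s => coth_im q s x * (cos eta * F (t - rho * cosh s))) 0 b).
{ apply (ex_RInt_ext (fun s => cos eta * (ker_im q 0 0 s x * F (t - rho * cosh s)))).
  { intros s _. rewrite ker_im_00. eqR. ring. }
  apply (ex_RInt_scal (V := R_NormedModule)). apply Eker. }
assert (Eall : ex_RInt (fun s => ker_red eta s x * F (t - rho * cosh s)) 0 b).
{ apply (ex_RInt_ext (fun s => ker_im q 1 (eta - x) s x * F (t - rho * cosh s) - sinh s * sin eta * F (t - rho * cosh s))).
  { intros s _. assert (KE := ker_red_eq (eta - x) s x).
    replace (x + (eta - x)) with eta in KE by ring. rewrite KE. eqR. ring. }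
  apply (ex_RInt_minus (V := R_NormedModule)); auto.
  apply (ex_RInt_continuous (V := R_CompleteNormedModule)). intros s _.
  apply (cont_mult (fun s => sinh s * sin eta)); [cont|apply FC]. }
split; auto.
(* The bounded-mass part [coth_im] times cos eta is taken off, leaving the cosh s - 1 that
   [coth_im_decay] handles. *)
set (m := fun s => ((coth_re q s x - 1) * sinh s * sin eta + coth_im q s x * (cosh s - 1) * cos eta) * F (t - rho * cosh s)).
assert (Em : ex_RInt m 0 b).
{ apply (ex_RInt_ext (fun s => ker_red eta s x * F (t - rho * cosh s) - coth_im q s x * (cos eta * F (t - rho * cosh s)))).
  { intros s _. unfold m, ker_red. eqR. ring. }
  now apply (ex_RInt_minus (V := R_NormedModule)). }
assert (SP : RInt (fun s => ker_red eta s x * F (t - rho * cosh s)) 0 b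
  = RInt (fun s => coth_im q s x * (cos eta * F (t - rho * cosh s))) 0 b + RInt m 0 b).
{ apply is_RInt_unique.
  apply (is_RInt_ext (V := R_NormedModule) (fun s => coth_im q s x * (cos eta * F (t - rho * cosh s)) + m s)).
  { intros s _. unfold m, ker_red. eqR. ring. }
  apply (is_RInt_plus (V := R_NormedModule)); now apply (RInt_correct (V := R_CompleteNormedModule)). }
rewrite SP. apply Rle_trans with (1 := Rabs_triang _ _). apply Rplus_le_compat.
- apply (RInt_coth_im_bound_0 q ltac:(lra) x b (fun s => cos eta * F (t - rho * cosh s)) C Hx ltac:(lra) C0 Eim).
  intros s _. rewrite Rabs_mult. rewrite <- (Rmult_1_l C). apply Rmult_le_compat; try apply Rabs_pos; auto.
  apply Rabs_le. apply COS_bound.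
- assert (E1 : ex_RInt m 0 bs) by (apply (ex_RInt_sub _ 0 b); auto; lra).
  assert (E2 : ex_RInt m bs b) by (apply (ex_RInt_sub _ 0 b); auto; lra).
  rewrite <- (RInt_Chasles (V := R_CompleteNormedModule) _ 0 bs b E1 E2). unfold plus; simpl.
  replace (RInt m bs b) with 0.
  2:{ symmetry. rewrite (RInt_ext m (fun _ => 0)).
      - rewrite RInt_const. apply Rmult_0_r.
      - intros s. rewrite Rmin_left by lra. intros Hs. unfold m. rewrite CF; [eqR; ring|].
        assert (exp bs = 2 * t / rho) by (apply exp_ln; lra).
        assert (exp bs <= exp s) by (left; apply exp_increasing; lra).
        assert (t / rho <= cosh s).
        { unfold cosh. generalize (exp_pos (- s)). replace (t / rho) with (2 * t / rho / 2) by (field; lra). lra. }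
        assert (t <= rho * cosh s).
        { replace t with (rho * (t / rho)) at 1 by (field; lra). apply Rmult_le_compat_l; lra. }
        lra. }
  rewrite Rplus_0_r.
  set (N := 1 - 2 * q) in *. assert (HN : 0 < N) by (unfold N; lra).
  assert (IE : is_RInt (fun s => 8 * C * exp (N * s)) 0 bs (8 * C * (exp (N * bs) / N) - 8 * C * (exp (N * 0) / N))).
  { apply (is_RInt_derive (V := R_CompleteNormedModule) (fun s => 8 * C * (exp (N * s) / N)) (fun s => 8 * C * exp (N * s))).
    - intros s _. auto_derive; auto. field. lra.
    - intros s _. cont. }
  assert (MB : forall s, 0 < s < bs -> Rabs (m s) <= 8 * C * exp (N * s)).
  { intros s Hs. unfold m. rewrite Rabs_mult.
    replace (8 * C * exp (N * s)) with ((4 * exp (N * s) + 4 * exp (N * s)) * C) by ring.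
    apply Rmult_le_compat; try apply Rabs_pos; auto.
    apply Rle_trans with (1 := Rabs_triang _ _).
    assert (S1 : Rabs (sin eta) <= 1) by (apply Rabs_le; apply SIN_bound).
    assert (S2 : Rabs (cos eta) <= 1) by (apply Rabs_le; apply COS_bound).
    assert (D1 := coth_re_decay s x (proj1 Hs)). assert (D2 := coth_im_decay s x (proj1 Hs)).
    fold N in D1, D2. assert (Hsi := sinh_pos s (proj1 Hs)). assert (Hco := cosh_ge_1 s).
    apply Rplus_le_compat; rewrite !Rabs_mult.
    - rewrite (Rabs_pos_eq (sinh s)) by lra.
      assert (0 <= Rabs (coth_re q s x - 1) * sinh s) by (apply Rmult_le_pos; [apply Rabs_pos|lra]).
      generalize (Rabs_pos (sin eta)). nra.
    - rewrite (Rabs_pos_eq (cosh s - 1)) by lra.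
      assert (0 <= Rabs (coth_im q s x) * (cosh s - 1)) by (apply Rmult_le_pos; [apply Rabs_pos|lra]).
      generalize (Rabs_pos (cos eta)). nra. }
  assert (V : exp (N * bs) = Rpower (2 * t / rho) N) by reflexivity.
  assert (FIN : RInt (fun s => 8 * C * exp (N * s)) 0 bs <= 8 * C / N * Rpower (2 * t / rho) N).
  { rewrite (is_RInt_unique _ _ _ _ IE), V, Rmult_0_r, exp_0.
    assert (0 <= 8 * C * (1 / N)) by (apply Rmult_le_pos; [lra|]; apply Rdiv_le_0_compat; lra).
    replace (8 * C / N * Rpower (2 * t / rho) N) with (8 * C * (Rpower (2 * t / rho) N / N)) by (field; lra). lra. }
  apply Rle_trans with (2 := FIN). apply Rabs_le. split.
  + assert (IE' := is_RInt_opp (V := R_NormedModule) _ _ _ _ IE).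
    rewrite <- (Ropp_involutive (RInt m 0 bs)). apply Ropp_le_contravar.
    replace (- RInt m 0 bs) with (RInt (fun s => - m s) 0 bs) by (apply (RInt_opp (V := R_CompleteNormedModule) m); auto).
    apply RInt_le; auto; try lra.
    * now apply (ex_RInt_opp (V := R_NormedModule)).
    * eexists; exact IE.
    * intros s Hs. generalize (MB s Hs) (Rle_abs (- m s)). rewrite Rabs_Ropp. lra.
  + apply RInt_le; auto; try lra.
    * eexists; exact IE.
    * intros s Hs. generalize (MB s Hs) (Rle_abs (m s)). lra.
Qed.
End KernelDecay.

(** cosh (n z + i g) is even in (n, g). Thus the waves n = 1 and n = -1 in the first derivative of a
    wave n = 0 coincide. *)
Lemma edge_wave_opp q n g F rho x t : edge_wave q (- n) (- g) F rho x t = edge_wave q n g F rho x t.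
Proof.
unfold edge_wave, diffracted. rewrite cos_neg. do 2 f_equal. apply RInt_ext. intros s _. f_equal.
unfold ker_im, mul_re, mul_im. replace (- n * x + - g) with (- (n * x + g)) by ring.
replace (- n * s) with (- (n * s)) by ring. rewrite cos_neg, sin_neg, cosh_opp, sinh_opp. ring.
Qed.

Section Gradient.
Variables (phi al : R).
Hypothesis Hphi : 0 < phi < PI.
Hypothesis Hal : 0 < al < phi /\ al < PI / 2.

(** The derivative of [total_real] in the direction psi, with [F'] the derivative of the profile;
    the last line belongs to the uncut plane wave. *)
Definition total_grad (psi : R) (F' : R -> R) (p : spacetime) : R :=
  - (image_wave (q phi) al (2 * PI + al) 1 (2 * PI + al - psi) F' p
     + image_wave (q phi) al (theta1 phi al) 1 (theta1 phi al - psi) F' p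
     - image_wave (q phi) al (theta2 al) 1 (theta2 al - psi) F' p
     - image_wave (q phi) al al 1 (al - psi) F' p)
  - cos (theta2 al - psi) * plane_real (theta2 al) F' p.

Lemma total_real_line F psi y t : causal F -> smooth_real F -> slit al y ->
  is_derive (fun h => total_real phi al F (line y psi h, t)) 0 (total_grad psi (Derive F) (y, t)).
Proof.
intros CF SF Hs. destruct (admissible_sources phi al Hphi Hal) as [A1 [A2 [A3 A4]]].
assert (I : forall a, admissible (q phi) al a ->
  is_derive (fun h => image_wave (q phi) al a 0 0 F (line y psi h, t)) 0
    (- image_wave (q phi) al a 1 (a - psi) (Derive F) (y, t))).
{ intros a Ha. evar_last.
  - now apply (image_wave_line (q phi) al (q_pos phi Hphi)).
  - rewrite !Rplus_0_l. replace (0 - 1) with (- (1)) by ring. replace (0 - (a - psi)) with (- (a - psi)) by ring.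
    unfold image_wave. rewrite edge_wave_opp. simpl. field. }
unfold total_real. evar_last.
- apply @is_derive_plus; [|now apply plane_real_line].
  apply @is_derive_minus; [|now apply I]. apply @is_derive_minus; [|now apply I].
  apply @is_derive_plus; now apply I.
- unfold total_grad, minus, plus, opp; simpl. ring.
Qed.

Lemma q_bounds : / 4 < q phi < / 2.
Proof.
assert (HP := Phi_pos phi Hphi). assert (HPI := PI_RGT_0). unfold q. split.
- apply Rmult_lt_reg_r with (2 * Phi phi); [lra|].
  replace (PI / (2 * Phi phi) * (2 * Phi phi)) with PI by (field; lra). lra.
- apply Rmult_lt_reg_r with (2 * Phi phi); [lra|].
  replace (PI / (2 * Phi phi) * (2 * Phi phi)) with PI by (field; lra). lra.
Qed.

(** At a given point the four waves share the phase (th - a) + (a - psi) = th - psi, so the growing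
    part sinh s sin (th - psi) of the kernel is common to them and cancels in the signed sum. For t
    <= |y| the diffracted wave has not arrived. *)
Lemma total_grad_bound F C : causal F -> (forall s, continuous F s) -> (forall s, Rabs (F s) <= C) ->
  exists K, 0 <= K /\ forall psi y t, slit al y -> 0 <= t ->
   (t <= Defs.abs y -> Rabs (total_grad psi F (y, t)) <= K) /\
   (Defs.abs y < t -> Rabs (total_grad psi F (y, t)) <= K * (1 + Rpower (2 * t / Defs.abs y) (1 - 2 * q phi))).
Proof.
intros CF F0 HC. destruct (admissible_sources phi al Hphi Hal) as [A1 [A2 [A3 A4]]].
assert (Hq := q_pos phi Hphi). assert (Hqb := q_bounds). assert (HPI := PI_RGT_0).
assert (C0 : 0 <= C) by (apply Rle_trans with (2 := HC 0); apply Rabs_pos).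
set (N := 1 - 2 * q phi). assert (HN : 0 < N) by (unfold N; lra).
set (K0 := C * (/ q phi * (PI / 2)) + 8 * C / N).
assert (Hiq : 0 < / q phi) by now apply Rinv_0_lt_compat.
assert (HK1 : 0 <= C * (/ q phi * (PI / 2))) by (apply Rmult_le_pos; [lra|apply Rmult_le_pos; lra]).
assert (HK2 : 0 <= 8 * C / N) by (apply Rdiv_le_0_compat; lra).
assert (QP : 0 < q phi / PI) by (apply Rdiv_lt_0_compat; lra).
(* Five plane waves of size at most [C] and four reduced integrals. *)
exists (5 * C + q phi / PI * (4 * K0)). split.
{ assert (0 <= q phi / PI * (4 * K0)) by (apply Rmult_le_pos; unfold K0; lra). lra. }
intros psi y t Hs Ht. assert (Hr := slit_abs_pos al y Hs). set (rho := Defs.abs y) in *.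
set (th := cut_angle al y). assert (Hth := cut_angle_bounds al y). fold th in Hth.
set (D := fun a => diffracted (q phi) 1 (a - psi) F rho (th - a) t).
set (DS := D (2 * PI + al) + D (theta1 phi al) - D (theta2 al) - D al).
set (ST := fun a => step (th - a) * cos (a - psi) * F (t - rho * cos (th - a))).
assert (BST : forall a, Rabs (ST a) <= C).
{ intros a. unfold ST. rewrite !Rabs_mult. rewrite <- (Rmult_1_l C).
  apply Rmult_le_compat; auto; try apply Rabs_pos. apply Rmult_le_pos; apply Rabs_pos.
  rewrite <- (Rmult_1_l 1). apply Rmult_le_compat; try apply Rabs_pos.
  - rewrite Rabs_pos_eq; apply step_bound.
  - apply Rabs_le. apply COS_bound. }
assert (BP : Rabs (cos (theta2 al - psi) * plane_real (theta2 al) F (y, t)) <= C).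
{ rewrite Rabs_mult, <- (Rmult_1_l C). apply Rmult_le_compat; try apply Rabs_pos.
  - apply Rabs_le. apply COS_bound.
  - apply HC. }
assert (MAIN : Rabs (total_grad psi F (y, t)) <= 5 * C + q phi / PI * Rabs DS).
{ replace (total_grad psi F (y, t)) with (- ST (2 * PI + al) + - ST (theta1 phi al) + ST (theta2 al) + ST al
     + - (cos (theta2 al - psi) * plane_real (theta2 al) F (y, t)) + q phi / PI * DS)
    by (unfold total_grad, image_wave, edge_wave, DS, D, ST; simpl fst; simpl snd; fold rho th; ring).
  apply Rle_trans with (1 := Rabs_triang _ _).
  rewrite Rabs_mult, (Rabs_pos_eq (q phi / PI)) by lra. apply Rplus_le_compat_r.
  generalize (BST (2 * PI + al)) (BST (theta1 phi al)) (BST (theta2 al)) (BST al) BP.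
  set (x1 := ST (2 * PI + al)). set (x2 := ST (theta1 phi al)). set (x3 := ST (theta2 al)). set (x4 := ST al).
  set (x5 := cos (theta2 al - psi) * plane_real (theta2 al) F (y, t)). intros.
  generalize (Rabs_triang (- x1 + - x2 + x3 + x4) (- x5)) (Rabs_triang (- x1 + - x2 + x3) x4)
    (Rabs_triang (- x1 + - x2) x3) (Rabs_triang (- x1) (- x2)). rewrite !Rabs_Ropp. lra. }
assert (Hb0 : 0 <= Rabs t / rho) by (apply Rdiv_le_0_compat; auto; apply Rabs_pos).
split; intros Htr.
- assert (DZ : forall a, D a = 0).
  { intros a. unfold D, diffracted. rewrite (RInt_ext _ (fun _ => 0)).
    - rewrite RInt_const. apply Rmult_0_r.
    - intros s _. rewrite CF; [eqR; ring|]. generalize (cosh_ge_1 s). nra. }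
  assert (DS = 0) as Z by (unfold DS; rewrite !DZ; ring). rewrite Z, Rabs_R0, Rmult_0_r in MAIN.
  assert (0 <= q phi / PI * (4 * K0)) by (apply Rmult_le_pos; unfold K0; lra). lra.
- set (b := Rmax (Rabs t / rho) (ln (2 * t / rho))).
  set (RP := Rpower (2 * t / rho) N) in *.
  assert (HRP : 0 < RP) by apply exp_pos.
  assert (KR : forall a, admissible (q phi) al a ->
    ex_RInt (fun s => ker_red (q phi) (th - psi) s (th - a) * F (t - rho * cosh s)) 0 b /\
    Rabs (RInt (fun s => ker_red (q phi) (th - psi) s (th - a) * F (t - rho * cosh s)) 0 b)
     <= C * (/ q phi * (PI / 2)) + 8 * C / N * RP).
  { intros a Ha. apply (RInt_ker_red (q phi) Hqb F C CF F0 HC); [now apply Ha|lra|apply Rmax_r]. }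
  set (I := fun a => RInt (fun s => ker_red (q phi) (th - psi) s (th - a) * F (t - rho * cosh s)) 0 b).
  assert (FC : forall s, continuous (fun s => F (t - rho * cosh s)) s).
  { intros s. apply (cont_comp F); [cont|apply F0]. }
  (* The part common to the four sources; it grows like t / rho and disappears only in [DS]. *)
  set (X := RInt (fun s => sinh s * sin (th - psi) * F (t - rho * cosh s)) 0 b).
  assert (EX : ex_RInt (fun s => sinh s * sin (th - psi) * F (t - rho * cosh s)) 0 b).
  { apply (ex_RInt_continuous (V := R_CompleteNormedModule)). intros s _.
    apply (cont_mult (fun s => sinh s * sin (th - psi))); [cont|apply FC]. }
  assert (DI : forall a, admissible (q phi) al a -> D a = I a + X).
  { intros a Ha. unfold D. rewrite (diffracted_eq (q phi) Hq F CF F0 1 (a - psi) rho (th - a) t b); [|now apply Ha|auto|apply Rmax_l].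
    apply is_RInt_unique.
    apply (is_RInt_ext (V := R_NormedModule) (fun s => ker_red (q phi) (th - psi) s (th - a) * F (t - rho * cosh s)
      + sinh s * sin (th - psi) * F (t - rho * cosh s))).
    { intros s _. replace (th - psi) with ((th - a) + (a - psi)) by ring. rewrite ker_red_eq. eqR. ring. }
    apply (is_RInt_plus (V := R_NormedModule)); apply (RInt_correct (V := R_CompleteNormedModule)); auto.
    now apply KR. }
  assert (BDS : Rabs DS <= 4 * (C * (/ q phi * (PI / 2)) + 8 * C / N * RP)).
  { replace DS with (I (2 * PI + al) + I (theta1 phi al) + - I (theta2 al) + - I al)
      by (unfold DS; rewrite !DI by auto; ring).
    generalize (proj2 (KR _ A1)) (proj2 (KR _ A2)) (proj2 (KR _ A3)) (proj2 (KR _ A4)).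
    fold (I (2 * PI + al)) (I (theta1 phi al)) (I (theta2 al)) (I al).
    generalize (Rabs_triang (I (2 * PI + al) + I (theta1 phi al) + - I (theta2 al)) (- I al))
      (Rabs_triang (I (2 * PI + al) + I (theta1 phi al)) (- I (theta2 al)))
      (Rabs_triang (I (2 * PI + al)) (I (theta1 phi al))). rewrite !Rabs_Ropp. lra. }
  apply Rle_trans with (1 := MAIN).
  apply Rle_trans with (5 * C + q phi / PI * (4 * (K0 * (1 + RP)))).
  + apply Rplus_le_compat_l. apply Rmult_le_compat_l; [lra|].
    apply Rle_trans with (1 := BDS). apply Rmult_le_compat_l; [lra|]. unfold K0. nra.
  + assert (0 <= 5 * C * RP) by (apply Rmult_le_pos; lra). nra.
Qed.
End Gradient.

Lemma partial_represented (O : spacetime -> Prop) (U : spacetime -> C) (u1 u2 w1 w2 : spacetime -> R) d :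
  (forall p, O p -> locally p O) -> (forall p, O p -> U p = (u1 p, u2 p)) ->
  (forall p, O p -> is_derive (fun h => u1 (shift d p h)) 0 (w1 p)) ->
  (forall p, O p -> is_derive (fun h => u2 (shift d p h)) 0 (w2 p)) ->
  forall p, O p -> partial d U p = (w1 p, w2 p).
Proof.
intros HO HU H1 H2 p Hp. assert (L := locally_shift d p O (HO p Hp)). unfold partial. f_equal.
- rewrite (Derive_ext_loc _ (fun h => u1 (shift d p h))).
  + apply is_derive_unique. auto.
  + generalize L. apply filter_imp. intros h Hh. now rewrite HU.
- rewrite (Derive_ext_loc _ (fun h => u2 (shift d p h))).
  + apply is_derive_unique. auto.
  + generalize L. apply filter_imp. intros h Hh. now rewrite HU.
Qed.

(** * Wave equation, Neumann condition and initial condition *)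

Section Existence.
Variables (phi al : R).
Hypothesis Hphi : 0 < phi < PI.
Hypothesis Hal : 0 < al < phi /\ al < PI / 2.

(** cosh (n z + i g) changes sign when g decreases by PI. For n = 2 this happens when the direction
    psi turns by PI / 2, so such waves cancel in the Laplacian. *)
Lemma edge_wave_shift_PI n g F rho x t : causal F -> (forall s, continuous F s) -> 0 < rho -> - PI < q phi * x < PI ->
  edge_wave (q phi) n (g - PI) F rho x t = - edge_wave (q phi) n g F rho x t.
Proof.
intros CF F0 Hr Hx. unfold edge_wave, diffracted. rewrite cos_minus, cos_PI, sin_PI.
replace (RInt (fun b => ker_im (q phi) n (g - PI) b x * F (t - rho * cosh b)) 0 (Rabs t / rho))
  with (- RInt (fun b => ker_im (q phi) n g b x * F (t - rho * cosh b)) 0 (Rabs t / rho)); [ring|].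
rewrite <- (RInt_opp (V := R_CompleteNormedModule) (fun b => ker_im (q phi) n g b x * F (t - rho * cosh b))).
- apply RInt_ext. intros s _. unfold opp; simpl. eqR. unfold ker_im, mul_re, mul_im.
  replace (n * x + (g - PI)) with ((n * x + g) - PI) by ring.
  rewrite cos_minus, sin_minus, cos_PI, sin_PI. ring.
- apply (ex_RInt_diffracted (q phi) (q_pos phi Hphi) F F0); auto.
  apply Rdiv_le_0_compat; auto. apply Rabs_pos.
Qed.

(** The second derivative in the direction psi, for the second derivative of the profile. The waves
    n = 2 and n = 0 come from 2 cosh^2 (z + i k) = cosh (2 z + 2 i k) + 1 with k = a - psi. *)
Definition total_grad2 (psi : R) (F : R -> R) (p : spacetime) : R :=
  let I a := image_wave (q phi) al a 2 (2 * (a - psi)) F p + image_wave (q phi) al a 0 0 F p in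
  / 2 * (I (2 * PI + al) + I (theta1 phi al) - I (theta2 al) - I al)
  + cos (theta2 al - psi) * cos (theta2 al - psi) * plane_real (theta2 al) F p.

Lemma total_grad_line F psi y t : causal F -> smooth_real F -> slit al y ->
  is_derive (fun h => total_grad phi al psi F (line y psi h, t)) 0 (total_grad2 psi (Derive F) (y, t)).
Proof.
intros CF SF Hs. destruct (admissible_sources phi al Hphi Hal) as [A1 [A2 [A3 A4]]].
assert (I : forall a, admissible (q phi) al a ->
  is_derive (fun h => image_wave (q phi) al a 1 (a - psi) F (line y psi h, t)) 0
    (- / 2 * (image_wave (q phi) al a 2 (2 * (a - psi)) (Derive F) (y, t) + image_wave (q phi) al a 0 0 (Derive F) (y, t)))).
{ intros a Ha. evar_last.
  - now apply (image_wave_line (q phi) al (q_pos phi Hphi)).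
  - replace (1 + 1) with 2 by ring. replace (1 - 1) with 0 by ring.
    replace (a - psi + (a - psi)) with (2 * (a - psi)) by ring.
    now replace (a - psi - (a - psi)) with 0 by ring. }
unfold total_grad. evar_last.
- apply @is_derive_minus; [|apply is_derive_scal; now apply plane_real_line].
  apply @is_derive_opp.
  apply @is_derive_minus; [|now apply I]. apply @is_derive_minus; [|now apply I].
  apply @is_derive_plus; now apply I.
- unfold total_grad2, minus, plus, opp; simpl. field.
Qed.

(** The waves n = 2 of the two coordinate directions cancel, the halves of the waves n = 0 add up.
    With the second derivative of the profile for [F], the right side is also the second time
    derivative: this is the wave equation. *)
Lemma total_grad2_sum F y t : causal F -> (forall s, continuous F s) -> slit al y ->
  total_grad2 0 F (y, t) + total_grad2 (PI / 2) F (y, t) = total_real phi al F (y, t).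
Proof.
intros CF F0 Hs. destruct (admissible_sources phi al Hphi Hal) as [A1 [A2 [A3 A4]]].
assert (I : forall a, admissible (q phi) al a ->
  image_wave (q phi) al a 2 (2 * (a - PI / 2)) F (y, t) = - image_wave (q phi) al a 2 (2 * (a - 0)) F (y, t)).
{ intros a Ha. unfold image_wave; simpl. replace (2 * (a - PI / 2)) with (2 * (a - 0) - PI) by field.
  apply edge_wave_shift_PI; auto. now apply (slit_abs_pos al). apply Ha. apply cut_angle_bounds. }
unfold total_grad2, total_real. rewrite !I by auto.
rewrite (cos_minus (theta2 al) (PI / 2)), sin_PI2, cos_PI2, !Rminus_0_r.
replace ((cos (theta2 al) * 0 + sin (theta2 al) * 1) * (cos (theta2 al) * 0 + sin (theta2 al) * 1))
  with (sin (theta2 al) * sin (theta2 al)) by ring. rewrite cos2_eq. field.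
Qed.

Lemma total_real_time F y t : causal F -> smooth_real F -> slit al y ->
  is_derive (fun h => total_real phi al F (y, t + h)) 0 (total_real phi al (Derive F) (y, t)).
Proof.
intros CF SF Hs. destruct (admissible_sources phi al Hphi Hal) as [A1 [A2 [A3 A4]]].
assert (SF' := smooth_real_Derive F SF). assert (SF'' := smooth_real_Derive _ SF').
assert (I : forall a, admissible (q phi) al a ->
  is_derive (fun h => image_wave (q phi) al a 0 0 F (y, t + h)) 0 (image_wave (q phi) al a 0 0 (Derive F) (y, t))).
{ intros a Ha. exact (is_derive_image_wave_time (q phi) al a (q_pos phi Hphi) Ha F (Derive F) (Derive (Derive F)) CF
    (causal_Derive F CF SF) (fun s => smooth_real_is_derive F s SF) (fun s => smooth_real_is_derive _ s SF')
    (fun s => smooth_real_continuous _ s SF'') 0 0 y t Hs). }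
unfold total_real.
apply @is_derive_plus.
- apply @is_derive_minus; [|now apply I]. apply @is_derive_minus; [|now apply I].
  apply @is_derive_plus; now apply I.
- unfold plane_real; simpl. evar_last.
  + apply (is_derive_comp F (fun h => t + h - dot (dir (theta2 al)) y)).
    now apply smooth_real_is_derive. auto_derive; auto.
  + unfold scal; simpl; unfold mult; simpl. rewrite Rplus_0_r. ring.
Qed.

Section Source.
Variables (om : R) (f : R -> C).
Hypothesis Hf : smooth f.
Hypothesis Hf0 : forall s, s <= 0 -> f s = RtoC 0.
Let Fr := modulated_re om f.
Let Fi := modulated_im om f.
Let U := total_wave om phi al f.

Lemma Q_Qbar_punctured y : Q phi y -> Qbar_punctured phi y.
Proof. intros H. split; [now apply Q_Qbar|now apply (Q_neq_0 phi)]. Qed.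

Lemma Q_slit y : Q phi y -> slit al y.
Proof. intros H. apply (Qbar_slit phi al Hphi (proj1 Hal)). now apply Q_Qbar_punctured. Qed.

Lemma open_cyl_Q p : cyl (Q phi) all_times p -> locally p (cyl (Q phi) all_times).
Proof.
intros [H _]. destruct (Q_open phi Hphi _ H) as [e He]. exists e. intros z Hz. split; [|exact I].
apply He. apply Hz.
Qed.

Lemma U_rep p : Qbar_punctured phi (fst p) -> U p = (total_real phi al Fr p, total_real phi al Fi p).
Proof. intros H. now apply total_wave_eq. Qed.

Lemma total_wave_C_n n (E : spacetime -> Prop) (D : spacetime -> Prop) :
  (forall p, D p -> Q phi (fst p)) -> (forall p, E p -> Qbar_punctured phi (fst p)) -> C_n n D E U.
Proof.
intros HD HE. destruct (smooth_modulated om f Hf) as [S1 S2]. destruct (causal_modulated om f Hf0) as [K1 K2].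
apply (C_n_represented (q phi) al (q_pos phi Hphi) (cyl (Q phi) all_times) U (total_real phi al Fr) (total_real phi al Fi)).
- apply open_cyl_Q.
- intros p [Hp _]. now apply Q_slit.
- now apply total_real_class.
- now apply total_real_class.
- intros p [Hp _]. apply U_rep. now apply Q_Qbar_punctured.
- intros p Hp. split; [auto|exact I].
- intros p Hp. apply (Qbar_slit phi al Hphi (proj1 Hal)). auto.
- intros p Hp. apply U_rep. auto.
Qed.

Lemma total_wave_dalembertian y t : Q phi y -> dalembertian U (y, t) = 0%C.
Proof.
intros Hy. destruct (smooth_modulated om f Hf) as [S1 S2]. destruct (causal_modulated om f Hf0) as [K1 K2].
fold Fr in S1, K1. fold Fi in S2, K2.
assert (S1' := smooth_real_Derive _ S1). assert (S2' := smooth_real_Derive _ S2).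
assert (S1'' := smooth_real_Derive _ S1'). assert (S2'' := smooth_real_Derive _ S2').
assert (K1' := causal_Derive _ K1 S1). assert (K2' := causal_Derive _ K2 S2).
assert (K1'' := causal_Derive _ K1' S1'). assert (K2'' := causal_Derive _ K2' S2').
set (O := cyl (Q phi) all_times).
assert (HU : forall p, O p -> U p = (total_real phi al Fr p, total_real phi al Fi p)).
{ intros p [Hp _]. apply U_rep. now apply Q_Qbar_punctured. }
assert (SL : forall y t, O (y, t) -> slit al y) by (intros z s [Hz _]; now apply Q_slit).
assert (L1 : forall F, causal F -> smooth_real F -> forall p, O p ->
   is_derive (fun h => total_real phi al F (shift dy1 p h)) 0 (total_grad phi al 0 (Derive F) p)).
{ intros F CF SF [z s] Hz. apply (is_derive_ext (fun h => total_real phi al F (line z 0 h, s))).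
  - intros h. now rewrite shift_dy1.
  - apply total_real_line; eauto. }
assert (L2 : forall F, causal F -> smooth_real F -> forall p, O p ->
   is_derive (fun h => total_real phi al F (shift dy2 p h)) 0 (total_grad phi al (PI / 2) (Derive F) p)).
{ intros F CF SF [z s] Hz. apply (is_derive_ext (fun h => total_real phi al F (line z (PI / 2) h, s))).
  - intros h. now rewrite shift_dy2.
  - apply total_real_line; eauto. }
assert (L3 : forall F, causal F -> smooth_real F -> forall p, O p ->
   is_derive (fun h => total_real phi al F (shift dt p h)) 0 (total_real phi al (Derive F) p)).
{ intros F CF SF [z s] Hz. apply (is_derive_ext (fun h => total_real phi al F (z, s + h))).
  - intros h. now rewrite shift_dt.
  - apply total_real_time; eauto. }
assert (G1 : forall F, causal F -> smooth_real F -> forall p, O p ->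
   is_derive (fun h => total_grad phi al 0 F (shift dy1 p h)) 0 (total_grad2 0 (Derive F) p)).
{ intros F CF SF [z s] Hz. apply (is_derive_ext (fun h => total_grad phi al 0 F (line z 0 h, s))).
  - intros h. now rewrite shift_dy1.
  - apply total_grad_line; eauto. }
assert (G2 : forall F, causal F -> smooth_real F -> forall p, O p ->
   is_derive (fun h => total_grad phi al (PI / 2) F (shift dy2 p h)) 0 (total_grad2 (PI / 2) (Derive F) p)).
{ intros F CF SF [z s] Hz. apply (is_derive_ext (fun h => total_grad phi al (PI / 2) F (line z (PI / 2) h, s))).
  - intros h. now rewrite shift_dy2.
  - apply total_grad_line; eauto. }
assert (Hp : O (y, t)) by (split; [exact Hy|exact I]).
assert (P11 := partial_represented O U _ _ _ _ dy1 open_cyl_Q HU (L1 Fr K1 S1) (L1 Fi K2 S2)).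
assert (P21 := partial_represented O U _ _ _ _ dy2 open_cyl_Q HU (L2 Fr K1 S1) (L2 Fi K2 S2)).
assert (P31 := partial_represented O U _ _ _ _ dt open_cyl_Q HU (L3 Fr K1 S1) (L3 Fi K2 S2)).
assert (P12 := partial_represented O _ _ _ _ _ dy1 open_cyl_Q P11 (G1 _ K1' S1') (G1 _ K2' S2') _ Hp).
assert (P22 := partial_represented O _ _ _ _ _ dy2 open_cyl_Q P21 (G2 _ K1' S1') (G2 _ K2' S2') _ Hp).
assert (P32 := partial_represented O _ _ _ _ _ dt open_cyl_Q P31 (L3 _ K1' S1') (L3 _ K2' S2') _ Hp).
unfold dalembertian. rewrite P12, P22, P32.
assert (E1 := total_grad2_sum (Derive (Derive Fr)) y t K1'' (fun s => smooth_real_continuous _ s S1'') (Q_slit y Hy)).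
assert (E2 := total_grad2_sum (Derive (Derive Fi)) y t K2'' (fun s => smooth_real_continuous _ s S2'') (Q_slit y Hy)).
apply injective_projections; simpl; lra.
Qed.

Hypothesis Hal2 : phi - PI / 2 < al.

Lemma diffracted_early F n g rho x t : causal F -> 0 < rho -> t <= 0 -> diffracted (q phi) n g F rho x t = 0.
Proof.
intros CF Hr Ht. unfold diffracted. rewrite (RInt_ext _ (fun _ => 0)).
- rewrite RInt_const. apply Rmult_0_r.
- intros s _. rewrite CF; [eqR; ring|]. generalize (cosh_ge_1 s). nra.
Qed.

(** Where a reflected wave is present its direction makes an angle below PI / 2 with y, by phi - PI
    / 2 < al < PI / 2; hence its phase is non-positive for t <= 0 and causality kills it, as it
    kills the diffracted part. *)
Lemma total_real_early F y t : causal F -> Qbar_punctured phi y -> t <= 0 ->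
  total_real phi al F (y, t) = plane_real al F (y, t).
Proof.
intros CF HQ Ht. destruct (Qbar_slit phi al Hphi (proj1 Hal) y HQ) as [_ [E [Hth Hr]]].
destruct (angle_spec y (proj2 HQ)) as [P _]. assert (HPI := PI_RGT_0).
assert (PR : forall b, F (t - Defs.abs y * cos (angle y - b)) = plane_real b F (y, t)).
{ intros b. unfold plane_real; simpl. now rewrite <- dot_dir_polar, <- P. }
unfold total_real, image_wave, edge_wave; simpl fst; simpl snd.
rewrite !diffracted_early by auto. rewrite E, cos_0.
replace (step (angle y - (2 * PI + al))) with 1.
2:{ unfold step. destruct (Rlt_dec (angle y - (2 * PI + al)) 0); lra. }
replace (step (angle y - al)) with 0.
2:{ unfold step. destruct (Rlt_dec (angle y - al) 0); [lra|]. destruct (Req_EM_T (angle y - al) 0); lra. }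
replace (plane_real al F (y, t)) with (F (t - Defs.abs y * cos (angle y - (2 * PI + al)))).
2:{ rewrite <- PR. f_equal. replace (angle y - (2 * PI + al)) with ((angle y - al) - 2 * PI) by ring.
    rewrite (cos_minus _ (2 * PI)), cos_2PI, sin_2PI. ring. }
rewrite <- (PR (theta2 al)).
assert (Z : forall x, - (PI / 2) <= x <= PI / 2 -> F (t - Defs.abs y * cos x) = 0).
{ intros x Hx. apply CF. assert (0 <= cos x) by (apply cos_ge_0; lra). nra. }
assert (T1 : step (angle y - theta1 phi al) * F (t - Defs.abs y * cos (angle y - theta1 phi al)) = 0).
{ unfold step. destruct (Rlt_dec (angle y - theta1 phi al) 0).
  - rewrite Z; [ring|]. unfold theta1 in *. lra.
  - destruct (Req_EM_T (angle y - theta1 phi al) 0) as [e|]; [rewrite Z; [ring|lra]|ring]. }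
assert (T2 : (1 - step (angle y - theta2 al)) * F (t - Defs.abs y * cos (angle y - theta2 al)) = 0).
{ unfold step. destruct (Rlt_dec (angle y - theta2 al) 0); [ring|].
  rewrite Z; [ring|]. unfold theta2 in *. lra. }
lra.
Qed.

Lemma total_wave_early y t : Qbar_punctured phi y -> t <= 0 -> U (y, t) = u_in om al f (y, t).
Proof.
intros HQ Ht. destruct (causal_modulated om f Hf0) as [K1 K2].
rewrite U_rep by auto. unfold u_in. rewrite plane_wave_eq. now rewrite !total_real_early.
Qed.

Lemma ker_im_reflect eta x x' s : cos eta = 0 -> coth_re (q phi) s x = coth_re (q phi) s x' ->
  ker_im (q phi) 1 (eta - x) s x = ker_im (q phi) 1 (eta - x') s x'.
Proof.
intros H1 H2. unfold ker_im, mul_re, mul_im. rewrite !Rmult_1_l.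
replace (x + (eta - x)) with eta by ring. replace (x' + (eta - x')) with eta by ring. rewrite H1, H2. ring.
Qed.

Lemma coth_re_even qq s x : coth_re qq s (- x) = coth_re qq s x.
Proof.
unfold coth_re, coth_den. replace (2 * qq * - x) with (- (2 * qq * x)) by ring. now rewrite cos_neg.
Qed.

(** For psi = th - eta with cos eta = 0, normal to the ray at angle th, only Re coth is left in the
    kernel, and it is even in the angle: sources that are mirror images in this ray, up to the
    period 2 Phi, give equal integrals. *)
Lemma diffracted_reflect F eta a a' th rho t :
  cos eta = 0 -> (forall s, coth_re (q phi) s (th - a) = coth_re (q phi) s (th - a')) ->
  diffracted (q phi) 1 (a - (th - eta)) F rho (th - a) t = diffracted (q phi) 1 (a' - (th - eta)) F rho (th - a') t.
Proof.
intros H1 H2. apply RInt_ext. intros s _. f_equal.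
replace (a - (th - eta)) with (eta - (th - a)) by ring. replace (a' - (th - eta)) with (eta - (th - a')) by ring.
now apply ker_im_reflect.
Qed.

(** At angle 2 PI the sources 2 PI + al and theta2 are mirror images, and theta1 and al are so up to
    the period 2 Phi; each pair has opposite signs. The normal direction PI / 2 is 2 PI - eta with
    eta = 3 PI / 2. The incident and the second reflected plane wave cancel likewise. *)
Lemma total_grad_Q1 F r t : causal F -> 0 < r -> total_grad phi al (PI / 2) F (polar r (2 * PI), t) = 0.
Proof.
intros CF Hr. assert (HPI := PI_RGT_0).
destruct (cut_angle_polar al r (2 * PI) Hr) as [Sl E]; [lra|].
assert (A := abs_polar r (2 * PI) (Rlt_le _ _ Hr)).
assert (C0 : cos (3 * (PI / 2)) = 0) by apply cos_3PI2.
unfold total_grad, image_wave, edge_wave; simpl fst; simpl snd. rewrite E, A.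
assert (D1 : diffracted (q phi) 1 (2 * PI + al - PI / 2) F r (2 * PI - (2 * PI + al)) t
  = diffracted (q phi) 1 (theta2 al - PI / 2) F r (2 * PI - theta2 al) t).
{ replace (PI / 2) with (2 * PI - 3 * (PI / 2)) by field. apply diffracted_reflect; auto.
  intros s. rewrite <- coth_re_even. f_equal. unfold theta2. ring. }
assert (D2 : diffracted (q phi) 1 (theta1 phi al - PI / 2) F r (2 * PI - theta1 phi al) t
  = diffracted (q phi) 1 (al - PI / 2) F r (2 * PI - al) t).
{ replace (PI / 2) with (2 * PI - 3 * (PI / 2)) by field. apply diffracted_reflect; auto.
  intros s. rewrite <- coth_re_periodic, <- coth_re_even by auto. f_equal. unfold theta1, Phi. ring. }
rewrite D1, D2.
assert (T1 : step (2 * PI - (2 * PI + al)) = 1) by (unfold step; destruct (Rlt_dec (2 * PI - (2 * PI + al)) 0); lra).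
assert (TP : forall x, 0 < x -> step x = 0).
{ intros x Hx. unfold step. destruct (Rlt_dec x 0); [lra|]. destruct (Req_EM_T x 0); lra. }
rewrite T1, (TP (2 * PI - theta1 phi al)), (TP (2 * PI - theta2 al)), (TP (2 * PI - al)) by (unfold theta1, theta2; lra).
unfold plane_real; simpl fst; simpl snd.
replace (dot (dir (theta2 al)) (polar r (2 * PI))) with (r * cos (2 * PI - (2 * PI + al))).
2:{ unfold dot, dir, polar, theta2; simpl. replace (2 * PI - (2 * PI + al)) with (- al) by ring.
    rewrite cos_neg, (cos_minus (2 * PI)), cos_2PI, sin_2PI. ring. }
replace (cos (theta2 al - PI / 2)) with (- cos (2 * PI + al - PI / 2)); [ring|].
unfold theta2. rewrite !cos_minus, !sin_minus, cos_plus, sin_plus, cos_2PI, sin_2PI, cos_PI2, sin_PI2. ring.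
Qed.

(** At angle phi the pairs are theta1 and al and, up to the period 2 Phi, 2 PI + al and theta2. The
    incident wave cancels against the first reflected wave, the cut plane wave at theta2 against the
    uncut one. *)
Lemma total_grad_Q2 F r t : causal F -> 0 < r -> total_grad phi al (phi - PI / 2) F (polar r phi, t) = 0.
Proof.
intros CF Hr. assert (HPI := PI_RGT_0).
destruct (cut_angle_polar al r phi Hr) as [Sl E]; [lra|].
assert (A := abs_polar r phi (Rlt_le _ _ Hr)).
unfold total_grad, image_wave, edge_wave; simpl fst; simpl snd. rewrite E, A.
assert (D1 : diffracted (q phi) 1 (2 * PI + al - (phi - PI / 2)) F r (phi - (2 * PI + al)) t
  = diffracted (q phi) 1 (theta2 al - (phi - PI / 2)) F r (phi - theta2 al) t).
{ apply diffracted_reflect; [apply cos_PI2|].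
  intros s. rewrite <- (coth_re_even _ _ (phi - (2 * PI + al))), <- coth_re_periodic by auto.
  f_equal. unfold theta2, Phi. ring. }
assert (D2 : diffracted (q phi) 1 (theta1 phi al - (phi - PI / 2)) F r (phi - theta1 phi al) t
  = diffracted (q phi) 1 (al - (phi - PI / 2)) F r (phi - al) t).
{ apply diffracted_reflect; [apply cos_PI2|].
  intros s. rewrite <- coth_re_even. f_equal. unfold theta1. ring. }
rewrite D1, D2.
assert (TN : forall x, x < 0 -> step x = 1) by (intros x Hx; unfold step; destruct (Rlt_dec x 0); lra).
assert (TP : forall x, 0 < x -> step x = 0).
{ intros x Hx. unfold step. destruct (Rlt_dec x 0); [lra|]. destruct (Req_EM_T x 0); lra. }
rewrite (TN (phi - (2 * PI + al))), (TN (phi - theta1 phi al)), (TN (phi - theta2 al)), (TP (phi - al))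
  by (unfold theta1, theta2; lra).
unfold plane_real; simpl fst; simpl snd.
replace (dot (dir (theta2 al)) (polar r phi)) with (r * cos (phi - theta2 al)) by (unfold dot, dir, polar; simpl; rewrite cos_minus; ring).
replace (cos (phi - (2 * PI + al))) with (cos (phi - theta1 phi al)).
2:{ unfold theta1. replace (phi - (2 * phi - al)) with (- (phi - al)) by ring.
    replace (phi - (2 * PI + al)) with ((phi - al) - 2 * PI) by ring.
    rewrite cos_neg, (cos_minus _ (2 * PI)), cos_2PI, sin_2PI. ring. }
replace (cos (2 * PI + al - (phi - PI / 2))) with (- cos (theta1 phi al - (phi - PI / 2))); [ring|].
unfold theta1. replace (2 * phi - al - (phi - PI / 2)) with ((phi - al) + PI / 2) by ring.
replace (2 * PI + al - (phi - PI / 2)) with (2 * PI - ((phi - al) - PI / 2)) by ring.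
generalize (phi - al); intros v.
rewrite (cos_minus (2 * PI)), cos_2PI, sin_2PI, cos_plus, cos_minus, cos_PI2, sin_PI2. ring.
Qed.

(** [total_real] continues beyond the side, into the wedge up to the slit, so the one-sided quotient
    is part of a two-sided derivative along the normal line. *)
Lemma normal_derivative_line (n y : plane) psi t : n = dir psi -> Qbar_punctured phi y ->
  (forall h, 0 < h -> Q phi (line y psi (- h))) ->
  total_grad phi al psi (Derive Fr) (y, t) = 0 -> total_grad phi al psi (Derive Fi) (y, t) = 0 ->
  is_normal_derivative U n y t 0%C.
Proof.
intros -> HQ HL Z1 Z2. destruct (smooth_modulated om f Hf) as [S1 S2]. destruct (causal_modulated om f Hf0) as [K1 K2].
fold Fr in S1, K1. fold Fi in S2, K2.
destruct (Qbar_slit phi al Hphi (proj1 Hal) y HQ) as [Sl _].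
assert (D1 := total_real_line phi al Hphi Hal Fr psi y t K1 S1 Sl). rewrite Z1 in D1.
assert (D2 := total_real_line phi al Hphi Hal Fi psi y t K2 S2 Sl). rewrite Z2 in D2.
assert (LIM : forall u : spacetime -> R, is_derive (fun h => u (line y psi h, t)) 0 0 ->
  filterlim (fun h => (u (y, t) - u (line y psi (- h), t)) / h) (at_right 0) (locally 0)).
{ intros u [_ Hu] P [e He]. specialize (Hu 0 (fun P HP => HP) (pos_div_2 e)). destruct Hu as [d Hd].
  exists d. intros h Hh Hh0. change R in (type of h). apply He. apply ball_R_sym.
  specialize (Hd (- h)).
  assert (Bh : ball 0 d (- h)).
  { apply ball_R_sym. apply ball_R_sym in Hh. replace (- h - 0) with (- (h - 0)) by ring. rewrite Rabs_Ropp. exact Hh. }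
  specialize (Hd Bh).
  unfold norm, minus, plus, opp, scal in Hd; simpl in Hd. unfold abs, mult, minus, plus, opp in Hd; simpl in Hd.
  rewrite line_0 in Hd.
  replace (u (line y psi (- h), t) + - u (y, t) + - ((- h + - 0) * 0)) with (- (u (y, t) - u (line y psi (- h), t))) in Hd by ring.
  replace (- h + - 0) with (- h) in Hd by ring. rewrite !Rabs_Ropp in Hd.
  rewrite Rminus_0_r. unfold Rdiv. rewrite Rabs_mult, Rabs_inv, (Rabs_pos_eq h) by lra.
  rewrite (Rabs_pos_eq h) in Hd by lra.
  apply Rmult_lt_reg_r with h; auto. rewrite Rmult_assoc, Rinv_l, Rmult_1_r by lra.
  apply Rle_lt_trans with (1 := Hd). apply Rmult_lt_compat_r; auto. destruct e; simpl; lra. }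
unfold is_normal_derivative.
apply (filterlim_ext_loc (F := at_right 0) (fun h : R =>
  ((total_real phi al Fr (y, t) - total_real phi al Fr (line y psi (- h), t)) / h,
   (total_real phi al Fi (y, t) - total_real phi al Fi (line y psi (- h), t)) / h))).
- exists (mkposreal 1 Rlt_0_1). intros h _ Hh. change R in (type of h).
  replace ((fst y - h * fst (dir psi))%R, (snd y - h * snd (dir psi))%R) with (line y psi (- h))
    by (unfold line, dir; simpl; f_equal; ring).
  change (@pair (R * R) R (line y psi (- h)) t) with (@pair plane R (line y psi (- h)) t).
  rewrite !U_rep; [|apply Q_Qbar_punctured; now apply HL|exact HQ].
  unfold Cdiv, Cinv, Cminus, Cplus, Copp, Cmult, RtoC.
  generalize (total_real phi al Fr (y, t)) (total_real phi al Fr (line y psi (- h), t))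
    (total_real phi al Fi (y, t)) (total_real phi al Fi (line y psi (- h), t)). intros a b c d.
  apply injective_projections; simpl; eqR; field; lra.
- apply (filterlim_comp_2 (G := locally (0 : R)) (H := locally (0 : R))
    (fun h => (total_real phi al Fr (y, t) - total_real phi al Fr (line y psi (- h), t)) / h)
    (fun h => (total_real phi al Fi (y, t) - total_real phi al Fi (line y psi (- h), t)) / h)
    (fun a b => (a, b) : C)).
  + now apply LIM.
  + now apply LIM.
  + intros P [e He]. apply (Filter_prod _ _ _ (ball 0 e) (ball 0 e)); try now exists e.
    intros a b Ha Hb. apply He. now split.
Qed.

Lemma total_wave_Neumann :
  (forall y t, Q1 y -> is_normal_derivative U normal1 y t 0%C) /\
  (forall y t, Q2 phi y -> is_normal_derivative U (normal2 phi) y t 0%C).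
Proof.
destruct (smooth_modulated om f Hf) as [S1 S2]. destruct (causal_modulated om f Hf0) as [K1 K2].
fold Fr in S1, K1. fold Fi in S2, K2. assert (HPI := PI_RGT_0).
assert (K1' := causal_Derive _ K1 S1). assert (K2' := causal_Derive _ K2 S2).
split; intros y t Hy.
- destruct (Q1_polar y Hy) as [r [Hr ->]].
  apply (normal_derivative_line normal1 _ (PI / 2)).
  + unfold normal1, dir. now rewrite cos_PI2, sin_PI2.
  + apply Qbar_polar; auto; lra.
  + intros h Hh. apply Q_iff; auto. left. unfold line, polar; simpl. rewrite sin_PI2, sin_2PI. lra.
  + now apply total_grad_Q1.
  + now apply total_grad_Q1.
- destruct Hy as [r [Hr ->]].
  apply (normal_derivative_line (normal2 phi) _ (phi - PI / 2)).
  + unfold normal2, dir. rewrite cos_minus, sin_minus, cos_PI2, sin_PI2. f_equal; ring.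
  + apply Qbar_polar; auto; lra.
  + intros h Hh. apply Q_iff; auto. right. unfold half_plane, line, polar; simpl.
    rewrite cos_minus, sin_minus, cos_PI2, sin_PI2.
    replace ((r * cos phi + - h * (cos phi * 0 + sin phi * 1)) * sin phi - (r * sin phi + - h * (sin phi * 0 - cos phi * 1)) * cos phi)
      with (- h * (sin phi * sin phi + cos phi * cos phi)) by ring.
    rewrite cos2_eq. lra.
  + now apply total_grad_Q2.
  + now apply total_grad_Q2.
Qed.

Lemma total_wave_solution : solution om phi al f U.
Proof.
split; [split; [|split]|].
- apply total_wave_C_n; intros p [Hp _]; auto. now apply Q_Qbar_punctured.
- intros y t Hy. now apply total_wave_dalembertian.
- apply total_wave_Neumann.
- intros y t Hy Ht. apply total_wave_early; [now apply Q_Qbar_punctured|lra].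
Qed.
End Source.
End Existence.

(** * Bounds, continuity at the vertex and the norm *)

Lemma bounded_causal F G s0 M : 0 < s0 -> causal F -> smooth_real F -> (forall s, s0 <= s -> F s = G s) ->
  (forall s, Rabs (G s) <= M) -> (forall s, Rabs (Derive G s) <= M) ->
  exists C, forall s, Rabs (F s) <= C /\ Rabs (Derive F s) <= C.
Proof.
intros Hs0 CF SF HG HM HM'.
assert (CB : forall H : R -> R, (forall s, continuous H s) -> exists m, forall s, 0 <= s <= s0 -> Rabs (H s) <= m).
{ intros H HC. destruct (continuity_ab_maj (fun s => Rabs (H s)) 0 s0 ltac:(lra)) as [m Hm].
  - intros s _. apply continuity_pt_cont. apply (cont_comp Rabs); [apply HC|apply continuous_Rabs].
  - exists (Rabs (H m)). exact (proj1 Hm). }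
destruct (CB F (fun s => smooth_real_continuous F s SF)) as [m1 H1].
destruct (CB (Derive F) (fun s => smooth_real_continuous _ s (smooth_real_Derive F SF))) as [m2 H2].
assert (CF' := causal_Derive F CF SF).
assert (M0 : 0 <= M) by (apply Rle_trans with (2 := HM 0); apply Rabs_pos).
assert (A1 : 0 <= m1) by (apply Rle_trans with (2 := H1 0 ltac:(lra)); apply Rabs_pos).
assert (A2 : 0 <= m2) by (apply Rle_trans with (2 := H2 0 ltac:(lra)); apply Rabs_pos).
exists (M + m1 + m2). intros s.
destruct (Rle_lt_dec s 0) as [L|L].
- rewrite CF, CF', Rabs_R0 by auto. lra.
- destruct (Rle_lt_dec s s0) as [L'|L'].
  + generalize (H1 s ltac:(lra)) (H2 s ltac:(lra)). lra.
  + rewrite HG by lra. rewrite (Derive_ext_loc F G).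
    * generalize (HM s) (HM' s). lra.
    * generalize (locally_continuous_gt (fun s => s) s s0 (continuous_id s) L').
      apply filter_imp. intros y Hy. apply HG. lra.
Qed.

Lemma modulated_bounded om f s0 : 0 < s0 -> smooth f -> (forall s, s <= 0 -> f s = RtoC 0) ->
  (forall s, s0 <= s -> f s = RtoC 1) ->
  exists C, forall s, (Rabs (modulated_re om f s) <= C /\ Rabs (Derive (modulated_re om f) s) <= C) /\
    (Rabs (modulated_im om f s) <= C /\ Rabs (Derive (modulated_im om f) s) <= C).
Proof.
intros Hs0 Hf Hf0 Hf1.
destruct (smooth_modulated om f Hf) as [S1 S2]. destruct (causal_modulated om f Hf0) as [K1 K2].
assert (B : forall u, Rabs (cos u) <= 1 + Rabs om /\ Rabs (- sin u) <= 1 + Rabs om /\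
   Rabs (om * cos u) <= 1 + Rabs om /\ Rabs (om * sin u) <= 1 + Rabs om).
{ intros u. assert (Rabs (cos u) <= 1) by (apply Rabs_le; apply COS_bound).
  assert (Rabs (sin u) <= 1) by (apply Rabs_le; apply SIN_bound).
  rewrite Rabs_Ropp, !Rabs_mult. generalize (Rabs_pos om) (Rabs_pos (cos u)) (Rabs_pos (sin u)).
  repeat split; nra. }
destruct (bounded_causal (modulated_re om f) (fun s => cos (om * s)) s0 (1 + Rabs om)) as [C1 H1]; auto.
{ intros s Hs. unfold modulated_re. rewrite Hf1 by auto. simpl. ring. }
{ intros s. apply B. }
{ intros s. replace (Derive (fun s => cos (om * s)) s) with (- (om * sin (om * s))).
  - rewrite Rabs_Ropp. apply B.
  - symmetry. apply is_derive_unique. auto_derive; auto. ring. }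
destruct (bounded_causal (modulated_im om f) (fun s => - sin (om * s)) s0 (1 + Rabs om)) as [C2 H2]; auto.
{ intros s Hs. unfold modulated_im. rewrite Hf1 by auto. simpl. ring. }
{ intros s. apply B. }
{ intros s. replace (Derive (fun s => - sin (om * s)) s) with (- (om * cos (om * s))).
  - rewrite Rabs_Ropp. apply B.
  - symmetry. apply is_derive_unique. auto_derive; auto. ring. }
exists (Rmax C1 C2). intros s. generalize (Rmax_l C1 C2) (Rmax_r C1 C2) (H1 s) (H2 s). lra.
Qed.

Section Vertex.
Variables (phi al : R).
Hypothesis Hphi : 0 < phi < PI.
Hypothesis Hal : 0 < al < phi /\ al < PI / 2.

Lemma Rabs_dot_dir b y : Rabs (dot (dir b) y) <= 2 * Defs.abs y.
Proof.
assert (S := abs_sqr y). assert (A := abs_nonneg y).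
assert (H1 : Rabs (fst y) <= Defs.abs y).
{ apply Rabs_le. split; nra. }
assert (H2 : Rabs (snd y) <= Defs.abs y).
{ apply Rabs_le. split; nra. }
unfold dot, dir; simpl. apply Rle_trans with (1 := Rabs_triang _ _). rewrite !Rabs_mult.
assert (Rabs (cos b) <= 1) by (apply Rabs_le; apply COS_bound).
assert (Rabs (sin b) <= 1) by (apply Rabs_le; apply SIN_bound).
generalize (Rabs_pos (cos b)) (Rabs_pos (sin b)) (Rabs_pos (fst y)) (Rabs_pos (snd y)). nra.
Qed.

Lemma total_real_bound F C y t : causal F -> (forall s, continuous F s) -> (forall s, Rabs (F s) <= C) ->
  slit al y -> Rabs (total_real phi al F (y, t)) <= 9 * C.
Proof.
intros CF F0 HC Hs. destruct (admissible_sources phi al Hphi Hal) as [A1 [A2 [A3 A4]]].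
assert (B : forall a, admissible (q phi) al a -> Rabs (image_wave (q phi) al a 0 0 F (y, t)) <= 2 * C).
{ intros a Ha. apply (edge_wave_bound (q phi) (q_pos phi Hphi) F C CF F0 HC).
  - apply Ha. apply cut_angle_bounds.
  - now apply (slit_abs_pos al). }
unfold total_real. generalize (B _ A1) (B _ A2) (B _ A3) (B _ A4).
assert (BP : Rabs (plane_real (theta2 al) F (y, t)) <= C) by apply HC. revert BP.
set (x1 := image_wave (q phi) al (2 * PI + al) 0 0 F (y, t)). set (x2 := image_wave (q phi) al (theta1 phi al) 0 0 F (y, t)).
set (x3 := image_wave (q phi) al (theta2 al) 0 0 F (y, t)). set (x4 := image_wave (q phi) al al 0 0 F (y, t)).
set (x5 := plane_real (theta2 al) F (y, t)). intros.
generalize (Rabs_triang (x1 + x2 - x3 - x4) x5) (Rabs_triang (x1 + x2 - x3) (- x4))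
  (Rabs_triang (x1 + x2) (- x3)) (Rabs_triang x1 x2).
rewrite !Rabs_Ropp. unfold Rminus in *. lra.
Qed.

(* The limits 1/2 - q x_k / PI of the four image waves and the 1 of the plane
   wave add up to 2 PI / Phi. *)
Lemma total_real_vertex F C t0 e : causal F -> (forall s, continuous F s) -> (forall s, Rabs (F s) <= C) -> 0 < e ->
  exists d, 0 < d /\ forall y t, slit al y -> Defs.abs y < d -> Rabs (t - t0) < d ->
    Rabs (total_real phi al F (y, t) - 2 * PI / Phi phi * F t0) < e.
Proof.
intros CF F0 HC He. destruct (admissible_sources phi al Hphi Hal) as [A1 [A2 [A3 A4]]].
assert (HP := Phi_pos phi Hphi). assert (HPI := PI_RGT_0).
destruct (edge_wave_vertex (q phi) (q_pos phi Hphi) F C CF F0 HC t0 (e / 5) ltac:(lra)) as [d1 [Hd1 HV]].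
destruct (continuous_locally_lt F t0 (e / 5) (F0 t0) ltac:(lra)) as [d2 Hd2].
(* A third, because the argument of the plane wave deviates from [t0] by at most |t - t0| + 2
   |y|. *)
exists (Rmin d1 (d2 / 3)). split.
{ apply Rmin_glb_lt; auto. generalize (cond_pos d2). lra. }
intros y t Hs Hy Ht.
assert (Y1 : Defs.abs y < d1) by (apply Rlt_le_trans with (1 := Hy); apply Rmin_l).
assert (Y2 : Defs.abs y < d2 / 3) by (apply Rlt_le_trans with (1 := Hy); apply Rmin_r).
assert (T1 : Rabs (t - t0) < d1) by (apply Rlt_le_trans with (1 := Ht); apply Rmin_l).
assert (T2 : Rabs (t - t0) < d2 / 3) by (apply Rlt_le_trans with (1 := Ht); apply Rmin_r).
assert (Hr := slit_abs_pos al y Hs). set (th := cut_angle al y).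
assert (V : forall a, admissible (q phi) al a ->
  Rabs (image_wave (q phi) al a 0 0 F (y, t) - (/ 2 - q phi * (th - a) / PI) * F t0) < e / 5).
{ intros a Ha. apply HV; auto. apply Ha. apply cut_angle_bounds. }
assert (VP : Rabs (plane_real (theta2 al) F (y, t) - F t0) < e / 5).
{ apply Hd2. apply ball_R_sym. simpl.
  replace (t - dot (dir (theta2 al)) y - t0) with ((t - t0) + - dot (dir (theta2 al)) y) by ring.
  apply Rle_lt_trans with (1 := Rabs_triang _ _). rewrite Rabs_Ropp.
  generalize (Rabs_dot_dir (theta2 al) y). lra. }
generalize (V _ A1) (V _ A2) (V _ A3) (V _ A4). revert VP. unfold total_real.
set (x1 := image_wave (q phi) al (2 * PI + al) 0 0 F (y, t)). set (x2 := image_wave (q phi) al (theta1 phi al) 0 0 F (y, t)).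
set (x3 := image_wave (q phi) al (theta2 al) 0 0 F (y, t)). set (x4 := image_wave (q phi) al al 0 0 F (y, t)).
set (x5 := plane_real (theta2 al) F (y, t)).
set (c1 := (/ 2 - q phi * (th - (2 * PI + al)) / PI) * F t0). set (c2 := (/ 2 - q phi * (th - theta1 phi al) / PI) * F t0).
set (c3 := (/ 2 - q phi * (th - theta2 al) / PI) * F t0). set (c4 := (/ 2 - q phi * (th - al) / PI) * F t0).
replace (2 * PI / Phi phi * F t0) with (c1 + c2 - c3 - c4 + F t0).
- intros B5 B1 B2 B3 B4. apply Rabs_def2 in B1, B2, B3, B4, B5. apply Rabs_def1; lra.
- unfold c1, c2, c3, c4, theta1, theta2, q, Phi in *. field. lra.
Qed.

Section Source.
Variables (om s0 : R) (f : R -> C).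
Hypothesis Hs0 : 0 < s0.
Hypothesis Hf : smooth f.
Hypothesis Hf0 : forall s, s <= 0 -> f s = RtoC 0.
Hypothesis Hf1 : forall s, s0 <= s -> f s = RtoC 1.
Let Fr := modulated_re om f.
Let Fi := modulated_im om f.
Let U := total_wave om phi al f.

Lemma abs_near_0 d : 0 < d -> locally ((0, 0) : plane) (fun y => Defs.abs y < d).
Proof.
intros Hd. apply (locally_continuous_lt Defs.abs).
- apply continuous_plane_abs.
- unfold Defs.abs, dot; simpl. rewrite Rmult_0_l, Rplus_0_r, sqrt_0. exact Hd.
Qed.

Lemma filterlim_pair_lt (G : (spacetime -> Prop) -> Prop) {FG : Filter G} (u : spacetime -> C) (l1 l2 : R) :
  (forall e, 0 < e -> G (fun p => Rabs (fst (u p) - l1) < e /\ Rabs (snd (u p) - l2) < e)) ->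
  filterlim u G (locally ((l1, l2) : C)).
Proof.
intros H P [e He]. specialize (H e (cond_pos e)). unfold filtermap. revert H. apply filter_imp.
intros p [H1 H2]. apply He. split; apply ball_R_sym; auto.
Qed.

Lemma regular_slit y : regular phi al y -> slit al y.
Proof. intros [H _]. now apply (Qbar_slit phi al Hphi (proj1 Hal)). Qed.

Lemma total_wave_vertex t0 : Qbar phi (0, 0) ->
  U (@pair plane R (0, 0) t0) = (2 * PI / Phi phi * Fr t0, 2 * PI / Phi phi * Fi t0).
Proof.
intros HQ. destruct (smooth_modulated om f Hf) as [S1 S2]. destruct (causal_modulated om f Hf0) as [K1 K2].
destruct (modulated_bounded om f s0 Hs0 Hf Hf0 Hf1) as [C HC].
apply (total_wave_limit phi al Hphi Hal); auto.
- intros [[_ H] _]. now apply H.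
- assert (FW := filter_filter' (ProperFilter' := proper_regular phi al Hphi Hal ((0, 0), t0) HQ)).
  apply filterlim_pair_lt; auto. intros e He.
  destruct (total_real_vertex Fr C t0 e K1 (fun s => smooth_real_continuous _ s S1) (fun s => proj1 (proj1 (HC s))) He) as [d1 [Hd1 H1]].
  destruct (total_real_vertex Fi C t0 e K2 (fun s => smooth_real_continuous _ s S2) (fun s => proj1 (proj2 (HC s))) He) as [d2 [Hd2 H2]].
  destruct (abs_near_0 (Rmin d1 d2)) as [e1 He1]; [now apply Rmin_glb_lt|].
  assert (P0 : 0 < Rmin e1 (Rmin d1 d2)).
  { apply Rmin_glb_lt; [apply cond_pos|now apply Rmin_glb_lt]. }
  exists (mkposreal _ P0). intros [y t] [By Bt] [Ry _]. cbn [fst snd] in *.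
  change (@pair (UniformSpace.sort _) (UniformSpace.sort _) y t) with (@pair plane R y t).
  rewrite (wave_sum_eq phi al Hphi Hal om f Hf Hf0 y t Ry).
  assert (Ay : Defs.abs y < Rmin d1 d2).
  { apply He1. apply ball_le with (2 := By). apply Rmin_l. }
  assert (At : Rabs (t - t0) < Rmin d1 d2).
  { apply Rlt_le_trans with (1 := Bt). apply Rmin_r. }
  assert (M1 := Rmin_l d1 d2). assert (M2 := Rmin_r d1 d2).
  split; [apply H1|apply H2]; try lra; now apply regular_slit.
Qed.

Lemma vertex_or_punctured y : Qbar phi y -> y = (0, 0) \/ Qbar_punctured phi y.
Proof. intros H. destruct (classic (y = (0, 0))); [now left|right; now split]. Qed.

Lemma total_wave_continuous : continuous_on (cyl (Qbar phi) nonneg_times) U.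
Proof.
destruct (smooth_modulated om f Hf) as [S1 S2]. destruct (causal_modulated om f Hf0) as [K1 K2].
fold Fr in S1, K1. fold Fi in S2, K2.
destruct (modulated_bounded om f s0 Hs0 Hf Hf0 Hf1) as [C HC].
assert (HP := Phi_pos phi Hphi). assert (HPI := PI_RGT_0).
intros [y0 t0] [HQ _]. cbn [fst snd] in HQ.
change (@pair (UniformSpace.sort _) (UniformSpace.sort _) y0 t0) with (@pair plane R y0 t0).
destruct (vertex_or_punctured y0 HQ) as [->|HQp].
- rewrite (total_wave_vertex t0 HQ).
  apply filterlim_pair_lt; [apply within_filter; apply filter_filter|]. intros e He.
  destruct (total_real_vertex Fr C t0 e K1 (fun s => smooth_real_continuous _ s S1) (fun s => proj1 (proj1 (HC s))) He) as [d1 [Hd1 H1]].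
  destruct (total_real_vertex Fi C t0 e K2 (fun s => smooth_real_continuous _ s S2) (fun s => proj1 (proj2 (HC s))) He) as [d2 [Hd2 H2]].
  destruct (abs_near_0 (Rmin d1 d2)) as [e1 He1]; [now apply Rmin_glb_lt|].
  assert (C1 : continuous (fun t => 2 * PI / Phi phi * Fr t) t0).
  { apply cont_mult; [apply cont_const|now apply smooth_real_continuous]. }
  assert (C2 : continuous (fun t => 2 * PI / Phi phi * Fi t) t0).
  { apply cont_mult; [apply cont_const|now apply smooth_real_continuous]. }
  destruct (continuous_locally_lt _ _ e C1 He) as [e2 He2]. destruct (continuous_locally_lt _ _ e C2 He) as [e3 He3].
  assert (P0 : 0 < Rmin (Rmin e2 e3) (Rmin e1 (Rmin d1 d2))).
  { repeat apply Rmin_glb_lt; auto; apply cond_pos. }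
  exists (mkposreal _ P0). intros [y t] [By Bt] [Hy _]. cbn [fst snd] in *.
  change (@pair (UniformSpace.sort _) (UniformSpace.sort _) y t) with (@pair plane R y t).
  assert (M1 := Rmin_l d1 d2). assert (M2 := Rmin_r d1 d2).
  assert (M3 := Rmin_l e1 (Rmin d1 d2)). assert (M4 := Rmin_r e1 (Rmin d1 d2)).
  assert (M5 := Rmin_l (Rmin e2 e3) (Rmin e1 (Rmin d1 d2))). assert (M6 := Rmin_r (Rmin e2 e3) (Rmin e1 (Rmin d1 d2))).
  assert (M7 := Rmin_l e2 e3). assert (M8 := Rmin_r e2 e3).
  assert (At : Rabs (t - t0) < Rmin (Rmin e2 e3) (Rmin e1 (Rmin d1 d2))) by exact Bt.
  destruct (vertex_or_punctured y Hy) as [->|Hyp].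
  + rewrite (total_wave_vertex t HQ). simpl. split; [apply He2|apply He3]; apply ball_R_sym; lra.
  + assert (Ay : Defs.abs y < Rmin d1 d2).
    { apply He1. apply ball_le with (2 := By). simpl. lra. }
    assert (Sl : slit al y) by now apply (Qbar_slit phi al Hphi (proj1 Hal)).
    unfold U. rewrite (total_wave_eq phi al Hphi Hal om f Hf Hf0 (@pair plane R y t) Hyp).
    split; [apply H1|apply H2]; auto; lra.
- destruct (total_wave_C_n phi al Hphi Hal om f Hf Hf0 0 (cyl (Qbar_punctured phi) nonneg_times) (cyl (Q phi) pos_times)) as [HC0 _].
  + intros p [H _]; auto.
  + intros p [H _]; auto.
  + unfold U. destruct (Qbar_slit phi al Hphi (proj1 Hal) y0 HQp) as [Sl _].
    rewrite (total_wave_eq phi al Hphi Hal om f Hf Hf0 (@pair plane R y0 t0) HQp).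
    apply filterlim_pair_lt; [apply within_filter; apply filter_filter|]. intros e He.
    assert (W1 : continuous (total_real phi al Fr) (y0, t0)).
    { apply (wave_class_continuous (q phi) al (q_pos phi Hphi)); auto. now apply total_real_class. }
    assert (W2 : continuous (total_real phi al Fi) (y0, t0)).
    { apply (wave_class_continuous (q phi) al (q_pos phi Hphi)); auto. now apply total_real_class. }
    destruct (continuous_locally_lt _ _ e W1 He) as [e2 He2]. destruct (continuous_locally_lt _ _ e W2 He) as [e3 He3].
    assert (NZ : locally y0 (fun y : plane => y <> (0, 0))).
    { apply (filter_imp (fun y => Defs.abs y <> 0)).
      - intros y Hy E. apply Hy. rewrite E. unfold Defs.abs, dot; simpl. now rewrite Rmult_0_l, Rplus_0_r, sqrt_0.
      - apply locally_continuous_neq; [apply continuous_plane_abs|]. generalize (slit_abs_pos al y0 Sl). lra. }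
    destruct NZ as [e1 He1].
    assert (P0 : 0 < Rmin e1 (Rmin e2 e3)) by (repeat apply Rmin_glb_lt; apply cond_pos).
    exists (mkposreal _ P0). intros [y t] By [Hy _]. cbn [fst snd] in *.
  change (@pair (UniformSpace.sort _) (UniformSpace.sort _) y t) with (@pair plane R y t).
    assert (M1 := Rmin_l e1 (Rmin e2 e3)). assert (M2 := Rmin_r e1 (Rmin e2 e3)).
    assert (M3 := Rmin_l e2 e3). assert (M4 := Rmin_r e2 e3).
    assert (Hyp : Qbar_punctured phi y).
    { split; auto. apply He1. apply ball_le with (2 := proj1 By). exact M1. }
    rewrite (total_wave_eq phi al Hphi Hal om f Hf Hf0 (@pair plane R y t) Hyp). simpl.
    split; [apply He2|apply He3]; apply ball_le with (2 := By); simpl; lra.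
Qed.

Lemma bracket_pos y : 0 < Defs.abs y -> 0 < bracket y < 1.
Proof.
intros H. unfold bracket. split; [apply Rdiv_lt_0_compat; lra|].
apply Rmult_lt_reg_r with (1 + Defs.abs y); [lra|]. unfold Rdiv. rewrite Rmult_assoc, Rinv_l; lra.
Qed.

Lemma Rpower_le_1 x N : 0 < x <= 1 -> 0 < N -> Rpower x N <= 1.
Proof.
intros Hx HN. rewrite <- (Rpower_O 1) by lra. replace (Rpower 1 0) with (Rpower 1 N).
- apply Rle_Rpower_l; lra.
- unfold Rpower. rewrite ln_1, !Rmult_0_r. reflexivity.
Qed.

(** The weights fit exactly: bracket y (2 t / |y|) = 2 t / (1 + |y|) <= 2 (1 + t), so the powers
    with exponent [N] cancel up to 2^N <= 2. *)
Lemma weighted_gradient K N y t g : 0 <= K -> 0 < N < 1 -> 0 < Defs.abs y -> 0 <= t ->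
  (t <= Defs.abs y -> g <= K) -> (Defs.abs y < t -> g <= K * (1 + Rpower (2 * t / Defs.abs y) N)) ->
  Rpower (1 + t) (- N) * Rpower (bracket y) N * g <= 3 * K.
Proof.
intros HK HN Hy Ht G1 G2. destruct (bracket_pos y Hy) as [B0 B1].
set (r := Defs.abs y) in *.
assert (P1 : 0 < Rpower (1 + t) (- N) <= 1).
{ split; [apply exp_pos|]. assert (E0 : Rpower (1 + t) 0 = 1) by (apply Rpower_O; lra).
  apply Rle_trans with (Rpower (1 + t) 0); [apply Rle_Rpower; lra|lra]. }
assert (P2 : 0 < Rpower (bracket y) N <= 1) by (split; [apply exp_pos|apply Rpower_le_1; lra]).
set (A := Rpower (1 + t) (- N)) in *. set (B := Rpower (bracket y) N) in *.
assert (AB : 0 < A * B <= 1) by (split; nra).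
destruct (Rle_lt_dec t r) as [L|L].
- specialize (G1 L). apply Rle_trans with (A * B * K); [apply Rmult_le_compat_l; lra|]. nra.
- specialize (G2 L). set (X := Rpower (2 * t / r) N) in *.
  assert (HX : 0 < X) by apply exp_pos.
  assert (ABX : A * B * X <= 2).
  { assert (E1 : B * X = Rpower (bracket y * (2 * t / r)) N).
    { unfold B, X. apply Rpower_mult_distr; auto. apply Rdiv_lt_0_compat; lra. }
    assert (E2 : Rpower (bracket y * (2 * t / r)) N <= Rpower (2 * (1 + t)) N).
    { apply Rle_Rpower_l; [lra|]. unfold bracket. fold r.
      replace (r / (1 + r) * (2 * t / r)) with (2 * t / (1 + r)) by (field; lra). split.
      - apply Rdiv_lt_0_compat; lra.
      - apply Rmult_le_reg_r with (1 + r); [lra|]. unfold Rdiv. rewrite Rmult_assoc, Rinv_l by lra. nra. }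
    assert (E3 : Rpower (2 * (1 + t)) N = Rpower 2 N * Rpower (1 + t) N) by (symmetry; apply Rpower_mult_distr; lra).
    assert (E4 : A * Rpower (1 + t) N = 1).
    { unfold A. rewrite <- Rpower_plus, Rplus_opp_l. apply Rpower_O. lra. }
    assert (E5 : Rpower 2 N <= 2).
    { rewrite <- (Rpower_1 2) at 2 by lra. apply Rle_Rpower; lra. }
    rewrite Rmult_assoc, E1. apply Rle_trans with (A * Rpower (2 * (1 + t)) N); [apply Rmult_le_compat_l; lra|].
    rewrite E3. replace (A * (Rpower 2 N * Rpower (1 + t) N)) with (A * Rpower (1 + t) N * Rpower 2 N) by ring.
    rewrite E4. lra. }
  apply Rle_trans with (A * B * (K * (1 + X))); [apply Rmult_le_compat_l; lra|].
  replace (A * B * (K * (1 + X))) with (K * (A * B + A * B * X)) by ring.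
  replace (3 * K) with (K * 3) by ring. apply Rmult_le_compat_l; lra.
Qed.

Lemma Lub_Rbar_finite_le (P : R -> Prop) x0 M : P x0 -> (forall x, P x -> x <= M) ->
  exists m : R, Lub_Rbar P = Finite m /\ x0 <= m <= M.
Proof.
intros H0 HM. destruct (Lub_Rbar_correct P) as [U1 U2].
assert (A := U1 x0 H0). assert (B := U2 (Finite M) HM).
destruct (Lub_Rbar P) as [m| |]; simpl in A, B; try contradiction. exists m. auto.
Qed.

Lemma Qbar_vertex : Qbar phi (0, 0).
Proof.
intros P [e He]. exists (0, - (e / 2)). split.
- apply He. destruct e as [e e0]; simpl in *. split; apply ball_R_sym; simpl.
  + rewrite Rminus_diag, Rabs_R0; lra.
  + rewrite Rminus_0_r, Rabs_Ropp, Rabs_pos_eq; lra.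
- apply Q_iff; auto. left. simpl. generalize (cond_pos e). lra.
Qed.

Lemma Cmod_le_sum (a b : R) : Cmod (a, b) <= Rabs a + Rabs b.
Proof.
replace ((a, b) : C) with (RtoC a + Ci * RtoC b)%C by (apply injective_projections; simpl; ring).
apply Rle_trans with (1 := Cmod_triangle _ _). rewrite Cmod_mult, !Cmod_R.
replace (Cmod Ci) with 1; [lra|]. unfold Cmod, Ci; simpl. replace (0 * (0 * 1) + 1 * (1 * 1)) with 1 by ring. now rewrite sqrt_1.
Qed.

Lemma sqrt_sum_sqr_le a b : 0 <= a -> 0 <= b -> sqrt (a ^ 2 + b ^ 2) <= a + b.
Proof.
intros Ha Hb. apply Rle_trans with (sqrt ((a + b) * (a + b))).
- apply sqrt_le_1_alt. nra.
- rewrite sqrt_square; lra.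
Qed.

Lemma total_wave_E_space : E_space (1 - 2 * q phi) (1 - 2 * q phi) phi U.
Proof.
destruct (smooth_modulated om f Hf) as [S1 S2]. destruct (causal_modulated om f Hf0) as [K1 K2].
fold Fr in S1, K1. fold Fi in S2, K2.
assert (S1' := smooth_real_Derive _ S1). assert (S2' := smooth_real_Derive _ S2).
assert (K1' := causal_Derive _ K1 S1). assert (K2' := causal_Derive _ K2 S2).
destruct (modulated_bounded om f s0 Hs0 Hf Hf0 Hf1) as [C HC]. fold Fr Fi in HC.
assert (Hqb := q_bounds phi al Hphi Hal). assert (HP := Phi_pos phi Hphi). assert (HPI := PI_RGT_0).
assert (SL : forall y, Qbar_punctured phi y -> slit al y) by (intros y H; now apply (Qbar_slit phi al Hphi (proj1 Hal))).
assert (REP : forall p, cyl (Q phi) all_times p -> U p = (total_real phi al Fr p, total_real phi al Fi p)).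
{ intros p [Hp _]. apply total_wave_eq; auto. now apply Q_Qbar_punctured. }
set (g := fun psi (p : spacetime) => (total_grad phi al psi (Derive Fr) p, total_grad phi al psi (Derive Fi) p) : Complex.C).
assert (SHIFT : forall F d psi, causal F -> smooth_real F ->
   (forall z s h, shift d (z, s) h = (line z psi h, s)) -> forall p, cyl (Q phi) all_times p ->
   is_derive (fun h => total_real phi al F (shift d p h)) 0 (total_grad phi al psi (Derive F) p)).
{ intros F d psi CF SF HS [z s] [Hz _]. apply (is_derive_ext (fun h => total_real phi al F (line z psi h, s))).
  - intros h. now rewrite HS.
  - apply total_real_line; auto. apply SL. now apply Q_Qbar_punctured. }
assert (PART : forall d psi, (forall z s h, shift d (z, s) h = (line z psi h, s)) ->
  forall p, cyl (Q phi) nonneg_times p -> ex_partial d U p /\ g psi p = partial d U p).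
{ intros d psi HS p [Hp _]. assert (Hp' : cyl (Q phi) all_times p) by (split; [exact Hp|exact I]). split.
  - apply (ex_partial_represented (q phi) al (q_pos phi Hphi) (cyl (Q phi) all_times) U (total_real phi al Fr) (total_real phi al Fi)
      (open_cyl_Q phi Hphi)) with (w := nil); auto using total_real_class.
    intros z [Hz _]. apply SL. now apply Q_Qbar_punctured.
  - symmetry. exact (partial_represented (cyl (Q phi) all_times) U _ _ _ _ d (open_cyl_Q phi Hphi) REP
      (SHIFT Fr d psi K1 S1 HS) (SHIFT Fi d psi K2 S2 HS) p Hp'). }
assert (GC : forall psi, continuous_on (cyl (Qbar_punctured phi) nonneg_times) (g psi)).
{ intros psi [y t] [Hy _]. apply (filterlim_filter_le_1 (F := locally ((y, t) : spacetime))); [apply filter_le_within; apply locally_filter|].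
  assert (W : forall F, causal F -> smooth_real F -> continuous (total_grad phi al psi F) (y, t)).
  { intros F CF SF. destruct (admissible_sources phi al Hphi Hal) as [A1 [A2 [A3 A4]]].
    assert (I : forall a, admissible (q phi) al a -> continuous (image_wave (q phi) al a 1 (a - psi) F) (y, t)).
    { intros a Ha. apply (wave_class_continuous (q phi) al (q_pos phi Hphi)); [now apply wave_class_image|now apply SL]. }
    assert (J : continuous (plane_real (theta2 al) F) (y, t)).
    { apply (wave_class_continuous (q phi) al (q_pos phi Hphi)); [now apply wave_class_plane|now apply SL]. }
    unfold total_grad.
    set (i1 := image_wave (q phi) al (2 * PI + al) 1 (2 * PI + al - psi) F).
    set (i2 := image_wave (q phi) al (theta1 phi al) 1 (theta1 phi al - psi) F).
    set (i3 := image_wave (q phi) al (theta2 al) 1 (theta2 al - psi) F).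
    set (i4 := image_wave (q phi) al al 1 (al - psi) F).
    apply (cont_minus (fun p : spacetime => - (i1 p + i2 p - i3 p - i4 p)) (fun p : spacetime => cos (theta2 al - psi) * plane_real (theta2 al) F p)).
    - apply (cont_opp (fun p : spacetime => i1 p + i2 p - i3 p - i4 p)).
      apply (cont_minus (fun p : spacetime => i1 p + i2 p - i3 p) i4); [|now apply I].
      apply (cont_minus (fun p : spacetime => i1 p + i2 p) i3); [|now apply I].
      apply (cont_plus i1 i2); now apply I.
    - apply (cont_mult (fun _ : spacetime => cos (theta2 al - psi)) (plane_real (theta2 al) F)); [apply cont_const|exact J]. }
  apply (cont_pair (total_grad phi al psi (Derive Fr)) (total_grad phi al psi (Derive Fi))); now apply W. }
split; [apply total_wave_continuous|].
exists (g 0), (g (PI / 2)). split.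
{ split; [apply GC|]. split; [apply GC|]. intros p Hp.
  destruct (PART dy1 0 shift_dy1 p Hp). destruct (PART dy2 (PI / 2) shift_dy2 p Hp). auto. }
destruct (total_grad_bound phi al Hphi Hal (Derive Fr) C K1' (fun s => smooth_real_continuous _ s S1') (fun s => proj2 (proj1 (HC s)))) as [Kr [HKr Gr]].
destruct (total_grad_bound phi al Hphi Hal (Derive Fi) C K2' (fun s => smooth_real_continuous _ s S2') (fun s => proj2 (proj2 (HC s)))) as [Ki [HKi Gi]].
set (N := 1 - 2 * q phi) in *. assert (HN : 0 < N < 1) by (unfold N; lra).
assert (C0 : 0 <= C) by (apply Rle_trans with (2 := proj1 (proj1 (HC 0))); apply Rabs_pos).
set (k := 2 * PI / Phi phi). assert (Hk : 0 < k) by (apply Rdiv_lt_0_compat; lra).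
(* Two components of size at most 9 C, plus the values at the vertex; [M2] collects two derivatives
   of two components, each at most 3 K after weighting. *)
set (M1 := 18 * C + k * (2 * C)). set (M2 := 6 * Kr + 6 * Ki).
assert (UB : forall y t, Qbar phi y -> Cmod (U (y, t)) <= M1).
{ intros y t Hy. assert (0 <= k * (2 * C)) by (apply Rmult_le_pos; lra). destruct (vertex_or_punctured y Hy) as [->|Hyp].
  - rewrite total_wave_vertex by auto. fold k. apply Rle_trans with (1 := Cmod_le_sum _ _).
    rewrite !Rabs_mult, (Rabs_pos_eq k) by lra. destruct (HC t) as [[B1 _] [B2 _]].
    fold Fr Fi. assert (k * Rabs (Fr t) <= k * C) by (apply Rmult_le_compat_l; lra).
    assert (k * Rabs (Fi t) <= k * C) by (apply Rmult_le_compat_l; lra). unfold M1. lra.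
  - unfold U. rewrite (total_wave_eq phi al Hphi Hal om f Hf Hf0 (@pair plane R y t) Hyp). apply Rle_trans with (1 := Cmod_le_sum _ _).
    assert (B1 := total_real_bound Fr C y t K1 (fun s => smooth_real_continuous _ s S1) (fun s => proj1 (proj1 (HC s))) (SL y Hyp)).
    assert (B2 := total_real_bound Fi C y t K2 (fun s => smooth_real_continuous _ s S2) (fun s => proj1 (proj2 (HC s))) (SL y Hyp)).
    fold Fr Fi. unfold M1. lra. }
set (wg := fun y t => Rpower (1 + t) (- N) * Rpower (bracket y) N * sqrt (Cmod (g 0 (y, t)) ^ 2 + Cmod (g (PI / 2) (y, t)) ^ 2)).
assert (GB : forall y t, 0 <= t -> Qbar_punctured phi y -> wg y t <= M2).
{ intros y t Ht Hy. assert (Sl := SL y Hy). assert (Hr := slit_abs_pos al y Sl).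
  assert (W : forall K F psi, 0 <= K -> (t <= Defs.abs y -> Rabs (total_grad phi al psi F (y, t)) <= K) /\
     (Defs.abs y < t -> Rabs (total_grad phi al psi F (y, t)) <= K * (1 + Rpower (2 * t / Defs.abs y) N)) ->
     Rpower (1 + t) (- N) * Rpower (bracket y) N * Rabs (total_grad phi al psi F (y, t)) <= 3 * K).
  { intros K F psi HK [H1 H2]. now apply weighted_gradient. }
  assert (W1 := W Kr _ 0 HKr (Gr 0 y t Sl Ht)). assert (W2 := W Kr _ (PI / 2) HKr (Gr (PI / 2) y t Sl Ht)).
  assert (W3 := W Ki _ 0 HKi (Gi 0 y t Sl Ht)). assert (W4 := W Ki _ (PI / 2) HKi (Gi (PI / 2) y t Sl Ht)).
  unfold wg. set (A := Rpower (1 + t) (- N) * Rpower (bracket y) N) in *.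
  assert (HA : 0 < A) by (apply Rmult_lt_0_compat; apply exp_pos).
  apply Rle_trans with (A * (Cmod (g 0 (y, t)) + Cmod (g (PI / 2) (y, t)))).
  - apply Rmult_le_compat_l; [lra|]. apply sqrt_sum_sqr_le; apply Cmod_ge_0.
  - assert (X1 := Cmod_le_sum (total_grad phi al 0 (Derive Fr) (y, t)) (total_grad phi al 0 (Derive Fi) (y, t))).
    assert (X2 := Cmod_le_sum (total_grad phi al (PI / 2) (Derive Fr) (y, t)) (total_grad phi al (PI / 2) (Derive Fi) (y, t))).
    apply Rmult_le_compat_l with (r := A) in X1; [|lra]. apply Rmult_le_compat_l with (r := A) in X2; [|lra].
    unfold g, M2. lra. }
(* A witness that both suprema are over nonempty sets, so that neither is [m_infty]. *)
assert (PY : Qbar_punctured phi (polar 1 PI)) by (apply Qbar_polar; auto; lra).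
assert (T : forall t, 0 <= t -> exists m : R, Rbar_plus
   (Lub_Rbar (fun x => exists y, Qbar phi y /\ x = Cmod (U (y, t))))
   (Lub_Rbar (fun x => exists y, Qbar_punctured phi y /\ x = wg y t)) = Finite m /\ 0 <= m <= M1 + M2).
{ intros t Ht.
  destruct (Lub_Rbar_finite_le (fun x => exists y, Qbar phi y /\ x = Cmod (U (y, t))) (Cmod (U (polar 1 PI, t))) M1) as [m1 [-> Hm1]].
  { exists (polar 1 PI). split; auto. apply PY. }
  { intros x [y [Hy ->]]. now apply UB. }
  destruct (Lub_Rbar_finite_le (fun x => exists y, Qbar_punctured phi y /\ x = wg y t) (wg (polar 1 PI) t) M2) as [m2 [-> Hm2]].
  { exists (polar 1 PI). auto. }
  { intros x [y [Hy ->]]. now apply GB. }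
  exists (m1 + m2). split; auto.
  assert (0 <= wg (polar 1 PI) t).
  { unfold wg. apply Rmult_le_pos; [|apply sqrt_pos]. apply Rmult_le_pos; left; apply exp_pos. }
  generalize (Cmod_ge_0 (U (polar 1 PI, t))). lra. }
assert (FIN : forall L, Rbar_is_lub (fun s : Rbar => exists t : R, 0 <= t /\ s = Rbar_plus
   (Lub_Rbar (fun x => exists y, Qbar phi y /\ x = Cmod (U (y, t))))
   (Lub_Rbar (fun x => exists y, Qbar_punctured phi y /\ x = wg y t))) L -> is_finite L).
{ intros L [L1 L2]. destruct (T 0 (Rle_refl 0)) as [m [Em Hm]].
  assert (B1 : Rbar_le (Finite m) L) by (apply L1; exists 0; split; [lra|now rewrite Em]).
  assert (B2 : Rbar_le L (Finite (M1 + M2))).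
  { apply L2. intros s [t [Ht ->]]. destruct (T t Ht) as [m' [-> Hm']]. simpl. lra. }
  destruct L; simpl in B1, B2; try contradiction. reflexivity. }
apply FIN. unfold E_norm. fold N. unfold Rbar_lub.
match goal with |- Rbar_is_lub _ (proj1_sig ?x) => exact (proj2_sig x) end.
Qed.

Lemma total_wave_space : solution_space phi U.
Proof.
split; [|split].
- intros n. apply total_wave_C_n; auto; intros p [Hp _]; auto.
- apply total_wave_continuous.
- apply total_wave_E_space.
Qed.
End Source.
End Vertex.

(** * Uniqueness *)

(** The hypotheses are local at each pair (h0, s); [tube] makes them uniform over [[a, b]], as
    differentiation under the integral requires. *)
Lemma is_derive_RInt_joint (G G' : R -> R -> R) (a b h0 : R) : a < b ->
  (forall s, a <= s <= b -> locally ((h0, s) : R * R) (fun z => is_derive (fun h => G h (snd z)) (fst z) (G' (fst z) (snd z)))) ->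
  (forall s, a <= s <= b -> continuous (fun z : R * R => G' (fst z) (snd z)) (h0, s)) ->
  (forall s, a <= s <= b -> locally ((h0, s) : R * R) (fun z => continuous (G (fst z)) (snd z))) ->
  is_derive (fun h => RInt (G h) a b) h0 (RInt (G' h0) a b).
Proof.
intros Hab HD HC HI. evar_last.
- apply (is_derive_RInt_param G a b h0).
  + assert (T := tube h0 (fun h s => is_derive (fun h => G h s) h (G' h s)) a b HD).
    generalize T. apply filter_imp. intros h Hh s. rewrite Rmin_left, Rmax_right by lra. intros Hs.
    eexists. now apply Hh.
  + intros s. rewrite Rmin_left, Rmax_right by lra. intros Hs.
    apply continuity_2d_pt_filterlim.
    replace (Derive (fun z => G z s) h0) with (G' h0 s).
    * apply (filterlim_ext_loc (fun z : R * R => G' (fst z) (snd z))); [|now apply HC].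
      generalize (HD s Hs). apply filter_imp. intros z Hz. symmetry. apply is_derive_unique. exact Hz.
    * symmetry. apply is_derive_unique. exact (locally_singleton _ _ (HD s Hs)).
  + assert (T := tube h0 (fun h s => continuous (G h) s) a b HI).
    generalize T. apply filter_imp. intros h Hh. apply (ex_RInt_continuous (V := R_CompleteNormedModule)).
    intros s. rewrite Rmin_left, Rmax_right by lra. intros Hs. now apply Hh.
- apply RInt_ext. intros s. rewrite Rmin_left, Rmax_right by lra. intros Hs. apply is_derive_unique.
  exact (locally_singleton _ _ (HD s ltac:(lra))).
Qed.

Lemma RInt_sub_le (f : R -> R) a b c d : a <= c <= d -> d <= b -> ex_RInt f a b ->
  (forall s, a < s < b -> 0 <= f s) -> RInt f c d <= RInt f a b.
Proof.
intros H1 H2 He Hp.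
assert (E1 : ex_RInt f a c) by (apply (ex_RInt_sub f a b); auto; lra).
assert (E2 : ex_RInt f c d) by (apply (ex_RInt_sub f a b); auto; lra).
assert (E3 : ex_RInt f d b) by (apply (ex_RInt_sub f a b); auto; lra).
assert (E4 : ex_RInt f a d) by (apply (ex_RInt_sub f a b); auto; lra).
rewrite <- (RInt_Chasles (V := R_CompleteNormedModule) f a d b E4 E3).
rewrite <- (RInt_Chasles (V := R_CompleteNormedModule) f a c d E1 E2). unfold plus; simpl.
assert (0 <= RInt f a c) by (apply RInt_ge_0; [lra|auto|intros; apply Hp; lra]).
assert (0 <= RInt f d b) by (apply RInt_ge_0; [lra|auto|intros; apply Hp; lra]).
lra.
Qed.

(** * Calculus on compact boxes in polar coordinates *)

Section PolarEnergy.
Variables (lo hi : R).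
Hypothesis Hlohi : lo < hi.

Definition strip (rho th : R) : Prop := 0 < rho /\ lo < th < hi.

(** Joint continuity in the open sector only: nothing is presupposed at the vertex or on the sides.
    This is why the integrals run over compact boxes inside the sector and boundary terms are
    estimated separately. *)
Definition good (g : R -> R -> R -> R) : Prop := forall rho th t, strip rho th ->
  continuous (fun z : (R * R) * R => g (fst (fst z)) (snd (fst z)) (snd z)) ((rho, th), t).
Definition derive_rho (g g' : R -> R -> R -> R) : Prop := forall rho th t, strip rho th ->
  is_derive (fun rho => g rho th t) rho (g' rho th t).
Definition derive_th (g g' : R -> R -> R -> R) : Prop := forall rho th t, strip rho th ->
  is_derive (fun th => g rho th t) th (g' rho th t).
Definition derive_t (g g' : R -> R -> R -> R) : Prop := forall rho th t, strip rho th ->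
  is_derive (fun t => g rho th t) t (g' rho th t).

Lemma locally_strip rho th : strip rho th -> locally ((rho, th) : R * R) (fun z => strip (fst z) (snd z)).
Proof.
intros [H1 [H2 H3]]. apply filter_and; [|apply filter_and].
- apply (locally_continuous_gt (fun z : R * R => fst z)); [cont|exact H1].
- apply (locally_continuous_gt (fun z : R * R => snd z)); [cont|exact H2].
- apply (locally_continuous_lt (fun z : R * R => snd z)); [cont|exact H3].
Qed.

Lemma locally_strip_rho rho th : strip rho th -> locally rho (fun r => strip r th).
Proof.
intros H. assert (C : continuous (fun r : R => (r, th)) rho) by (apply cont_pair; cont).
exact (C _ (locally_strip rho th H)).
Qed.
Lemma locally_strip_th rho th : strip rho th -> locally th (fun s => strip rho s).
Proof.
intros H. assert (C : continuous (fun r : R => (rho, r)) th) by (apply cont_pair; cont).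
exact (C _ (locally_strip rho th H)).
Qed.

Lemma good_comp {E : UniformSpace} g (r th t : E -> R) p : good g -> strip (r p) (th p) ->
  continuous r p -> continuous th p -> continuous t p -> continuous (fun p => g (r p) (th p) (t p)) p.
Proof.
intros Hg Hs Hr Hth Ht.
apply (continuous_comp (fun p => ((r p, th p), t p)) (fun z : (R * R) * R => g (fst (fst z)) (snd (fst z)) (snd z))).
- apply cont_pair; auto. now apply cont_pair.
- now apply Hg.
Qed.

Definition tint (g : R -> R -> R -> R) (rho th t : R) : R := RInt (g rho th) 0 t.

Lemma good_t_continuous g rho th t : good g -> strip rho th -> continuous (g rho th) t.
Proof. intros Hg Hs. apply (good_comp g (fun _ => rho) (fun _ => th) (fun t => t)); auto; cont. Qed.

(** Rescaling to [[0, 1]] moves [t] from the limit of integration into the integrand, where the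
    results on parametric integrals apply. *)
Lemma tint_scaled g rho th t : good g -> strip rho th -> tint g rho th t = t * RInt (fun u => g rho th (t * u)) 0 1.
Proof.
intros Hg Hs. unfold tint.
assert (C : forall a b, ex_RInt (g rho th) a b).
{ intros a b. apply (ex_RInt_continuous (V := R_CompleteNormedModule)). intros s _. now apply good_t_continuous. }
assert (E := RInt_comp_lin (V := R_CompleteNormedModule) (g rho th) t 0 0 1 (C _ _)).
replace (t * 0 + 0) with 0 in E by ring. replace (t * 1 + 0) with t in E by ring.
rewrite <- E. symmetry. rewrite <- (RInt_scal (V := R_CompleteNormedModule)).
- apply RInt_ext. intros s _. now rewrite Rplus_0_r.
- apply (ex_RInt_continuous (V := R_CompleteNormedModule)). intros s _.
  apply (cont_comp (g rho th)); [cont|]. now apply good_t_continuous.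
Qed.

Lemma good_ext g g' : (forall rho th t, strip rho th -> g rho th t = g' rho th t) -> good g -> good g'.
Proof.
intros He Hg rho th t Hs.
apply (continuous_ext_loc _ (fun z : (R * R) * R => g (fst (fst z)) (snd (fst z)) (snd z))); [|now apply Hg].
assert (C : continuous (fun z : (R * R) * R => fst z) ((rho, th), t)) by cont.
generalize (C _ (locally_strip rho th Hs)). unfold filtermap. apply filter_imp. intros z Hz. now apply He.
Qed.

Lemma good_tint g : good g -> good (tint g).
Proof.
intros Hg. apply (good_ext (fun rho th t => t * RInt (fun u => g rho th (t * u)) 0 1)).
{ intros. symmetry. now apply tint_scaled. }
intros rho th t Hs. apply cont_mult; [cont|].
apply (continuous_RInt_param (fun (z : (R * R) * R) u => g (fst (fst z)) (snd (fst z)) (snd z * u))); [lra| |].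
- intros s _. apply (good_comp g (fun w : ((R * R) * R) * R => fst (fst (fst w))) (fun w => snd (fst (fst w))) (fun w => snd (fst w) * snd w)); auto.
  + apply (continuous_comp fst (fun z : (R * R) * R => fst (fst z))); cont.
  + apply (continuous_comp fst (fun z : (R * R) * R => snd (fst z))); cont.
  + cont.
- assert (C : continuous (fun z : (R * R) * R => fst z) ((rho, th), t)) by cont.
  generalize (C _ (locally_strip rho th Hs)). unfold filtermap. apply filter_imp. intros z Hz.
  apply (ex_RInt_continuous (V := R_CompleteNormedModule)). intros s _.
  apply (cont_comp (g (fst (fst z)) (snd (fst z)))); [cont|]. now apply good_t_continuous.
Qed.

Lemma derive_t_tint g : good g -> derive_t (tint g) g.
Proof.
intros Hg rho th t Hs. unfold tint. apply (is_derive_RInt (V := R_NormedModule) (g rho th) (fun t => RInt (g rho th) 0 t) 0).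
- apply filter_forall. intros s. apply (RInt_correct (V := R_CompleteNormedModule)).
  apply (ex_RInt_continuous (V := R_CompleteNormedModule)). intros u _. now apply good_t_continuous.
- now apply good_t_continuous.
Qed.

Lemma derive_rho_tint g g' : good g -> good g' -> derive_rho g g' -> derive_rho (tint g) (tint g').
Proof.
intros Hg Hg' HD rho th t Hs.
assert (L := locally_strip_rho rho th Hs).
apply (is_derive_ext_loc (fun rho => t * RInt (fun u => g rho th (t * u)) 0 1)).
{ generalize L. apply filter_imp. intros r Hr. symmetry. now apply tint_scaled. }
rewrite tint_scaled by auto. apply is_derive_scal.
assert (L2 : forall s : R, locally ((rho, s) : R * R) (fun z => strip (fst z) th)).
{ intros s. assert (C : continuous (fun z : R * R => fst z) (rho, s)) by cont. exact (C _ L). }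
apply (is_derive_RInt_joint (fun r u => g r th (t * u)) (fun r u => g' r th (t * u))); [lra| | |].
- intros s _. generalize (L2 s). apply filter_imp. intros z Hz. now apply HD.
- intros s _. apply (good_comp g' (fun z : R * R => fst z) (fun _ => th) (fun z : R * R => t * snd z)); auto; cont.
- intros s _. generalize (L2 s). apply filter_imp. intros z Hz.
  apply (good_comp g (fun _ => fst z) (fun _ => th) (fun u => t * u)); auto; cont.
Qed.

Lemma derive_th_tint g g' : good g -> good g' -> derive_th g g' -> derive_th (tint g) (tint g').
Proof.
intros Hg Hg' HD rho th t Hs.
assert (L := locally_strip_th rho th Hs).
apply (is_derive_ext_loc (fun th => t * RInt (fun u => g rho th (t * u)) 0 1)).
{ generalize L. apply filter_imp. intros r Hr. symmetry. now apply tint_scaled. }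
rewrite tint_scaled by auto. apply is_derive_scal.
assert (L2 : forall s : R, locally ((th, s) : R * R) (fun z => strip rho (fst z))).
{ intros s. assert (C : continuous (fun z : R * R => fst z) (th, s)) by cont. exact (C _ L). }
apply (is_derive_RInt_joint (fun r u => g rho r (t * u)) (fun r u => g' rho r (t * u))); [lra| | |].
- intros s _. generalize (L2 s). apply filter_imp. intros z Hz. now apply HD.
- intros s _. apply (good_comp g' (fun _ => rho) (fun z : R * R => fst z) (fun z : R * R => t * snd z)); auto; cont.
- intros s _. generalize (L2 s). apply filter_imp. intros z Hz.
  apply (good_comp g (fun _ => rho) (fun _ => fst z) (fun u => t * u)); auto; cont.
Qed.

Lemma good_mult g h : good g -> good h -> good (fun rho th t => g rho th t * h rho th t).
Proof. intros Hg Hh rho th t Hs. apply cont_mult; [now apply Hg|now apply Hh]. Qed.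
Lemma good_plus g h : good g -> good h -> good (fun rho th t => g rho th t + h rho th t).
Proof. intros Hg Hh rho th t Hs. apply cont_plus; [now apply Hg|now apply Hh]. Qed.
Lemma good_radial m : (forall rho, 0 < rho -> continuous m rho) -> good (fun rho _ _ => m rho).
Proof.
intros Hm rho th t Hs. apply (cont_comp m); [cont|]. apply Hm. apply Hs.
Qed.

Section Box.
Variables (de R0 c d : R).
Hypothesis Hde : 0 < de < R0.
Hypothesis Hcd : lo < c /\ c < d /\ d < hi.

Definition ith (g : R -> R -> R -> R) (rho t : R) : R := RInt (fun th => g rho th t) c d.
Definition box (g : R -> R -> R -> R) (t : R) : R := RInt (fun rho => ith g rho t) de R0.

Lemma ex_RInt_th g rho t : good g -> 0 < rho -> ex_RInt (fun th => g rho th t) c d.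
Proof.
intros Hg Hr. apply (ex_RInt_continuous (V := R_CompleteNormedModule)). intros s.
rewrite Rmin_left, Rmax_right by lra. intros Hs.
apply (good_comp g (fun _ => rho) (fun s => s) (fun _ => t)); auto; try cont. split; lra.
Qed.

Lemma continuous_ith {E : UniformSpace} g (r t : E -> R) p : good g -> 0 < r p ->
  continuous r p -> continuous t p -> continuous (fun p => ith g (r p) (t p)) p.
Proof.
intros Hg Hr0 Hr Ht. apply (continuous_RInt_param (fun p th => g (r p) th (t p))); [lra| |].
- intros s Hs. apply (good_comp g (fun z : E * R => r (fst z)) (fun z => snd z) (fun z => t (fst z))); auto.
  + split; simpl; lra.
  + apply (continuous_comp fst r); cont.
  + cont.
  + apply (continuous_comp fst t); cont.
- generalize (locally_continuous_gt r p 0 Hr Hr0). apply filter_imp. intros z Hz. now apply ex_RInt_th.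
Qed.

Lemma ex_RInt_ith g t : good g -> ex_RInt (fun rho => ith g rho t) de R0.
Proof.
intros Hg. apply (ex_RInt_continuous (V := R_CompleteNormedModule)). intros s.
rewrite Rmin_left, Rmax_right by lra. intros Hs.
apply (continuous_ith g (fun s => s) (fun _ => t)); auto; try cont. lra.
Qed.

Lemma is_derive_ith_t g g' rho t : good g -> good g' -> derive_t g g' -> 0 < rho ->
  is_derive (fun t => ith g rho t) t (ith g' rho t).
Proof.
intros Hg Hg' HD Hr.
assert (L : forall s : R, c <= s <= d -> locally ((t, s) : R * R) (fun z => strip rho (snd z))).
{ intros s Hs. assert (C : continuous (fun z : R * R => snd z) (t, s)) by cont.
  apply (C _ (locally_strip_th rho s ltac:(split; lra))). }
apply (is_derive_RInt_joint (fun t th => g rho th t) (fun t th => g' rho th t)); [lra| | |].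
- intros s Hs. generalize (L s Hs). apply filter_imp. intros z Hz. now apply HD.
- intros s Hs. apply (good_comp g' (fun _ => rho) (fun z : R * R => snd z) (fun z : R * R => fst z)); auto; try cont.
  split; simpl; lra.
- intros s Hs. generalize (L s Hs). apply filter_imp. intros z Hz.
  apply (good_comp g (fun _ => rho) (fun th => th) (fun _ => fst z)); auto; cont.
Qed.

Lemma is_derive_box_t g g' t : good g -> good g' -> derive_t g g' -> is_derive (box g) t (box g' t).
Proof.
intros Hg Hg' HD.
assert (L : forall s : R, de <= s <= R0 -> locally ((t, s) : R * R) (fun z => 0 < snd z)).
{ intros s Hs. apply (locally_continuous_gt (fun z : R * R => snd z)); [cont|simpl; lra]. }
apply (is_derive_RInt_joint (fun t rho => ith g rho t) (fun t rho => ith g' rho t)); [lra| | |].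
- intros s Hs. generalize (L s Hs). apply filter_imp. intros z Hz. now apply is_derive_ith_t.
- intros s Hs. apply (continuous_ith g' (fun z : R * R => snd z) (fun z : R * R => fst z)); auto; try cont. simpl; lra.
- intros s Hs. generalize (L s Hs). apply filter_imp. intros z Hz.
  apply (continuous_ith g (fun r => r) (fun _ => fst z)); auto; cont.
Qed.

Lemma is_derive_ith_rho g g' rho t : good g -> good g' -> derive_rho g g' -> 0 < rho ->
  is_derive (fun rho => ith g rho t) rho (ith g' rho t).
Proof.
intros Hg Hg' HD Hr.
assert (L : forall s : R, c <= s <= d -> locally ((rho, s) : R * R) (fun z => strip (fst z) (snd z))).
{ intros s Hs. apply locally_strip. split; lra. }
apply (is_derive_RInt_joint (fun rho th => g rho th t) (fun rho th => g' rho th t)); [lra| | |].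
- intros s Hs. generalize (L s Hs). apply filter_imp. intros z Hz. now apply HD.
- intros s Hs. apply (good_comp g' (fun z : R * R => fst z) (fun z : R * R => snd z) (fun _ => t)); auto; try cont.
  split; simpl; lra.
- intros s Hs. generalize (L s Hs). apply filter_imp. intros z Hz.
  apply (good_comp g (fun _ => fst z) (fun th => th) (fun _ => t)); auto; cont.
Qed.

Lemma box_derive_rho g g' t : good g -> good g' -> derive_rho g g' -> box g' t = ith g R0 t - ith g de t.
Proof.
intros Hg Hg' HD. apply is_RInt_unique.
apply (is_RInt_derive (V := R_CompleteNormedModule) (fun rho => ith g rho t) (fun rho => ith g' rho t)).
- intros s. rewrite Rmin_left, Rmax_right by lra. intros Hs. apply is_derive_ith_rho; auto; lra.
- intros s. rewrite Rmin_left, Rmax_right by lra. intros Hs.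
  apply (continuous_ith g' (fun r => r) (fun _ => t)); auto; try cont. lra.
Qed.

Lemma ith_derive_th g g' rho t : good g -> good g' -> derive_th g g' -> 0 < rho ->
  ith g' rho t = g rho d t - g rho c t.
Proof.
intros Hg Hg' HD Hr. apply is_RInt_unique.
apply (is_RInt_derive (V := R_CompleteNormedModule) (fun th => g rho th t) (fun th => g' rho th t)).
- intros s. rewrite Rmin_left, Rmax_right by lra. intros Hs. apply HD. split; lra.
- intros s. rewrite Rmin_left, Rmax_right by lra. intros Hs.
  apply (good_comp g' (fun _ => rho) (fun th => th) (fun _ => t)); auto; try cont. split; lra.
Qed.

Lemma box_plus g h t : good g -> good h -> box (fun rho th t => g rho th t + h rho th t) t = box g t + box h t.
Proof.
intros Hg Hh. apply is_RInt_unique.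
apply (is_RInt_ext (V := R_NormedModule) (fun rho => ith g rho t + ith h rho t)).
- intros s. rewrite Rmin_left by lra. intros Hs. symmetry.
  apply (RInt_plus (V := R_CompleteNormedModule)); apply ex_RInt_th; auto; lra.
- apply (is_RInt_plus (V := R_NormedModule)); apply (RInt_correct (V := R_CompleteNormedModule)); now apply ex_RInt_ith.
Qed.

Lemma box_le g h t : good g -> good h ->
  (forall rho th, de <= rho <= R0 -> c <= th <= d -> g rho th t <= h rho th t) -> box g t <= box h t.
Proof.
intros Hg Hh HL. apply RInt_le; [lra|now apply ex_RInt_ith|now apply ex_RInt_ith|].
intros rho Hr. apply RInt_le; [lra|apply ex_RInt_th; auto; lra|apply ex_RInt_th; auto; lra|].
intros th Ht. apply HL; lra.
Qed.

Lemma ith_abs_le g rho t M : good g -> 0 < rho -> (forall th, c <= th <= d -> Rabs (g rho th t) <= M) ->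
  Rabs (ith g rho t) <= (d - c) * M.
Proof.
intros Hg Hr HM. apply abs_RInt_le_open; [lra|now apply ex_RInt_th|]. intros th Ht. apply HM. lra.
Qed.
End Box.
End PolarEnergy.

(** The quantity is at most sqrt (rho (1 + rho)): the flux through a small arc vanishes because the
    gradient grows no faster than rho^(-1/2). *)
Lemma small_radius eta : 0 < eta -> exists d, 0 < d /\ forall rho, 0 < rho <= d ->
  exp (- rho) * (rho * sqrt ((1 + rho) / rho)) <= eta.
Proof.
intros He. exists (Rmin 1 (eta * eta / 2)). split; [apply Rmin_glb_lt; nra|].
intros rho Hr. assert (R1 : rho <= 1) by (apply Rle_trans with (1 := proj2 Hr); apply Rmin_l).
assert (R2 : rho <= eta * eta / 2) by (apply Rle_trans with (1 := proj2 Hr); apply Rmin_r).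
assert (E1 : exp (- rho) <= 1) by (rewrite <- exp_0; left; apply exp_increasing; lra).
assert (S : rho * sqrt ((1 + rho) / rho) <= eta).
{ rewrite <- (sqrt_square eta) by lra. rewrite <- (sqrt_square rho) at 1 by lra.
  rewrite <- sqrt_mult_alt by nra. apply sqrt_le_1_alt.
  replace (rho * rho * ((1 + rho) / rho)) with (rho * (1 + rho)) by (field; lra). nra. }
assert (0 <= rho * sqrt ((1 + rho) / rho)) by (apply Rmult_le_pos; [lra|apply sqrt_pos]).
generalize (exp_pos (- rho)). nra.
Qed.

(** exp R0 >= (1 + R0 / 2)^2 beats the linear factor 1 + R0; the summand 4 / eta in the witness
    ensures eta (1 + R0 / 2) >= 2. *)
Lemma large_radius eta B : 0 < eta -> exists R0, B < R0 /\ 0 < R0 /\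
  exp (- R0) * (R0 * sqrt ((1 + R0) / R0)) <= eta.
Proof.
intros He. set (R0 := Rabs B + 1 + 4 / eta).
assert (P : 0 < 4 / eta) by (apply Rdiv_lt_0_compat; lra).
assert (HB := Rabs_pos B). assert (HB2 := Rle_abs B).
exists R0. split; [unfold R0; lra|]. split; [unfold R0; lra|].
assert (HR : 4 / eta < R0) by (unfold R0; lra). assert (HR0 : 0 < R0) by (unfold R0; lra). clearbody R0.
assert (S : R0 * sqrt ((1 + R0) / R0) <= 1 + R0).
{ assert (Y : 1 < (1 + R0) / R0).
  { apply Rmult_lt_reg_r with R0; auto. replace ((1 + R0) / R0 * R0) with (1 + R0) by (field; lra). lra. }
  replace (1 + R0) with (R0 * ((1 + R0) / R0)) at 2 by (field; lra).
  apply Rmult_le_compat_l; [lra|]. left. now apply sqrt_less_alt. }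
assert (E1 : 1 + R0 / 2 < exp (R0 / 2)) by (apply exp_ineq1; lra).
assert (E2 : exp R0 = exp (R0 / 2) * exp (R0 / 2)) by (rewrite <- exp_plus; f_equal; field).
assert (E3 : exp (- R0) * exp R0 = 1) by (rewrite <- exp_plus, Rplus_opp_l; apply exp_0).
assert (X := exp_pos (- R0)).
apply Rle_trans with (exp (- R0) * (1 + R0)); [apply Rmult_le_compat_l; lra|].
assert (Q : (1 + R0) <= eta * exp R0).
{ rewrite E2. assert (A : 2 <= eta * (1 + R0 / 2)).
  { apply Rmult_lt_compat_l with (r := eta) in HR; auto.
    replace (eta * (4 / eta)) with 4 in HR by (field; lra). nra. }
  apply Rle_trans with (eta * ((1 + R0 / 2) * (1 + R0 / 2))); [nra|].
  apply Rmult_le_compat_l; [lra|]. nra. }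
apply Rle_trans with (exp (- R0) * (eta * exp R0)); [apply Rmult_le_compat_l; lra|].
replace (exp (- R0) * (eta * exp R0)) with (eta * (exp (- R0) * exp R0)) by ring. rewrite E3. lra.
Qed.

(** * The weighted energy estimate in the sector *)

Section Uniqueness.
Variables (lo hi : R).
Hypothesis Hlohi : lo < hi.
Variables (w a b wt A B wtt : R -> R -> R -> R).
Notation good := (good lo hi). Notation strip := (strip lo hi).
Notation derive_rho := (derive_rho lo hi). Notation derive_th := (derive_th lo hi). Notation derive_t := (derive_t lo hi).
Hypothesis Gw : good w. Hypothesis Ga : good a. Hypothesis Gb : good b. Hypothesis Gwt : good wt.
Hypothesis GA : good A. Hypothesis GB : good B. Hypothesis Gwtt : good wtt.
Hypothesis Da : derive_rho w a. Hypothesis Db : derive_th w b.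
Hypothesis Dt : derive_t w wt. Hypothesis Dtt : derive_t wt wtt.
Hypothesis DA : derive_rho (fun rho th t => rho * a rho th t) A.
Hypothesis DB : derive_th b B.
Hypothesis WAVE : forall rho th t, strip rho th -> rho * wtt rho th t = A rho th t + B rho th t / rho.
Hypothesis IC0 : forall rho th, strip rho th -> w rho th 0 = 0.
Hypothesis IC1 : forall rho th, strip rho th -> wt rho th 0 = 0.
Variable M : R.
Hypothesis HM : forall rho th t, strip rho th -> 0 <= t -> Rabs (w rho th t) <= M.
Hypothesis HK : forall T, 0 <= T -> exists K, 0 <= K /\ forall rho th t, strip rho th -> 0 <= t <= T ->
  Rabs (a rho th t) <= K * sqrt ((1 + rho) / rho).
Hypothesis NB : forall th0 k rho0 t0, th0 = lo \/ th0 = hi -> 0 < k -> 0 < rho0 -> 0 <= t0 ->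
  locally (((th0, rho0), t0) : (R * R) * R) (fun z => lo < fst (fst z) < hi -> 0 <= snd z ->
    Rabs (b (snd (fst z)) (fst (fst z)) (snd z)) <= k).

(* Time integrals: the gradient bound controls [p] near the vertex, whereas
   nothing is known about [wt] there. *)
Let p := tint a.
Let r := tint b.

Lemma good_p : good p. Proof. now apply good_tint. Qed.
Lemma good_r : good r. Proof. now apply good_tint. Qed.

Lemma tint_abs_le g rho th t K : good g -> strip rho th -> 0 <= t ->
  (forall s, 0 <= s <= t -> Rabs (g rho th s) <= K) -> Rabs (tint g rho th t) <= t * K.
Proof.
intros Hg Hs Ht HB. unfold tint. replace (t * K) with ((t - 0) * K) by ring.
apply abs_RInt_le_open; auto.
- apply (ex_RInt_continuous (V := R_CompleteNormedModule)). intros s _.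
  apply (good_t_continuous lo hi); auto.
- intros s Hs'. apply HB. lra.
Qed.

Lemma derive_rho_rho_p : derive_rho (fun rho th t => rho * p rho th t) (tint A).
Proof.
assert (G1 : good (fun rho th t => rho * a rho th t)).
{ apply (good_mult lo hi (fun rho _ _ => rho)); auto. apply (good_radial lo hi (fun x => x)). intros; cont. }
intros rho th t Hs.
apply (is_derive_ext_loc (fun rho => tint (fun rho th t => rho * a rho th t) rho th t)).
- generalize (locally_strip_rho lo hi rho th Hs). apply filter_imp. intros s Hs'. unfold p, tint.
  apply (RInt_scal (V := R_CompleteNormedModule) (a s th)).
  apply (ex_RInt_continuous (V := R_CompleteNormedModule)). intros u _. now apply (good_t_continuous lo hi).
- now apply (derive_rho_tint lo hi).
Qed.

(** The wave equation integrated in time from zero velocity. It expresses [wt] as a divergence of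
    the time integrals [p] and [r], on which there are bounds near the boundary. *)
Lemma wt_tint rho th t : strip rho th -> rho * wt rho th t = tint A rho th t + tint B rho th t / rho.
Proof.
intros Hs.
assert (C : forall g, good g -> forall u v, ex_RInt (g rho th) u v).
{ intros g Hg u v. apply (ex_RInt_continuous (V := R_CompleteNormedModule)). intros s _.
  now apply (good_t_continuous lo hi). }
assert (E1 : is_RInt (wtt rho th) 0 t (wt rho th t - wt rho th 0)).
{ apply (is_RInt_derive (V := R_CompleteNormedModule) (wt rho th) (wtt rho th)).
  - intros s _. now apply Dtt.
  - intros s _. now apply (good_t_continuous lo hi). }
rewrite IC1, Rminus_0_r in E1 by auto.
assert (E2 : is_RInt (fun s => rho * wtt rho th s) 0 t (rho * wt rho th t)) by now apply (is_RInt_scal (V := R_NormedModule)).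
assert (E3 : is_RInt (fun s => rho * wtt rho th s) 0 t (tint A rho th t + tint B rho th t * / rho)).
{ apply (is_RInt_ext (V := R_NormedModule) (fun s => A rho th s + B rho th s * / rho)).
  - intros s _. symmetry. now apply WAVE.
  - apply (is_RInt_plus (V := R_NormedModule)); [|apply is_RInt_mult_r];
    apply (RInt_correct (V := R_CompleteNormedModule)); now apply C. }
unfold Rdiv. rewrite <- (is_RInt_unique _ _ _ _ E2). exact (is_RInt_unique _ _ _ _ E3).
Qed.

(** [e] is the energy density, [G] and [H] are the radial and angular fluxes. Inserting [wt_tint]
    into [e'] gives d_rho G + d_theta H plus a term from the derivative of the weight. *)
Let e rho th t := exp (- rho) / 2 * (rho * (w rho th t * w rho th t) + rho * (p rho th t * p rho th t) + r rho th t * r rho th t / rho).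
Let e' rho th t := exp (- rho) * (rho * (w rho th t * wt rho th t) + rho * (p rho th t * a rho th t) + r rho th t * b rho th t / rho).
Let G rho th t := exp (- rho) * (rho * p rho th t * w rho th t).
Let G' rho th t := - exp (- rho) * (rho * p rho th t * w rho th t)
  + exp (- rho) * (tint A rho th t * w rho th t + rho * p rho th t * a rho th t).
Let H rho th t := exp (- rho) / rho * (r rho th t * w rho th t).
Let H' rho th t := exp (- rho) / rho * (tint B rho th t * w rho th t + r rho th t * b rho th t).

Lemma good_rho : good (fun rho _ _ => rho).
Proof. apply (good_radial lo hi (fun x => x)). intros; cont. Qed.
Lemma good_inv : good (fun rho _ _ => / rho).
Proof. apply (good_radial lo hi (fun x => / x)). intros; cont. lra. Qed.
Lemma good_exp : good (fun rho _ _ => exp (- rho)).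
Proof. apply (good_radial lo hi (fun x => exp (- x))). intros; cont. apply (cont_opp (fun x => x)); cont. Qed.

Ltac good_tac := intros rho th t Hs;
  generalize (good_p rho th t Hs) (good_r rho th t Hs) (Gw rho th t Hs) (Ga rho th t Hs) (Gb rho th t Hs) (Gwt rho th t Hs)
    (good_tint lo hi A GA rho th t Hs) (good_tint lo hi B GB rho th t Hs)
    (good_rho rho th t Hs) (good_inv rho th t Hs) (good_exp rho th t Hs); cbv beta; intros;
  repeat match goal with
  | |- continuous (fun _ => _ + _) _ => apply cont_plus
  | |- continuous (fun _ => _ * _) _ => apply cont_mult
  | |- continuous (fun _ => - _) _ => apply cont_opp
  end; first [assumption | apply cont_const].

Lemma good_e : good e. Proof. unfold e, Rdiv. good_tac. Qed.
Lemma good_e' : good e'. Proof. unfold e', Rdiv. good_tac. Qed.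
Lemma good_G : good G. Proof. unfold G. good_tac. Qed.
Lemma good_G' : good G'. Proof. unfold G'. good_tac. Qed.
Lemma good_H : good H. Proof. unfold H, Rdiv. good_tac. Qed.
Lemma good_H' : good H'. Proof. unfold H', Rdiv. good_tac. Qed.

Lemma derive_t_e : derive_t e e'.
Proof.
intros rho th t Hs. assert (Hr : rho <> 0) by (destruct Hs; lra).
assert (D1 := Dt rho th t Hs). assert (D2 := derive_t_tint lo hi a Ga rho th t Hs).
assert (D3 := derive_t_tint lo hi b Gb rho th t Hs). fold p in D2. fold r in D3.
unfold e. evar_last.
- apply is_derive_scal. apply @is_derive_plus; [apply @is_derive_plus|].
  + apply is_derive_scal. apply Derive.is_derive_mult; exact D1.
  + apply is_derive_scal. apply Derive.is_derive_mult; exact D2.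
  + apply (is_derive_scal_l (fun t => r rho th t * r rho th t) t (b rho th t * r rho th t + r rho th t * b rho th t) (/ rho)).
    apply Derive.is_derive_mult; exact D3.
- unfold e', plus, scal; simpl; unfold mult; simpl. field. exact Hr.
Qed.

Lemma derive_rho_G : derive_rho G G'.
Proof.
intros rho th t Hs. assert (D1 := Da rho th t Hs). assert (D2 := derive_rho_rho_p rho th t Hs).
unfold G. evar_last.
- apply Derive.is_derive_mult.
  + apply (is_derive_comp exp (fun rho => - rho)). apply is_derive_exp. apply @is_derive_opp. apply @is_derive_id.
  + apply Derive.is_derive_mult; [exact D2|exact D1].
- unfold G', scal, opp, one; simpl; unfold mult; simpl. ring.
Qed.

Lemma derive_th_H : derive_th H H'.
Proof.
intros rho th t Hs. unfold H. evar_last.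
- apply is_derive_scal. apply Derive.is_derive_mult.
  + apply (derive_th_tint lo hi b B Gb GB DB rho th t Hs).
  + apply Db. exact Hs.
- unfold H'. fold r. ring.
Qed.

Section Energy.
Variables (de R0 c d T k : R).
Hypothesis Hde : 0 < de < R0.
Hypothesis Hcd : lo < c /\ c < d /\ d < hi.
Hypothesis HT : 0 < T.
Hypothesis BG1 : forall t, 0 <= t <= T -> Rabs (ith c d G R0 t) <= k.
Hypothesis BG2 : forall t, 0 <= t <= T -> Rabs (ith c d G de t) <= k.
Hypothesis BH : forall t, 0 <= t <= T -> Rabs (box de R0 c d H' t) <= k.

Lemma energy_derivative_bound t : 0 <= t <= T -> box de R0 c d e' t <= box de R0 c d e t + 3 * k.
Proof.
intros Ht. assert (HdeR := Hde). assert (HcdR := Hcd).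
(* The error from differentiating the weight; 2 p w <= p^2 + w^2 bounds it by [e]. *)
set (X := fun rho th t => exp (- rho) * (rho * p rho th t * w rho th t)).
assert (E : box de R0 c d e' t = box de R0 c d G' t + box de R0 c d X t + box de R0 c d H' t).
{ rewrite <- (box_plus lo hi de R0 c d Hde Hcd G' X) by (apply good_G' || apply good_G).
  rewrite <- (box_plus lo hi de R0 c d Hde Hcd (fun rho th t => G' rho th t + X rho th t) H').
  - apply RInt_ext. intros rho. rewrite Rmin_left, Rmax_right by lra. intros Hr.
    apply RInt_ext. intros th. rewrite Rmin_left, Rmax_right by lra. intros Hth.
    assert (Hs : strip rho th) by (split; lra).
    unfold e', G', X, H'. assert (W := wt_tint rho th t Hs). eqR.
    replace (rho * (w rho th t * wt rho th t)) with (w rho th t * (rho * wt rho th t)) by ring.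
    rewrite W. field. lra.
  - apply (good_plus lo hi); [apply good_G'|apply good_G].
  - apply good_H'. }
rewrite E.
rewrite (box_derive_rho lo hi de R0 c d Hde Hcd G G' t good_G good_G' derive_rho_G).
assert (LX : box de R0 c d X t <= box de R0 c d e t).
{ apply (box_le lo hi de R0 c d Hde Hcd); [apply good_G|apply good_e|].
  intros rho th Hr Hth. unfold X, e.
  assert (Hx := exp_pos (- rho)). set (u := p rho th t). set (v := w rho th t). set (z := r rho th t).
  assert (0 <= z * z / rho) by (apply Rdiv_le_0_compat; [apply Rle_0_sqr|lra]).
  assert (0 <= rho * ((u - v) * (u - v))) by (apply Rmult_le_pos; [lra|apply Rle_0_sqr]).
  unfold Rdiv at 1. rewrite (Rmult_assoc (exp (- rho))). apply Rmult_le_compat_l; [lra|]. lra. }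
generalize (BG1 t Ht) (BG2 t Ht) (BH t Ht) (Rle_abs (ith c d G R0 t)) (Rle_abs (- ith c d G de t)) (Rle_abs (box de R0 c d H' t)).
rewrite Rabs_Ropp. lra.
Qed.

(** Gronwall, through the mean value theorem for exp(-t) E(t). At time 0 the energy is zero: [w] by
    [IC0], and [p], [r] as time integrals from 0. *)
Lemma energy_bound : box de R0 c d e T <= exp T * (3 * k * T).
Proof.
assert (HdeR := Hde). assert (HcdR := Hcd).
assert (k0 : 0 <= k) by (apply Rle_trans with (2 := BG1 0 ltac:(lra)); apply Rabs_pos).
assert (D : forall t, is_derive (fun t => exp (- t) * box de R0 c d e t) t
   (exp (- t) * (box de R0 c d e' t - box de R0 c d e t))).
{ intros t. evar_last.
  - apply Derive.is_derive_mult.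
    + apply (is_derive_comp exp (fun t => - t)). apply is_derive_exp. apply @is_derive_opp. apply @is_derive_id.
    + apply (is_derive_box_t lo hi de R0 c d Hde Hcd e e' t good_e good_e' derive_t_e).
  - unfold scal, opp, one; simpl; unfold mult; simpl. ring. }
destruct (MVT_gen (fun t => exp (- t) * box de R0 c d e t) 0 T (fun t => exp (- t) * (box de R0 c d e' t - box de R0 c d e t))) as [x [Hx E]].
- intros; apply D.
- intros; apply continuity_pt_cont; apply (ex_derive_continuous (V := R_NormedModule)); eexists; apply D.
- rewrite Rmin_left, Rmax_right in Hx by lra.
  assert (Z : box de R0 c d e 0 = 0).
  { unfold box. rewrite (RInt_ext _ (fun _ => 0)).
    - rewrite RInt_const. apply Rmult_0_r.
    - intros rho. rewrite Rmin_left, Rmax_right by lra. intros Hr. unfold ith. rewrite (RInt_ext _ (fun _ => 0)).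
      + rewrite RInt_const. apply Rmult_0_r.
      + intros th. rewrite Rmin_left, Rmax_right by lra. intros Hth.
        assert (Hs : strip rho th) by (split; lra).
        unfold e. rewrite (IC0 rho th Hs). unfold p, r, tint. rewrite !(RInt_point (V := R_CompleteNormedModule)).
        unfold zero; simpl. eqR. field. lra. }
  rewrite Z in E.
  assert (B1 := energy_derivative_bound x Hx).
  assert (Y : 0 < exp (- x) <= 1).
  { split; [apply exp_pos|]. rewrite <- exp_0. destruct (Rle_lt_or_eq_dec 0 x (proj1 Hx)) as [L| <-].
    - left; apply exp_increasing; lra.
    - rewrite Ropp_0. lra. }
  assert (B2 : exp (- x) * (box de R0 c d e' x - box de R0 c d e x) <= 3 * k).
  { apply Rle_trans with (exp (- x) * (3 * k)); [apply Rmult_le_compat_l; lra|nra]. }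
  assert (B3 : exp (- T) * box de R0 c d e T <= 3 * k * T).
  { replace (exp (- T) * box de R0 c d e T) with (exp (- T) * box de R0 c d e T - exp (- 0) * 0) by ring.
    rewrite E, Rminus_0_r. apply Rmult_le_compat_r; lra. }
  assert (P := exp_pos T). assert (EE : exp T * exp (- T) = 1) by (rewrite <- exp_plus, Rplus_opp_r; apply exp_0).
  apply Rle_trans with (exp T * (exp (- T) * box de R0 c d e T)).
  + rewrite <- Rmult_assoc, EE. lra.
  + apply Rmult_le_compat_l; lra.
Qed.
End Energy.

Lemma G_bound T : 0 < T -> exists K, 0 <= K /\ forall rho th t, strip rho th -> 0 <= t <= T ->
  Rabs (G rho th t) <= exp (- rho) * (rho * sqrt ((1 + rho) / rho)) * K.
Proof.
intros HT. destruct (HK T (Rlt_le _ _ HT)) as [K [K0 HKb]].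
assert (M0 : 0 <= M).
{ apply Rle_trans with (2 := HM 1 ((lo + hi) / 2) 0 ltac:(split; lra) (Rle_refl 0)). apply Rabs_pos. }
exists (T * K * M). split; [apply Rmult_le_pos; nra|]. intros rho th t Hs Ht.
assert (Hr : 0 < rho) by apply Hs. assert (S := sqrt_pos ((1 + rho) / rho)). set (s := sqrt ((1 + rho) / rho)) in *.
assert (Bp : Rabs (p rho th t) <= T * (K * s)).
{ apply Rle_trans with (t * (K * s)).
  - apply tint_abs_le; auto; [lra|]. intros u Hu. apply HKb; auto. lra.
  - apply Rmult_le_compat_r; [apply Rmult_le_pos; lra|lra]. }
assert (Bw := HM rho th t Hs (proj1 Ht)).
assert (X := exp_pos (- rho)).
unfold G. rewrite !Rabs_mult, (Rabs_pos_eq (exp (- rho))), (Rabs_pos_eq rho) by lra.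
replace (exp (- rho) * (rho * s) * (T * K * M)) with (exp (- rho) * (rho * (T * (K * s)) * M)) by ring.
apply Rmult_le_compat_l; [lra|]. apply Rmult_le_compat; try apply Rabs_pos; auto.
- apply Rmult_le_pos; [lra|apply Rabs_pos].
- apply Rmult_le_compat_l; lra.
Qed.

(** The Neumann condition is local in radius and time; [tube] is applied once in each of them. *)
Lemma uniform_Neumann th0 k de R0 T : th0 = lo \/ th0 = hi -> 0 < k -> 0 < de ->
  locally th0 (fun th => forall rho, de <= rho <= R0 -> lo < th < hi -> forall t, 0 <= t <= T -> Rabs (b rho th t) <= k).
Proof.
intros Hth Hk Hde.
apply (tube th0 (fun th rho => lo < th < hi -> forall t, 0 <= t <= T -> Rabs (b rho th t) <= k)).
intros rho0 Hr.
assert (L : locally ((th0, rho0) : R * R) (fun z => forall t, 0 <= t <= T ->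
  lo < fst z < hi -> 0 <= t -> Rabs (b (snd z) (fst z) t) <= k)).
{ apply (tube ((th0, rho0) : R * R) (fun z t => lo < fst z < hi -> 0 <= t -> Rabs (b (snd z) (fst z) t) <= k)).
  intros t0 Ht0. apply NB; auto; lra. }
generalize L. apply filter_imp. intros z Hz H1 t Ht. apply Hz; auto. lra.
Qed.

(** The angular flux integrates in theta to its values at [c] and [d], where [r] is at most T k. *)
Lemma box_H'_bound de R0 c d T k : 0 < de < R0 -> lo < c /\ c < d /\ d < hi -> 0 <= k ->
  (forall rho t, de <= rho <= R0 -> 0 <= t <= T -> Rabs (b rho c t) <= k /\ Rabs (b rho d t) <= k) ->
  forall t, 0 <= t <= T -> Rabs (box de R0 c d H' t) <= (R0 - de) * (2 * (/ de * (T * k * M))).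
Proof.
intros Hde Hcd Hk HB t Ht.
assert (M0 : 0 <= M).
{ apply Rle_trans with (2 := HM 1 ((lo + hi) / 2) 0 ltac:(split; lra) (Rle_refl 0)). apply Rabs_pos. }
assert (P : forall rho th, de <= rho <= R0 -> (th = c \/ th = d) -> Rabs (H rho th t) <= / de * (T * k * M)).
{ intros rho th Hr Hth. assert (Hs : strip rho th) by (destruct Hth; subst; split; lra).
  assert (Br : Rabs (r rho th t) <= T * k).
  { apply Rle_trans with (t * k).
    - apply tint_abs_le; auto; [lra|]. intros s Hs'.
      destruct (HB rho s Hr ltac:(lra)). now destruct Hth; subst.
    - apply Rmult_le_compat_r; lra. }
  assert (Bw := HM rho th t Hs (proj1 Ht)).
  assert (Be : 0 < exp (- rho) / rho <= / de).
  { split; [apply Rdiv_lt_0_compat; [apply exp_pos|lra]|].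
    apply Rle_trans with (1 / rho).
    - apply Rmult_le_compat_r; [left; apply Rinv_0_lt_compat; lra|]. rewrite <- exp_0. left; apply exp_increasing; lra.
    - unfold Rdiv. rewrite Rmult_1_l. apply Rinv_le_contravar; lra. }
  unfold H. rewrite !Rabs_mult, (Rabs_pos_eq (exp (- rho) / rho)) by lra.
  apply Rmult_le_compat; [lra| |lra|].
  - apply Rmult_le_pos; apply Rabs_pos.
  - apply Rmult_le_compat; try apply Rabs_pos; auto. }
apply abs_RInt_le_open; [lra| |].
- apply (ex_RInt_ith lo hi); auto. apply good_H'.
- intros rho Hr. rewrite (ith_derive_th lo hi c d Hcd H H' rho t good_H good_H' derive_th_H) by lra.
  unfold Rminus. apply Rle_trans with (1 := Rabs_triang _ _). rewrite Rabs_Ropp.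
  generalize (P rho c ltac:(lra) (or_introl eq_refl)) (P rho d ltac:(lra) (or_intror eq_refl)). lra.
Qed.

Lemma e_nonneg rho th t : strip rho th -> 0 <= e rho th t.
Proof.
intros [Hr _]. unfold e. apply Rmult_le_pos; [left; apply Rdiv_lt_0_compat; [apply exp_pos|lra]|].
assert (0 <= r rho th t * r rho th t / rho) by (apply Rdiv_le_0_compat; [apply Rle_0_sqr|lra]).
assert (0 <= rho * (p rho th t * p rho th t)) by (apply Rmult_le_pos; [lra|apply Rle_0_sqr]).
assert (0 <= rho * (w rho th t * w rho th t)) by (apply Rmult_le_pos; [lra|apply Rle_0_sqr]). lra.
Qed.

Lemma RInt_ge_const (f : R -> R) x y m : x <= y -> ex_RInt f x y -> (forall s, x < s < y -> m <= f s) ->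
  (y - x) * m <= RInt f x y.
Proof.
intros Hxy He Hm. replace ((y - x) * m) with (RInt (fun _ => m) x y) by (rewrite RInt_const; reflexivity).
apply RInt_le; auto. apply ex_RInt_const.
Qed.

(** The density is non-negative, so a positive value at one point bounds from below the energy of
    every box around a fixed small square. The bound stays the same while the box grows to exhaust
    the sector. *)
Lemma box_e_lower rho1 th1 t v : strip rho1 th1 -> v < e rho1 th1 t -> exists eta, 0 < eta /\
  eta < rho1 /\ lo < th1 - eta /\ th1 + eta < hi /\
  forall de R0 c d, 0 < de <= rho1 - eta -> rho1 + eta <= R0 -> lo < c <= th1 - eta -> th1 + eta <= d < hi ->
  2 * eta * (2 * eta * v) <= box de R0 c d e t.
Proof.
intros Hs Hv.
assert (C : continuous (fun z : R * R => e (fst z) (snd z) t) (rho1, th1)).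
{ apply (good_comp lo hi e (fun z : R * R => fst z) (fun z => snd z) (fun _ => t)); [apply good_e|exact Hs|cont|cont|cont]. }
destruct (filter_and _ _ (locally_strip lo hi rho1 th1 Hs) (locally_continuous_gt _ _ v C Hv)) as [h Hh].
assert (h0 := cond_pos h).
assert (Near : forall rho th, Rabs (rho - rho1) < h -> Rabs (th - th1) < h -> strip rho th /\ v < e rho th t).
{ intros rho th H1 H2. apply (Hh (rho, th)). split; assumption. }
exists (h / 2).
assert (S1 := proj1 (Near (rho1 - h / 2) th1 ltac:(apply Rabs_def1; lra) ltac:(apply Rabs_def1; lra))).
assert (S2 := proj1 (Near rho1 (th1 - h / 2) ltac:(apply Rabs_def1; lra) ltac:(apply Rabs_def1; lra))).
assert (S3 := proj1 (Near rho1 (th1 + h / 2) ltac:(apply Rabs_def1; lra) ltac:(apply Rabs_def1; lra))).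
destruct S1 as [S1 _], S2 as [_ S2], S3 as [_ S3].
split; [lra|]. split; [lra|]. split; [lra|]. split; [lra|].
intros de R0 c d H1 H2 H3 H4.
assert (Hde : 0 < de < R0) by lra. assert (Hcd : lo < c /\ c < d /\ d < hi) by lra.
assert (EX := ex_RInt_ith lo hi de R0 c d Hde Hcd e t good_e).
apply Rle_trans with (RInt (fun rho => ith c d e rho t) (rho1 - h / 2) (rho1 + h / 2)).
- replace (2 * (h / 2) * (2 * (h / 2) * v)) with ((rho1 + h / 2 - (rho1 - h / 2)) * (2 * (h / 2) * v)) by ring.
  apply RInt_ge_const; [lra|apply (ex_RInt_sub _ de R0); auto; lra|].
  intros rho Hr.
  assert (EX2 := ex_RInt_th lo hi c d Hcd e rho t good_e ltac:(lra)).
  apply Rle_trans with (RInt (fun th => e rho th t) (th1 - h / 2) (th1 + h / 2)).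
  + replace (2 * (h / 2) * v) with ((th1 + h / 2 - (th1 - h / 2)) * v) by ring.
    apply RInt_ge_const; [lra|apply (ex_RInt_sub _ c d); auto; lra|].
    intros th Hth. left. apply Near; apply Rabs_def1; lra.
  + apply RInt_sub_le; auto; try lra. intros th Hth. apply e_nonneg. split; lra.
- apply RInt_sub_le; auto; try lra. intros rho Hr.
  apply RInt_ge_0; [lra|apply (ex_RInt_th lo hi); auto; [apply good_e|lra]|].
  intros th Hth. apply e_nonneg. split; lra.
Qed.

(** A nonzero value keeps the energy of all large boxes above a fixed amount, while the boundary
    terms can be made arbitrarily small. The order of choices matters: [k], then the radii [de] and
    [R0], then [k2], then the sides [c] and [d]. *)
Theorem polar_wave_unique rho th t : strip rho th -> 0 <= t -> w rho th t = 0.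
Proof.
intros Hs Ht0. apply NNPP. intros Hw.
assert (HT : 0 < t).
{ destruct Ht0 as [|E]; auto. exfalso. apply Hw. rewrite <- E. now apply IC0. }
assert (Hv : 0 < e rho th t).
{ unfold e. destruct Hs as [Hr _]. apply Rmult_lt_0_compat; [apply Rdiv_lt_0_compat; [apply exp_pos|lra]|].
  assert (0 <= r rho th t * r rho th t / rho) by (apply Rdiv_le_0_compat; [apply Rle_0_sqr|lra]).
  assert (0 <= rho * (p rho th t * p rho th t)) by (apply Rmult_le_pos; [lra|apply Rle_0_sqr]).
  assert (0 < rho * (w rho th t * w rho th t)) by (apply Rmult_lt_0_compat; [lra|now apply Rlt_0_sqr]). lra. }
set (v := e rho th t / 2). assert (v0 : 0 < v) by (unfold v; lra).
destruct (box_e_lower rho th t v Hs ltac:(unfold v; lra)) as [eta [E0 [E1 [E2 [E3 LB]]]]].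
assert (P := exp_pos t).
(* With this [k] the upper bound exp(t) 3 k t is eta^2 v, a quarter of the lower bound of
   [box_e_lower]. *)
set (k := eta * (eta * v) / (exp t * 3 * t)).
assert (k0 : 0 < k).
{ apply Rdiv_lt_0_compat; [apply Rmult_lt_0_compat; [lra|apply Rmult_lt_0_compat; lra]|].
  apply Rmult_lt_0_compat; [lra|lra]. }
destruct (G_bound t HT) as [K [K0 HG]].
set (x := k / ((hi - lo) * (K + 1))).
assert (x0 : 0 < x) by (apply Rdiv_lt_0_compat; [lra|apply Rmult_lt_0_compat; lra]).
assert (xk : (hi - lo) * (x * K) <= k).
{ replace k with ((hi - lo) * (x * (K + 1))) by (unfold x; field; split; lra).
  apply Rmult_le_compat_l; [lra|]. apply Rmult_le_compat_l; lra. }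
destruct (small_radius x x0) as [d0 [Hd0 SR]].
destruct (large_radius x (rho + eta) x0) as [R0 [HR0 [HR1 LR]]].
set (de := Rmin d0 (rho - eta)).
assert (Hde : 0 < de) by (apply Rmin_glb_lt; lra).
assert (Hde1 : de <= d0) by apply Rmin_l. assert (Hde2 : de <= rho - eta) by apply Rmin_r.
assert (M0 : 0 <= M) by (apply Rle_trans with (2 := HM rho th t Hs Ht0); apply Rabs_pos).
assert (DEN : 0 < (R0 - de) * (2 * (/ de * (t * (M + 1))))).
{ assert (0 < / de) by now apply Rinv_0_lt_compat.
  repeat apply Rmult_lt_0_compat; lra. }
(* Chosen after the radii, since the factor 1 / de in [box_H'_bound] has to be beaten by moving [c]
   and [d] toward the sides. *)
set (k2 := k / ((R0 - de) * (2 * (/ de * (t * (M + 1)))))).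
assert (k20 : 0 < k2) by (apply Rdiv_lt_0_compat; lra).
assert (HH : (R0 - de) * (2 * (/ de * (t * k2 * M))) <= k).
{ replace k with ((R0 - de) * (2 * (/ de * (t * k2 * (M + 1))))) by (unfold k2; field; repeat split; lra).
  assert (0 < / de) by now apply Rinv_0_lt_compat.
  repeat apply Rmult_le_compat_l; try lra. apply Rmult_le_pos; lra. }
destruct (uniform_Neumann lo k2 de R0 t (or_introl eq_refl) k20 Hde) as [e1 Hc].
destruct (uniform_Neumann hi k2 de R0 t (or_intror eq_refl) k20 Hde) as [e2 Hd].
assert (e10 := cond_pos e1). assert (e20 := cond_pos e2).
set (c := lo + Rmin (e1 / 2) (th - eta - lo)). set (d := hi - Rmin (e2 / 2) (hi - (th + eta))).
assert (c1 : 0 < Rmin (e1 / 2) (th - eta - lo)) by (apply Rmin_glb_lt; lra).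
assert (c2 := Rmin_l (e1 / 2) (th - eta - lo)). assert (c3 := Rmin_r (e1 / 2) (th - eta - lo)).
assert (d1 : 0 < Rmin (e2 / 2) (hi - (th + eta))) by (apply Rmin_glb_lt; lra).
assert (d2 := Rmin_l (e2 / 2) (hi - (th + eta))). assert (d3 := Rmin_r (e2 / 2) (hi - (th + eta))).
assert (Hcd : lo < c /\ c < d /\ d < hi) by (unfold c, d; lra).
assert (HdR : 0 < de < R0) by lra.
assert (BG : forall R1 s, 0 < R1 -> exp (- R1) * (R1 * sqrt ((1 + R1) / R1)) <= x -> 0 <= s <= t ->
  Rabs (ith c d G R1 s) <= k).
{ intros R1 s H1 H2 H3. apply Rle_trans with ((d - c) * (x * K)).
  - apply (ith_abs_le lo hi c d Hcd); [apply good_G|lra|]. intros u Hu.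
    apply Rle_trans with (exp (- R1) * (R1 * sqrt ((1 + R1) / R1)) * K).
    + apply HG; auto. split; lra.
    + apply Rmult_le_compat_r; lra.
  - apply Rle_trans with (2 := xk). apply Rmult_le_compat_r; [apply Rmult_le_pos; lra|lra]. }
assert (EB : box de R0 c d e t <= exp t * (3 * k * t)).
{ apply (energy_bound de R0 c d t k HdR Hcd HT).
  - intros s H1. apply BG; auto; lra.
  - intros s H1. apply BG; auto; apply SR; lra.
  - intros s H1. apply Rle_trans with (2 := HH). apply box_H'_bound; auto; [lra|].
    intros r1 s1 H2 H3. split.
    + apply Hc; auto; [|lra]. unfold ball; simpl; unfold AbsRing_ball, minus, plus, opp, Hierarchy.abs; simpl.
      apply Rabs_def1; unfold c; lra.
    + apply Hd; auto; [|lra]. unfold ball; simpl; unfold AbsRing_ball, minus, plus, opp, Hierarchy.abs; simpl.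
      apply Rabs_def1; unfold d; lra. }
specialize (LB de R0 c d ltac:(lra) ltac:(lra) ltac:(unfold c; lra) ltac:(unfold d; lra)).
assert (EK : exp t * (3 * k * t) = eta * (eta * v)).
{ unfold k. generalize (eta * (eta * v)); intros m. field. split; lra. }
rewrite EK in EB. assert (0 < eta * (eta * v)) by (apply Rmult_lt_0_compat; [lra|now apply Rmult_lt_0_compat]).
lra.
Qed.
End Uniqueness.

(** * From Cartesian to polar coordinates *)

Lemma is_derive_curve (f : R -> R -> R) (fx : R -> R -> R) (fy : R) (X Y : R -> R) (s dX dY : R) :
  locally ((X s, Y s) : R * R) (fun z => is_derive (fun x => f x (snd z)) (fst z) (fx (fst z) (snd z))) ->
  is_derive (f (X s)) (Y s) fy -> continuous (fun z : R * R => fx (fst z) (snd z)) (X s, Y s) ->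
  is_derive X s dX -> is_derive Y s dY ->
  is_derive (fun s => f (X s) (Y s)) s (dX * fx (X s) (Y s) + dY * fy).
Proof.
intros H1 H2 H3 H4 H5. unfold is_derive.
assert (D := is_derive_filterdiff f (X s) (Y s) fx fy H1 H2 H3).
apply (filterdiff_ext_lin _ (fun h : R => plus (scal (scal h dX) (fx (X s) (Y s))) (scal (scal h dY) fy))).
- apply (filterdiff_comp'_2 X Y f s (fun h => scal h dX) (fun h => scal h dY)
    (fun a b => plus (scal a (fx (X s) (Y s))) (scal b fy)) H4 H5).
  exact D.
- intros h. unfold plus, scal; simpl; unfold mult; simpl. eqR. ring.
Qed.

Lemma is_derive_from_0 (f : R -> R) x l : is_derive (fun h => f (x + h)) 0 l -> is_derive f x l.
Proof.
intros H. apply (is_derive_ext (fun z => f (x + (z - x)))).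
- intros z. f_equal. ring.
- evar_last. apply (is_derive_comp (fun h => f (x + h)) (fun z => z - x)).
  + replace (x - x) with 0 by ring. exact H.
  + auto_derive; auto.
  + unfold scal; simpl; unfold mult; simpl. ring.
Qed.

Lemma left_limit_0 (g : R -> R) : continuous g 0 -> (forall t, t < 0 -> g t = 0) -> g 0 = 0.
Proof.
intros C H. apply NNPP. intros N.
destruct (continuous_locally_lt g 0 (Rabs (g 0)) C (Rabs_pos_lt _ N)) as [e He].
assert (e0 := cond_pos e).
assert (K := He (- e / 2)). rewrite H in K by lra.
rewrite Rminus_0_l, Rabs_Ropp in K.
enough (Rabs (g 0) < Rabs (g 0)) by lra. apply K.
unfold ball; simpl; unfold AbsRing_ball, minus, plus, opp, Hierarchy.abs; simpl. apply Rabs_def1; lra.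
Qed.

Section Conversion.
Variable phi : R.
Hypothesis Hphi : 0 < phi < PI.
Variables w w1 w2 wt w11 w12 w21 w22 wtt : spacetime -> R.
Definition cont_Q (g : spacetime -> R) : Prop := forall p : spacetime, Q phi (fst p) -> continuous g p.
Definition derive_Q (d : coord) (g g' : spacetime -> R) : Prop :=
  forall p, Q phi (fst p) -> is_derive (fun h => g (shift d p h)) 0 (g' p).
Hypothesis C0 : cont_Q w. Hypothesis C1 : cont_Q w1. Hypothesis C2 : cont_Q w2. Hypothesis Ct : cont_Q wt.
Hypothesis C11 : cont_Q w11. Hypothesis C12 : cont_Q w12. Hypothesis C21 : cont_Q w21.
Hypothesis C22 : cont_Q w22. Hypothesis Ctt : cont_Q wtt.
Hypothesis D1 : derive_Q dy1 w w1. Hypothesis D2 : derive_Q dy2 w w2. Hypothesis Dt : derive_Q dt w wt.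
Hypothesis D11 : derive_Q dy1 w1 w11. Hypothesis D12 : derive_Q dy2 w1 w12.
Hypothesis D21 : derive_Q dy1 w2 w21. Hypothesis D22 : derive_Q dy2 w2 w22. Hypothesis Dtt : derive_Q dt wt wtt.
Hypothesis WAVE : forall p, Q phi (fst p) -> wtt p = w11 p + w22 p.
Hypothesis IC : forall y t, Q phi y -> t < 0 -> w (y, t) = 0.
Variable M : R.
Hypothesis HM : forall y t, Q phi y -> 0 <= t -> Rabs (w (y, t)) <= M.
Hypothesis HK : forall T, 0 <= T -> exists K, 0 <= K /\ forall y t, Q phi y -> 0 <= t <= T ->
  Rabs (w1 (y, t)) <= K * sqrt ((1 + Defs.abs y) / Defs.abs y) /\ Rabs (w2 (y, t)) <= K * sqrt ((1 + Defs.abs y) / Defs.abs y).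
Hypothesis NB : forall th0 r0 t0, th0 = phi \/ th0 = 2 * PI -> 0 < r0 -> 0 <= t0 -> exists l1 l2,
  - sin th0 * l1 + cos th0 * l2 = 0 /\
  forall e, 0 < e -> locally ((polar r0 th0, t0) : spacetime) (fun p => Q phi (fst p) -> 0 <= snd p ->
    Rabs (w1 p - l1) <= e /\ Rabs (w2 p - l2) <= e).

Notation strip := (strip phi (2 * PI)).
Notation good := (good phi (2 * PI)).

Lemma strip_Q rho th : strip rho th -> Q phi (polar rho th).
Proof. intros [H1 H2]. now apply Q_polar. Qed.

Lemma continuous_polar2 {E : UniformSpace} (r th t : E -> R) p :
  continuous r p -> continuous th p -> continuous t p -> continuous (fun p => ((polar (r p) (th p), t p) : spacetime)) p.
Proof. intros Hr Hth Ht. unfold polar. repeat apply cont_pair; cont. Qed.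

Lemma good_polar g : cont_Q g -> good (fun rho th t => g (polar rho th, t)).
Proof.
intros Hg rho th t Hs.
apply (continuous_comp (fun z : (R * R) * R => ((polar (fst (fst z)) (snd (fst z)), snd z) : spacetime)) g).
- apply continuous_polar2; cont.
- apply Hg. now apply strip_Q.
Qed.

Lemma derive_curve_Q g g1 g2 (X Y : R -> R) s dX dY t : cont_Q g1 -> derive_Q dy1 g g1 -> derive_Q dy2 g g2 ->
  Q phi (X s, Y s) -> is_derive X s dX -> is_derive Y s dY ->
  is_derive (fun s => g ((X s, Y s), t)) s (dX * g1 ((X s, Y s), t) + dY * g2 ((X s, Y s), t)).
Proof.
intros Cg Dg1 Dg2 HQ HX HY.
apply (is_derive_curve (fun x y => g ((x, y), t)) (fun x y => g1 ((x, y), t))); auto.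
- generalize (Q_open phi Hphi (X s, Y s) HQ). apply filter_imp. intros [x y] Hz. cbn [fst snd].
  apply (is_derive_from_0 (fun x => g ((x, y), t))). exact (Dg1 ((x, y), t) Hz).
- apply (is_derive_from_0 (fun y => g ((X s, y), t))). exact (Dg2 ((X s, Y s), t) HQ).
- apply (continuous_comp (fun z : R * R => ((fst z, snd z), t) : spacetime) g1).
  + repeat apply cont_pair; cont.
  + now apply Cg.
Qed.

Lemma derive_rho_polar g g1 g2 : cont_Q g1 -> derive_Q dy1 g g1 -> derive_Q dy2 g g2 ->
  derive_rho phi (2 * PI) (fun rho th t => g (polar rho th, t))
    (fun rho th t => cos th * g1 (polar rho th, t) + sin th * g2 (polar rho th, t)).
Proof.
intros Cg Dg1 Dg2 rho th t Hs.
apply (derive_curve_Q g g1 g2 (fun rho => rho * cos th) (fun rho => rho * sin th)); auto.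
- now apply (strip_Q rho th).
- auto_derive; auto; ring.
- auto_derive; auto; ring.
Qed.

Lemma derive_th_polar g g1 g2 : cont_Q g1 -> derive_Q dy1 g g1 -> derive_Q dy2 g g2 ->
  derive_th phi (2 * PI) (fun rho th t => g (polar rho th, t))
    (fun rho th t => - (rho * sin th) * g1 (polar rho th, t) + rho * cos th * g2 (polar rho th, t)).
Proof.
intros Cg Dg1 Dg2 rho th t Hs.
apply (derive_curve_Q g g1 g2 (fun th => rho * cos th) (fun th => rho * sin th)); auto.
- now apply (strip_Q rho th).
- auto_derive; auto; ring.
- auto_derive; auto; ring.
Qed.

Lemma derive_t_polar g g' : derive_Q dt g g' ->
  derive_t phi (2 * PI) (fun rho th t => g (polar rho th, t)) (fun rho th t => g' (polar rho th, t)).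
Proof.
intros Dg rho th t Hs. apply (is_derive_from_0 (fun t => g (polar rho th, t))).
exact (Dg (polar rho th, t) (strip_Q rho th Hs)).
Qed.

Let a rho th t := cos th * w1 (polar rho th, t) + sin th * w2 (polar rho th, t).
Let b rho th t := - (rho * sin th) * w1 (polar rho th, t) + rho * cos th * w2 (polar rho th, t).
Let A rho th t := a rho th t
  + rho * (cos th * (cos th * w11 (polar rho th, t) + sin th * w12 (polar rho th, t))
         + sin th * (cos th * w21 (polar rho th, t) + sin th * w22 (polar rho th, t))).
Let B rho th t := - rho * a rho th t
  + (- (rho * sin th) * (- (rho * sin th) * w11 (polar rho th, t) + rho * cos th * w12 (polar rho th, t))
     + rho * cos th * (- (rho * sin th) * w21 (polar rho th, t) + rho * cos th * w22 (polar rho th, t))).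

Ltac good_tac := intros rho th t Hs;
  generalize (good_polar w C0 rho th t Hs) (good_polar w1 C1 rho th t Hs) (good_polar w2 C2 rho th t Hs)
    (good_polar w11 C11 rho th t Hs) (good_polar w12 C12 rho th t Hs)
    (good_polar w21 C21 rho th t Hs) (good_polar w22 C22 rho th t Hs); cbv beta; intros;
  repeat first [match goal with
  | |- continuous (fun _ => _ + _) _ => apply cont_plus
  | |- continuous (fun _ => _ * _) _ => apply cont_mult
  | |- continuous (fun _ => - _) _ => apply cont_opp
  end]; first [assumption | solve [cont]].

Lemma good_a : good a. Proof. unfold a. good_tac. Qed.
Lemma good_b : good b. Proof. unfold b. good_tac. Qed.
Lemma good_A : good A. Proof. unfold A, a. good_tac. Qed.
Lemma good_B : good B. Proof. unfold B, a. good_tac. Qed.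

Lemma derive_rho_A : derive_rho phi (2 * PI) (fun rho th t => rho * a rho th t) A.
Proof.
intros rho th t Hs. unfold a. evar_last.
- apply Derive.is_derive_mult; [apply @is_derive_id|].
  apply @is_derive_plus; apply is_derive_scal.
  + exact (derive_rho_polar w1 w11 w12 C11 D11 D12 rho th t Hs).
  + exact (derive_rho_polar w2 w21 w22 C21 D21 D22 rho th t Hs).
- unfold A, a, one, plus; simpl. ring.
Qed.

Lemma derive_th_B : derive_th phi (2 * PI) b B.
Proof.
intros rho th t Hs. unfold b. evar_last.
- apply @is_derive_plus; apply Derive.is_derive_mult.
  + apply (is_derive_opp (V := R_NormedModule) (fun th => rho * sin th)). apply is_derive_scal. apply is_derive_sin.
  + exact (derive_th_polar w1 w11 w12 C11 D11 D12 rho th t Hs).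
  + apply is_derive_scal. apply is_derive_cos.
  + exact (derive_th_polar w2 w21 w22 C21 D21 D22 rho th t Hs).
- unfold B, a, opp, plus; simpl. ring.
Qed.

Lemma wt_negative y t : Q phi y -> t < 0 -> wt (y, t) = 0.
Proof.
intros Hy Ht.
assert (E := is_derive_unique _ _ _ (Dt (y, t) Hy)). rewrite <- E.
rewrite (Derive_ext_loc _ (fun _ => 0)).
- apply Derive_const.
- assert (L : locally 0 (fun h : R => t + h < 0)).
  { apply (locally_continuous_lt (fun h => t + h)); [cont|lra]. }
  generalize L. apply filter_imp. intros h Hh. destruct y; simpl. now apply IC.
Qed.

(** Initial data are prescribed for t < 0 only; continuity in time inside [Q] carries the zeros to t
    = 0. *)
Lemma zero_at_0 g : cont_Q g -> (forall y t, Q phi y -> t < 0 -> g (y, t) = 0) -> forall y, Q phi y -> g (y, 0) = 0.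
Proof.
intros Cg H y Hy. apply (left_limit_0 (fun t => g (y, t))).
- apply (continuous_comp (fun t : R => ((y, t) : spacetime)) g); [|now apply Cg].
  apply cont_pair; [apply continuous_const|cont].
- intros t Ht. now apply H.
Qed.

(** [b] is rho times the angular component of the gradient. For the limit (l1, l2) at the side this
    component is zero, and nearby both the gradient and the angular unit vector vary little. *)
Lemma polar_Neumann th0 k rho0 t0 : th0 = phi \/ th0 = 2 * PI -> 0 < k -> 0 < rho0 -> 0 <= t0 ->
  locally (((th0, rho0), t0) : (R * R) * R) (fun z => phi < fst (fst z) < 2 * PI -> 0 <= snd z ->
    Rabs (b (snd (fst z)) (fst (fst z)) (snd z)) <= k).
Proof.
intros Hth Hk Hr Ht. destruct (NB th0 rho0 t0 Hth Hr Ht) as [l1 [l2 [HL HN]]].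
set (e := k / (4 * (rho0 + 1))). assert (e0 : 0 < e) by (apply Rdiv_lt_0_compat; lra).
assert (C : continuous (fun z : (R * R) * R => ((polar (snd (fst z)) (fst (fst z)), snd z) : spacetime)) ((th0, rho0), t0)).
{ apply continuous_polar2; cont. }
assert (L1 := C _ (HN e e0)). unfold filtermap in L1.
assert (L2 : locally (((th0, rho0), t0) : (R * R) * R) (fun z =>
  Rabs (snd (fst z) * (- sin (fst (fst z)) * l1 + cos (fst (fst z)) * l2) - rho0 * (- sin th0 * l1 + cos th0 * l2)) < k / 2)).
{ apply (continuous_locally_lt (fun z : (R * R) * R => snd (fst z) * (- sin (fst (fst z)) * l1 + cos (fst (fst z)) * l2)));
  [cont|lra]. }
assert (L3 : locally (((th0, rho0), t0) : (R * R) * R) (fun z => snd (fst z) < rho0 + 1)).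
{ apply (locally_continuous_lt (fun z : (R * R) * R => snd (fst z))); [cont|simpl; lra]. }
assert (L4 : locally (((th0, rho0), t0) : (R * R) * R) (fun z => 0 < snd (fst z))).
{ apply (locally_continuous_gt (fun z : (R * R) * R => snd (fst z))); [cont|simpl; lra]. }
generalize (filter_and _ _ L1 (filter_and _ _ L2 (filter_and _ _ L3 L4))). apply filter_imp.
intros [[th rho] t]; cbn [fst snd]. intros [K1 [K2 [K3 K4]]] Hth' Ht'.
destruct (K1 (strip_Q rho th (conj K4 Hth')) Ht') as [A1 A2].
rewrite HL, Rmult_0_r, Rminus_0_r in K2.
unfold b. set (x1 := w1 (polar rho th, t)) in *. set (x2 := w2 (polar rho th, t)) in *.
change (Rabs (- (rho * sin th) * x1 + rho * cos th * x2) <= k).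
replace (- (rho * sin th) * x1 + rho * cos th * x2) with
  (rho * (- sin th * l1 + cos th * l2) + rho * (- sin th * (x1 - l1) + cos th * (x2 - l2))) by ring.
apply Rle_trans with (1 := Rabs_triang _ _).
assert (B1 : Rabs (- sin th * (x1 - l1) + cos th * (x2 - l2)) <= e + e).
{ apply Rle_trans with (1 := Rabs_triang _ _). rewrite !Rabs_mult, Rabs_Ropp.
  assert (S : Rabs (sin th) <= 1) by (apply Rabs_le; apply SIN_bound).
  assert (S' : Rabs (cos th) <= 1) by (apply Rabs_le; apply COS_bound).
  generalize (Rabs_pos (sin th)) (Rabs_pos (cos th)) (Rabs_pos (x1 - l1)) (Rabs_pos (x2 - l2)). intros.
  apply Rplus_le_compat; [apply Rle_trans with (1 * e)|apply Rle_trans with (1 * e)]; try lra; apply Rmult_le_compat; auto. }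
rewrite (Rabs_mult rho (- sin th * (x1 - l1) + cos th * (x2 - l2))), (Rabs_pos_eq rho) by lra.
assert (B2 : rho * Rabs (- sin th * (x1 - l1) + cos th * (x2 - l2)) <= (rho0 + 1) * (e + e)).
{ apply Rmult_le_compat; auto; try lra. apply Rabs_pos. }
replace ((rho0 + 1) * (e + e)) with (k / 2) in B2 by (unfold e; field; lra). lra.
Qed.

Theorem wedge_wave_unique y t : Q phi y -> 0 <= t -> w (y, t) = 0.
Proof.
intros Hy Ht. assert (H0 := Q_neq_0 phi Hphi y Hy).
destruct (angle_spec y H0) as [E _]. assert (Ha := Q_angle phi Hphi y Hy). assert (Hr := abs_pos_neq y H0).
rewrite E.
apply (polar_wave_unique phi (2 * PI) ltac:(lra) (fun rho th t => w (polar rho th, t)) a b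
  (fun rho th t => wt (polar rho th, t)) A B (fun rho th t => wtt (polar rho th, t))) with (M := M);
  try (apply good_polar; assumption).
- apply good_a.
- apply good_b.
- apply good_A.
- apply good_B.
- now apply derive_rho_polar.
- now apply derive_th_polar.
- now apply derive_t_polar.
- now apply derive_t_polar.
- apply derive_rho_A.
- apply derive_th_B.
(* The polar form of the Laplacian: the mixed derivatives and the terms with [a] cancel between [A]
   and B / rho. *)
- intros rho th s Hs. rewrite WAVE by (now apply strip_Q). unfold A, B.
  assert (SC := sin2_cos2 th). unfold Rsqr in SC. destruct Hs as [Hs _].
  set (x11 := w11 (polar rho th, s)). set (x22 := w22 (polar rho th, s)).
  set (x12 := w12 (polar rho th, s)). set (x21 := w21 (polar rho th, s)).
  replace (x11 + x22) with ((sin th * sin th + cos th * cos th) * (x11 + x22)) by (rewrite SC; ring).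
  field. lra.
- intros rho th Hs. apply (zero_at_0 w C0 IC). now apply strip_Q.
- intros rho th Hs. apply (zero_at_0 wt Ct wt_negative). now apply strip_Q.
- intros rho th s Hs Hs'. apply HM; auto. now apply strip_Q.
- intros T HT. destruct (HK T HT) as [K [K0 HKb]]. exists (2 * K). split; [lra|].
  intros rho th s Hs Hs'. destruct (HKb (polar rho th) s (strip_Q rho th Hs) Hs') as [B1 B2].
  destruct Hs as [Hs _]. rewrite abs_polar in B1, B2 by lra. unfold a.
  apply Rle_trans with (1 := Rabs_triang _ _). rewrite !Rabs_mult.
  assert (S : Rabs (sin th) <= 1) by (apply Rabs_le; apply SIN_bound).
  assert (S' : Rabs (cos th) <= 1) by (apply Rabs_le; apply COS_bound).
  generalize (Rabs_pos (sin th)) (Rabs_pos (cos th)) (Rabs_pos (w1 (polar rho th, s))) (Rabs_pos (w2 (polar rho th, s))).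
  intros. nra.
- intros; now apply polar_Neumann.
- split; auto.
- exact Ht.
Qed.
End Conversion.

(** * Comparison of two solutions *)

Definition cpt (j : bool) (z : C) : R := if j then fst z else snd z.

Lemma continuous_cpt j (z : C) : continuous (cpt j) z.
Proof. destruct j; [apply continuous_fst|apply continuous_snd]. Qed.

Lemma Rabs_cpt_le j (z : C) : Rabs (cpt j z) <= Cmod z.
Proof.
apply Rle_trans with (2 := Rmax_Cmod z). destruct j; [apply Rmax_l|apply Rmax_r].
Qed.

Lemma cpt_eq (z1 z2 : C) : (forall j, cpt j z1 = cpt j z2) -> z1 = z2.
Proof.
intros H. generalize (H true) (H false). destruct z1, z2; simpl. now intros -> ->.
Qed.

Lemma continuous_on_cpt (E : spacetime -> Prop) (g : spacetime -> C) j p e : continuous_on E g -> E p -> 0 < e ->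
  locally p (fun p' : spacetime => E p' -> Rabs (cpt j (g p') - cpt j (g p)) < e).
Proof.
intros Hg Hp He.
exact (Hg p Hp _ (continuous_locally_lt (cpt j) (g p) e (continuous_cpt j (g p)) He)).
Qed.

Lemma locally_and {E : UniformSpace} (p : E) (A B : E -> Prop) : locally p A -> locally p B ->
  locally p (fun x => A x /\ B x).
Proof. apply filter_and. Qed.

Lemma extends_continuous (D : spacetime -> Prop) (g : spacetime -> C) (p : spacetime) : extends_continuously D D g ->
  locally p D -> continuous g p.
Proof.
intros [h [Hc He]] HD. assert (Dp := locally_singleton _ _ HD).
intros P HP. rewrite <- (He p Dp) in HP.
generalize (locally_and p D (fun x => D x -> P (h x)) HD (Hc p Dp P HP)).
change (filtermap g (locally p) P) with (locally p (fun x : spacetime => P (g x))). apply filter_imp.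
intros x [H1 H2]. rewrite <- (He x H1). exact (H2 H1).
Qed.

(** The Neumann condition speaks of difference quotients at the boundary, the solution space of
    interior derivatives that have a limit there. The mean value theorem links the two along the
    normal. *)
Lemma one_sided_derivative_0 (g dg : R -> R) m : (forall h, 0 < h -> is_derive g h (dg h)) ->
  (forall e, 0 < e -> at_right 0 (fun h => Rabs (dg h - m) <= e)) ->
  (forall e, 0 < e -> at_right 0 (fun h => Rabs (g 0 - g h) <= e * h)) -> m = 0.
Proof.
intros HD HL H0. apply NNPP. intros N. assert (P := Rabs_pos_lt _ N).
destruct (HL (Rabs m / 8) ltac:(lra)) as [e1 E1]. destruct (H0 (Rabs m / 8) ltac:(lra)) as [e2 E2].
assert (P1 := cond_pos e1). assert (P2 := cond_pos e2).
set (h := Rmin (e1 / 2) (e2 / 2)).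
assert (h0 : 0 < h) by (apply Rmin_glb_lt; lra).
assert (h1 : h <= e1 / 2) by apply Rmin_l. assert (h2 : h <= e2 / 2) by apply Rmin_r.
assert (BALL : forall x (e : posreal), 0 < x -> x < e -> ball 0 e x).
{ intros x e Hx Hxe. unfold ball; simpl; unfold AbsRing_ball, minus, plus, opp, Hierarchy.abs; simpl. apply Rabs_def1; lra. }
(* The interval stays off 0, where no continuity of [g] is given; the estimates at [h] and [h / 2]
   are subtracted to eliminate [g 0]. *)
destruct (MVT_gen g (h / 2) h dg) as [x [Hx E]].
- intros x. rewrite Rmin_left, Rmax_right by lra. intros Hx. apply HD. lra.
- intros x. rewrite Rmin_left, Rmax_right by lra. intros Hx. apply continuity_pt_cont.
  apply (ex_derive_continuous (V := R_NormedModule)). eexists. apply HD. lra.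
- rewrite Rmin_left, Rmax_right in Hx by lra.
  assert (A1 := E1 x ltac:(apply BALL; lra) ltac:(lra)).
  assert (A2 := E2 h ltac:(apply BALL; lra) h0).
  assert (A3 := E2 (h / 2) ltac:(apply BALL; lra) ltac:(lra)).
  assert (A4 : Rabs (dg x) * (h / 2) <= Rabs m / 8 * h + Rabs m / 8 * (h / 2)).
  { replace (Rabs (dg x) * (h / 2)) with (Rabs (g h - g (h / 2))).
    - replace (g h - g (h / 2)) with ((g 0 - g (h / 2)) - (g 0 - g h)) by ring.
      unfold Rminus at 1. apply Rle_trans with (1 := Rabs_triang _ _). rewrite Rabs_Ropp. lra.
    - rewrite E, Rabs_mult. f_equal. rewrite Rabs_pos_eq; lra. }
  assert (A5 : Rabs (dg x) <= 3 * (Rabs m / 8)) by nra.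
  assert (A6 : Rabs m <= Rabs (dg x) + Rabs (dg x - m)).
  { replace m with (dg x - (dg x - m)) at 1 by ring. unfold Rminus at 1.
    apply Rle_trans with (1 := Rabs_triang _ _). rewrite Rabs_Ropp. lra. }
  lra.
Qed.

Definition inward (y n : plane) (h : R) : plane := (fst y - h * fst n, snd y - h * snd n).

Lemma normal_quotient j u n y t e : is_normal_derivative u n y t 0%C -> 0 < e ->
  at_right 0 (fun h => Rabs (cpt j (u (y, t)) - cpt j (u (inward y n h, t))) <= e * h).
Proof.
intros HN He.
assert (L : locally (0%C : C) (fun z => Rabs (cpt j z - cpt j 0%C) < e)).
{ apply (continuous_locally_lt (cpt j)); auto. apply continuous_cpt. }
assert (K := HN _ L). unfold filtermap, at_right, within in *. revert K. apply filter_imp.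
intros h Hh Hp. specialize (Hh Hp). change R in (type of h). fold (inward y n h) in Hh.
set (z1 := u (y, t)) in *. set (z2 := u (inward y n h, t)) in *.
assert (E : cpt j ((z1 - z2) / RtoC h)%C = (cpt j z1 - cpt j z2) / h).
{ unfold Cdiv. rewrite <- RtoC_inv by lra. destruct z1, z2, j; simpl; field; lra. }
assert (Hh2 : Rabs ((cpt j z1 - cpt j z2) / h - cpt j 0%C) < e) by (rewrite <- E; exact Hh). clear Hh; rename Hh2 into Hh. replace (cpt j 0%C) with 0 in Hh by (now destruct j). rewrite Rminus_0_r in Hh.
unfold Rdiv in Hh. rewrite Rabs_mult, (Rabs_pos_eq (/ h)) in Hh by (left; now apply Rinv_0_lt_compat).
apply Rmult_lt_compat_r with (r := h) in Hh; auto.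
rewrite Rmult_assoc, Rinv_l, Rmult_1_r in Hh by lra. lra.
Qed.

Section Edges.
Variable phi : R.
Hypothesis Hphi : 0 < phi < PI.

Definition edge (th : R) (n : plane) : Prop := (th = 2 * PI /\ n = normal1) \/ (th = phi /\ n = normal2 phi).

Lemma edge_inside th n r h : edge th n -> 0 < r -> 0 < h -> Q phi (inward (polar r th) n h).
Proof.
intros [[-> ->]|[-> ->]] Hr Hh; apply (Q_iff phi Hphi); unfold inward, half_plane, polar, normal1, normal2; simpl.
- left. rewrite sin_2PI. lra.
- right. assert (S := sin2_cos2 phi). unfold Rsqr in S. nra.
Qed.

Lemma edge_normal th n : edge th n -> exists s, s <> 0 /\ fst n = s * - sin th /\ snd n = s * cos th.
Proof.
intros [[-> ->]|[-> ->]]; unfold normal1, normal2; simpl.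
- exists 1. rewrite sin_2PI, cos_2PI. lra.
- exists (-1). lra.
Qed.

Lemma edge_zero u th n r t : wave_solution phi u -> edge th n -> 0 < r ->
  is_normal_derivative u n (polar r th) t 0%C.
Proof.
intros [_ [_ [N1 N2]]] [[-> ->]|[-> ->]] Hr.
- apply N1. exists r. split; auto. unfold polar. rewrite cos_2PI, sin_2PI. f_equal; ring.
- apply N2. now exists r.
Qed.

Lemma boundary_edge y : Qbar_punctured phi y -> ~ Q phi y -> exists th n r, edge th n /\ 0 < r /\ y = polar r th.
Proof.
intros Hy HQ. assert (A := Qbar_angle phi Hphi y Hy). destruct Hy as [_ H0].
destruct (angle_spec y H0) as [E _]. assert (Hr := abs_pos_neq y H0).
assert (D : angle y = 2 * PI \/ angle y = phi).
{ apply NNPP. intros N. apply HQ. rewrite E. apply Q_polar; auto. lra. }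
destruct D as [D|D]; rewrite D in E.
- exists (2 * PI), normal1, (Defs.abs y). split; [left; auto|auto].
- exists phi, (normal2 phi), (Defs.abs y). split; [right; auto|auto].
Qed.

Lemma wave_solution_cont u l j : wave_solution phi u -> (length l <= 2)%nat ->
  cont_Q phi (fun p => cpt j (partials l u p)).
Proof.
intros [[_ [_ HE]] _] Hl p Hp.
apply (continuous_comp (partials l u) (cpt j)); [|apply continuous_cpt].
apply (extends_continuous (cyl (Q phi) all_times)); auto.
assert (C : continuous (fun p : spacetime => fst p) p) by apply continuous_fst.
assert (L := C _ (Q_open phi Hphi (fst p) Hp)). unfold filtermap in L. revert L. apply filter_imp.
intros z Hz. split; [exact Hz|exact I].
Qed.

Lemma wave_solution_derive u l d j : wave_solution phi u -> (length l < 2)%nat ->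
  derive_Q phi d (fun p => cpt j (partials l u p)) (fun p => cpt j (partials (d :: l) u p)).
Proof.
intros [[_ [HD _]] _] Hl p Hp. destruct (HD l d Hl p (conj Hp I)) as [H1 H2].
destruct j; simpl; apply Derive_correct; assumption.
Qed.

(** A finite bound on the sum bounds each summand because both suprema are non-negative, being taken
    over nonempty sets of non-negative numbers. *)
Lemma E_space_bounds eps N u : E_space eps N phi u -> exists g1 g2 K, 0 <= K /\ is_gradient phi u g1 g2 /\
  (forall y t, Qbar phi y -> 0 <= t -> Cmod (u (y, t)) <= K) /\
  (forall y t, Qbar_punctured phi y -> 0 <= t -> Rpower (1 + t) (- N) * Rpower (bracket y) eps
                 * sqrt (Cmod (g1 (y, t)) ^ 2 + Cmod (g2 (y, t)) ^ 2) <= K).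
Proof.
intros [_ [g1 [g2 [HG HF]]]]. exists g1, g2.
set (S1 := fun t x => exists y, Qbar phi y /\ x = Cmod (u (y, t))).
set (S2 := fun t x => exists y, Qbar_punctured phi y /\ x = Rpower (1 + t) (- N) * Rpower (bracket y) eps
                 * sqrt (Cmod (g1 (y, t)) ^ 2 + Cmod (g2 (y, t)) ^ 2)).
assert (Hv := Qbar_vertex phi Hphi).
assert (Hv1 := Qbar_polar phi Hphi 1 phi Rlt_0_1 ltac:(lra)).
assert (Pos2 : forall t x, S2 t x -> 0 <= x).
{ intros t x [y [_ ->]]. apply Rmult_le_pos; [|apply sqrt_pos]. apply Rmult_le_pos; left; apply exp_pos. }
unfold E_norm in HF. set (S := fun s : Rbar => _) in HF.
assert (LUB : Rbar_is_upper_bound S (Rbar_lub S)).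
{ unfold Rbar_lub. exact (proj1 (proj2_sig (Rbar_ex_lub S))). }
destruct (Rbar_lub S) as [K| |] eqn:EK; try discriminate HF.
assert (BD : forall t, 0 <= t -> (forall x, S1 t x -> x <= K) /\ (forall x, S2 t x -> x <= K)).
{ intros t Ht.
  assert (B := LUB (Rbar_plus (Lub_Rbar (S1 t)) (Lub_Rbar (S2 t))) (ex_intro _ t (conj Ht eq_refl))).
  assert (U1 := proj1 (Lub_Rbar_correct (S1 t))). assert (U2 := proj1 (Lub_Rbar_correct (S2 t))).
  assert (X1 : S1 t (Cmod (u ((0, 0), t)))) by (exists (0, 0); auto).
  assert (X2 := ex_intro _ (polar 1 phi) (conj Hv1 eq_refl) : S2 t _).
  assert (V1 := U1 _ X1). assert (V2 := U2 _ X2). assert (V3 := Pos2 _ _ X2). assert (V4 := Cmod_ge_0 (u ((0, 0), t))).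
  (* [Rbar_plus] of opposite infinities defaults to 0, so [m_infty] has to be excluded; [V1] and
     [V2] do this through members of the two sets. *)
  destruct (Lub_Rbar (S1 t)) as [L1| |]; destruct (Lub_Rbar (S2 t)) as [L2| |]; simpl in B, V1, V2; try contradiction.
  assert (W1 := Rle_trans _ _ _ V4 V1). assert (W2 := Rle_trans _ _ _ V3 V2).
  split; intros x Hx.
  - assert (Y := U1 x Hx). simpl in Y. lra.
  - assert (Y := U2 x Hx). simpl in Y. lra. }
exists K. split; [|split; [|split]].
- apply Rle_trans with (2 := proj1 (BD 0 (Rle_refl 0)) _ (ex_intro _ (0, 0) (conj Hv eq_refl))). apply Cmod_ge_0.
- exact HG.
- intros y t Hy Ht. apply (proj1 (BD t Ht)). now exists y.
- intros y t Hy Ht. apply (proj2 (BD t Ht)). now exists y.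
Qed.

(** As N <= 1/2 and 1 / bracket y >= 1, the power N of 1 / bracket y is at most its square root: the
    exponent 1/2 of the polar energy estimate. *)
Lemma gradient_bound N K S t T y : 0 <= N <= / 2 -> 0 <= t <= T -> y <> (0, 0) -> 0 <= S ->
  Rpower (1 + t) (- N) * Rpower (bracket y) N * S <= K ->
  S <= K * Rpower (1 + T) N * sqrt ((1 + Defs.abs y) / Defs.abs y).
Proof.
intros HN Ht Hy HS HK. assert (Hr := abs_pos_neq y Hy).
set (c := (1 + Defs.abs y) / Defs.abs y).
assert (c1 : 1 <= c).
{ apply Rmult_le_reg_r with (Defs.abs y); auto. unfold c, Rdiv. rewrite Rmult_assoc, Rinv_l by lra. lra. }
assert (b0 : 0 < bracket y) by (apply Rdiv_lt_0_compat; lra).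
assert (bc : bracket y * c = 1) by (unfold bracket, c; field; lra).
assert (P1 : Rpower (1 + t) (- N) * Rpower (1 + t) N = 1).
{ rewrite <- Rpower_plus, Rplus_opp_l. apply Rpower_O. lra. }
assert (P2 : Rpower (bracket y) N * Rpower c N = 1).
{ rewrite Rpower_mult_distr by lra. rewrite bc. unfold Rpower. now rewrite ln_1, Rmult_0_r, exp_0. }
assert (P3 : Rpower (1 + t) N <= Rpower (1 + T) N) by (apply Rle_Rpower_l; lra).
assert (P4 : Rpower c N <= sqrt c) by (rewrite <- Rpower_sqrt by lra; apply Rle_Rpower; lra).
assert (Q1 : 0 < Rpower (1 + t) N) by apply exp_pos. assert (Q2 : 0 < Rpower c N) by apply exp_pos.
assert (Q3 : 0 < Rpower (1 + t) (- N)) by apply exp_pos. assert (Q4 : 0 < Rpower (bracket y) N) by apply exp_pos.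
assert (K0 : 0 <= K).
{ apply Rle_trans with (2 := HK). apply Rmult_le_pos; auto. apply Rmult_le_pos; lra. }
apply Rle_trans with (K * Rpower (1 + t) N * Rpower c N).
- replace S with (Rpower (1 + t) (- N) * Rpower (bracket y) N * S * Rpower (1 + t) N * Rpower c N).
  + apply Rmult_le_compat_r; [lra|]. apply Rmult_le_compat_r; lra.
  + transitivity (S * (Rpower (1 + t) (- N) * Rpower (1 + t) N) * (Rpower (bracket y) N * Rpower c N)); [ring|].
    rewrite P1, P2. ring.
- apply Rmult_le_compat; [apply Rmult_le_pos; lra|lra| |exact P4]. apply Rmult_le_compat_l; lra.
Qed.

Lemma Rabs_cpt_sqrt j (z1 z2 : C) : Rabs (cpt j z1) <= sqrt (Cmod z1 ^ 2 + Cmod z2 ^ 2) /\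
  Rabs (cpt j z2) <= sqrt (Cmod z1 ^ 2 + Cmod z2 ^ 2).
Proof.
assert (A := Cmod_ge_0 z1). assert (B := Cmod_ge_0 z2).
split.
- apply Rle_trans with (1 := Rabs_cpt_le j z1). rewrite <- (sqrt_pow2 (Cmod z1)) at 1 by auto.
  apply sqrt_le_1_alt. nra.
- apply Rle_trans with (1 := Rabs_cpt_le j z2). rewrite <- (sqrt_pow2 (Cmod z2)) at 1 by auto.
  apply sqrt_le_1_alt. nra.
Qed.

Section Difference.
Variables (om al : R) (f : R -> C) (u v : spacetime -> C).
Hypothesis Su : solution om phi al f u. Hypothesis Sv : solution om phi al f v.
Hypothesis Eu : solution_space phi u. Hypothesis Ev : solution_space phi v.
Variable j : bool.

Definition part_diff (l : list coord) (p : spacetime) : R := cpt j (partials l v p) - cpt j (partials l u p).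

Lemma part_diff_cont l : (length l <= 2)%nat -> cont_Q phi (part_diff l).
Proof.
intros Hl p Hp. apply (cont_minus (fun p => cpt j (partials l v p)) (fun p => cpt j (partials l u p))).
- now apply (wave_solution_cont v l j (proj1 Sv)).
- now apply (wave_solution_cont u l j (proj1 Su)).
Qed.

Lemma part_diff_derive l d : (length l < 2)%nat -> derive_Q phi d (part_diff l) (part_diff (d :: l)).
Proof.
intros Hl p Hp.
apply (is_derive_minus (fun h => cpt j (partials l v (shift d p h))) (fun h => cpt j (partials l u (shift d p h)))).
- now apply (wave_solution_derive v l d j (proj1 Sv)).
- now apply (wave_solution_derive u l d j (proj1 Su)).
Qed.

Lemma part_diff_wave p : Q phi (fst p) -> part_diff [dt; dt] p = part_diff [dy1; dy1] p + part_diff [dy2; dy2] p.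
Proof.
intros Hp. destruct p as [y t].
assert (A := proj1 (proj2 (proj1 Sv)) y t Hp). assert (B := proj1 (proj2 (proj1 Su)) y t Hp).
unfold dalembertian in A, B.
assert (E : forall z1 z2 z3 : C, (z1 - (z2 + z3))%C = 0%C -> cpt j z1 = cpt j z2 + cpt j z3).
{ intros [x1 y1] [x2 y2] [x3 y3] H. injection H as H1 H2. destruct j; simpl; lra. }
apply E in A. apply E in B. unfold part_diff; simpl. rewrite A, B. ring.
Qed.

Lemma diff_initial y t : Q phi y -> t < 0 -> part_diff [] (y, t) = 0.
Proof.
intros Hy Ht. unfold part_diff; simpl. rewrite (proj2 Sv y t Hy Ht), (proj2 Su y t Hy Ht). ring.
Qed.

Lemma diff_normal th n r t e : edge th n -> 0 < r -> 0 < e ->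
  at_right 0 (fun h => Rabs (part_diff [] (polar r th, t) - part_diff [] (inward (polar r th) n h, t)) <= e * h).
Proof.
intros Hn Hr He.
assert (A := normal_quotient j v n (polar r th) t (e / 2) (edge_zero v th n r t (proj1 Sv) Hn Hr) ltac:(lra)).
assert (B := normal_quotient j u n (polar r th) t (e / 2) (edge_zero u th n r t (proj1 Su) Hn Hr) ltac:(lra)).
generalize (filter_and _ _ A B). apply filter_imp. intros h [H1 H2]. unfold part_diff; simpl.
match goal with |- Rabs (?x1 - ?x2 - (?x3 - ?x4)) <= _ => replace (x1 - x2 - (x3 - x4)) with ((x1 - x3) + - (x2 - x4)) by ring end.
apply Rle_trans with (1 := Rabs_triang _ _). rewrite Rabs_Ropp. change R in (type of h). lra.
Qed.

Lemma at_right_witness (P : R -> Prop) : at_right 0 P -> exists h, 0 < h /\ P h.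
Proof.
intros [e He]. assert (P0 := cond_pos e). exists (e / 2). split; [lra|]. apply He; [|lra].
unfold ball; simpl; unfold AbsRing_ball, minus, plus, opp, Hierarchy.abs; simpl. apply Rabs_def1; lra.
Qed.

(** Continuity up to the sides is given only for t >= 0. For t < 0 the Neumann difference quotient
    ties the value on a side to the zeros inside [Q]. *)
Lemma diff_boundary_negative y t : Qbar_punctured phi y -> t < 0 -> part_diff [] (y, t) = 0.
Proof.
intros Hy Ht. destruct (classic (Q phi y)) as [HQ|HQ]; [now apply diff_initial|].
destruct (boundary_edge y Hy HQ) as [th [n [r [Hn [Hr ->]]]]].
apply NNPP. intros N.
set (m := Rabs (part_diff [] (polar r th, t))). assert (P : 0 < m) by exact (Rabs_pos_lt _ N).
assert (m2 : 0 < m / 2) by (clear - P; clearbody m; lra).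
assert (L1 : at_right 0 (fun h => h < 1)).
{ exists (mkposreal 1 Rlt_0_1). intros h Hh _. apply Rabs_def2 in Hh. simpl in Hh. unfold minus, plus, opp in Hh; simpl in Hh. lra. }
destruct (at_right_witness _ (filter_and _ _ (diff_normal th n r t (m / 2) Hn Hr m2) L1)) as [h [H0 [H1 H2]]].
rewrite (diff_initial (inward (polar r th) n h)) in H1 by (auto; now apply edge_inside).
rewrite Rminus_0_r in H1. fold m in H1. nra.
Qed.

Lemma gradient_limits z t0 : Qbar_punctured phi z -> 0 <= t0 -> exists l1 l2, forall e, 0 < e ->
  locally ((z, t0) : spacetime) (fun p => Q phi (fst p) -> 0 <= snd p ->
    Rabs (part_diff [dy1] p - l1) <= e /\ Rabs (part_diff [dy2] p - l2) <= e).
Proof.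
intros Hz Ht.
destruct Eu as [_ [_ [_ [a1 [a2 [[A1 [A2 A3]] _]]]]]]. destruct Ev as [_ [_ [_ [b1 [b2 [[B1 [B2 B3]] _]]]]]].
exists (cpt j (b1 (z, t0)) - cpt j (a1 (z, t0))), (cpt j (b2 (z, t0)) - cpt j (a2 (z, t0))).
intros e He. assert (Hp : cyl (Qbar_punctured phi) nonneg_times (z, t0)) by (split; auto).
assert (e2 : 0 < e / 2) by lra.
generalize (locally_and _ _ _ (locally_and _ _ _ (continuous_on_cpt _ a1 j _ _ A1 Hp e2) (continuous_on_cpt _ a2 j _ _ A2 Hp e2))
  (locally_and _ _ _ (continuous_on_cpt _ b1 j _ _ B1 Hp e2) (continuous_on_cpt _ b2 j _ _ B2 Hp e2))).
apply filter_imp. intros p [[H1 H2] [H3 H4]] HQ Hs.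
assert (Hp' : cyl (Qbar_punctured phi) nonneg_times p) by (split; [now apply Q_Qbar_punctured|exact Hs]).
specialize (H1 Hp'). specialize (H2 Hp'). specialize (H3 Hp'). specialize (H4 Hp').
destruct (A3 p (conj HQ Hs)) as [_ [_ [EA1 EA2]]]. destruct (B3 p (conj HQ Hs)) as [_ [_ [EB1 EB2]]].
unfold part_diff; simpl. rewrite <- EA1, <- EA2, <- EB1, <- EB2.
apply Rabs_def2 in H1. apply Rabs_def2 in H2. apply Rabs_def2 in H3. apply Rabs_def2 in H4.
split; apply Rabs_le; lra.
Qed.

Lemma diff_Neumann th0 r0 t0 : th0 = phi \/ th0 = 2 * PI -> 0 < r0 -> 0 <= t0 -> exists l1 l2,
  - sin th0 * l1 + cos th0 * l2 = 0 /\
  forall e, 0 < e -> locally ((polar r0 th0, t0) : spacetime) (fun p => Q phi (fst p) -> 0 <= snd p ->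
    Rabs (part_diff [dy1] p - l1) <= e /\ Rabs (part_diff [dy2] p - l2) <= e).
Proof.
intros Hth Hr Ht.
assert (Hn : exists n, edge th0 n).
{ destruct Hth; [exists (normal2 phi); now right|exists normal1; now left]. }
destruct Hn as [n Hn].
assert (Hz : Qbar_punctured phi (polar r0 th0)) by (apply Qbar_polar; auto; destruct Hth; lra).
destruct (gradient_limits _ t0 Hz Ht) as [l1 [l2 HL]]. exists l1, l2. split; [|exact HL].
destruct (edge_normal th0 n Hn) as [s [Hs [N1 N2]]].
set (y0 := polar r0 th0) in *.
set (dg := fun h => - fst n * part_diff [dy1] (inward y0 n h, t0) + - snd n * part_diff [dy2] (inward y0 n h, t0)).
enough (Z : - fst n * l1 + - snd n * l2 = 0).
{ rewrite N1, N2 in Z. apply Rmult_eq_reg_l with (- s); [|lra]. rewrite Rmult_0_r, <- Z. ring. }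
apply (one_sided_derivative_0 (fun h => part_diff [] (inward y0 n h, t0)) dg).
- intros h Hh. assert (HQ := edge_inside th0 n r0 h Hn Hr Hh). fold y0 in HQ.
  apply (derive_curve_Q phi Hphi (part_diff []) (part_diff [dy1]) (part_diff [dy2])
    (fun h => fst y0 - h * fst n) (fun h => snd y0 - h * snd n)).
  + apply part_diff_cont. simpl; lia.
  + apply part_diff_derive. simpl; lia.
  + apply part_diff_derive. simpl; lia.
  + exact HQ.
  + auto_derive; auto; ring.
  + auto_derive; auto; ring.
- intros e He. set (k := e / (2 * (Rabs (fst n) + Rabs (snd n) + 1))).
  assert (F1 := Rabs_pos (fst n)). assert (F2 := Rabs_pos (snd n)).
  assert (k0 : 0 < k) by (apply Rdiv_lt_0_compat; lra).
  assert (C : continuous (fun h : R => ((inward y0 n h, t0) : spacetime)) 0).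
  { unfold inward. repeat apply cont_pair; cont. }
  assert (P : locally ((inward y0 n 0, t0) : spacetime) (fun p => Q phi (fst p) -> 0 <= snd p ->
    Rabs (part_diff [dy1] p - l1) <= k /\ Rabs (part_diff [dy2] p - l2) <= k)).
  { replace (inward y0 n 0) with y0; [now apply HL|]. unfold inward. destruct y0; simpl. f_equal; ring. }
  generalize (C _ P). unfold filtermap, at_right, within. apply filter_imp. intros h Hh Hp. change R in (type of h).
  destruct (Hh (edge_inside th0 n r0 h Hn Hr Hp) Ht) as [H1 H2].
  unfold dg.
  match goal with |- Rabs (_ * ?x + _ * ?y - _) <= _ =>
    replace (- fst n * x + - snd n * y - (- fst n * l1 + - snd n * l2)) with (- fst n * (x - l1) + - snd n * (y - l2)) by ring end.
  apply Rle_trans with (1 := Rabs_triang _ _). rewrite !Rabs_mult, !Rabs_Ropp.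
  apply Rle_trans with (Rabs (fst n) * k + Rabs (snd n) * k).
  + apply Rplus_le_compat; apply Rmult_le_compat_l; auto.
  + apply Rle_trans with ((Rabs (fst n) + Rabs (snd n) + 1) * k); [lra|].
    unfold k; apply Rle_trans with (e / 2); [right; field; lra|lra].
- intros e He.
  assert (Z := diff_normal th0 n r0 t0 e Hn Hr He). fold y0 in Z.
  replace (inward y0 n 0) with y0; [exact Z|]. unfold inward. destruct y0; simpl. f_equal; ring.
Qed.

Lemma diff_gradient_bound T : 0 <= T -> exists K, 0 <= K /\ forall y t, Q phi y -> 0 <= t <= T ->
  Rabs (part_diff [dy1] (y, t)) <= K * sqrt ((1 + Defs.abs y) / Defs.abs y) /\
  Rabs (part_diff [dy2] (y, t)) <= K * sqrt ((1 + Defs.abs y) / Defs.abs y).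
Proof.
intros HT.
assert (HPI := PI_RGT_0).
assert (HN : 0 <= 1 - 2 * q phi <= / 2).
{ generalize (q_bounds phi (phi / 2) Hphi ltac:(lra)). lra. }
destruct (E_space_bounds _ _ u (proj2 (proj2 Eu))) as [a1 [a2 [Ka [Ka0 [[_ [_ A3]] [_ BA]]]]]].
destruct (E_space_bounds _ _ v (proj2 (proj2 Ev))) as [b1 [b2 [Kb [Kb0 [[_ [_ B3]] [_ BB]]]]]].
set (P := Rpower (1 + T) (1 - 2 * q phi)). assert (P0 : 0 < P) by apply exp_pos.
exists (Kb * P + Ka * P). split; [nra|].
intros y t Hy Ht. assert (Hy' := Q_Qbar_punctured phi Hphi y Hy).
assert (G1 := gradient_bound _ Ka _ t T y HN Ht (proj2 Hy') (sqrt_pos _) (BA y t Hy' (proj1 Ht))).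
assert (G2 := gradient_bound _ Kb _ t T y HN Ht (proj2 Hy') (sqrt_pos _) (BB y t Hy' (proj1 Ht))).
fold P in G1, G2.
destruct (A3 (y, t) (conj Hy (proj1 Ht))) as [_ [_ [EA1 EA2]]]. destruct (B3 (y, t) (conj Hy (proj1 Ht))) as [_ [_ [EB1 EB2]]].
unfold part_diff; simpl. rewrite <- EA1, <- EA2, <- EB1, <- EB2.
destruct (Rabs_cpt_sqrt j (a1 (y, t)) (a2 (y, t))) as [X1 X2]. destruct (Rabs_cpt_sqrt j (b1 (y, t)) (b2 (y, t))) as [Y1 Y2].
split; unfold Rminus at 1; apply Rle_trans with (1 := Rabs_triang _ _); rewrite Rabs_Ropp, Rmult_plus_distr_r; lra.
Qed.

Lemma diff_zero_Q y t : Q phi y -> part_diff [] (y, t) = 0.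
Proof.
intros Hy. destruct (Rlt_or_le t 0) as [Ht|Ht]; [now apply diff_initial|].
destruct (E_space_bounds _ _ u (proj2 (proj2 Eu))) as [a1 [a2 [Ka [Ka0 [_ [BA _]]]]]].
destruct (E_space_bounds _ _ v (proj2 (proj2 Ev))) as [b1 [b2 [Kb [Kb0 [_ [BB _]]]]]].
apply (wedge_wave_unique phi Hphi (part_diff []) (part_diff [dy1]) (part_diff [dy2]) (part_diff [dt])
  (part_diff [dy1; dy1]) (part_diff [dy2; dy1]) (part_diff [dy1; dy2]) (part_diff [dy2; dy2]) (part_diff [dt; dt]))
  with (M := Kb + Ka); auto; try (apply part_diff_cont; simpl; lia); try (apply part_diff_derive; simpl; lia).
- exact part_diff_wave.
- exact diff_initial.
- intros z s Hz Hs. unfold part_diff; simpl.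
  assert (H1 := Rabs_cpt_le j (v (z, s))). assert (H2 := Rabs_cpt_le j (u (z, s))).
  specialize (BA z s (Q_Qbar phi z Hz) Hs). specialize (BB z s (Q_Qbar phi z Hz) Hs).
  unfold Rminus. apply Rle_trans with (1 := Rabs_triang _ _). rewrite Rabs_Ropp. lra.
- exact diff_gradient_bound.
- exact diff_Neumann.
Qed.

(** For t >= 0 continuity on [Qbar] extends the identity from [Q]; for t < 0 the sides were treated
    separately. At the vertex nothing determines the values for t < 0, whence the alternative in the
    hypothesis. *)
Lemma diff_zero y t : Qbar phi y -> (y <> (0, 0) \/ 0 <= t) -> part_diff [] (y, t) = 0.
Proof.
intros Hy Hyt. destruct (Rlt_or_le t 0) as [Ht|Ht].
- apply diff_boundary_negative; auto. split; auto. destruct Hyt; auto. lra.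
- apply NNPP. intros N. assert (P := Rabs_pos_lt _ N). set (m := part_diff [] (y, t)) in *.
  assert (Hp : cyl (Qbar phi) nonneg_times (y, t)) by (split; auto).
  assert (L1 := continuous_on_cpt _ v j _ (Rabs m / 2) (proj1 (proj2 Ev)) Hp ltac:(lra)).
  assert (L2 := continuous_on_cpt _ u j _ (Rabs m / 2) (proj1 (proj2 Eu)) Hp ltac:(lra)).
  assert (C : continuous (fun z : plane => ((z, t) : spacetime)) y).
  { apply cont_pair; [apply continuous_id|apply continuous_const]. }
  destruct (Hy _ (C _ (locally_and _ _ _ L1 L2))) as [z [[H1 H2] Hz]].
  assert (Hz' : cyl (Qbar phi) nonneg_times (z, t)) by (split; [now apply Q_Qbar|auto]).
  specialize (H1 Hz'). specialize (H2 Hz').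
  assert (Z := diff_zero_Q z t Hz). unfold part_diff in Z; simpl in Z.
  assert (E : m = (cpt j (u (z, t)) - cpt j (u (y, t))) - (cpt j (v (z, t)) - cpt j (v (y, t)))).
  { unfold m, part_diff; simpl. lra. }
  assert (B := Rabs_triang (cpt j (u (z, t)) - cpt j (u (y, t))) (- (cpt j (v (z, t)) - cpt j (v (y, t))))).
  rewrite Rabs_Ropp in B. unfold Rminus in E at 1. rewrite <- E in B. lra.
Qed.
End Difference.

Lemma solution_unique om al f u v : solution om phi al f u -> solution_space phi u ->
  solution om phi al f v -> solution_space phi v ->
  forall y t, Qbar phi y -> (y <> (0, 0) \/ 0 <= t) -> v (y, t) = u (y, t).
Proof.
intros Su Eu Sv Ev y t Hy Hyt. apply cpt_eq. intros j.
assert (Z := diff_zero om al f u v Su Sv Eu Ev j y t Hy Hyt). unfold part_diff in Z; simpl in Z. lra.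
Qed.
End Edges.

Theorem theorem6p1 (omega0 phi alpha s0 : R) (f : R -> C)
  (homega0 : 0 < omega0)
  (hphi : 0 < phi < PI)
  (halpha : Rmax (phi - PI / 2) 0 < alpha < Rmin (PI / 2) phi)
  (hs0 : 0 < s0 < 1)
  (hf : smooth f)
  (hf0 : forall s, s <= 0 -> f s = RtoC 0)
  (hf1 : forall s, s0 <= s -> f s = RtoC 1) :
  let u := total_wave omega0 phi alpha f in
  solution omega0 phi alpha f u /\
  solution_space phi u /\
  (forall v : spacetime -> C,
     solution omega0 phi alpha f v -> solution_space phi v ->
     forall y t, Qbar phi y -> (y <> (0, 0) \/ 0 <= t) ->
       v (y, t) = u (y, t)).
Proof.
intros u.
assert (A1 := Rmax_l (phi - PI / 2) 0). assert (A2 := Rmax_r (phi - PI / 2) 0).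
assert (A3 := Rmin_l (PI / 2) phi). assert (A4 := Rmin_r (PI / 2) phi).
assert (Hal : 0 < alpha < phi /\ alpha < PI / 2) by lra.
assert (S : solution omega0 phi alpha f u) by (apply total_wave_solution; auto; lra).
assert (E : solution_space phi u) by (apply (total_wave_space phi alpha hphi Hal omega0 s0 f); auto; lra).
split; [exact S|]. split; [exact E|].
intros v Sv Ev. now apply (solution_unique phi hphi omega0 alpha f u v).
Qed.
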